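(* Every smooth closed orientable $3$-manifold is parallelizable.
   Context: A closed manifold is a compact manifold without boundary. A smooth $m$-manifold $M$ is called parallelizable if its tangent bundle $TM$ is trivial or, equivalently, if there are $m$ vector fields on $M$ which are linearly independent at every point of $M$. *)

(* Defs.v *)
From mathcomp Require Import all_boot all_order all_algebra.
From mathcomp Require Import all_classical all_reals all_analysis.

Set Implicit Arguments.
Unset Strict Implicit.
Unset Printing Implicit Defensive.

Import Order.TTheory GRing.Theory Num.Theory numFieldNormedType.Exports.

Local Open Scope classical_set_scope.
Local Open Scope ring_scope.

(* C^k on an open set U of R^m; the recursion is on directional derivatives,
   which for open U gives the usual notion. *)
Fixpoint Ck_on (R : realType) (m n k : nat) (U : set 'rV[R]_m)
    (f : 'rV[R]_m -> 'rV[R]_n) : Prop :=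
  match k with
  | 0%N => forall x, U x -> {for x, continuous f}
  | k'.+1 => (forall x, U x -> differentiable f x) /\
             (forall v, Ck_on k' U (fun x => 'D_v f x))
  end.

Definition smooth_on (R : realType) (m n : nat) (U : set 'rV[R]_m)
  (f : 'rV[R]_m -> 'rV[R]_n) : Prop := forall k, Ck_on k U f.

(* A homeomorphism from an open set of M onto an open set of R^n. Both maps are
   total, but their values outside source and target are irrelevant. *)
Record chart (R : realType) (n : nat) (M : topologicalType) := Chart {
  source : set M;
  target : set 'rV[R]_n;
  chart_map : M -> 'rV[R]_n;
  chart_inv : 'rV[R]_n -> M;
  source_open : open source;
  target_open : open target;
  chart_map_target : forall p, source p -> target (chart_map p);
  chart_inv_source : forall x, target x -> source (chart_inv x);
  chart_mapK : forall p, source p -> chart_inv (chart_map p) = p;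
  chart_invK : forall x, target x -> chart_map (chart_inv x) = x;
  chart_map_continuous : {within source, continuous chart_map};
  chart_inv_continuous : {within target, continuous chart_inv} }.

Section Transition.
Variables (R : realType) (n : nat) (M : topologicalType).
Implicit Types c d : chart R n M.

Definition transition c d : 'rV[R]_n -> 'rV[R]_n := chart_map d \o chart_inv c.

Definition overlap c d : set 'rV[R]_n :=
  target c `&` chart_inv c @^-1` source d.

Definition compatible c d : Prop :=
  smooth_on (overlap c d) (transition c d) /\
  smooth_on (overlap d c) (transition d c).

Definition covers (A : set (chart R n M)) : Prop :=
  forall p : M, exists2 c, A c & source c p.

Definition oriented (A : set (chart R n M)) : Prop :=
  forall c d, A c -> A d ->
    forall x, overlap c d x -> 0 < \det ('J (transition c d) x).

End Transition.

(* No boundary, since charts are modelled on open subsets of R^n. The smooth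
   structure is a maximal atlas. *)
Record smooth_manifold (R : realType) (n : nat) := SmoothManifold {
  carrier :> topologicalType;
  atlas : set (chart R n carrier);
  manifold_hausdorff : hausdorff_space carrier;
  manifold_second_countable : @second_countable carrier;
  atlas_covers : covers atlas;
  atlas_compatible : forall c d, atlas c -> atlas d -> compatible c d;
  atlas_maximal : forall c, (forall d, atlas d -> compatible c d) -> atlas c }.

Arguments atlas {R n} s.

Section Manifold.
Variables (R : realType) (n : nat) (M : smooth_manifold R n).

Definition closed_manifold : Prop := compact [set: M].

Definition orientable : Prop :=
  exists A : set (chart R n M), [/\ A `<=` atlas M, covers A & oriented A].

Definition charts_at (p : M) : set (chart R n M) :=
  [set c | atlas M c /\ source c p].

(* T_pM, as a linear subspace of the functions from charts to R^n: a tangent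
   vector at p is the family of its components v c in the charts c around p,
   related to each other by the differentials of the transition maps, and
   v c = 0 for the other charts. *)
Definition tangent_space (p : M) : set (chart R n M -> 'rV[R]_n) :=
  [set v | (forall c, ~ charts_at p c -> v c = 0) /\
           (forall c d, charts_at p c -> charts_at p d ->
              v d = 'd (transition c d) (chart_map c p) (v c))].

Definition vector_field (X : M -> chart R n M -> 'rV[R]_n) : Prop :=
  (forall p, tangent_space p (X p)) /\
  (forall c, atlas M c -> smooth_on (target c) (fun x => X (chart_inv c x) c)).

Definition linearly_independent (k : nat) (V : lmodType R) (v : 'I_k -> V) :=
  forall a : 'I_k -> R, \sum_(i < k) a i *: v i = 0 -> forall i, a i = 0.

Definition parallelizable : Prop :=
  exists X : 'I_n -> M -> chart R n M -> 'rV[R]_n,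
    (forall i, vector_field (X i)) /\
    (forall p, linearly_independent (fun i => X i p)).

End Manifold.

(* Main.v *)
(** Cover [M] by finitely many charts of an oriented atlas and embed it in [R^N] with
    bump functions. At the points of a fine net of the image choose oriented orthonormal
    frames of the tangent spaces; the comparison of neighbouring frames is close to a
    rotation, hence to [rot q] for a unit quaternion [q] that is determined up to sign.
    Over the small triangles of the net the lifts [q] compose up to a sign cocycle, the
    discrete second Stiefel-Whitney class. After a generic perturbation this cocycle is the
    coboundary of an explicit cochain that counts, modulo 2, how segments cross triangles
    in the tangent projections; this replaces Wu's formula. So the signs can be
    corrected, and the [q]'s become transition functions of a bundle with fibre the
    quaternions. As the fibre has dimension 4 and [M] has dimension 3, small corrections at
    the net points give a section without zeros, and the rotations [rot] of this section turn
    the local frames into a global one. *)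

(* The sign class is never computed. It is evaluated on an arbitrary modulo 2 cycle of triangles;
   the value turns out to depend only on the combinatorics of the cycle, and points on the moment
   curve with trivial transitions realise the same combinatorics with value zero. Duality over F_2
   then yields the cochain that corrects the signs. The independence rests on two parities. On the
   sphere of directions around a vertex, turning plus self-crossings of a closed polygon depends
   only on the polygon as a graph, a modulo 2 Whitney formula. In space, the crossings seen from all
   vertices cancel, because two disjoint triangles in general position meet along a segment with two
   ends. The manifold is not triangulated; there is only a separated net, and no common 3-space
   contains its points. Signs of determinants have to be compared between different tangent spaces,
   so general position is needed with explicit margins. All tolerances depend on scale-free data
   alone (a bound on the number of neighbours, a Lipschitz constant) and are fixed before the mesh
   is refined. *)
From mathcomp Require Import all_boot.

(** * Parity combinatorics: quadratic forms over F_2, spherical links, cycles of triangles *)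

Module Core.

Set Implicit Arguments.
Unset Strict Implicit.
Unset Printing Implicit Defensive.

Local Notation "\xor_ i F" := (\big[addb/false]_i F)
  (at level 41, F at level 41, i at level 0, format "\xor_ i  F").

Lemma addb_eq0 (a b : bool) : (a (+) b == false) = (a == b).
Proof. by case: a; case: b. Qed.

Section XorSums.

Lemma xorD (A : finType) (F G : A -> bool) :
  \xor_x (F x (+) G x) = (\xor_x F x) (+) (\xor_x G x).
Proof. by rewrite big_split. Qed.

Lemma xor0 (A : finType) (F : A -> bool) :
  (forall x, F x = false) -> \xor_x F x = false.
Proof. by move=> h; rewrite big1. Qed.

Lemma xorMl (A : finType) (b : bool) (F : A -> bool) :
  \xor_x (b && F x) = b && \xor_x F x.
Proof. by rewrite big_distrr. Qed.

Lemma xorMr (A : finType) (b : bool) (F : A -> bool) :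
  \xor_x (F x && b) = (\xor_x F x) && b.
Proof. by rewrite big_distrl. Qed.

Lemma xor_eq (A : finType) (F G : A -> bool) :
  F =1 G -> \xor_x F x = \xor_x G x.
Proof. by move=> h; apply: eq_bigr => x _; rewrite h. Qed.

Lemma xor_ex (A B : finType) (F : A -> B -> bool) :
  \xor_x \xor_y F x y = \xor_y \xor_x F x y.
Proof. exact: exchange_big. Qed.

Lemma xor_pair (A B : finType) (F : A -> B -> bool) :
  \xor_x \xor_y F x y = \xor_p F p.1 p.2.
Proof. exact: (pair_big predT predT F). Qed.

Lemma xor_pred1 (A : finType) (a : A) (F : A -> bool) :
  \xor_x ((x == a) && F x) = F a.
Proof.
rewrite (bigD1 a) //= eqxx big1 ?addbF // => x /negbTE xa.
by rewrite xa.
Qed.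

Variables (A : finType) (r : rel A).
Hypothesis r_tri : forall x y, r x y (+) r y x (+) (x == y).

Hypothesis rxx : forall x, r x x = false.

(** The strict order [r] selects one of (x, y) and (y, x), so a double sum folds onto unordered
    pairs and the diagonal. *)
Lemma xor_sym (g : A -> A -> bool) :
  \xor_x \xor_y g x y =
  (\xor_x \xor_y (r x y && (g x y (+) g y x))) (+) \xor_x g x x.
Proof.
have -> : \xor_x \xor_y g x y = (\xor_x \xor_y (r x y && g x y)) (+)
   ((\xor_x \xor_y (r y x && g x y)) (+) \xor_x \xor_y ((y == x) && g x y)).
  rewrite -!xorD; apply: xor_eq => x; rewrite -!xorD; apply: xor_eq => y.
  by have := r_tri x y; rewrite (eq_sym y x);
     case: (r x y); case: (r y x); case: (x == y); case: (g x y).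
rewrite addbA; congr (_ (+) _); last by apply: xor_eq => x; rewrite xor_pred1.
rewrite (xor_ex (fun x y => r y x && g x y)) -xorD; apply: xor_eq => x.
by rewrite -xorD; apply: xor_eq => y; rewrite -andb_addr.
Qed.

(** The quadratic form over F_2 whose polar form is the off-diagonal part of a symmetric [f]. The
    order [r] serves only to count each unordered pair once. *)
Definition quad (f : A -> A -> bool) (z : A -> bool) : bool :=
  \xor_x \xor_y (r x y && (z x && z y && f x y)).

Lemma eq_quad f g z z' : f =2 g -> z =1 z' -> quad f z = quad g z'.
Proof.
move=> h h'; apply: xor_eq => x; apply: xor_eq => y.
by rewrite h !h'.
Qed.

Lemma quadDf f g z : quad (fun x y => f x y (+) g x y) z = quad f z (+) quad g z.
Proof.
rewrite /quad -xorD; apply: xor_eq => x; rewrite -xorD; apply: xor_eq => y.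
by rewrite andb_addr andb_addr.
Qed.

Lemma quad_polar f z z' : (forall x y, f x y = f y x) ->
  quad f (fun x => z x (+) z' x) =
  quad f z (+) quad f z' (+) \xor_x \xor_y (z x && z' y && ((x != y) && f x y)).
Proof.
move=> fs.
rewrite (xor_sym (fun x y => z x && z' y && ((x != y) && f x y))).
rewrite [X in _ (+) (_ (+) X)]xor0; last by move=> x; rewrite eqxx /= andbF.
rewrite addbF -!xorD; apply: xor_eq => x; rewrite -!xorD; apply: xor_eq => y.
rewrite (fs y x) (eq_sym y x); have [->|_] := eqVneq x y.
  by rewrite rxx.
by case: (r x y); case: (z x); case: (z y); case: (z' x); case: (z' y);
   case: (f x y).
Qed.

(** In a set of even size every element lies in an odd number of pairs, so each value of [g]
    survives once. *)
Lemma quad_lin (g z : A -> bool) : \xor_x z x = false ->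
  quad (fun x y => g x (+) g y) z = \xor_x (z x && g x).
Proof.
move=> z0.
have := xor_sym (fun x y => z x && z y && g x).
rewrite [LHS]xor0; last first.
  move=> x; under xor_eq => y do rewrite -andbA [z y && _]andbC andbA.
  by rewrite xorMl z0 andbF.
move/esym/eqP; rewrite addb_eq0.
have -> : \xor_x \xor_y (r x y && (z x && z y && g x (+) z y && z x && g y)) =
          quad (fun x y => g x (+) g y) z.
  apply: xor_eq => x; apply: xor_eq => y.
  by case: (r x y) => //=; case: (z x); case: (z y); case: (g x); case: (g y).
by move/eqP=> ->; apply: xor_eq => x; rewrite andbb.
Qed.

End XorSums.


Section RankOrder.
Variable A : finType.

Definition ranklt : rel A := fun e f => (enum_rank e < enum_rank f)%N.

Lemma ranklt_tri (e f : A) : ranklt e f (+) ranklt f e (+) (e == f).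
Proof.
rewrite /ranklt; case: (ltngtP (enum_rank e) (enum_rank f)) => [h|h|/val_inj/enum_rank_inj ->].
- by rewrite -(inj_eq enum_rank_inj) -val_eqE /= ltn_eqF.
- by rewrite -(inj_eq enum_rank_inj) -val_eqE /= gtn_eqF.
- by rewrite eqxx.
Qed.

Lemma rankltxx (e : A) : ranklt e e = false.
Proof. exact: ltnn. Qed.

End RankOrder.

(** A reflexive truth table: the sign identities in 10 and 15 unknown bits are verified by
    computation instead of case splits in the goal. *)
Fixpoint taut (n : nat) (f : seq bool -> bool) (s : seq bool) : bool :=
  if n is n'.+1 then taut n' f (true :: s) && taut n' f (false :: s) else f s.

Lemma tautP n f s : taut n f s -> forall t, size t = n -> f (catrev t s).
Proof.
elim: n s => [|n IH] s /=; first by move=> h [].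
by move=> /andP[h1 h2] [|[] t] //= [ts]; apply: IH.
Qed.

(** * Turning and crossings of cycles drawn on a sphere *)

Section Link.

Variable n : nat.
Implicit Types (a b p q r u : 'I_n) (z : 'I_n -> 'I_n -> bool).

Definition ordlt : rel 'I_n := fun a b => (a < b)%N.
Definition arclt : rel ('I_n * 'I_n) := @ranklt _.

Lemma ordlt_tri a b : ordlt a b (+) ordlt b a (+) (a == b).
Proof.
rewrite /ordlt; case: (ltngtP a b) => [h|h|/val_inj ->]; last by rewrite eqxx.
  by rewrite -val_eqE /= ltn_eqF.
by rewrite -val_eqE /= gtn_eqF.
Qed.

Lemma ordltxx a : ordlt a a = false.
Proof. exact: ltnn. Qed.

Lemma ordlt_neg a b : a != b -> ordlt b a = ~~ ordlt a b.
Proof. by move=> /negbTE ab; have := ordlt_tri a b; rewrite ab; do 2!case: ordlt. Qed.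

Definition arclt_tri := @ranklt_tri ('I_n * 'I_n)%type.
Definition arcltxx := @rankltxx ('I_n * 'I_n)%type.

(** Signs of a drawing of the complete graph on the sphere of directions, with [true] for negative.
    In the geometric model [lo] is the sign of a 3 by 3 determinant, [lchi u a b] belongs to the
    quaternion that turns the flag of the arc ua into that of ub, and [ldl a b] to the half-turn
    that exchanges the two flags of the arc ab. Only the last two see the double cover. *)
Record linkdata := LinkData {
  lo : 'I_n -> 'I_n -> 'I_n -> bool;
  lchi : 'I_n -> 'I_n -> 'I_n -> bool;
  ldl : 'I_n -> 'I_n -> bool }.

(** This test and the two after it are Cramer's rule in signs: a direction is a positive combination
    of others exactly when the corresponding determinants agree in sign. In [arcs_cross] the last
    clause rules out the case where an arc crosses the antipode of the other one. *)
Definition in_sector (o : 'I_n -> 'I_n -> 'I_n -> bool) p b q r :=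
  (o p q b == o p b r) && (o p q b == o p q r).

Definition in_triangle (o : 'I_n -> 'I_n -> 'I_n -> bool) a p q r :=
  [&& o a q r == o p a r, o a q r == o p q a & o a q r == o p q r].

Definition arcs_cross (o : 'I_n -> 'I_n -> 'I_n -> bool) a b c d :=
  [&& o b c d != o a c d, o a b d != o a b c & o b c d != o a b d].

(* [same] excludes the sign patterns incompatible with a three-term
   Grassmann-Pluecker relation [t1 - t2 + t3 = 0] with nonzero terms. *)
Definition gp_ok (s1 s2 s3 : bool) := (s1 == s3) ==> (s2 == s1).

(** [lchi_sector] is the addition of angles at a corner, read on half-angles: the sign of the lift
    jumps according to the orientation and the position of the middle arc. [lchi_triangle] says that
    the path through the six flags of a spherical triangle closes up in the double cover. *)
Record link_axioms (P : pred 'I_n) (L : linkdata) : Prop := LinkAxioms {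
  lo_alt12 : forall a b c, all P [:: a; b; c] -> uniq [:: a; b; c] ->
    lo L b a c = ~~ lo L a b c;
  lo_alt23 : forall a b c, all P [:: a; b; c] -> uniq [:: a; b; c] ->
    lo L a c b = ~~ lo L a b c;
  lo_gp : forall x a b c d, all P [:: x; a; b; c; d] -> uniq [:: x; a; b; c; d] ->
    gp_ok (lo L x a b (+) lo L x c d) (lo L x a c (+) lo L x b d)
          (lo L x a d (+) lo L x b c);
  lchi_alt : forall u a b, all P [:: u; a; b] -> uniq [:: u; a; b] ->
    lchi L u b a = ~~ lchi L u a b;
  ldl_alt : forall a b, P a -> P b -> a != b -> ldl L b a = ~~ ldl L a b;
  lchi_sector : forall u b a c, all P [:: u; b; a; c] -> uniq [:: u; b; a; c] ->
    lchi L u b a (+) lchi L u a c (+) lchi L u b c =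
    ~~ (lo L u b c (+) in_sector (lo L) u a b c);
  lchi_triangle : forall p q r, all P [:: p; q; r] -> uniq [:: p; q; r] ->
    lchi L p q r (+) ldl L p r (+) lchi L r p q (+) ldl L r q (+)
    lchi L q r p (+) ldl L q p = false }.

(** [lchi] alternates in its last two arguments; sorting them makes it symmetric, as polarisation of
    [quad] requires. *)
Definition sorted_chi (L : linkdata) u a b :=
  if ordlt a b then lchi L u a b else lchi L u b a.

(** All pairs of edges at a vertex are counted, rather than the pairs traversed by some chosen
    curve. The expression thus makes sense for every even graph [z] and is quadratic in [z]. *)
Definition turning (L : linkdata) z :=
  (\xor_u quad ordlt (sorted_chi L u) (z u)) (+)
  \xor_a \xor_b (ordlt a b && (z a b && ldl L a b)).

Definition arc_crossing (P : pred 'I_n) (L : linkdata) (e f : 'I_n * 'I_n) :=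
  [&& all P [:: e.1; e.2; f.1; f.2], uniq [:: e.1; e.2; f.1; f.2] &
      arcs_cross (lo L) e.1 e.2 f.1 f.2].

Definition crossings (P : pred 'I_n) (L : linkdata) z :=
  quad arclt (arc_crossing P L) (fun e => ordlt e.1 e.2 && z e.1 e.2).

(** The combination in Whitney's formula for closed curves, modulo 2: turning alone depends on the
    drawing, and the self-crossings compensate for this. *)
Definition total (P : pred 'I_n) (L : linkdata) z :=
  turning L z (+) crossings P L z.

Definition tri p q r a b :=
  ((a == p) && ((b == q) (+) (b == r))) (+)
  (((a == q) && ((b == p) (+) (b == r))) (+)
   ((a == r) && ((b == p) (+) (b == q)))).

Lemma xor_tri p q r a (G : 'I_n -> bool) :
  \xor_b (tri p q r a b && G b) =
  ((a == p) && (G q (+) G r)) (+)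
  (((a == q) && (G p (+) G r)) (+) ((a == r) && (G p (+) G q))).
Proof.
have E x y : \xor_b (((b == x) (+) (b == y)) && G b) = G x (+) G y.
  by rewrite -(xor_pred1 x G) -(xor_pred1 y G) -xorD; apply: xor_eq => b;
     rewrite andb_addl.
under xor_eq => b do rewrite /tri !andb_addl -!andbA.
by rewrite !xorD !xorMl !E.
Qed.

Lemma triC p q r a b : tri p q r a b = tri p q r b a.
Proof.
by rewrite /tri; case: (a == p); case: (a == q); case: (a == r);
   case: (b == p); case: (b == q); case: (b == r).
Qed.

Lemma xor_tri_lt p q r (K : 'I_n -> 'I_n -> bool) : uniq [:: p; q; r] ->
  \xor_a \xor_b (ordlt a b && (tri p q r a b && K a b)) =
  (if ordlt p q then K p q else K q p) (+)
  ((if ordlt p r then K p r else K r p) (+)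
   (if ordlt q r then K q r else K r q)).
Proof.
rewrite /= !inE negb_or !andbT => /andP[/andP[pq pr] qr].
under xor_eq => a.
  under xor_eq => b do rewrite andbCA.
  rewrite xor_tri; over.
rewrite !xorD !xor_pred1 (ordlt_neg pq) (ordlt_neg pr) (ordlt_neg qr).
move: (K p q) (K q p) (K p r) (K r p) (K q r) (K r q).
by case: (ordlt p q); case: (ordlt p r); case: (ordlt q r); do 6!case.
Qed.

Lemma quad_pair (f : 'I_n -> 'I_n -> bool) q r : (forall a b, f a b = f b a) ->
  q != r -> quad ordlt f (fun a => (a == q) (+) (a == r)) = f q r.
Proof.
move=> fs qr; rewrite (quad_polar ordlt_tri ordltxx _ _ fs).
have E x : quad ordlt f (eq_op^~ x) = false.
  apply: xor0 => a; apply: xor0 => b.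
  have [->|_] := eqVneq a x; last by rewrite /= andbF.
  by have [->|_] := eqVneq b x; rewrite ?ordltxx //= andbF.
rewrite !E !addFb.
under xor_eq => x do (under xor_eq => y do rewrite -andbA; rewrite xorMl).
rewrite xor_pred1.
by under xor_eq => y do idtac; rewrite xor_pred1 qr.
Qed.

(** Five points a, b, p, q, r on the sphere, with the Grassmann-Pluecker relation pivoted at each of
    them as premises. Conclusion: the arc ab crosses the boundary of the triangle pqr an odd number
    of times exactly when one of its ends is inside. *)
Definition brute5_bits (s : seq bool) : bool :=
  if s is [:: abp; abq; abr; apq; apr; aqr; bpq; bpr; bqr; pqr] then
  [&& gp_ok (abp (+) aqr) (abq (+) apr) (abr (+) apq),
  gp_ok (abp (+) bqr) (abq (+) bpr) (abr (+) bpq),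
  gp_ok (abp (+) pqr) (apq (+) bpr) (apr (+) bpq),
  gp_ok (abq (+) pqr) (apq (+) bqr) (aqr (+) bpq) &
  gp_ok (abr (+) pqr) (apr (+) bqr) (aqr (+) bpr)] ==>
  ([&& bpq != apq, abq != abp & bpq != abq] (+)
  ([&& bpr != apr, abr != abp & bpr != abr] (+)
   [&& bqr != aqr, abr != abq & bqr != abr]) ==
  [&& aqr == ~~ apr, aqr == apq & aqr == pqr] (+)
  [&& bqr == ~~ bpr, bqr == bpq & bqr == pqr]) else true.

Section Alternating.

Variables (P : pred 'I_n) (L : linkdata).
Hypothesis LP : link_axioms P L.
Local Notation o := (lo L).

Lemma lo_perm x y v : P x -> P y -> P v -> x != y -> x != v -> y != v ->
  [/\ o y x v = ~~ o x y v, o x v y = ~~ o x y v, o v x y = o x y v,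
      o y v x = o x y v & o v y x = ~~ o x y v].
Proof.
move=> Px Py Pv xy xv yv.
have A (s : seq 'I_n) : all (mem [:: x; y; v]) s -> all P s.
  by move/allP => h; apply/allP => w /h; rewrite !inE => /or3P[] /eqP ->.
have e1 : o y x v = ~~ o x y v.
  by apply: (lo_alt12 LP); rewrite /= ?Px ?Py ?Pv //= !inE negb_or xy xv yv.
have e2 : o x v y = ~~ o x y v.
  by apply: (lo_alt23 LP); rewrite /= ?Px ?Py ?Pv //= !inE negb_or xy xv yv.
have e3 : o v x y = ~~ o x v y.
  by apply: (lo_alt12 LP); rewrite /= ?Px ?Py ?Pv //= !inE negb_or xy xv eq_sym yv.
have e4 : o y v x = ~~ o y x v.
  by apply: (lo_alt23 LP); rewrite /= ?Px ?Py ?Pv //= !inE negb_or yv (eq_sym y) xy xv.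
have e5 : o v y x = ~~ o y v x.
  apply: (lo_alt12 LP); rewrite /= ?Px ?Py ?Pv //= !inE negb_or (eq_sym y x) xy.
  by rewrite yv (eq_sym v) xv.
by rewrite e5 e4 e3 e1 e2 !negbK.
Qed.

Lemma crossing_at_vertex p b q r : P p -> P b -> P q -> P r ->
  uniq [:: p; b; q; r] ->
  arcs_cross o p b q r = in_sector o p b q r (+) in_triangle o b p q r.
Proof.
move=> Pp Pb Pq Pr; rewrite /= !inE !negb_or !andbT.
case/and3P=> /and3P[pb pq pr] /andP[bq br] qr.
rewrite /arcs_cross /in_sector /in_triangle.
have [_ -> _ _ _] := lo_perm Pp Pb Pq pb pq bq.
by case: (o b q r); case: (o p q r); case: (o p b r); case: (o p b q).
Qed.

Lemma arcs_crossC a b c d : P a -> P b -> P c -> P d -> uniq [:: a; b; c; d] ->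
  arcs_cross o a b c d = arcs_cross o b a c d.
Proof.
move=> Pa Pb Pc Pd; rewrite /= !inE !negb_or !andbT.
case/and3P=> /and3P[ab ac ad] /andP[bc bd] cd.
rewrite /arcs_cross.
have [-> _ _ _ _] := lo_perm Pa Pb Pc ab ac bc.
have [-> _ _ _ _] := lo_perm Pa Pb Pd ab ad bd.
by case: (o b c d); case: (o a c d); case: (o a b c); case: (o a b d).
Qed.

Lemma arcs_cross_swap a b c d : P a -> P b -> P c -> P d -> uniq [:: a; b; c; d] ->
  arcs_cross o a b c d = arcs_cross o c d a b.
Proof.
move=> Pa Pb Pc Pd; rewrite /= !inE !negb_or !andbT.
case/and3P=> /and3P[ab ac ad] /andP[bc bd] cd.
rewrite /arcs_cross.
have [_ _ -> _ _] := lo_perm Pa Pb Pc ab ac bc.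
have [_ _ -> _ _] := lo_perm Pa Pb Pd ab ad bd.
have [_ _ _ -> _] := lo_perm Pa Pc Pd ac ad cd.
have [_ _ _ -> _] := lo_perm Pb Pc Pd bc bd cd.
by case: (o b c d); case: (o a c d); case: (o a b c); case: (o a b d).
Qed.

Lemma in_triangle_perm a p q r : P a -> P p -> P q -> P r ->
  uniq [:: a; p; q; r] ->
  in_triangle o a q p r = in_triangle o a p q r /\
  in_triangle o a r p q = in_triangle o a p q r.
Proof.
move=> Pa Pp Pq Pr; rewrite /= !inE !negb_or !andbT.
case/and3P=> /and3P[ap aq ar] /andP[pq pr] qr.
rewrite /in_triangle.
have [a1 a2 a3 a4 a5] := lo_perm Pa Pp Pq ap aq pq.
have [b1 b2 b3 b4 b5] := lo_perm Pa Pp Pr ap ar pr.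
have [c1 c2 c3 c4 c5] := lo_perm Pa Pq Pr aq ar qr.
have [d1 d2 d3 d4 d5] := lo_perm Pp Pq Pr pq pr qr.
rewrite ?(a1, a2, a3, a4, a5, b1, b2, b3, b4, b5) ?(c1, c2, c3, c4, c5, d1, d2, d3, d4, d5).
by case: (o a p q); case: (o a p r); case: (o a q r); case: (o p q r).
Qed.

End Alternating.

Section Corner.

Variables (P : pred 'I_n) (L : linkdata).
Hypothesis LP : link_axioms P L.
Variable z : 'I_n -> 'I_n -> bool.
Hypothesis zP : forall a b, z a b -> P a && P b && (a != b).
Hypothesis z0 : forall a, \xor_b z a b = false.
Local Notation o := (lo L).

Definition corner_terms p q r b :=
  ((b != q) && sorted_chi L p b q) (+) ((b != r) && sorted_chi L p b r).

(** The part of the corner sum that depends on [z] and on the order of the indices only, hence is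
    the same for all links. *)
Definition univ_corner p q r :=
  \xor_b (z p b && (if (b == q) || (b == r) then ordlt r q
                    else ~~ (ordlt b q (+) ordlt r b))).

Lemma sorted_chiC u a b : sorted_chi L u a b = sorted_chi L u b a.
Proof.
rewrite /sorted_chi; have [->//|ab] := eqVneq a b.
by rewrite (ordlt_neg ab); case: (ordlt a b).
Qed.

Lemma sorted_chiE u a b : P u -> P a -> P b -> uniq [:: u; a; b] ->
  sorted_chi L u a b = lchi L u a b (+) ordlt b a.
Proof.
move=> Pu Pa Pb U; rewrite /sorted_chi (lchi_alt LP (u := u) (a := a)) /= ?Pu ?Pa ?Pb //.
have ab : a != b by move: U; rewrite /= !inE andbT => /andP[].
by rewrite (ordlt_neg ab); case: (ordlt a b); case: (lchi L u a b).
Qed.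

(** For an edge pb, [lchi_sector] converts its corner bits against pq and pr plus the sector test
    into a constant independent of b. These constants cancel because [z] has even degree at p; only
    b = q and b = r, which have no sector test, leave an orientation bit. *)
Lemma xor_corner p q r (Pp : P p) (Pq : P q) (Pr : P r) (U : uniq [:: p; q; r]) :
  \xor_b (z p b && (corner_terms p q r b (+)
     (~~ ((b == p) || (b == q) || (b == r)) && in_sector o p b q r))) =
  ((z p q (+) z p r) && o p q r) (+) univ_corner p q r.
Proof.
have := U; rewrite /= !inE negb_or !andbT => /andP[/andP[pq' pr'] qr'].
transitivity (\xor_b ((z p b && lchi L p q r) (+) ((z p b && o p q r) (+)
   (((b == q) && (z p b && o p q r)) (+) (((b == r) && (z p b && o p q r)) (+)
   (z p b && (if (b == q) || (b == r) then ordlt r q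
                    else ~~ (ordlt b q (+) ordlt r b)))))))).
  apply: xor_eq => b; case zpb : (z p b); last by rewrite !andbF.
  have /andP[/andP[_ Pb] pb] := zP zpb; rewrite (eq_sym b p) (negbTE pb) /=.
  rewrite /corner_terms; have [->|bq] := eqVneq b q.
    rewrite qr' (negbTE qr') /= addbF sorted_chiE //.
    by case: (lchi _ _ _ _); case: (o _ _ _); case: (ordlt _ _).
  have [->|br] := eqVneq b r.
    rewrite /= !addbF sorted_chiC sorted_chiE //.
    by case: (lchi _ _ _ _); case: (o _ _ _); case: (ordlt _ _).
  rewrite /= sorted_chiC !sorted_chiE //=; last 2 first.
  - by rewrite !inE negb_or pb pr' br.
  - by rewrite !inE negb_or pb pq' eq_sym bq.
  have := @lchi_sector P L LP p q b r; rewrite /= Pp Pq Pb Pr /= !inE !negb_or.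
  rewrite pq' pb pr' (eq_sym q b) bq qr' br => /(_ isT isT).
  case: (in_sector _ _ _ _ _); case: (lchi _ _ _ _); case: (lchi _ _ _ _);
  by case: (lchi _ _ _ _); case: (o _ _ _); case: (ordlt _ _); case: (ordlt _ _).
rewrite !xorD !xorMr z0 !andFb !addFb !xor_pred1 /univ_corner addbA.
by rewrite -andb_addl.
Qed.

End Corner.

Section Polar.

Variables (P : pred 'I_n) (L : linkdata).
Hypothesis LP : link_axioms P L.
Variable z : 'I_n -> 'I_n -> bool.
Hypothesis zC : forall a b, z a b = z b a.
Hypothesis zP : forall a b, z a b -> P a && P b && (a != b).
Hypothesis z0 : forall a, \xor_b z a b = false.
Variables p q r : 'I_n.
Hypothesis pqrP : all P [:: p; q; r].
Hypothesis pqr : uniq [:: p; q; r].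

Local Notation o := (lo L).

Definition vertex p q r b := (b == p) || (b == q) || (b == r).

Definition sector_at a b :=
  if a == p then in_sector o p b q r else
  if a == q then in_sector o q b p r else in_sector o r b p q.

(** Distributes the parity of crossings of the arc ab with the boundary of pqr over its two ends, so
    that a sum over edges of [z] becomes a sum over vertices. *)
Definition half_crossing a b :=
  if vertex p q r a then ~~ vertex p q r b && sector_at a b
  else in_triangle o a p q r.

Let pq : p != q. Proof. by move: pqr; rewrite /= !inE negb_or => /andP[/andP[]]. Qed.
Let pr : p != r. Proof. by move: pqr; rewrite /= !inE negb_or => /andP[/andP[]]. Qed.
Let qr : q != r. Proof. by move: pqr; rewrite /= !inE => /andP[_ /andP[]]. Qed.
Let Pp : P p. Proof. by case/and4P: pqrP. Qed.
Let Pq : P q. Proof. by case/and4P: pqrP. Qed.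
Let Pr : P r. Proof. by case/and4P: pqrP. Qed.

Lemma arc_crossing_outside a b : P a -> P b -> a != b ->
  ~~ vertex p q r a -> ~~ vertex p q r b ->
  arc_crossing P L (a, b) (p, q) (+)
   (arc_crossing P L (a, b) (p, r) (+) arc_crossing P L (a, b) (q, r)) =
  in_triangle o a p q r (+) in_triangle o b p q r.
Proof.
move=> Pa Pb ab; rewrite /vertex !negb_or => /andP[/andP[ap aq] ar] /andP[/andP[bp bq] br].
have U : uniq [:: a; b; p; q; r].
  by rewrite /= !inE !negb_or ab ap aq ar bp bq br pq pr qr.
have Q w : w \in [:: a; b; p; q; r] -> P w.
  by rewrite !inE => /or4P[|||/orP[]] /eqP ->.
have gp x a' b' c d : x \in [:: a; b; p; q; r] -> a' \in [:: a; b; p; q; r] ->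
  b' \in [:: a; b; p; q; r] -> c \in [:: a; b; p; q; r] ->
  d \in [:: a; b; p; q; r] -> uniq [:: x; a'; b'; c; d] ->
  gp_ok (o x a' b' (+) o x c d) (o x a' c (+) o x b' d) (o x a' d (+) o x b' c).
  by move=> h1 h2 h3 h4 h5; apply: (lo_gp LP); rewrite /= !Q.
have mem5 : [/\ a \in [:: a; b; p; q; r], b \in [:: a; b; p; q; r],
  p \in [:: a; b; p; q; r], q \in [:: a; b; p; q; r] & r \in [:: a; b; p; q; r]].
  by rewrite !inE !eqxx !orbT.
case: mem5 => ma mb mp mq mr.
have ne := (ab, ap, aq, ar, bp, bq, br, pq, pr, qr).
have ne' : [/\ b != a, p != a, q != a & r != a] /\ [/\ p != b, q != b & r != b] /\
  [/\ q != p, r != p & r != q] by rewrite (eq_sym b a) (eq_sym p a) (eq_sym q a) (eq_sym r a) (eq_sym p b) (eq_sym q b) (eq_sym r b) (eq_sym q p) (eq_sym r p) (eq_sym r q) !ne.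
case: ne' => -[ba pa qa ra] [[pb qb rb] [qp rp rq]].
have ga := gp a b p q r ma mb mp mq mr; have gb := gp b a p q r mb ma mp mq mr.
have gp' := gp p a b q r mp ma mb mq mr; have gq := gp q a b p r mq ma mb mp mr.
have gr := gp r a b p q mr ma mb mp mq.
move: ga gb gp' gq gr.
rewrite /= !inE !negb_or !ne ba pa qa ra pb qb rb qp rp rq /=.
move=> /(_ isT) ga /(_ isT) gb /(_ isT) gp' /(_ isT) gq /(_ isT) gr.
have S x y v (mx : x \in [:: a; b; p; q; r]) (my : y \in [:: a; b; p; q; r])
    (mv : v \in [:: a; b; p; q; r]) (xy : x != y) (xv : x != v) (yv : y != v) :=
  lo_perm LP (Q _ mx) (Q _ my) (Q _ mv) xy xv yv.
have [abp _ pab _ _] := S a b p ma mb mp ab ap bp.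
have [abq _ qab _ _] := S a b q ma mb mq ab aq bq.
have [abr _ rab _ _] := S a b r ma mb mr ab ar br.
have [apq aqp qap _ _] := S a p q ma mp mq ap aq pq.
have [apr _ rap _ _] := S a p r ma mp mr ap ar pr.
have [aqr _ raq _ _] := S a q r ma mq mr aq ar qr.
have [bpq _ qbp _ _] := S b p q mb mp mq bp bq pq.
have [bpr _ rbp _ _] := S b p r mb mp mr bp br pr.
have [bqr _ rbq _ _] := S b q r mb mq mr bq br qr.
have [qpr _ rpq _ _] := S p q r mp mq mr pq pr qr.
have [_ pqa _ _ _] := S p a q mp ma mq pa pq aq.
have [_ pqb _ _ _] := S p b q mp mb mq pb pq bq.
rewrite /arc_crossing /= !Pa !Pb !Pp !Pq !Pr /= !inE !negb_or !ne /= /arcs_cross /in_triangle.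
rewrite pqa pqb apr apq bpr bpq !negbK.
have := @tautP 10 brute5_bits [::] isT
  [:: o p q r; o b q r; o b p r; o b p q; o a q r; o a p r; o a p q; o a b r; o a b q; o a b p] erefl.
rewrite /= => /implyP h; apply/eqP; apply: h.
have N x y v : gp_ok (~~ x) (~~ y) (~~ v) = gp_ok x y v by case: x; case: y; case: v.
rewrite ga -[X in _ && X]andbT.
move: gb gp' gq gr; rewrite abp abq abr pab qab rab apq apr qap rap aqr raq bpq qbp bpr rbp bqr rbq qpr rpq.
by rewrite ?addNb ?addbN ?negbK !N => -> -> -> ->.
Qed.

Lemma arc_crossing_half a b : z a b ->
  arc_crossing P L (a, b) (p, q) (+)
   (arc_crossing P L (a, b) (p, r) (+) arc_crossing P L (a, b) (q, r)) =
  half_crossing a b (+) half_crossing b a.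
Proof.
move=> /zP /andP[/andP[Pa Pb] ab].
have [qp rp rq] : [/\ q != p, r != p & r != q] by rewrite (eq_sym q p) (eq_sym r p) (eq_sym r q) pq pr qr.
have main x y : P x -> P y -> x != y -> vertex p q r x -> ~~ vertex p q r y ->
  arc_crossing P L (x, y) (p, q) (+)
   (arc_crossing P L (x, y) (p, r) (+) arc_crossing P L (x, y) (q, r)) =
  half_crossing x y (+) half_crossing y x.
  move=> Px Py xy vx vy; rewrite /half_crossing vx (negbTE vy) /=.
  move: vx vy; rewrite /vertex !negb_or => vx /andP[/andP[yp yq] yr].
  have [py qy ry] : [/\ p != y, q != y & r != y] by rewrite (eq_sym p) (eq_sym q) (eq_sym r) yp yq yr.
  rewrite /arc_crossing /= !inE !negb_or ?negb_and !Px !Py !Pp !Pq !Pr /= pq pr qr yp yq yr /=.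
  move: vx; rewrite xy /sector_at => /orP[/orP[]|] /eqP ->.
  - rewrite !eqxx /= ?pq ?pr ?qr ?andbF ?addFb (crossing_at_vertex LP) //.
    by rewrite /= !inE !negb_or py pq pr yq yr qr.
  - rewrite !eqxx (negbTE qp) /= ?qp ?pr ?qr ?andbF ?addFb ?addbF (crossing_at_vertex LP) //.
      by rewrite (in_triangle_perm LP Py Pp Pq Pr _).1 //= !inE !negb_or yp yq yr pq pr qr.
    by rewrite /= !inE !negb_or qy qp qr yp yr pr.
  - rewrite !eqxx (negbTE rp) (negbTE rq) /= ?rp ?rq ?pq ?andbF ?addFb ?addbF (crossing_at_vertex LP) //.
      by rewrite (in_triangle_perm LP Py Pp Pq Pr _).2 //= !inE !negb_or yp yq yr pq pr qr.
    by rewrite /= !inE !negb_or ry rp rq yp yq pq.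
have sw x y e : P x -> P y -> P e.1 -> P e.2 -> 
   arc_crossing P L (x, y) e = arc_crossing P L (y, x) e.
  move=> Px Py P1 P2; rewrite /arc_crossing.
  have -> : uniq [:: (y, x).1; (y, x).2; e.1; e.2] =
            uniq [:: (x, y).1; (x, y).2; e.1; e.2].
    rewrite /= !inE !negb_or (eq_sym y x).
    by case: (x == y); case: (x == e.1); case: (x == e.2); case: (y == e.1); case: (y == e.2).
  case U : uniq; last by rewrite !andbF.
  by rewrite /= Px Py P1 P2 (arcs_crossC LP).
case: (boolP (vertex p q r a)) => va; case: (boolP (vertex p q r b)) => vb.
- rewrite /half_crossing va vb /= /arc_crossing /= !inE.
  move: va vb; rewrite /vertex => /orP[/orP[]|] /eqP -> /orP[/orP[]|] /eqP ->;
  by rewrite !eqxx /= ?orbT /= ?andbF /= ?andbF.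
- exact: main.
- rewrite addbC [in RHS]addbC -main 1?eq_sym // addbC.
  by rewrite !(sw b a).
- by rewrite arc_crossing_outside // /half_crossing (negbTE va) (negbTE vb).
Qed.

Definition univ_polar :=
  univ_corner z p q r (+) (univ_corner z q p r (+) univ_corner z r p q) (+)
  (z q p (+) z q r).

Lemma arc_crossingC e f : arc_crossing P L e f = arc_crossing P L f e.
Proof.
case: e f => [a b] [c d]; rewrite /arc_crossing /= !inE !negb_or !andbT.
rewrite (eq_sym c a) (eq_sym c b) (eq_sym d a) (eq_sym d b).
case Pa : (P a); case Pb : (P b); case Pc : (P c); case Pd : (P d) => //=.
case ab : (a == b); case ac : (a == c); case ad : (a == d); case bc : (b == c);
  case bd : (b == d); case cd : (c == d) => //=.
by rewrite (arcs_cross_swap LP) //= !inE ab ac ad bc bd cd.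
Qed.

Lemma arc_crossing_rev e a b : arc_crossing P L e (a, b) = arc_crossing P L e (b, a).
Proof.
rewrite !(arc_crossingC e); case: e => [c d]; rewrite /arc_crossing /= !inE !negb_or !andbT.
rewrite (eq_sym b a).
case Pa : (P a); case Pb : (P b); case Pc : (P c); case Pd : (P d) => //=.
case ab : (a == b); case ac : (a == c); case ad : (a == d); case bc : (b == c);
  case bd : (b == d); case cd : (c == d) => //=.
by rewrite (arcs_crossC LP) //= !inE ab ac ad bc bd cd.
Qed.

(** At a vertex a outside pqr the half crossing does not depend on the other end, so the even degree
    of [z] cancels it. Only the sector tests at p, q and r remain. *)
Lemma polar_crossings :
  crossings P L (fun a b => z a b (+) tri p q r a b) =
  crossings P L z (+) crossings P L (tri p q r) (+)
  ((\xor_b (z p b && (~~ vertex p q r b && in_sector o p b q r))) (+)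
   ((\xor_b (z q b && (~~ vertex p q r b && in_sector o q b p r))) (+)
    (\xor_b (z r b && (~~ vertex p q r b && in_sector o r b p q))))).
Proof.
rewrite {1}/crossings.
rewrite (eq_quad _ (g := arc_crossing P L) (z' := fun e =>
  (ordlt e.1 e.2 && z e.1 e.2) (+) (ordlt e.1 e.2 && tri p q r e.1 e.2))) //; last first.
  by move=> e; rewrite andb_addr.
rewrite (quad_polar arclt_tri arcltxx _ _ arc_crossingC); congr (_ (+) _).
transitivity (\xor_e ((ordlt e.1 e.2 && z e.1 e.2) &&
   (half_crossing e.1 e.2 (+) half_crossing e.2 e.1))).
  apply: xor_eq => e; case ze : (z e.1 e.2); last first.
    by rewrite xor0 ?andbF // => f; rewrite !andbF.
  rewrite -arc_crossing_half //; case: e ze => [a b] /= ze.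
  under xor_eq => f do rewrite -andbA.
  rewrite xorMl andbT; congr (_ && _).
  transitivity (\xor_c \xor_d (ordlt c d && (tri p q r c d && arc_crossing P L (a, b) (c, d)))).
    rewrite xor_pair; apply: xor_eq => -[c d] /=.
    rewrite -andbA; congr (_ && (_ && _)).
    have [[-> ->]|//] := eqVneq (a, b) (c, d).
    by rewrite /arc_crossing /= !inE eqxx orbT /= andbF.
  rewrite xor_tri_lt // (arc_crossing_rev (a, b) q p) (arc_crossing_rev (a, b) r p).
  by rewrite (arc_crossing_rev (a, b) r q) !if_same.
rewrite -(xor_pair (fun a b => (ordlt a b && z a b) && (half_crossing a b (+) half_crossing b a))).
transitivity (\xor_a \xor_b (z a b && half_crossing a b)).
  rewrite [RHS](xor_sym ordlt_tri) [X in _ = _ (+) X]xor0 ?addbF.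
    apply: xor_eq => a; apply: xor_eq => b; rewrite (zC b a).
    by rewrite -andb_addr andbA.
  by move=> a; apply/negP => /andP[/zP]; rewrite eqxx andbF.
transitivity (\xor_a ((vertex p q r a && \xor_b (z a b && (~~ vertex p q r b && sector_at a b))) (+)
   (~~ vertex p q r a && in_triangle o a p q r && \xor_b z a b))).
  apply: xor_eq => a; rewrite -!xorMl -xorD; apply: xor_eq => b; rewrite /half_crossing.
  by case: (vertex p q r a); case: (z a b); rewrite /= ?andbF ?addbF ?andbT.
under xor_eq => a do rewrite z0 andbF addbF.
transitivity (\xor_a (((a == p) && \xor_b (z a b && (~~ vertex p q r b && in_sector o p b q r))) (+)
 (((a == q) && \xor_b (z a b && (~~ vertex p q r b && in_sector o q b p r))) (+)
  ((a == r) && \xor_b (z a b && (~~ vertex p q r b && in_sector o r b p q)))))).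
  apply: xor_eq => a; rewrite /sector_at {1}/vertex.
  have [->|ap] := eqVneq a p; first by rewrite (negbTE pq) (negbTE pr) /= addbF.
  have [->|aq] := eqVneq a q; first by rewrite (negbTE qr) /= addbF.
  by [].
by rewrite !xorD !xor_pred1.
Qed.

Lemma polar_turning :
  turning L (fun a b => z a b (+) tri p q r a b) =
  turning L z (+) turning L (tri p q r) (+)
  ((\xor_b (z p b && corner_terms L p q r b)) (+)
   ((\xor_b (z q b && corner_terms L q p r b)) (+)
    (\xor_b (z r b && corner_terms L r p q b)))).
Proof.
rewrite /turning.
under xor_eq => u do rewrite (quad_polar ordlt_tri ordltxx _ _ (sorted_chiC L u)).
rewrite !xorD.
under [X in _ (+) X = _]xor_eq => a.
  under xor_eq => b do rewrite andb_addl andb_addr.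
  rewrite xorD; over.
rewrite xorD.
set A := \xor_u \xor_a \xor_b _.
set B := (X in _ = _ (+) _ (+) X).
suff -> : A = B.
  by rewrite addbAC; congr (_ (+) _); exact: addbACA.
rewrite /A /B; under xor_eq => u.
  under xor_eq => a.
    under xor_eq => b do rewrite -andbA.
    rewrite xorMl xor_tri; over.
  over.
rewrite -[X in _ = _ (+) (X (+) _)](xor_pred1 q (fun u => \xor_b (z u b && corner_terms L u p r b))).
rewrite -[X in _ = X (+) _](xor_pred1 p (fun u => \xor_b (z u b && corner_terms L u q r b))).
rewrite -[X in _ = _ (+) (_ (+) X)](xor_pred1 r (fun u => \xor_b (z u b && corner_terms L u p q b))).
rewrite -!xorD; apply: xor_eq => u; rewrite -!xorMl -!xorD; apply: xor_eq => a.
rewrite /corner_terms.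
by case: (z u a); case: (u == p); case: (u == q); case: (u == r); rewrite //= ?addbF.
Qed.

(** Neither turning nor crossings has a polar form independent of [L], but the sector tests of one
    meet the corner bits of the other in [xor_corner]. The orientation of pqr then occurs with
    coefficient zero, and its alternation leaves the two bits of [z] at q. *)
Lemma polar_total :
  total P L (fun a b => z a b (+) tri p q r a b) =
  total P L z (+) total P L (tri p q r) (+) univ_polar.
Proof.
rewrite /total polar_turning polar_crossings.
have qp : q != p by rewrite eq_sym.
have rp : r != p by rewrite eq_sym.
have rq : r != q by rewrite eq_sym.
have U1 : uniq [:: q; p; r] by rewrite /= !inE !negb_or qp qr pr.
have U2 : uniq [:: r; p; q] by rewrite /= !inE !negb_or rp rq pq.
have c1 := @xor_corner P L LP z zP z0 p q r Pp Pq Pr pqr.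
have c2 := @xor_corner P L LP z zP z0 q p r Pq Pp Pr U1.
have c3 := @xor_corner P L LP z zP z0 r p q Pr Pp Pq U2.
have E x y v : \xor_b (z x b && (corner_terms L x y v b (+)
     (~~ ((b == x) || (b == y) || (b == v)) && in_sector o x b y v))) =
  (\xor_b (z x b && corner_terms L x y v b)) (+)
  (\xor_b (z x b && (~~ ((b == x) || (b == y) || (b == v)) && in_sector o x b y v))).
  by rewrite -xorD; apply: xor_eq => b; rewrite andb_addr.
rewrite !E in c1 c2 c3.
have V2 b : (b == q) || (b == p) || (b == r) = vertex p q r b.
  by rewrite /vertex (orbC (b == q)).
have V3 b : (b == r) || (b == p) || (b == q) = vertex p q r b.
  by rewrite /vertex; case: (b == p); case: (b == q); case: (b == r).
have W2 : \xor_b (z q b && (~~ ((b == q) || (b == p) || (b == r)) && in_sector o q b p r)) =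
  \xor_b (z q b && (~~ vertex p q r b && in_sector o q b p r)).
  by apply: xor_eq => b; rewrite V2.
have W3 : \xor_b (z r b && (~~ ((b == r) || (b == p) || (b == q)) && in_sector o r b p q)) =
  \xor_b (z r b && (~~ vertex p q r b && in_sector o r b p q)).
  by apply: xor_eq => b; rewrite V3.
have [e1 e2 e3 _ _] := lo_perm LP Pp Pq Pr pq pr qr.
rewrite W2 e1 in c2; rewrite W3 e3 in c3.
rewrite /univ_polar (zC q p).
move: c1 c2 c3; rewrite (zC r p) (zC r q) (zC q p).
rewrite -/(vertex p q r _).
move: (\xor_b (z p b && corner_terms L p q r b)) => v1.
move: (\xor_b (z q b && corner_terms L q p r b)) => v2.
move: (\xor_b (z r b && corner_terms L r p q b)) => v3.
move: (\xor_b (z p b && (~~ vertex p q r b && in_sector o p b q r))) => s1.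
move: (\xor_b (z q b && (~~ vertex p q r b && in_sector o q b p r))) => s2.
move: (\xor_b (z r b && (~~ vertex p q r b && in_sector o r b p q))) => s3.
move: (univ_corner z p q r) (univ_corner z q p r) (univ_corner z r p q) => u1 u2 u3 c1 c2 c3.
rewrite addbACA; congr (_ (+) _); first exact: addbACA.
have K x y v : x (+) y = v -> x = v (+) y by move=> <-; rewrite addbK.
rewrite (K _ _ _ c1) (K _ _ _ c2) (K _ _ _ c3).
move: (z p q) (z p r) (z q r) (o p q r) => b1 b2 b3 b4.
clear; case: b1; case: b2; case: b3; case: b4 => /=;
by case: s1; case: s2; case: s3; case: u1; case: u2; case: u3.
Qed.


Lemma turning_tri : turning L (tri p q r) =
  (sorted_chi L p q r (+) (sorted_chi L q p r (+) sorted_chi L r p q)) (+)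
  ((if ordlt p q then ldl L p q else ldl L q p) (+)
  ((if ordlt p r then ldl L p r else ldl L r p) (+)
   (if ordlt q r then ldl L q r else ldl L r q))).
Proof.
rewrite /turning xor_tri_lt //; congr (_ (+) _).
rewrite -[X in _ = X (+) _](xor_pred1 p (fun u => sorted_chi L u q r)).
rewrite -[X in _ = _ (+) (X (+) _)](xor_pred1 q (fun u => sorted_chi L u p r)).
rewrite -[X in _ = _ (+) (_ (+) X)](xor_pred1 r (fun u => sorted_chi L u p q)).
rewrite -!xorD; apply: xor_eq => u.
have Z (f : 'I_n -> 'I_n -> bool) : quad ordlt f (fun=> false) = false.
  by apply: xor0 => a; apply: xor0 => b; rewrite /= andbF.
have [up|up] := eqVneq u p.
  rewrite up (negbTE pq) (negbTE pr) /= addbF -(quad_pair (sorted_chiC L p) qr).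
  by apply: eq_quad => // a; rewrite /tri eqxx (negbTE pq) (negbTE pr) /= addbF.
have [uq|uq] := eqVneq u q.
  rewrite uq (negbTE qr) /= addbF -(quad_pair (sorted_chiC L q) pr).
  by apply: eq_quad => // a; rewrite /tri eqxx (negbTE qr) -uq (negbTE up) /= addbF.
have [ur|ur] := eqVneq u r.
  rewrite /= ur -(quad_pair (sorted_chiC L r) pq).
  by apply: eq_quad => // a; rewrite /tri eqxx -ur (negbTE up) (negbTE uq).
transitivity (quad ordlt (sorted_chi L u) (fun=> false)); last by rewrite Z.
apply: eq_quad => // a.
by rewrite /tri (negbTE up) (negbTE uq) (negbTE ur).
Qed.

Lemma crossings_tri : crossings P L (tri p q r) = false.
Proof.
apply: xor0 => -[a b]; apply: xor0 => -[c d]; apply/negbTE/negP.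
have H x y : tri p q r x y -> (x \in [:: p; q; r]) && (y \in [:: p; q; r]).
  rewrite /tri !inE; case: (x == p); case: (x == q); case: (x == r);
  by case: (y == p); case: (y == q); case: (y == r).
case/andP=> _ /andP[/andP[/andP[_ /= /H/andP[h1 h2]] /andP[_ /H/andP[h3 h4]]]].
case/and3P=> _ U _; have /= := @uniq_leq_size _ _ [:: p; q; r] U.
move=> Q; have: (4 <= 3)%N; last by [].
apply: Q => x; rewrite !inE => /or4P[] /eqP ->;
by move: h1 h2 h3 h4; rewrite !inE.
Qed.

(** A triangle has no crossings, and [lchi_triangle] cancels its lift bits up to the signs from
    sorting the indices, which add up to one. *)
Lemma total_tri : total P L (tri p q r) = true.
Proof.
rewrite /total crossings_tri addbF turning_tri.
have qp : q != p by rewrite eq_sym.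
have rp : r != p by rewrite eq_sym.
have rq : r != q by rewrite eq_sym.
rewrite (sorted_chiC L q) !(sorted_chiE LP) //=; last 2 first.
- by rewrite !inE !negb_or rp rq pq.
- by rewrite !inE !negb_or qr qp rp.
have := lchi_triangle LP pqrP pqr.
rewrite (ldl_alt LP Pp Pq pq) (ldl_alt LP Pp Pr pr) (ldl_alt LP Pq Pr qr).
rewrite (ordlt_neg pq) (ordlt_neg qr) .
case: (lchi L p q r); case: (lchi L r p q); case: (lchi L q r p);
case: (ordlt p q); case: (ordlt p r); case: (ordlt q r);
by case: (ldl L p q); case: (ldl L p r); case: (ldl L q r).
Qed.

End Polar.

Lemma eq_total P L z z' : z =2 z' -> total P L z = total P L z'.
Proof.
move=> zz; rewrite /total /turning /crossings; congr (_ (+) _ (+) _).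
- by apply: xor_eq => u; apply: eq_quad.
- by apply: xor_eq => a; apply: xor_eq => b; rewrite zz.
- by apply: eq_quad => // e; rewrite zz.
Qed.

Lemma total0 P L z : (forall a b, z a b = false) -> total P L z = false.
Proof.
move=> z00; have B : crossings P L z = false.
  by apply: xor0 => e; apply: xor0 => f; rewrite !z00 !andbF.
have A : \xor_u quad ordlt (sorted_chi L u) (z u) = false.
  by apply: xor0 => u; apply: xor0 => a; apply: xor0 => b; rewrite !z00 /= andbF.
rewrite /total B /turning A addbF; apply: xor0 => a; apply: xor0 => b.
by rewrite z00 andbF.
Qed.

(** A cycle is a sum of triangles with a common apex [o], and adding one triangle changes [total] by
    an amount that does not involve the link. The induction is on the number of edges that avoid
    [o]. *)
Lemma total_universal P L L' z : link_axioms P L -> link_axioms P L' ->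
  (forall a b, z a b = z b a) -> (forall a b, z a b -> P a && P b && (a != b)) ->
  (forall a, \xor_b z a b = false) -> total P L z = total P L' z.
Proof.
move=> LP LP'.
case: (pickP P) => [o Po|P0]; last first.
  move=> _ zP _; have z00 a b : z a b = false by apply/negbTE/negP => /zP; rewrite P0.
  by rewrite !total0.
pose N z := [set e : 'I_n * 'I_n | [&& z e.1 e.2, e.1 != o & e.2 != o]].
have [k] := ubnP #|N z|; elim: k z => // k IH z Nk zC zP z0.
(* If all edges pass through [o], every other vertex has degree at most one, hence zero by
   evenness. *)
have [N0|[[a b]]] := set_0Vmem (N z).
  have z00 x y : z x y = false.
    have zo w : w != o -> z w o = false.
      move=> wo; have := z0 w; rewrite (bigD1 o) //= big1 ?addbF // => v vo.
      apply/negbTE/negP => wv; have : (w, v) \in N z by rewrite inE wv wo.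
      by rewrite N0 inE.
    apply/negbTE/negP => xy; have : (x, y) \in N z.
      rewrite inE xy /=; have /andP[_ ne] := zP _ _ xy; apply/andP; split.
        apply: contraTneq xy => xo; rewrite zC xo zo // -xo eq_sym //.
      by apply: contraTneq xy => yo; rewrite yo zo // -yo.
    by rewrite N0 inE.
  by rewrite !total0.
rewrite inE /= => /and3P[ab ao bo]; have /andP[/andP[Pa Pb] ne] := zP _ _ ab.
have U : uniq [:: o; a; b] by rewrite /= !inE !negb_or (eq_sym o) ao (eq_sym o) bo ne.
have PP : all P [:: o; a; b] by rewrite /= Po Pa Pb.
pose z' x y := z x y (+) tri o a b x y.
have zE : z =2 (fun x y => z' x y (+) tri o a b x y) by move=> x y; rewrite /z' addbK.
have z'C x y : z' x y = z' y x by rewrite /z' zC triC.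
have z'P x y : z' x y -> P x && P y && (x != y).
  rewrite /z'; case zxy : (z x y); first by move=> _; apply: zP.
  move: U; rewrite /= !inE negb_or andbT => /andP[/andP[oa ob] _].
  rewrite /tri; have [->|] := eqVneq x o.
    rewrite (negbTE oa) (negbTE ob) Po /= addbF.
    by have [->|_] := eqVneq y a; [rewrite Pa oa | have [->|//] := eqVneq y b; rewrite Pb ob].
  have [->|] := eqVneq x a.
    rewrite (negbTE ne) Pa /= addbF => _.
    by have [->|_] := eqVneq y o; [rewrite Po ao | have [->|//] := eqVneq y b; rewrite Pb ne].
  have [->|//] := eqVneq x b; rewrite Pb /= => _ _.
  by have [->|_] := eqVneq y o; [rewrite Po bo | have [->|//] := eqVneq y a; rewrite Pa eq_sym ne].
have z'0 x : \xor_y z' x y = false.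
  rewrite /z' xorD z0 addFb; under xor_eq => y do rewrite -[tri _ _ _ _ _]andbT.
  by rewrite xor_tri !andbF.
have H : total P L z' = total P L' z'.
  apply: IH => //; rewrite -ltnS; apply: leq_trans Nk; rewrite ltnS.
  apply: proper_card; apply/properP; split.
    apply/subsetP => -[x y]; rewrite !inE /= /z' => /and3P[h xo yo]; rewrite xo yo !andbT.
    case zxy : (z x y) h => //=; rewrite /tri (negbTE xo) (negbTE yo) /=.
    have [xa|xa] := eqVneq x a.
      by rewrite xa (negbTE ne) /= ?addbF => /eqP yb; rewrite -zxy xa yb ab.
    by have [xb|//] := eqVneq x b; rewrite /= ?addbF => /eqP ya; rewrite -zxy xb ya zC ab.
  exists (a, b); rewrite !inE /= ?ab ?ao ?bo // /z' ab /tri !eqxx (negbTE ao) (negbTE ne).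
  by rewrite (negbTE bo).
rewrite !(eq_total _ _ zE) !(polar_total _ z'C z'P z'0 PP U) //.
by rewrite H !total_tri.
Qed.

End Link.

(** Six points in space forming the triangles abe and xyz, with the Pluecker relations for each side
    of either triangle as premises. The incidences of a side of one with the other triangle are even
    in number: they are the ends of the common segment. *)
Definition brute6_bits (s : seq bool) : bool :=
  if s is [:: abex; abey; abez; abxy; abxz; abyz; aexy; aexz; aeyz; axyz;
              bexy; bexz; beyz; bxyz; exyz] then
  [&& gp_ok (abex (+) abyz) (abey (+) abxz) (abez (+) abxy),
      gp_ok (abex (+) aeyz) (abey (+) aexz) (abez (+) aexy),
      gp_ok (abex (+) beyz) (abey (+) bexz) (abez (+) bexy),
      gp_ok (abxy (+) exyz) (aexy (+) bxyz) (axyz (+) bexy),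
      gp_ok (abxz (+) exyz) (aexz (+) bxyz) (axyz (+) bexz) &
      gp_ok (abyz (+) exyz) (aeyz (+) bxyz) (axyz (+) beyz)] ==>
  ([&& axyz != bxyz, abxy == abyz & abxy != abxz] (+)
   ([&& axyz != exyz, aexy == aeyz & aexy != aexz] (+)
   ([&& bxyz != exyz, bexy == beyz & bexy != bexz] (+)
   ([&& abex != abey, abxy == bexy & abxy != aexy] (+)
   ([&& abex != abez, abxz == bexz & abxz != aexz] (+)
    [&& abey != abez, abyz == beyz & abyz != aeyz])))) == false)
  else true.

(** * Local signs of a spatial configuration, summed over a modulo 2 cycle of triangles *)

Section Cycle.

Variable n : nat.
Implicit Types (a b i j k v u x y : 'I_n).

(** [ori] is the orientation of a tetrahedron, meaningful only for points related by [nr], since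
    distant points share no chart. [chi v] and [dl v] are the link data at v; [ga v u a] is the lift
    bit for moving the flag of the triangle vua along its edge from v to u. *)
Record system := System {
  nr : rel 'I_n;
  ori : 'I_n -> 'I_n -> 'I_n -> 'I_n -> bool;
  chi : 'I_n -> 'I_n -> 'I_n -> 'I_n -> bool;
  dl : 'I_n -> 'I_n -> 'I_n -> bool;
  ga : 'I_n -> 'I_n -> 'I_n -> bool }.

Definition all_near (S : system) (s : seq 'I_n) := all (fun x => all (nr S x) s) s.

Definition link (S : system) v := LinkData (ori S v) (chi S v) (dl S v).

(* The segment [ab] meets the triangle [xyz]. *)
Definition meets (S : system) a b x y z :=
  [&& ori S a x y z != ori S b x y z, ori S a b x y == ori S a b y z &
      ori S a b x y == ori S a b z x].

Definition six_ok (O : 'I_n -> 'I_n -> 'I_n -> 'I_n -> bool) a b e x y z :=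
  [&& gp_ok (O a b e x (+) O a b y z) (O a b e y (+) O a b x z) (O a b e z (+) O a b x y),
      gp_ok (O a b e x (+) O a e y z) (O a b e y (+) O a e x z) (O a b e z (+) O a e x y),
      gp_ok (O a b e x (+) O b e y z) (O a b e y (+) O b e x z) (O a b e z (+) O b e x y),
      gp_ok (O a b x y (+) O e x y z) (O a e x y (+) O b x y z) (O a x y z (+) O b e x y),
      gp_ok (O a b x z (+) O e x y z) (O a e x z (+) O b x y z) (O a x y z (+) O b e x z) &
      gp_ok (O a b y z (+) O e x y z) (O a e y z (+) O b x y z) (O a x y z (+) O b e y z)].

Definition nbr (adj : rel 'I_n) v a := adj v a && (v != a).

(** The bits met along the closed path through the six flags of a triangle, which alternately
    changes the edge at a vertex ([dl]) and the vertex of an edge ([ga]). *)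
Definition hexagon (S : system) v u a :=
  dl S v u a (+) ga S v a u (+) dl S a v u (+) ga S a u v (+) dl S u a v (+) ga S u v a.

Record system_axioms (adj : rel 'I_n) (S : system) : Prop := SystemAxioms {
  nr_star : forall v a b, adj v a -> adj v b -> all_near S [:: v; a; b];
  ori_alt : forall a b c d, all_near S [:: a; b; c; d] -> uniq [:: a; b; c; d] ->
    [/\ ori S b a c d = ~~ ori S a b c d, ori S a c b d = ~~ ori S a b c d &
        ori S a b d c = ~~ ori S a b c d];
  ori_gp : forall a b e x y z, all_near S [:: a; b; e; x; y; z] ->
    uniq [:: a; b; e; x; y; z] -> six_ok (ori S) a b e x y z;
  system_link : forall v, link_axioms (nbr adj v) (link S v);
  ga_alt : forall v u a, uniq [:: v; u; a] -> adj v u -> adj v a -> adj u a ->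
    ga S u v a = ~~ ga S v u a;
  chi_flip : forall v u a b, uniq [:: v; u; a; b] ->
    adj v u -> adj v a -> adj u a -> adj v b -> adj u b ->
    chi S u v a b = ~~ (ga S v u a (+) ga S v u b (+) chi S v u a b);
  meets_near : forall a b e x y z, uniq [:: a; b; e; x; y; z] ->
    adj a b -> adj a e -> adj b e -> adj x y -> adj x z -> adj y z ->
    all_near S [:: a; b; x; y; z] -> meets S a b x y z ->
    all_near S [:: a; b; e; x; y; z] }.

Variable adj : rel 'I_n.
Hypothesis adjC : symmetric adj.
Variable c : 'I_n -> 'I_n -> 'I_n -> bool.
Hypothesis c12 : forall a b x, c a b x = c b a x.
Hypothesis c23 : forall a b x, c a b x = c a x b.
Hypothesis c_uniq : forall a b x, c a b x -> uniq [:: a; b; x].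
Hypothesis c_adj : forall a b x, c a b x -> adj a b.
Hypothesis c_cycle : forall a b, \xor_x c a b x = false.

(** [c] is a set of triangles with an even number of them on each edge; increasing indices select
    each triangle once. *)
Definition xorT (G : 'I_n -> 'I_n -> 'I_n -> bool) :=
  \xor_i \xor_j \xor_k ((ordlt i j && ordlt j k) && (c i j k && G i j k)).

Lemma xorTD G H : xorT (fun i j k => G i j k (+) H i j k) = xorT G (+) xorT H.
Proof.
rewrite /xorT -xorD; apply: xor_eq => i; rewrite -xorD; apply: xor_eq => j.
by rewrite -xorD; apply: xor_eq => k; rewrite !andb_addr.
Qed.

Lemma eq_xorT G H : (forall i j k, c i j k -> G i j k = H i j k) -> xorT G = xorT H.
Proof.
move=> GH; apply: xor_eq => i; apply: xor_eq => j; apply: xor_eq => k.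
by case cc : (c i j k); [rewrite GH | rewrite /= !andbF].
Qed.

Lemma xorT_flag G :
  \xor_x \xor_d \xor_e (ordlt d e && (c x d e && G x d e)) =
  xorT (fun i j k => G i j k (+) G j i k (+) G k i j).
Proof.
rewrite !xorTD.
have -> : xorT (fun i j k => G j i k) =
  \xor_x \xor_d \xor_e ((ordlt d x && ordlt x e) && (c x d e && G x d e)).
  rewrite /xorT xor_ex; apply: xor_eq => j; apply: xor_eq => i; apply: xor_eq => k.
  by rewrite c12.
have -> : xorT (fun i j k => G k i j) =
  \xor_x \xor_d \xor_e ((ordlt d e && ordlt e x) && (c x d e && G x d e)).
  rewrite /xorT; under xor_eq => i do rewrite xor_ex.
  rewrite xor_ex; apply: xor_eq => k; apply: xor_eq => i; apply: xor_eq => j.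
  by rewrite (c23 i) (c12 i).
rewrite /xorT -!xorD; apply: xor_eq => x; rewrite -!xorD; apply: xor_eq => d.
rewrite -!xorD; apply: xor_eq => e.
case cc : (c x d e); last by rewrite !andbF.
move: (c_uniq cc); rewrite /= !inE negb_or andbT => /andP[/andP[xd xe] de].
rewrite (ordlt_neg xd) (ordlt_neg xe); case: (G x d e); rewrite ?andbF //= !andbT.
rewrite /ordlt; have : (x : nat) != d by []. have : (x : nat) != e by []. have : (d : nat) != e by [].
clear; case: (ltngtP d e) => h1 // _; case: (ltngtP x e) => h2 // _;
  case: (ltngtP x d) => h3 //= _;
  exfalso; first [by move: (ltn_trans (ltn_trans h1 h2) h3); rewrite ltnn |
                   by move: (ltn_trans (ltn_trans h2 h1) h3); rewrite ltnn].
Qed.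

Lemma adjxx a b x : c a b x -> [/\ adj a b, adj a x & adj b x].
Proof.
by move=> cc; split; [exact: c_adj cc | apply: (@c_adj a x b); rewrite -c23
  | apply: (@c_adj b x a); rewrite -c23 -c12].
Qed.

Section OneSystem.

Variable S : system.
Hypothesis SP : system_axioms adj S.

Lemma all_near_sub (s t : seq 'I_n) : {subset t <= s} -> all_near S s -> all_near S t.
Proof.
move=> ts /allP h; apply/allP => x xt; apply/allP => y yt.
by have /allP := h x (ts _ xt); apply; apply: ts.
Qed.

Lemma ori_perm a b x y : all_near S [:: a; b; x; y] -> uniq [:: a; b; x; y] ->
  [/\ ori S x a b y = ori S a b x y, ori S x y a b = ori S a b x y,
      ori S a b y x = ~~ ori S a b x y, ori S a x y b = ori S a b x y &
      ori S y a b x = ~~ ori S a b x y] /\ ori S b a x y = ~~ ori S a b x y.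
Proof.
move=> N U.
have [-> _ e3] := ori_alt SP N U.
have A s : {subset s <= [:: a; b; x; y]} -> all_near S s by move=> h; apply: all_near_sub N.
move: (U); rewrite /= !inE !negb_or andbT => /and3P[/and3P[ab ax ay] /andP[bx by'] xy].
have [ba xa ya] : [/\ b != a, x != a & y != a] by rewrite (eq_sym b) (eq_sym x) (eq_sym y).
have [xb yb yx] : [/\ x != b, y != b & y != x] by rewrite (eq_sym x) (eq_sym y b) (eq_sym y x).
have N1 : all_near S [:: a; x; b; y].
  by apply: A => w; rewrite !inE => /or4P[] ->; rewrite ?orbT.
have N2 : all_near S [:: x; a; b; y].
  by apply: A => w; rewrite !inE => /or4P[] ->; rewrite ?orbT.
have N3 : all_near S [:: x; a; y; b].
  by apply: A => w; rewrite !inE => /or4P[] ->; rewrite ?orbT.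
have N4 : all_near S [:: a; b; y; x].
  by apply: A => w; rewrite !inE => /or4P[] ->; rewrite ?orbT.
have N5 : all_near S [:: a; y; b; x].
  by apply: A => w; rewrite !inE => /or4P[] ->; rewrite ?orbT.
have U1 : uniq [:: a; x; b; y] by rewrite /= !inE !negb_or ab ax ay xb by' xy.
have U2 : uniq [:: x; a; b; y] by rewrite /= !inE !negb_or xa xb xy ab ay by'.
have U3 : uniq [:: x; a; y; b] by rewrite /= !inE !negb_or xa xb xy ab ay yb.
have U4 : uniq [:: a; b; y; x] by rewrite /= !inE !negb_or ab ax ay bx by' yx.
have U5 : uniq [:: a; y; b; x] by rewrite /= !inE !negb_or ab ax ay yb yx bx.
have [_ q1 _] := ori_alt SP N U.
have [q2 _ q3] := ori_alt SP N1 U1.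
have [_ _ q4] := ori_alt SP N2 U2.
have [_ q5 _] := ori_alt SP N3 U3.
have [_ q6 _] := ori_alt SP N4 U4.
have [q7 _ _] := ori_alt SP N5 U5.
by rewrite q5 q4 q7 q6 q3 q2 q1 e3 !negbK.
Qed.

Local Notation O := (ori S).

Lemma meets_triangle_last a b x y z :
  all_near S [:: a; b; x; y; z] -> uniq [:: a; b; x; y; z] ->
  meets S a b x y z =
  [&& O a x y z != O b x y z, O a b x y == O a b y z & O a b x y != O a b x z].
Proof.
move=> N U; rewrite /meets.
have [|//|[_ _ -> _ _] _] := @ori_perm a b x z.
- by apply: all_near_sub N => w; rewrite !inE => /or4P[] ->; rewrite ?orbT.
- move: U; rewrite /= !inE !negb_or !andbT.
  by case/and4P=> /and4P[-> -> _ ->] /and3P[-> _ ->] /andP[_ ->].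
by case: (O a b x y); case: (O a b x z).
Qed.

Lemma meets_triangle_first a b e x y :
  all_near S [:: a; b; e; x; y] -> uniq [:: a; b; e; x; y] ->
  meets S x y a b e =
  [&& O a b e x != O a b e y, O a b x y == O b e x y & O a b x y != O a e x y].
Proof.
move=> N U; rewrite /meets.
have sub s : {subset s <= [:: a; b; e; x; y]} -> all_near S s.
  by move=> h; apply: all_near_sub N.
move: (U); rewrite /= !inE !negb_or !andbT.
case/and4P=> /and4P[ab ae ax ay] /and3P[be bx by'] /andP[ex ey] xy.
have [|//|[_ _ _ _ ->] _] := @ori_perm a b e x.
- by apply: sub => w; rewrite !inE => /or4P[] ->; rewrite ?orbT.
- by rewrite /= !inE !negb_or ab ae ax be bx ex.
have [|//|[_ _ _ _ ->] _] := @ori_perm a b e y.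
- by apply: sub => w; rewrite !inE => /or4P[] ->; rewrite ?orbT.
- by rewrite /= !inE !negb_or ab ae ay be by' ey.
have [|//|[_ -> _ _ _] _] := @ori_perm a b x y.
- by apply: sub => w; rewrite !inE => /or4P[] ->; rewrite ?orbT.
- by rewrite /= !inE !negb_or ab ax ay bx by' xy.
have [|//|[_ -> _ _ _] _] := @ori_perm b e x y.
- by apply: sub => w; rewrite !inE => /or4P[] ->; rewrite ?orbT.
- by rewrite /= !inE !negb_or be bx by' ex ey xy.
have [|//|[_ _ -> _ _] _] := @ori_perm x y a e.
- by apply: sub => w; rewrite !inE => /or4P[] ->; rewrite ?orbT.
- by rewrite /= !inE !negb_or xy (eq_sym x) ax (eq_sym x) ex (eq_sym y) ay (eq_sym y) ey ae.
have [|//|[_ -> _ _ _] _] := @ori_perm a e x y.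
- by apply: sub => w; rewrite !inE => /or4P[] ->; rewrite ?orbT.
- by rewrite /= !inE !negb_or ae ax ay ex ey xy.
by case: (O a b e x); case: (O a b e y); case: (O a b x y); case: (O b e x y);
   case: (O a e x y).
Qed.

Definition hits a b x y z :=
  [&& all_near S [:: a; b; x; y; z], uniq [:: a; b; x; y; z] & meets S a b x y z].

(** Either the six points are mutually near and [brute6_bits] applies, or by [meets_near] there is
    no incidence at all. *)
Lemma hits_triangles a b e x y z : c a b e -> c x y z ->
  uniq [:: a; b; e; x; y; z] ->
  hits a b x y z (+) hits a e x y z (+) hits b e x y z (+)
  (hits x y a b e (+) hits x z a b e (+) hits y z a b e) = false.
Proof.
move=> cabe cxyz U.
have [ab ae be] := adjxx cabe; have [xy xz yz] := adjxx cxyz.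
have sub s t : all_near S s -> all (mem s) t -> all_near S t.
  by move=> h /allP m; apply: all_near_sub h => w /m.
have usub s (t : seq 'I_n) : uniq s -> subseq t s -> uniq t by move=> h1 h2; apply: subseq_uniq h1.
move: (U); rewrite /= !inE !negb_or !andbT.
case/and5P=> /and5P[nab nae nax nay naz] /and4P[nbe nbx nby nbz] /and3P[nex ney nez] /andP[nxy nxz] nyz.
have ne := (nab, nae, nax, nay, naz, nbe, nbx, nby, nbz, nex, ney, nez).
have ne3 := (nxy, nxz, nyz).
have [xa ya za] : [/\ x != a, y != a & z != a] by rewrite (eq_sym x) (eq_sym y) (eq_sym z) !ne.
have [xb yb zb] : [/\ x != b, y != b & z != b] by rewrite (eq_sym x) (eq_sym y) (eq_sym z) !ne.
have [xe ye ze] : [/\ x != e, y != e & z != e] by rewrite (eq_sym x) (eq_sym y) (eq_sym z) !ne.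
have [ba ea eb] : [/\ b != a, e != a & e != b] by rewrite (eq_sym b) (eq_sym e) (eq_sym e) !ne.
have [yx zx zy] : [/\ y != x, z != x & z != y] by rewrite (eq_sym y) (eq_sym z) (eq_sym z) !ne3.
have ne2 := (xa, ya, za, xb, yb, zb, xe, ye, ze).
have ne4 := (ba, ea, eb, yx, zx, zy).
have far p q r u v w : hits p q u v w -> uniq [:: p; q; r; u; v; w] ->
  adj p q -> adj p r -> adj q r -> adj u v -> adj u w -> adj v w ->
  all_near S [:: p; q; r; u; v; w].
  by case/and3P=> h1 h2 h3 h4 *; apply: (meets_near SP).
have [N|N] := boolP (all_near S [:: a; b; e; x; y; z]); last first.
  have F p q r u v w : all (mem [:: p; q; r; u; v; w]) [:: a; b; e; x; y; z] ->
     uniq [:: p; q; r; u; v; w] ->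
     adj p q -> adj p r -> adj q r -> adj u v -> adj u w -> adj v w -> hits p q u v w = false.
    move=> h1 h2 *; apply: contraNF N => /far h3; apply: sub h1; exact: h3.
  have M s : perm_eq s [:: a; b; e; x; y; z] -> all (mem s) [:: a; b; e; x; y; z].
    by move=> h; apply/allP => w /=; rewrite (perm_mem h).
  rewrite (F a b e x y z) ?(F a e b x y z) ?(F b e a x y z) ?(F x y z a b e)
    ?(F x z y a b e) ?(F y z x a b e) //= ?inE ?eqxx ?orbT ?negb_or ?ne ?ne2 ?ne3 ?ne4 //;
  by rewrite adjC.
have E p q u v w : all (mem [:: a; b; e; x; y; z]) [:: p; q; u; v; w] ->
   uniq [:: p; q; u; v; w] -> hits p q u v w = meets S p q u v w.
  by move=> h1 h2; rewrite /hits h2 (sub _ _ N h1).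
rewrite !E; try by rewrite /= ?inE ?eqxx ?orbT ?negb_or ?ne ?ne2 ?ne3 ?ne4.
rewrite (@meets_triangle_last a b x y z) ?(@meets_triangle_last a e x y z)
  ?(@meets_triangle_last b e x y z) ?(@meets_triangle_first a b e x y)
  ?(@meets_triangle_first a b e x z) ?(@meets_triangle_first a b e y z);
  try by rewrite /= ?inE ?eqxx ?orbT ?negb_or ?ne ?ne2 ?ne3 ?ne4.
all: try by apply: (sub _ _ N); rewrite /= ?inE ?eqxx ?orbT.
have := ori_gp SP N U; rewrite /six_ok => gp.
have := @tautP 15 brute6_bits [::] isT
  [:: O e x y z; O b x y z; O b e y z; O b e x z; O b e x y; O a x y z; O a e y z;
      O a e x z; O a e x y; O a b y z; O a b x z; O a b x y; O a b e z; O a b e y; O a b e x] erefl.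
by rewrite /= => /implyP h; rewrite -!addbA; apply/eqP; exact: (h gp).
Qed.

(** If the arcs ab and de cross in the view from v, then the segment closer to v along that ray
    pierces the triangle spanned by v and the other segment. *)
Lemma hits_link v a b d e : c v a b -> c v d e -> uniq [:: v; a; b; d; e] ->
  hits a b v d e (+) hits d e v a b =
  arc_crossing (nbr adj v) (link S v) (a, b) (d, e).
Proof.
move=> cab cde U.
have [va vb ab] := adjxx cab; have [vd ve de] := adjxx cde.
have N : all_near S [:: v; a; b; d; e].
  apply/allP => p pin; apply/allP => q qin.
  have A w : w \in [:: v; a; b; d; e] -> w = v \/ adj v w.
    by rewrite !inE => /or4P[|||/orP[]] /eqP ->; [left|right..].
  have S1 p' q' : adj v p' -> adj v q' -> [/\ nr S v p', nr S p' v, nr S v v & nr S p' q'].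
    move=> h1 h2; have := nr_star SP h1 h2; rewrite /all_near /=.
    by rewrite !andbT => /and3P[/and3P[-> -> _] /and3P[-> _ ->] _].
  have [->|h1] := A _ pin; have [->|h2] := A _ qin.
  - by have [] := S1 a a va va.
  - by have [] := S1 q q h2 h2.
  - by have [] := S1 p p h1 h1.
  - by have [] := S1 p q h1 h2.
move: (U); rewrite /= !inE !negb_or !andbT.
case/and4P=> /and4P[nva nvb nvd nve] /and3P[nab nad nae] /andP[nbd nbe] nde.
have sub t : all (mem [:: v; a; b; d; e]) t -> all_near S t.
  by move=> /allP m; apply: all_near_sub N => w /m.
have [av bv dv ev] : [/\ a != v, b != v, d != v & e != v].
  by rewrite (eq_sym a) (eq_sym b) (eq_sym d) (eq_sym e).
have [da db ea eb] : [/\ d != a, d != b, e != a & e != b].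
  by rewrite (eq_sym d) (eq_sym d b) (eq_sym e) (eq_sym e b).
have ne := (nva, nvb, nvd, nve, nab, nad, nae, nbd, nbe, nde).
have ne2 := (av, bv, dv, ev, da, db, ea, eb).
rewrite /hits !sub /=; try by rewrite /= ?inE ?eqxx ?orbT.
rewrite !inE !negb_or !ne !ne2 /= /arc_crossing /nbr /= va vb vd ve !inE !negb_or !ne /=.
rewrite /meets /arcs_cross /=.
have [||[vade1 vade2 vade3 vade4 vade5] vade6] := @ori_perm v a d e.
- by apply: sub; rewrite /= ?inE ?eqxx ?orbT.
- by rewrite /= !inE !negb_or ?ne ?ne2.
have [||[vbde1 vbde2 vbde3 vbde4 vbde5] vbde6] := @ori_perm v b d e.
- by apply: sub; rewrite /= ?inE ?eqxx ?orbT.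
- by rewrite /= !inE !negb_or ?ne ?ne2.
have [||[abvd1 abvd2 abvd3 abvd4 abvd5] abvd6] := @ori_perm a b v d.
- by apply: sub; rewrite /= ?inE ?eqxx ?orbT.
- by rewrite /= !inE !negb_or ?ne ?ne2.
have [||[abve1 abve2 abve3 abve4 abve5] abve6] := @ori_perm a b v e.
- by apply: sub; rewrite /= ?inE ?eqxx ?orbT.
- by rewrite /= !inE !negb_or ?ne ?ne2.
have [||[vdab1 vdab2 vdab3 vdab4 vdab5] vdab6] := @ori_perm v d a b.
- by apply: sub; rewrite /= ?inE ?eqxx ?orbT.
- by rewrite /= !inE !negb_or ?ne ?ne2.
have [||[veab1 veab2 veab3 veab4 veab5] veab6] := @ori_perm v e a b.
- by apply: sub; rewrite /= ?inE ?eqxx ?orbT.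
- by rewrite /= !inE !negb_or ?ne ?ne2.
have [||[abde1 abde2 abde3 abde4 abde5] abde6] := @ori_perm a b d e.
- by apply: sub; rewrite /= ?inE ?eqxx ?orbT.
- by rewrite /= !inE !negb_or ?ne ?ne2.
have [||[devb1 devb2 devb3 devb4 devb5] devb6] := @ori_perm d e v b.
- by apply: sub; rewrite /= ?inE ?eqxx ?orbT.
- by rewrite /= !inE !negb_or ?ne ?ne2.
rewrite vade6 vbde6 -abvd1 abve3 -abve1 vdab6 -vdab4 veab6 -veab4 vade2 abde2 devb3 vbde2.
by case: (O v a d e); case: (O v b d e); case: (O v a b d); case: (O v a b e);
   case: (O a b d e).
Qed.

Lemma hits_triangle_perm a b x y z : hits a b y x z = hits a b x y z /\
  hits a b x z y = hits a b x y z.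
Proof.
have P1 : {subset [:: a; b; y; x; z] <= [:: a; b; x; y; z]}.
  by move=> w; rewrite !inE => /or4P[|||/orP[]] ->; rewrite ?orbT.
have P1' : {subset [:: a; b; x; y; z] <= [:: a; b; y; x; z]}.
  by move=> w; rewrite !inE => /or4P[|||/orP[]] ->; rewrite ?orbT.
have P2 : {subset [:: a; b; x; z; y] <= [:: a; b; x; y; z]}.
  by move=> w; rewrite !inE => /or4P[|||/orP[]] ->; rewrite ?orbT.
have P2' : {subset [:: a; b; x; y; z] <= [:: a; b; x; z; y]}.
  by move=> w; rewrite !inE => /or4P[|||/orP[]] ->; rewrite ?orbT.
have N1 : all_near S [:: a; b; y; x; z] = all_near S [:: a; b; x; y; z].
  by apply/idP/idP; apply: all_near_sub.
have N2 : all_near S [:: a; b; x; z; y] = all_near S [:: a; b; x; y; z].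
  by apply/idP/idP; apply: all_near_sub.
have U1 : uniq [:: a; b; y; x; z] = uniq [:: a; b; x; y; z].
  rewrite /= !inE !negb_or (eq_sym y x).
  by case: (a == b); case: (a == x); case: (a == y); case: (b == x); case: (b == y);
     case: (x == y); case: (x == z); case: (y == z); rewrite ?andbF.
have U2 : uniq [:: a; b; x; z; y] = uniq [:: a; b; x; y; z].
  rewrite /= !inE !negb_or (eq_sym z y).
  by case: (a == y); case: (a == z); case: (b == y); case: (b == z); case: (x == z); case: (x == y);
     case: (y == z); rewrite ?andbF.
rewrite /hits N1 N2 U1 U2; case N : all_near => //; case U : uniq => //=.
have sub t : all (mem [:: a; b; x; y; z]) t -> all_near S t.
  by move=> /allP m; apply: all_near_sub N => w /m.
move: (U); rewrite /= !inE !negb_or !andbT.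
case/and4P=> /and4P[nab nax nay naz] /and3P[nbx nby nbz] /andP[nxy nxz] nyz.
have ne := (nab, nax, nay, naz, nbx, nby, nbz, nxy, nxz, nyz).
have M t : all (mem [:: a; b; x; y; z]) t -> uniq t -> all_near S t && uniq t.
  by move=> /sub -> ->.
have [xa xb yx zx zy] : [/\ x != a, x != b, y != x, z != x & z != y].
  by rewrite (eq_sym x) (eq_sym x b) (eq_sym y) (eq_sym z) (eq_sym z) !ne.
rewrite /meets.
have [||[axyz1 axyz2 axyz3 axyz4 axyz5] axyz6] := @ori_perm a x y z.
- by apply: sub; rewrite /= ?inE ?eqxx ?orbT.
- by rewrite /= !inE !negb_or ?ne.
have [||[bxyz1 bxyz2 bxyz3 bxyz4 bxyz5] bxyz6] := @ori_perm b x y z.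
- by apply: sub; rewrite /= ?inE ?eqxx ?orbT.
- by rewrite /= !inE !negb_or ?ne.
have [||[abxy1 abxy2 abxy3 abxy4 abxy5] abxy6] := @ori_perm a b x y.
- by apply: sub; rewrite /= ?inE ?eqxx ?orbT.
- by rewrite /= !inE !negb_or ?ne.
have [||[abxz1 abxz2 abxz3 abxz4 abxz5] abxz6] := @ori_perm a b x z.
- by apply: sub; rewrite /= ?inE ?eqxx ?orbT.
- by rewrite /= !inE !negb_or ?ne.
have [||[abyz1 abyz2 abyz3 abyz4 abyz5] abyz6] := @ori_perm a b y z.
- by apply: sub; rewrite /= ?inE ?eqxx ?orbT.
- by rewrite /= !inE !negb_or ?ne.
rewrite abxy3 abxz3 abyz3.
have [||_ a2 _] := @ori_alt adj S SP a x y z.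
- by apply: sub; rewrite /= ?inE ?eqxx ?orbT.
- by rewrite /= !inE !negb_or ?ne.
have [||_ b2 _] := @ori_alt adj S SP b x y z.
- by apply: sub; rewrite /= ?inE ?eqxx ?orbT.
- by rewrite /= !inE !negb_or ?ne.
rewrite a2 b2 axyz3 bxyz3.
by case: (O a x y z); case: (O b x y z); case: (O a b x y); case: (O a b x z);
   case: (O a b y z).
Qed.

Definition on_triangle x i j k := (x == i) (+) (x == j) (+) (x == k).

Lemma xorT_link x (G : 'I_n -> 'I_n -> 'I_n -> bool) :
  (forall i j k, G j i k = G i j k) -> (forall i j k, G i k j = G i j k) ->
  xorT (fun i j k => on_triangle x i j k && G i j k) =
  \xor_d \xor_e (ordlt d e && (c x d e && G x d e)).
Proof.
move=> G12 G23.
have := xorT_flag (fun y d e => (y == x) && G y d e).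
rewrite [LHS](_ : _ = \xor_y ((y == x) && \xor_d \xor_e (ordlt d e && (c y d e && G y d e)))).
  rewrite xor_pred1 => ->; apply: eq_xorT => i j k _.
  rewrite /on_triangle (G12 i j k) (G12 i k j) (G23 i j k) (eq_sym x i) (eq_sym x j) (eq_sym x k).
  by case: (i == x); case: (j == x); case: (k == x); case: (G i j k).
apply: xor_eq => y; rewrite -xorMl; apply: xor_eq => d; rewrite -xorMl.
by apply: xor_eq => e; case: (y == x); rewrite //= !andbF.
Qed.

Lemma xorTE G : xorT G =
  \xor_t ((ordlt t.1.1 t.1.2 && ordlt t.1.2 t.2) && c t.1.1 t.1.2 t.2 && G t.1.1 t.1.2 t.2).
Proof.
rewrite /xorT; under xor_eq => i do rewrite xor_pair.
rewrite (xor_pair (fun i p => (ordlt i p.1 && ordlt p.1 p.2) && (c i p.1 p.2 && G i p.1 p.2))).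
rewrite (reindex (fun t : 'I_n * 'I_n * 'I_n => (t.1.1, (t.1.2, t.2)))) /=.
  by apply: xor_eq => t; rewrite andbA.
by exists (fun t => ((t.1, t.2.1), t.2.2)) => [[[a b] d]|[a [b d]]] _.
Qed.

Lemma on_triangleN x i j k : uniq [:: i; j; k] ->
  ~~ on_triangle x i j k = [&& x != i, x != j & x != k].
Proof.
rewrite /= !inE negb_or andbT => /andP[/andP[ij ik] jk]; rewrite /on_triangle.
have [->|_] := eqVneq x i; first by rewrite (negbTE ij) (negbTE ik).
by have [->|_] := eqVneq x j; rewrite ?(negbTE jk) //=; case: (x == k).
Qed.

(** For triangles with a common vertex all six terms vanish: [hits] demands five distinct indices,
    and the guard on the third vertex excludes the sixth coincidence. *)
Lemma hits_disjoint_sum (i j k x y z : 'I_n) : c i j k -> c x y z ->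
  let D i j k x y z := ~~ on_triangle k x y z && hits i j x y z in
  (D j k i x y z (+) D i k j x y z (+) D i j k x y z) (+)
  (D y z x i j k (+) D x z y i j k (+) D x y z i j k) = false.
Proof.
move=> cijk cxyz D; rewrite /D.
have U1 := c_uniq cijk; have U2 := c_uniq cxyz.
have [U|U] := boolP (uniq [:: i; j; k; x; y; z]).
  have := hits_triangles cijk cxyz U.
  move: U; rewrite /= !inE !negb_or !andbT.
  case/and5P=> /and5P[nab nae nax nay naz] /and4P[nbe nbx nby nbz] /and3P[nex ney nez] _ _.
  rewrite !on_triangleN // nax nay naz nbx nby nbz nex ney nez.
  rewrite (eq_sym x i) (eq_sym x j) (eq_sym x k) (eq_sym y i) (eq_sym y j) (eq_sym y k) (eq_sym z i) (eq_sym z j) (eq_sym z k) nax nay naz nbx nby nbz nex ney nez /=.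
  by move=> <-; rewrite -!addbA; case: (hits j k _ _ _); case: (hits i k _ _ _);
     case: (hits i j _ _ _); case: (hits y z _ _ _); case: (hits x z _ _ _);
     case: (hits x y _ _ _).
have Z (p q r u v w : 'I_n) : uniq [:: p; q; r] -> uniq [:: u; v; w] ->
    perm_eq ([:: p; q; r] ++ [:: u; v; w]) [:: i; j; k; x; y; z] ->
    ~~ on_triangle r u v w && hits p q u v w = false.
  move=> h1 h2 h3; apply/negP; rewrite on_triangleN // => /andP[h4 /and3P[_ h5 _]].
  move: U; rewrite -(perm_uniq h3) => /negP; apply.
  move: h1 h4 h5; rewrite /= !inE !negb_or !andbT.
  case/andP=> /andP[-> ->] -> /and3P[-> -> ->].
  by case/and4P=> /and4P[_ -> -> ->] /and3P[-> -> ->] -> ->.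
have V (p q r : 'I_n) : uniq [:: p; q; r] -> uniq [:: q; r; p] /\ uniq [:: p; r; q].
  rewrite /= !inE !negb_or !andbT (eq_sym q p) (eq_sym r p) (eq_sym r q).
  by case/andP=> /andP[-> ->] ->.
have [V1 V2] := V _ _ _ U1; have [V3 V4] := V _ _ _ U2.
by rewrite !Z //; apply/permP => f /=; case: (f i); case: (f j); case: (f k);
  case: (f x); case: (f y); case: (f z).
Qed.

(** The number of triangles of [c] hit by an edge ab is counted once for each triangle of [c] on ab,
    an even number of times ([E1]). When the triangle hit contains the third vertex x of abx, the
    hit is a crossing in the link of x by [hits_link]; the other hits come from disjoint triangles
    and cancel ([E3]). *)
Lemma crossings_total :
  \xor_v crossings (nbr adj v) (link S v) (c v) = false.
Proof.
have E0 : \xor_a \xor_b ((ordlt a b && xorT (hits a b)) && \xor_x c a b x) = false.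
  by apply: xor0 => a; apply: xor0 => b; rewrite c_cycle andbF.
have E1 : \xor_x \xor_a \xor_b (ordlt a b && (c x a b && xorT (hits a b))) = false.
  rewrite -[RHS]E0 [LHS]xor_ex; apply: xor_eq => a; rewrite [LHS]xor_ex; apply: xor_eq => b.
  rewrite -xorMl; apply: xor_eq => x; rewrite (c23 a b x) (c12 a x b).
  by case: (ordlt a b) => //=; rewrite andbC.
have E2 x a b : xorT (hits a b) =
  (\xor_d \xor_e (ordlt d e && (c x d e && hits a b x d e))) (+)
  xorT (fun i j k => ~~ on_triangle x i j k && hits a b i j k).
  rewrite -xorT_link.
  - rewrite -xorTD; apply: eq_xorT => i j k _.
    by case: (on_triangle x i j k); rewrite /= ?addbF.
  - by move=> i j k; rewrite (hits_triangle_perm a b i j k).1.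
  - by move=> i j k; rewrite (hits_triangle_perm a b i j k).2.
have E3 : \xor_x \xor_a \xor_b (ordlt a b && (c x a b &&
    xorT (fun i j k => ~~ on_triangle x i j k && hits a b i j k))) = false.
  rewrite (xorT_flag (fun x a b => xorT (fun i j k => ~~ on_triangle x i j k && hits a b i j k))).
  pose D i j k x y z := ~~ on_triangle k x y z && hits i j x y z.
  pose B (t : 'I_n * 'I_n * 'I_n) := (ordlt t.1.1 t.1.2 && ordlt t.1.2 t.2) && c t.1.1 t.1.2 t.2.
  pose g (t t' : 'I_n * 'I_n * 'I_n) :=
    D t.1.2 t.2 t.1.1 t'.1.1 t'.1.2 t'.2 (+) D t.1.1 t.2 t.1.2 t'.1.1 t'.1.2 t'.2 (+)
    D t.1.1 t.1.2 t.2 t'.1.1 t'.1.2 t'.2.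
  transitivity (\xor_t \xor_t' (B t && (B t' && g t t'))).
    rewrite xorTE; apply: xor_eq => t; rewrite xorMl /B; congr (_ && _).
    rewrite -!xorTD xorTE; apply: xor_eq => t'; rewrite /g /D.
    by rewrite -!andbA.
  rewrite (xor_sym (@ranklt_tri _)) xor0.
    rewrite xor0 // => t; case Bt : (B t) => //=.
    have ct : c t.1.1 t.1.2 t.2 by case/andP: Bt.
    rewrite /g /D /hits /= !inE !eqxx /= ?orbT /= ?andbF //.
  move=> t; apply: xor0 => t'; case Bt : (B t); case Bt' : (B t'); rewrite ?andbF //=.
  have ct : c t.1.1 t.1.2 t.2 by case/andP: Bt.
  have ct' : c t'.1.1 t'.1.2 t'.2 by case/andP: Bt'.
  by have := hits_disjoint_sum ct ct'; rewrite /= -/(D _ _ _ _ _ _) /g => ->; rewrite andbF.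
rewrite -[RHS]E1 -[RHS]addbF -[X in _ = _ (+) X]E3 -xorD; apply: xor_eq => x.
rewrite -xorD.
transitivity (\xor_a \xor_b (ordlt a b && (c x a b &&
    \xor_d \xor_e (ordlt d e && (c x d e && hits a b x d e))))); last first.
  apply: xor_eq => a; rewrite -xorD; apply: xor_eq => b; rewrite (E2 x a b).
  by rewrite -!andb_addr -addbA addbb addbF.
pose Z (e : 'I_n * 'I_n) := ordlt e.1 e.2 && c x e.1 e.2.
transitivity (\xor_e \xor_f (Z e && Z f && hits e.1 e.2 x f.1 f.2)); last first.
  rewrite [RHS]xor_pair; apply: xor_eq => e; rewrite [in RHS]xor_pair andbA -[RHS]xorMl.
  by apply: xor_eq => f; rewrite /Z -!andbA.
rewrite [RHS](xor_sym (@ranklt_tri _)) [X in _ = _ (+) X]xor0 ?addbF; last first.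
  move=> [a b]; rewrite /hits /= !inE !negb_or !eqxx.
  by rewrite !(andbF, andbT, andFb).
apply: xor_eq => -[a b]; apply: xor_eq => -[d e]; congr (_ && _); rewrite /Z /=.
rewrite (andbC (ordlt d e && _) (_ && _)) -andb_addr.
case: (boolP (ordlt a b && c x a b)) => // /andP[_ cab].
case: (boolP (ordlt d e && c x d e)) => // /andP[_ cde] /=.
have [U|U] := boolP (uniq [:: x; a; b; d; e]); first by rewrite (hits_link cab cde U).
have -> : arc_crossing (nbr adj x) (link S x) (a, b) (d, e) = false.
  apply: contraNF U => /and3P[_ U' _].
  move: (c_uniq cab) (c_uniq cde) U'; rewrite /= !inE !negb_or !andbT.
  by case/andP=> /andP[-> ->] _ /andP[/andP[-> ->] _] /and3P[/and3P[-> -> ->] /andP[-> ->] ->].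
have Q p q r s : uniq [:: p; q; x; r; s] -> uniq [:: x; p; q; r; s].
  rewrite /= !inE !negb_or !andbT (eq_sym x p) (eq_sym x q).
  by case/and4P=> /and4P[-> -> -> ->] /and3P[-> -> ->] /andP[-> ->] ->.
rewrite /hits; case U1 : (uniq [:: a; b; x; d; e]); first by rewrite Q in U.
case U2 : (uniq [:: d; e; x; a; b]); last by rewrite !andbF.
have e0 : uniq [:: x; a; b; d; e] = uniq [:: x; d; e; a; b].
  by apply: perm_uniq; apply/permP => f /=; case: (f x); case: (f a); case: (f b);
    case: (f d); case: (f e).
by move: U; rewrite e0 Q.
Qed.

Lemma eq_quad_on (f g : 'I_n -> 'I_n -> bool) (z : 'I_n -> bool) :
  (forall a b, z a -> z b -> a != b -> f a b = g a b) ->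
  quad (@ordlt n) f z = quad (@ordlt n) g z.
Proof.
move=> h; apply: xor_eq => a; apply: xor_eq => b.
have [->|ab] := eqVneq a b; first by rewrite ordltxx.
by case za : (z a); case zb : (z b) => /=; rewrite ?andbF // h.
Qed.

Definition univ_turning :=
  (\xor_v \xor_u (ordlt v u && quad (@ordlt n) (fun _ _ => true) (c v u))) (+)
  xorT (fun _ _ _ => true).

(** Each pair of triangles at an edge vu contributes a corner bit at v and one at u. By [chi_flip]
    their sum is linear in the bits [ga], so [quad_lin], applied to the even set of triangles at vu,
    leaves one [ga] per triangle. Together with [dl] these form the hexagons. *)
Lemma turning_total :
  \xor_v turning (link S v) (c v) = xorT (hexagon S) (+) univ_turning.
Proof.
rewrite /turning xorD /=.
rewrite (xorT_flag (dl S)).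
rewrite (xor_sym (@ordlt_tri n)) [X in _ (+) X (+) _]xor0; last first.
  move=> v; apply: xor0 => a; apply: xor0 => b; case cc : (c v v a); last by rewrite andbF.
  by have := c_uniq cc; rewrite /= inE eqxx.
rewrite addbF.
have -> : \xor_v \xor_u (ordlt v u && (quad (@ordlt n) (sorted_chi (link S v) u) (c v u) (+)
    quad (@ordlt n) (sorted_chi (link S u) v) (c u v))) =
  (\xor_v \xor_u (ordlt v u && quad (@ordlt n) (fun _ _ => true) (c v u))) (+)
  xorT (fun i j k => ga S j k i (+) ga S i k j (+) ga S i j k).
  rewrite -(xorT_flag (fun a v u => ga S v u a)) [X in _ = _ (+) X]xor_ex -xorD.
  apply: xor_eq => v; rewrite [X in _ = _ (+) X]xor_ex -xorD; apply: xor_eq => u.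
  have -> : \xor_x (ordlt v u && (c x v u && ga S v u x)) =
            ordlt v u && \xor_x (c v u x && ga S v u x).
    by rewrite -xorMl; apply: xor_eq => a; rewrite (c12 a) (c23 v).
  rewrite -andb_addr; congr (_ && _).
  rewrite (@eq_quad _ (@ordlt n) (sorted_chi (link S u) v) (sorted_chi (link S u) v) (c u v) (c v u)) //.
  rewrite -quadDf -(quad_lin (@ordlt_tri n)) //.
  rewrite -quadDf; apply: eq_quad_on => a b ca cb ab.
  have [vu va ua] := adjxx ca; have [_ vb ub] := adjxx cb.
  have U : uniq [:: v; u; a; b].
    move: (c_uniq ca) (c_uniq cb); rewrite /= !inE !negb_or !andbT ab !andbT.
    by case/andP=> /andP[-> ->] -> /andP[/andP[_ ->] ->].
  have U' : uniq [:: v; u; b; a].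
    move: (c_uniq ca) (c_uniq cb); rewrite /= !inE !negb_or !andbT (eq_sym b) ab !andbT.
    by case/andP=> /andP[-> ->] -> /andP[/andP[_ ->] ->].
  rewrite /sorted_chi /=; case: (ordlt a b).
    rewrite (chi_flip SP U) //.
    by case: (chi _ _ _ _ _); case: (ga _ _ _ _); case: (ga _ _ _ _).
  rewrite (chi_flip SP U') //.
  by case: (chi _ _ _ _ _); case: (ga _ _ _ _); case: (ga _ _ _ _).
rewrite /univ_turning [RHS]addbCA -addbA; congr (_ (+) _).
rewrite -!xorTD; apply: eq_xorT => i j k cc; rewrite /hexagon.
have [ij ik jk] := adjxx cc; have U := c_uniq cc.
have [nij nik njk] : [/\ i != j, i != k & j != k].
  by move: U; rewrite /= !inE negb_or andbT => /andP[/andP[]].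
have := @ldl_alt _ _ _ (system_link SP j) i k; rewrite /nbr /= adjC ij eq_sym nij jk njk.
move=> /(_ isT isT nik) ->.
have ji : adj j i by rewrite adjC.
have ki : adj k i by rewrite adjC.
have U1 : uniq [:: j; k; i] by rewrite /= !inE !negb_or njk (eq_sym j) nij (eq_sym k) nik.
rewrite (ga_alt SP U1 jk ji ki) (ga_alt SP U ij ik jk).
by case: (dl S i j k); case: (dl S j i k); case: (dl S k i j); case: (ga S j k i);
   case: (ga S i k j); case: (ga S i j k).
Qed.

End OneSystem.

(* Both sides equal the same combinatorial expression in [c], because the numbers
   of crossings vanish in total and turning plus crossings is universal. *)
Theorem hexagon_sum_eq S S' : system_axioms adj S -> system_axioms adj S' ->
  xorT (hexagon S) = xorT (hexagon S').
Proof.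
move=> SP SP'.
have E : \xor_v total (nbr adj v) (link S v) (c v) =
         \xor_v total (nbr adj v) (link S' v) (c v).
  apply: xor_eq => v; apply: total_universal.
  - exact: system_link.
  - exact: system_link.
  - by move=> a b; rewrite c23.
  - move=> a b cc; have [va vb ab] := adjxx cc; rewrite /nbr va vb.
    by move: (c_uniq cc); rewrite /= !inE negb_or andbT => /andP[/andP[-> ->] ->].
  - by move=> a; apply: c_cycle.
have D T : \xor_v total (nbr adj v) (link T v) (c v) =
  (\xor_v turning (link T v) (c v)) (+) \xor_v crossings (nbr adj v) (link T v) (c v).
  by rewrite -xorD.
rewrite !D (crossings_total SP) (crossings_total SP') !addbF in E.
by rewrite (turning_total SP) (turning_total SP') in E; exact: addIb E.
Qed.

End Cycle.

End Core.

From mathcomp Require Import all_order all_algebra.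
From mathcomp Require Import ring lra.

(** * Quaternion lifts of flags and the signs of a link of vectors *)

Module Geo.

Import Core.
Set Implicit Arguments.
Unset Strict Implicit.
Unset Printing Implicit Defensive.
Import Order.TTheory GRing.Theory Num.Theory.
Local Open Scope ring_scope.

Section Quaternions.

Variable R : rcfType.

Record vec := Vec { vx : R; vy : R; vz : R }.
Record quat := Quat { q0 : R; q1 : R; q2 : R; q3 : R }.
Implicit Types (u v w a b n : vec) (p q : quat).

Definition dot u v := vx u * vx v + vy u * vy v + vz u * vz v.
Definition cross u v := Vec (vy u * vz v - vz u * vy v)
  (vz u * vx v - vx u * vz v) (vx u * vy v - vy u * vx v).
Definition det3 u v w := dot u (cross v w).
Definition vadd u v := Vec (vx u + vx v) (vy u + vy v) (vz u + vz v).
Definition vsub u v := Vec (vx u - vx v) (vy u - vy v) (vz u - vz v).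
Definition vscale (k : R) u := Vec (k * vx u) (k * vy u) (k * vz u).
Definition vnorm u := Num.sqrt (dot u u).

Definition qmul p q := Quat
  (q0 p * q0 q - q1 p * q1 q - q2 p * q2 q - q3 p * q3 q)
  (q0 p * q1 q + q1 p * q0 q + q2 p * q3 q - q3 p * q2 q)
  (q0 p * q2 q - q1 p * q3 q + q2 p * q0 q + q3 p * q1 q)
  (q0 p * q3 q + q1 p * q2 q - q2 p * q1 q + q3 p * q0 q).
Definition qconj p := Quat (q0 p) (- q1 p) (- q2 p) (- q3 p).
Definition qnorm p := q0 p ^+ 2 + q1 p ^+ 2 + q2 p ^+ 2 + q3 p ^+ 2.
Definition qone := Quat 1 0 0 0.
Definition qscale (k : R) p := Quat (k * q0 p) (k * q1 p) (k * q2 p) (k * q3 p).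

(** The matrix of v -> q v q*, without normalisation: a non-unit [q] also scales by [qnorm q]. This
    keeps it polynomial in [q], and a section without zeros acts by invertible maps. *)
Definition rot q v := Vec
  ((q0 q ^+ 2 + q1 q ^+ 2 - q2 q ^+ 2 - q3 q ^+ 2) * vx v +
   2 * (q1 q * q2 q - q0 q * q3 q) * vy v + 2 * (q1 q * q3 q + q0 q * q2 q) * vz v)
  (2 * (q1 q * q2 q + q0 q * q3 q) * vx v +
   (q0 q ^+ 2 - q1 q ^+ 2 + q2 q ^+ 2 - q3 q ^+ 2) * vy v +
   2 * (q2 q * q3 q - q0 q * q1 q) * vz v)
  (2 * (q1 q * q3 q - q0 q * q2 q) * vx v + 2 * (q2 q * q3 q + q0 q * q1 q) * vy v +
   (q0 q ^+ 2 - q1 q ^+ 2 - q2 q ^+ 2 + q3 q ^+ 2) * vz v).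

Definition e1 := Vec 1 0 0.
Definition e3 := Vec 0 0 1.

Ltac vring := repeat match goal with v : vec |- _ => destruct v end;
  repeat match goal with v : quat |- _ => destruct v end;
  rewrite /det3 /dot /rot /qnorm /cross /qmul /qconj /qscale /vscale /vadd /vsub /=;
  rewrite /det3 /dot /qnorm /cross /=;
  try congr Vec; try congr Quat; ring.

Lemma qmulA p q r : qmul p (qmul q r) = qmul (qmul p q) r.
Proof. vring. Qed.
Lemma qmul1 p : qmul p qone = p. Proof. vring. Qed.
Lemma mul1q p : qmul qone p = p. Proof. vring. Qed.
Lemma qconjM p q : qconj (qmul p q) = qmul (qconj q) (qconj p). Proof. vring. Qed.
Lemma qconjK p : qconj (qconj p) = p. Proof. vring. Qed.
Lemma qnormM p q : qnorm (qmul p q) = qnorm p * qnorm q. Proof. vring. Qed.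
Lemma qnorm_conj p : qnorm (qconj p) = qnorm p. Proof. vring. Qed.
Lemma qmulV p : qnorm p = 1 -> qmul p (qconj p) = qone.
Proof.
by move=> h; rewrite /qone -h; vring.
Qed.
Lemma qmulVl p : qnorm p = 1 -> qmul (qconj p) p = qone.
Proof. by move=> h; rewrite -[X in qmul _ X]qconjK qmulV ?qnorm_conj. Qed.
Lemma qnorm_ge0 p : 0 <= qnorm p.
Proof. by rewrite /qnorm !addr_ge0 ?sqr_ge0. Qed.

Lemma rotM p q v : rot (qmul p q) v = rot p (rot q v). Proof. vring. Qed.
Lemma dot_rot q u v : dot (rot q u) (rot q v) = qnorm q ^+ 2 * dot u v.
Proof. vring. Qed.
Lemma dot_rot_conj q u v : dot (rot q u) v = dot u (rot (qconj q) v).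
Proof. vring. Qed.
Lemma cross_rot q u v : cross (rot q u) (rot q v) = vscale (qnorm q) (rot q (cross u v)).
Proof. vring. Qed.
Lemma rot_scale q k v : rot q (vscale k v) = vscale k (rot q v). Proof. vring. Qed.
Lemma rot1 v : rot qone v = v. Proof. vring. Qed.
Lemma rotVK q v : qnorm q = 1 -> rot q (rot (qconj q) v) = v.
Proof. by move=> h; rewrite -rotM qmulV // rot1. Qed.
Lemma dotC u v : dot u v = dot v u. Proof. vring. Qed.
Lemma dotZl k u v : dot (vscale k u) v = k * dot u v. Proof. vring. Qed.
Lemma dotZr k u v : dot u (vscale k v) = k * dot u v. Proof. vring. Qed.
Lemma crossZl k u v : cross (vscale k u) v = vscale k (cross u v). Proof. vring. Qed.
Lemma crossZr k u v : cross u (vscale k v) = vscale k (cross u v). Proof. vring. Qed.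
Lemma scaleM k l u : vscale k (vscale l u) = vscale (k * l) u. Proof. vring. Qed.
Lemma scale1 u : vscale 1 u = u. Proof. vring. Qed.
Lemma lagrange u v : dot (cross u v) (cross u v) = dot u u * dot v v - dot u v ^+ 2.
Proof. vring. Qed.

Lemma dot_ge0 u : 0 <= dot u u.
Proof. by rewrite /dot -!expr2 !addr_ge0 ?sqr_ge0. Qed.
Lemma vnorm_ge0 u : 0 <= vnorm u. Proof. exact: sqrtr_ge0. Qed.
Lemma vnorm2 u : vnorm u ^+ 2 = dot u u. Proof. by rewrite sqr_sqrtr ?dot_ge0. Qed.
Lemma vnorm_gt0 u : 0 < dot u u -> 0 < vnorm u. Proof. by rewrite sqrtr_gt0. Qed.

(* [q] carries the directions of the first and third basis vectors to those of [u] and [n]. *)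
Definition frame q u n := [/\ qnorm q = 1, u = vscale (vnorm u) (rot q e1) &
  n = vscale (vnorm n) (rot q e3)].

Lemma lift_direction u : dot u u = 1 -> exists q, qnorm q = 1 /\ rot q e1 = u.
Proof.
case: u => x y z; rewrite /dot /= => h.
(* The rotation half-way between the first basis vector and u has real part proportional to 1 + x.
   It degenerates at the antipode, where a half-turn about a perpendicular axis is taken instead. *)
have [x1|x1] := eqVneq x (-1).
  have yz : y ^+ 2 + z ^+ 2 = 0 by rewrite x1 in h; lra.
  have y0 : y = 0 by apply/eqP; rewrite -sqrf_eq0; have := sqr_ge0 y; have := sqr_ge0 z; lra.
  have z0 : z = 0 by apply/eqP; rewrite -sqrf_eq0; have := sqr_ge0 y; have := sqr_ge0 z; lra.
  exists (Quat 0 0 1 0); rewrite /qnorm /rot /e1 /= x1 y0 z0; split; first by ring.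
  by congr Vec; ring.
have p : 0 < 1 + x.
  rewrite lt_neqAle; apply/andP; split; first by apply: contra_neq x1 => h'; lra.
  by have := sqr_ge0 y; have := sqr_ge0 z; nra.
have s0 : 0 < Num.sqrt (2 * (1 + x)) by rewrite sqrtr_gt0; lra.
have s2 : Num.sqrt (2 * (1 + x)) ^+ 2 = 2 * (1 + x) by rewrite sqr_sqrtr //; lra.
set s := Num.sqrt _ in s0 s2.
have T : s^-1 ^+ 2 * (2 * (1 + x)) = 1 by rewrite -s2 exprVn mulVf // expf_neq0 // gt_eqF.
move: (s^-1) T => t T.
have H : t ^+ 2 * (x * x + y * y + z * z) = t ^+ 2 by rewrite h mulr1.
have Tm k : k * (t ^+ 2 * (2 * (1 + x))) = k by rewrite T mulr1.
exists (Quat ((1 + x) * t) 0 (- z * t) (y * t)).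
rewrite /qnorm /rot /e1 /=; split; first by lra.
by have := Tm x; have := Tm y; have := Tm z => Tx Ty Tz; congr Vec; lra.
Qed.

Lemma lift_around y z : y ^+ 2 + z ^+ 2 = 1 ->
  exists q, [/\ qnorm q = 1, rot q e1 = e1 & rot q e3 = Vec 0 y z].
Proof.
move=> h; have [z1|z1] := eqVneq z (-1).
  have y0 : y = 0 by apply/eqP; rewrite -sqrf_eq0; rewrite z1 in h; lra.
  exists (Quat 0 1 0 0); rewrite /qnorm /rot /e1 /e3 /= y0 z1.
  by split; [ring | congr Vec; ring | congr Vec; ring].
have p : 0 < 1 + z.
  rewrite lt_neqAle; apply/andP; split; first by apply: contra_neq z1 => h'; lra.
  by have := sqr_ge0 y; nra.
have s0 : 0 < Num.sqrt (2 * (1 + z)) by rewrite sqrtr_gt0; lra.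
have s2 : Num.sqrt (2 * (1 + z)) ^+ 2 = 2 * (1 + z) by rewrite sqr_sqrtr //; lra.
set s := Num.sqrt _ in s0 s2.
have T : s^-1 ^+ 2 * (2 * (1 + z)) = 1 by rewrite -s2 exprVn mulVf // expf_neq0 // gt_eqF.
move: (s^-1) T => t T.
have H : t ^+ 2 * (y ^+ 2 + z ^+ 2) = t ^+ 2 by rewrite h mulr1.
have Tm k : k * (t ^+ 2 * (2 * (1 + z))) = k by rewrite T mulr1.
exists (Quat ((1 + z) * t) (- y * t) 0 0).
rewrite /qnorm /rot /e1 /e3 /=; split; first by lra.
  by congr Vec; lra.
by have := Tm y; have := Tm z => Ty Tz; congr Vec; lra.
Qed.

Lemma frame_exists u n : 0 < dot u u -> 0 < dot n n -> dot u n = 0 -> exists q, frame q u n.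
Proof.
move=> u0 n0 un.
have U0 := vnorm_gt0 u0; have N0 := vnorm_gt0 n0.
have Un : vnorm u != 0 by rewrite gt_eqF. have Nn : vnorm n != 0 by rewrite gt_eqF.
have U1 : dot (vscale (vnorm u)^-1 u) (vscale (vnorm u)^-1 u) = 1.
  by rewrite dotZl dotZr -vnorm2; field.
have [q [q1 qu]] := lift_direction U1.
pose m := rot (qconj q) (vscale (vnorm n)^-1 n).
have m1 : dot m m = 1.
  by rewrite /m dot_rot qnorm_conj q1 expr1n mul1r dotZl dotZr -vnorm2; field.
have mx : vx m = 0.
  have -> : vx m = dot e1 m by rewrite /dot /e1 /=; ring.
  by rewrite /m -dot_rot_conj qu dotZl dotZr un !mulr0.
have [p [p1 pe1 pe3]] : exists p, [/\ qnorm p = 1, rot p e1 = e1 & rot p e3 = Vec 0 (vy m) (vz m)].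
  by apply: lift_around; move: m1; rewrite /dot mx; lra.
exists (qmul q p); split; first by rewrite qnormM q1 p1 mulr1.
  by rewrite rotM pe1 qu scaleM divff // scale1.
have -> : rot (qmul q p) e3 = vscale (vnorm n)^-1 n.
  rewrite rotM pe3 -[RHS](rotVK _ q1); congr rot.
  by rewrite -/m; case: (m) mx => /= ? ? ? ->.
by rewrite scaleM divff // scale1.
Qed.


Lemma sgM (x y : R) : x != 0 -> y != 0 -> (x * y < 0) = (x < 0) (+) (y < 0).
Proof.
case: (ltgtP x 0) => // hx _; case: (ltgtP y 0) => // hy _ /=.
- by apply/negbTE; rewrite -leNgt ltW // nmulr_lgt0.
- by rewrite nmulr_rlt0.
- by rewrite pmulr_rlt0.
- by apply/negbTE; rewrite -leNgt ltW // mulr_gt0.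
Qed.

Lemma sgN (x : R) : x != 0 -> (- x < 0) = ~~ (x < 0).
Proof. by case: (ltgtP x 0) => // hx _; rewrite oppr_lt0 ?hx // ltNge ltW. Qed.

Lemma gp_okP (x1 y1 x2 y2 x3 y3 : R) : x1 != 0 -> y1 != 0 -> x2 != 0 -> y2 != 0 ->
  x3 != 0 -> y3 != 0 -> x1 * y1 - x2 * y2 + x3 * y3 = 0 ->
  gp_ok ((x1 < 0) (+) (y1 < 0)) ((x2 < 0) (+) (y2 < 0)) ((x3 < 0) (+) (y3 < 0)).
Proof.
move=> a1 b1 a2 b2 a3 b3; rewrite -!sgM // => h; apply/implyP => /eqP h13; apply/eqP.
have n1 : x1 * y1 != 0 by rewrite mulf_neq0.
have n2 : x2 * y2 != 0 by rewrite mulf_neq0.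
have n3 : x3 * y3 != 0 by rewrite mulf_neq0.
move: h13 h; move: (x1 * y1) (x2 * y2) (x3 * y3) n1 n2 n3 => t1 t2 t3.
case: (ltgtP t1 0) => // s1 _; case: (ltgtP t2 0) => // s2 _; case: (ltgtP t3 0) => // s3 _ _ h //; lra.
Qed.

Lemma unit_frame_norm q u n : frame q u n -> 0 < dot u u -> 0 < vnorm u /\ vnorm u != 0.
Proof. by move=> _ h; have := vnorm_gt0 h => h'; rewrite h' gt_eqF. Qed.

Lemma vscale_inj k u v : k != 0 -> vscale k u = vscale k v -> u = v.
Proof.
by case: u v => [a b c] [a' b' c'] k0 [] /(mulfI k0) -> /(mulfI k0) -> /(mulfI k0) ->.
Qed.

(** The two rotations agree on [e1], so [z] fixes it and (q0, q1) are cosine and sine of half the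
    angle from n to n'. The last formula is the double angle formula for the sine. *)
Lemma frame_pair A B u n n' : frame A u n -> frame B u n' -> 0 < dot u u ->
  let z := qmul (qconj A) B in
  [/\ q2 z = 0, q3 z = 0, q0 z ^+ 2 + q1 z ^+ 2 = 1 &
   dot u (cross n n') = 2 * (vnorm u * vnorm n * vnorm n') * (q0 z * q1 z)].
Proof.
move=> [A1 Au An] [B1 Bu Bn] u0 z; have un : vnorm u != 0 by rewrite gt_eqF ?vnorm_gt0.
have z1 : qnorm z = 1 by rewrite qnormM qnorm_conj A1 B1 mulr1.
have AB : rot A e1 = rot B e1 by apply: (vscale_inj un); rewrite -Au -Bu.
have ze : rot z e1 = e1 by rewrite rotM -AB -rotM qmulVl // rot1.
have h : q0 z ^+ 2 + q1 z ^+ 2 - q2 z ^+ 2 - q3 z ^+ 2 = 1.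
  by have := congr1 vx ze; rewrite /rot /e1 /= !mulr0 !addr0 mulr1.
have z20 : q2 z = 0.
  apply/eqP; rewrite -sqrf_eq0; move: z1; rewrite /qnorm.
  by have := sqr_ge0 (q2 z); have := sqr_ge0 (q3 z); lra.
have z30 : q3 z = 0.
  apply/eqP; rewrite -sqrf_eq0; move: z1; rewrite /qnorm.
  by have := sqr_ge0 (q2 z); have := sqr_ge0 (q3 z); lra.
split => //; first by move: z1; rewrite /qnorm z20 z30; lra.
have Bz : B = qmul A z by rewrite /z qmulA qmulV // mul1q.
clearbody z; rewrite {1}Au {1}An {1}Bn Bz rotM crossZl crossZr !dotZl !dotZr cross_rot dotZr dot_rot.
rewrite A1 expr1n !mul1r /rot /e1 /e3 /dot /cross /= z20 z30; ring.
Qed.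

(** The two flags lie in the same plane with opposite normals, so [z] reverses [e3] and is a
    half-turn about an axis in the plane of the first two coordinates. The sign of [q1 z * q2 z] is
    therefore forced to be negative. *)
Lemma frame_flip A B u b : frame A u (cross b u) -> frame B b (cross u b) ->
  0 < dot u u -> 0 < dot b b -> 0 < dot (cross b u) (cross b u) ->
  let z := qmul (qconj A) B in
  [/\ q0 z = 0, q3 z = 0, q1 z ^+ 2 + q2 z ^+ 2 = 1 &
   2 * (vnorm u * vnorm b) * (q1 z * q2 z) = - vnorm (cross b u)].
Proof.
move=> [A1 Au An] [B1 Bb Bn] u0 b0 c0 z.
have nn : vnorm (cross b u) != 0 by rewrite gt_eqF ?vnorm_gt0.
have z1 : qnorm z = 1 by rewrite qnormM qnorm_conj A1 B1 mulr1.
have Bz : B = qmul A z by rewrite /z qmulA qmulV // mul1q.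
have cc : cross u b = vscale (-1) (cross b u) by vring.
have nc : vnorm (cross u b) = vnorm (cross b u).
  by rewrite /vnorm cc dotZl dotZr mulrA mulrNN mulr1 mul1r.
have AB : rot A e3 = vscale (-1) (rot B e3).
  apply: (vscale_inj nn); rewrite -An scaleM mulrC -scaleM -nc -Bn cc scaleM.
  by rewrite mulrNN mulr1 scale1.
have ze : vscale (-1) (rot z e3) = e3.
  by rewrite -rot_scale /z rotM rot_scale -AB -rotM qmulVl // rot1.
clearbody z; have h : q0 z ^+ 2 - q1 z ^+ 2 - q2 z ^+ 2 + q3 z ^+ 2 = -1.
  by have := congr1 vz ze; rewrite /rot /e3 /= !mulr0 !add0r mulr1 => <-; ring.
have z00 : q0 z = 0.
  apply/eqP; rewrite -sqrf_eq0; move: z1; rewrite /qnorm.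
  by have := sqr_ge0 (q0 z); have := sqr_ge0 (q3 z); lra.
have z30 : q3 z = 0.
  apply/eqP; rewrite -sqrf_eq0; move: z1; rewrite /qnorm.
  by have := sqr_ge0 (q0 z); have := sqr_ge0 (q3 z); lra.
split => //; first by move: z1; rewrite /qnorm z00 z30; lra.
apply: (mulfI nn).
have -> : vnorm (cross b u) * - vnorm (cross b u) = dot b (cross (cross b u) u).
  by rewrite mulrN -expr2 vnorm2; vring.
have D w x y : dot (rot A w) (cross (rot A x) (rot A y)) = dot w (cross x y).
  by rewrite cross_rot dotZr dot_rot A1 expr1n !mul1r.
have E k l m w x y : dot (vscale k w) (cross (vscale l x) (vscale m y)) =
   k * l * m * dot w (cross x y) by vring.
have <- : dot (vscale (vnorm b) (rot B e1)) (cross (vscale (vnorm (cross b u)) (rot A e3))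
   (vscale (vnorm u) (rot A e1))) = dot b (cross (cross b u) u) by rewrite -Bb -An -Au.
rewrite Bz rotM E D.
rewrite /rot /e1 /e3 /dot /cross /= z00 z30; ring.
Qed.

(** The pairs (a, b) are cosine and sine of half-angles, the third being the sum of the first two;
    [s1], [s2], [s3] are the signs of the sines of the full angles. *)
Lemma sector_bits (a1 b1 a2 b2 a3 b3 : R) : a3 = a1 * a2 - b1 * b2 -> b3 = a1 * b2 + b1 * a2 ->
  a1 != 0 -> b1 != 0 -> a2 != 0 -> b2 != 0 -> a3 != 0 -> b3 != 0 ->
  let s1 := (a1 < 0) (+) (b1 < 0) in let s2 := (a2 < 0) (+) (b2 < 0) in
  let s3 := (a3 < 0) (+) (b3 < 0) in
  (b1 < 0) (+) (b2 < 0) (+) (b3 < 0) = ~~ (s3 (+) ((s1 == s2) && (s1 == s3))).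
Proof.
move=> ha hb; case: (ltgtP a1 0) => // p1 _; case: (ltgtP b1 0) => // p2 _;
case: (ltgtP a2 0) => // p3 _; case: (ltgtP b2 0) => // p4 _;
case: (ltgtP a3 0) => // p5 _; case: (ltgtP b3 0) => // p6 _ //=; exfalso; nra.
Qed.

(* [z] is a rotation about the first axis and [m] a half-turn; such an alternating
   product arises around the six flags of a triangle. *)
Lemma hexagon_bits (zp m1 zr m2 zq m3 : quat) :
  qmul zp (qmul m1 (qmul zr (qmul m2 (qmul zq m3)))) = qone ->
  q2 zp = 0 -> q3 zp = 0 -> q2 zr = 0 -> q3 zr = 0 -> q2 zq = 0 -> q3 zq = 0 ->
  q0 m1 = 0 -> q3 m1 = 0 -> q0 m2 = 0 -> q3 m2 = 0 -> q0 m3 = 0 -> q3 m3 = 0 ->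
  qnorm zp = 1 -> qnorm m1 = 1 -> qnorm zr = 1 ->
  q1 m1 * q2 m1 < 0 -> q1 m2 * q2 m2 < 0 -> q1 m3 * q2 m3 < 0 ->
  0 < (q0 zp * q1 zp) * (q0 zr * q1 zr) -> 0 < (q0 zr * q1 zr) * (q0 zq * q1 zq) ->
  (q1 zp < 0) (+) (q1 m1 < 0) (+) (q1 zr < 0) (+) (q1 m2 < 0) (+) (q1 zq < 0) (+)
  (q1 m3 < 0) = false.
Proof.
move=> P a1 a2 a3 a4 a5 a6 b1 b2 b3 b4 b5 b6 n1 n2 n3 s1 s2 s3 t1 t2.
set X := qmul zp (qmul m1 zr); set W := qmul m2 (qmul zq m3).
have XW : qmul X W = qone by rewrite /X /W -P !qmulA.
have X1 : qnorm X = 1 by rewrite /X !qnormM n1 n2 n3 !mulr1.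
have XE : X = qconj W.
  have -> : W = qconj X by rewrite -[W]mul1q -(qmulVl X1) -qmulA XW qmul1.
  by rewrite qconjK.
have := congr1 q0 XE; rewrite /X /W /= a1 a2 a3 a4 a5 a6 b1 b2 b3 b4 b5 b6.
rewrite !(mul0r, mulr0, subr0, addr0, add0r, sub0r).
move: (q0 zp) (q1 zp) (q0 zr) (q1 zr) (q0 zq) (q1 zq) (q1 m1) (q2 m1) (q1 m2) (q2 m2) (q1 m3) (q2 m3) s1 s2 s3 t1 t2.
move=> ap bp ar br aq bq c1 d1 c2 d2 c3 d3 s1 s2 s3 t1 t2 E.
have nz (x y : R) : x * y != 0 -> x != 0 /\ y != 0 by rewrite mulf_eq0 negb_or => /andP[].
have [c10 _] : c1 != 0 /\ d1 != 0 by apply: nz; rewrite lt_eqF.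
have [c20 d20] : c2 != 0 /\ d2 != 0 by apply: nz; rewrite lt_eqF.
have [c30 d30] : c3 != 0 /\ d3 != 0 by apply: nz; rewrite lt_eqF.
have [pp rr] : ap * bp != 0 /\ ar * br != 0 by apply: nz; rewrite gt_eqF.
have [_ qq] : ar * br != 0 /\ aq * bq != 0 by apply: nz; rewrite gt_eqF.
have [ap0 bp0] := nz _ _ pp; have [ar0 br0] := nz _ _ rr; have [aq0 bq0] := nz _ _ qq.
have t3 : 0 < (ap * bp) * (aq * bq).
  have : 0 < ((ap * bp) * (ar * br)) * ((ar * br) * (aq * bq)) by rewrite mulr_gt0.
  rewrite (_ : _ * _ = (ar * br) ^+ 2 * ((ap * bp) * (aq * bq))); last by ring.
  by rewrite pmulr_rgt0 // exprn_even_gt0.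
(* The goal is that c1 c2 c3 bp br bq is positive. Multiplying the equation of real parts by a
   suitable factor exhibits this positive quantity as that product times the positive factor of
   [K3]. *)
have K1 : 0 < (aq * bq * bp * br) ^+ 2 * ((c2 * c3) ^+ 2 + (c2 * d2) * (c3 * d3)).
  rewrite mulr_gt0 // ?exprn_even_gt0 //= ?mulf_neq0 //.
  by rewrite addr_gt0 // ?exprn_even_gt0 //= ?mulf_neq0 // nmulr_lgt0.
have K2 : (aq * bq * bp * br) ^+ 2 * ((c2 * c3) ^+ 2 + (c2 * d2) * (c3 * d3)) =
  (c1 * c2 * c3 * bp * br * bq) *
  ((ap * bp * (aq * bq)) * br ^+ 2 + (ar * br * (aq * bq)) * bp ^+ 2).
  have {}E : c1 * (ap * br + bp * ar) = aq * (c2 * c3 + d2 * d3).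
    move/(congr1 -%R): E => E.
    by etransitivity; [|etransitivity; [exact: E|]]; ring.
  transitivity (aq * (c2 * c3 + d2 * d3) * (aq * bq ^+ 2 * bp ^+ 2 * br ^+ 2 * c2 * c3)); first by ring.
  by rewrite -E; ring.
have K3 : 0 < (ap * bp * (aq * bq)) * br ^+ 2 + (ar * br * (aq * bq)) * bp ^+ 2.
  by rewrite addr_gt0 // mulr_gt0 // exprn_even_gt0.
have K : 0 < c1 * c2 * c3 * bp * br * bq by move: K1; rewrite K2 pmulr_lgt0.
have : (c1 * c2 * c3 * bp * br * bq < 0) = false by rewrite ltNge ltW.
rewrite !sgM ?mulf_neq0 // => <-.
by case: (c1 < 0); case: (c2 < 0); case: (c3 < 0); case: (bp < 0); case: (br < 0); case: (bq < 0).
Qed.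

Lemma dot_gt0_of_cross u v : 0 < dot (cross u v) (cross u v) -> 0 < dot u u /\ 0 < dot v v.
Proof.
rewrite lagrange => h; have := dot_ge0 u; have := dot_ge0 v; have := sqr_ge0 (dot u v).
move: (dot u u) (dot v v) (dot u v ^+ 2) h => a b c h hc hb ha.
have : 0 < a * b by lra.
by move=> hab; split; rewrite lt_neqAle ?ha ?hb andbT; apply: contraTneq hab => <-;
   rewrite ?mul0r ?mulr0 ltxx.
Qed.

End Quaternions.

Arguments e1 {R}.
Arguments e3 {R}.
Arguments qone {R}.

Ltac vec_ring := repeat match goal with v : vec _ |- _ => destruct v end;
  repeat match goal with v : quat _ |- _ => destruct v end;
  rewrite /det3 /dot /rot /qnorm /cross /qmul /qconj /qscale /vscale /vadd /vsub /=;
  rewrite /det3 /dot /qnorm /cross /=;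
  try congr Vec; try congr Quat; ring.

Section Links.

Variable R : rcfType.
Local Notation vec := (vec R).
Local Notation quat := (quat R).

Section LinkAxioms.

Variables (n : nat) (P : pred 'I_n) (x : 'I_n -> vec) (H : 'I_n -> 'I_n -> quat).
Implicit Types (a b c p q r u v : 'I_n).
Hypothesis det_neq0 : forall a b c, all P [:: a; b; c] -> uniq [:: a; b; c] ->
  det3 (x a) (x b) (x c) != 0.
Hypothesis cross_gt0 : forall a b, P a -> P b -> a != b ->
  0 < dot (cross (x b) (x a)) (cross (x b) (x a)).
Hypothesis HP : forall a b, P a -> P b -> a != b -> frame (H a b) (x a) (cross (x b) (x a)).

Definition geo_link := LinkData (fun a b c => det3 (x a) (x b) (x c) < 0)
  (fun u a b => q1 (qmul (qconj (H u a)) (H u b)) < 0)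
  (fun a b => q1 (qmul (qconj (H a b)) (H b a)) < 0).

Lemma pair_bits u a b : all P [:: u; a; b] -> uniq [:: u; a; b] ->
  let z := qmul (qconj (H u a)) (H u b) in
  [/\ q2 z = 0, q3 z = 0, q0 z ^+ 2 + q1 z ^+ 2 = 1, q0 z != 0 & q1 z != 0] /\
  exists2 k, 0 < k & det3 (x u) (x a) (x b) = k * (q0 z * q1 z).
Proof.
move=> PP U z; have /and4P[Pu Pa Pb _] := PP.
have [ua ub ab] : [/\ u != a, u != b & a != b].
  by move: U; rewrite /= !inE negb_or andbT => /andP[/andP[]].
have cua := cross_gt0 Pu Pa ua; have cub := cross_gt0 Pu Pb ub.
have [_ u0] := dot_gt0_of_cross cua.
have [z2 z3 z1 E] := frame_pair (HP Pu Pa ua) (HP Pu Pb ub) u0.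
have E2 : dot (x u) (cross (cross (x a) (x u)) (cross (x b) (x u))) =
  dot (x u) (x u) * det3 (x u) (x a) (x b) by move: (x u) (x a) (x b) => ? ? ?; vec_ring.
have n1 := vnorm_gt0 u0; have n2 := vnorm_gt0 cua; have n3 := vnorm_gt0 cub.
pose k := 2 * (vnorm (x u) * vnorm (cross (x a) (x u)) * vnorm (cross (x b) (x u))) / dot (x u) (x u).
have k0 : 0 < k by rewrite divr_gt0 // mulr_gt0 // !mulr_gt0.
have D : det3 (x u) (x a) (x b) = k * (q0 z * q1 z).
  apply: (mulfI (lt0r_neq0 u0)); rewrite -E2 E /k /z; field.
  by rewrite gt_eqF.
have := det_neq0 PP U; rewrite D mulf_eq0 negb_or => /andP[_].
by rewrite mulf_eq0 negb_or => /andP[z00 z10]; split; [split | exists k].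
Qed.

Lemma pair_bits_sign u a b : all P [:: u; a; b] -> uniq [:: u; a; b] ->
  (det3 (x u) (x a) (x b) < 0) = (q0 (qmul (qconj (H u a)) (H u b)) < 0) (+)
  (q1 (qmul (qconj (H u a)) (H u b)) < 0).
Proof.
move=> PP U; have [[_ _ _ h0 h1] [k k0 ->]] := pair_bits PP U.
by rewrite pmulr_rlt0 // sgM.
Qed.

(** Alternation comes from inverting quaternions, [lchi_sector] from multiplying two rotations about
    the same axis, and [lchi_triangle] from a product of six flag changes that telescopes to one. *)
Lemma geo_link_axioms : link_axioms P geo_link.
Proof.
have D a b c := @det_neq0 a b c.
split; cbn [lo lchi ldl geo_link].
- move=> a b c PP U; rewrite -sgN ?D //; congr (_ < 0).
  by move: (x a) (x b) (x c) => ? ? ?; vec_ring.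
- move=> a b c PP U; rewrite -sgN ?D //; congr (_ < 0).
  by move: (x a) (x b) (x c) => ? ? ?; vec_ring.
- move=> v a b c d PP U; have /and5P[Pv Pa Pb Pc /andP[Pd _]] := PP.
  move: U; rewrite /= !inE !negb_or !andbT.
  case/and4P=> /and4P[va vb vc vd] /and3P[ab ac ad] /andP[bc bd] cd.
  apply: gp_okP; rewrite ?D //= ?inE ?negb_or ?Pv ?Pa ?Pb ?Pc ?Pd ?va ?vb ?vc ?vd ?ab ?ac ?ad ?bc ?bd ?cd //.
  by clear; move: (x v) (x a) (x b) (x c) (x d) => X A B C E; vec_ring.
- move=> u a b PP U; have [[_ _ _ _ h1] _] := pair_bits PP U.
  rewrite -sgN //; congr (_ < 0).
  by move: (H u a) (H u b) => ? ?; vec_ring.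
- move=> a b Pa Pb ab; rewrite -sgN; last first.
    have ba : b != a by rewrite eq_sym.
    have c1 := cross_gt0 Pa Pb ab; have [b0 a0] := dot_gt0_of_cross c1.
    have [_ _ _ E] := frame_flip (HP Pa Pb ab) (HP Pb Pa ba) a0 b0 c1.
    apply/eqP => z; move: E; rewrite z mul0r mulr0 => /esym/eqP; rewrite oppr_eq0.
    by rewrite gt_eqF // vnorm_gt0.
  congr (_ < 0); by move: (H a b) (H b a) => ? ?; vec_ring.
- move=> u b a c PP U; have /and5P[Pu Pb Pa Pc _] := PP.
  move: (U); rewrite /= !inE !negb_or !andbT => /and3P[/and3P[ub ua uc] /andP[ba bc] ac].
  have A1 : all P [:: u; b; a] by rewrite /= Pu Pb Pa.
  have A2 : all P [:: u; a; c] by rewrite /= Pu Pa Pc.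
  have A3 : all P [:: u; b; c] by rewrite /= Pu Pb Pc.
  have U1 : uniq [:: u; b; a] by rewrite /= !inE !negb_or ub ua ba.
  have U2 : uniq [:: u; a; c] by rewrite /= !inE !negb_or ua uc ac.
  have U3 : uniq [:: u; b; c] by rewrite /= !inE !negb_or ub uc bc.
  have [[x2 x3 _ x0 x1] _] := pair_bits A1 U1.
  have [[y2 y3 _ y0 y1] _] := pair_bits A2 U2.
  have [[_ _ _ w0 w1] _] := pair_bits A3 U3.
  rewrite /in_sector !pair_bits_sign //; have [Hn _ _] := HP Pu Pa ua.
  have E : qmul (qconj (H u b)) (H u c) =
    qmul (qmul (qconj (H u b)) (H u a)) (qmul (qconj (H u a)) (H u c)).
    by rewrite -qmulA (qmulA (H u a)) qmulV // mul1q.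
  have M : forall z w : quat, q2 z = 0 -> q3 z = 0 ->
      q0 (qmul z w) = q0 z * q0 w - q1 z * q1 w /\ q1 (qmul z w) = q0 z * q1 w + q1 z * q0 w.
    by move=> z w /= -> ->; split; ring.
  have [e0 e1'] := M _ (qmul (qconj (H u a)) (H u c)) x2 x3; rewrite -E in e0 e1'.
  exact: (sector_bits e0 e1' x0 x1 y0 y1 w0 w1).
- move=> p q r PP U; have /and4P[Pp Pq Pr _] := PP.
  have [pq pr qr] : [/\ p != q, p != r & q != r].
    by move: U; rewrite /= !inE negb_or andbT => /andP[/andP[]].
  have [qp rp rq] : [/\ q != p, r != p & r != q] by rewrite (eq_sym q p) (eq_sym r p) (eq_sym r q).
  have A2 : all P [:: r; p; q] by rewrite /= Pr Pp Pq.
  have A3 : all P [:: q; r; p] by rewrite /= Pq Pr Pp.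
  have U2 : uniq [:: r; p; q] by rewrite /= !inE !negb_or rp rq pq.
  have U3 : uniq [:: q; r; p] by rewrite /= !inE !negb_or qr qp rp.
  have [[x2 x3 xn _ _] [k1 k10 E1]] := pair_bits PP U.
  have [[y2 y3 yn _ _] [k2 k20 E2]] := pair_bits A2 U2.
  have [[w2 w3 _ _ _] [k3 k30 E3]] := pair_bits A3 U3.
  have flip a b : P a -> P b -> a != b -> let z := qmul (qconj (H a b)) (H b a) in
    [/\ q0 z = 0, q3 z = 0, qnorm z = 1 & q1 z * q2 z < 0].
    move=> Pa Pb ab z; have ba : b != a by rewrite eq_sym.
    have c1 := cross_gt0 Pa Pb ab; have [b0 a0] := dot_gt0_of_cross c1.
    have [z0 z3 z1 E] := frame_flip (HP Pa Pb ab) (HP Pb Pa ba) a0 b0 c1.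
    split => //.
      by have [h _ _] := HP Pa Pb ab; have [h' _ _] := HP Pb Pa ba; rewrite /z qnormM qnorm_conj h h' mulr1.
    have K : 0 < 2 * (vnorm (x a) * vnorm (x b)) by rewrite mulr_gt0 // mulr_gt0 // vnorm_gt0.
    by rewrite -(pmulr_rlt0 _ K) E oppr_lt0 vnorm_gt0.
  have [m10 m13 m1n m1s] := flip _ _ Pp Pr pr; have [m20 m23 m2n m2s] := flip _ _ Pr Pq rq.
  have [m30 m33 m3n m3s] := flip _ _ Pq Pp qp.
  have hn a b : P a -> P b -> a != b -> qnorm (H a b) = 1 by move=> Pa Pb ab; case: (HP Pa Pb ab).
  have dpos : 0 < (det3 (x p) (x q) (x r)) ^+ 2 by rewrite exprn_even_gt0 //= D.
  have d2 : det3 (x r) (x p) (x q) = det3 (x p) (x q) (x r).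
    by clear; move: (x p) (x q) (x r) => X Y Z; vec_ring.
  have d3 : det3 (x q) (x r) (x p) = det3 (x p) (x q) (x r).
    by clear; move: (x p) (x q) (x r) => X Y Z; vec_ring.
  have pos (k l X Y d : R) : 0 < k -> 0 < l -> d = k * X -> d = l * Y -> 0 < d ^+ 2 -> 0 < X * Y.
    move=> k0 l0 e f; rewrite expr2 {1}e f mulrACA pmulr_rgt0 //; exact: mulr_gt0.
  apply: hexagon_bits => //.
  + have K a b (s t : quat) : P a -> P b -> a != b -> qmul (qmul s (H a b)) (qmul (qconj (H a b)) t) = qmul s t.
      by move=> Pa Pb ab; rewrite -qmulA (qmulA (H a b)) qmulV ?hn // mul1q.
    by rewrite !K // qmulVl ?hn.
  + by rewrite qnormM qnorm_conj !hn // mulr1.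
  + by rewrite qnormM qnorm_conj !hn // mulr1.
  + by apply: (pos k1 k2 _ _ _ k10 k20 E1 _ dpos); rewrite -d2.
  + by apply: (pos k2 k3 _ _ _ k20 k30 E2); rewrite ?d2 // -d3.
Qed.

End LinkAxioms.

End Links.

End Geo.

(** * Signs of quaternion lifts in the presence of errors *)

Module Config.

Import Core Geo.
Set Implicit Arguments.
Unset Strict Implicit.
Unset Printing Implicit Defensive.
Import Order.TTheory GRing.Theory Num.Theory.
Local Open Scope ring_scope.

Section Estimates.

Variable R : rcfType.
Local Notation vec := (vec R).
Local Notation quat := (quat R).
Implicit Types (p q r d z : quat) (t s : R).

Definition qle q t := [&& `|q0 q| <= t, `|q1 q| <= t, `|q2 q| <= t & `|q3 q| <= t].
Definition qsub p q := Quat (q0 p - q0 q) (q1 p - q1 q) (q2 p - q2 q) (q3 p - q3 q).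
Definition qadd p q := Quat (q0 p + q0 q) (q1 p + q1 q) (q2 p + q2 q) (q3 p + q3 q).

Lemma norm4 (a b c e k : R) : `|a| <= k -> `|b| <= k -> `|c| <= k -> `|e| <= k ->
  [/\ `|a - b - c - e| <= 4 * k, `|a + b + c - e| <= 4 * k,
      `|a - b + c + e| <= 4 * k & `|a + b - c + e| <= 4 * k].
Proof. by rewrite !ler_norml => /andP[a1 a2] /andP[b1 b2] /andP[c1 c2] /andP[d1 d2]; split; lra. Qed.

Lemma qle_mul p q t s : qle p t -> qle q s -> qle (qmul p q) (4 * (t * s)).
Proof.
case/and4P=> a0 a1 a2 a3 /and4P[b0 b1 b2 b3].
have M (x y : R) : `|x| <= t -> `|y| <= s -> `|x * y| <= t * s.
  by move=> h1 h2; rewrite normrM ler_pM.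
rewrite /qle /qmul /=; apply/and4P; split.
- by have [] := norm4 (M _ _ a0 b0) (M _ _ a1 b1) (M _ _ a2 b2) (M _ _ a3 b3).
- by have [] := norm4 (M _ _ a0 b1) (M _ _ a1 b0) (M _ _ a2 b3) (M _ _ a3 b2).
- by have [] := norm4 (M _ _ a0 b2) (M _ _ a1 b3) (M _ _ a2 b0) (M _ _ a3 b1).
- by have [] := norm4 (M _ _ a0 b3) (M _ _ a1 b2) (M _ _ a2 b1) (M _ _ a3 b0).
Qed.

Lemma qle_add p q t s : qle p t -> qle q s -> qle (qadd p q) (t + s).
Proof.
by case/and4P=> a0 a1 a2 a3 /and4P[b0 b1 b2 b3]; apply/and4P; split; rewrite /=;
   apply: (le_trans (ler_normD _ _)); apply: lerD.
Qed.

Lemma qle_trans p t s : qle p t -> t <= s -> qle p s.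
Proof. by case/and4P=> a0 a1 a2 a3 h; apply/and4P; split; apply: le_trans h. Qed.

Lemma qle_unit p : qnorm p <= 1 -> qle p 1.
Proof.
rewrite /qnorm => h; have A (x : R) : x ^+ 2 <= 1 -> `|x| <= 1.
  by move=> hx; rewrite -(@ler_pXn2r _ 2%N) ?nnegrE // real_normK ?num_real // expr1n.
have := (sqr_ge0 (q0 p), sqr_ge0 (q1 p), sqr_ge0 (q2 p), sqr_ge0 (q3 p)).
by case=> -[[h0 h1] h2] h3; apply/and4P; split; apply: A; lra.
Qed.

(* A half-turn about the second axis up to the error [t]; the sign of its
   [q2]-component is the sign of the lift. *)
Definition near_j (T : quat) t := [/\ qnorm T = 1, `|q0 T| <= t, `|q1 T| <= t & `|q3 T| <= t].

Lemma near_j_q2 T t : near_j T t -> 0 <= t -> t <= 1 / 1000 ->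
  1 - t <= `|q2 T| /\ qle (qsub T (Quat 0 0 (q2 T) 0)) t.
Proof.
case=> n h0 h1 h3 t0 t1; split; last first.
  by apply/and4P; split; rewrite /= ?subr0 ?subrr ?normr0.
have sq (x : R) : `|x| <= t -> x ^+ 2 <= t ^+ 2.
  by move=> hx; rewrite -[x ^+ 2]real_normK ?num_real // lerXn2r ?nnegrE.
have := sq _ h0; have := sq _ h1; have := sq _ h3; move: n; rewrite /qnorm => n s3 s1 s0.
rewrite leNgt; apply/negP => hlt.
have : `|q2 T| ^+ 2 < (1 - t) ^+ 2 by rewrite ltr_pXn2r ?nnegrE //; lra.
rewrite real_normK ?num_real // => h2.
by nra.
Qed.

Lemma sg_close (x y e : R) : `|x - y| <= e -> e < `|y| -> (x < 0) = (y < 0).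
Proof.
rewrite ler_norml => /andP[h1 h2]; case: (ltgtP y 0) => [y0|y0|->].
- by rewrite ltr0_norm // => h; lra.
- by rewrite gtr0_norm // => h; apply/negbTE; rewrite -leNgt; lra.
- by rewrite normr0 => h; lra.
Qed.

(** Conjugation by the second quaternion unit keeps [q0 z] and reverses [q1 z], so up to 32 t the
    components of [z'] are plus and minus those of [z] times [q2 Ta * q2 Tb]. If [q1 z] is large its
    sign is read off directly; otherwise [q0 z] is large, and the exact sign relation in the last
    hypothesis transfers the information to [q1 z']. *)
Lemma flip_bits (Ta Tb z z' : quat) t : near_j Ta t -> near_j Tb t ->
  0 <= t -> t <= 1 / 1000 -> z' = qmul Ta (qmul z (qconj Tb)) ->
  q2 z = 0 -> q3 z = 0 -> q0 z ^+ 2 + q1 z ^+ 2 = 1 -> q0 z != 0 -> q1 z != 0 ->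
  q0 z' != 0 -> q1 z' != 0 ->
  (q0 z' < 0) (+) (q1 z' < 0) = ~~ ((q0 z < 0) (+) (q1 z < 0)) ->
  (q1 z' < 0) = ~~ ((q2 Ta < 0) (+) (q2 Tb < 0) (+) (q1 z < 0)).
Proof.
move=> ja jb t0 t1 zE z2 z3 z1 n0 n1 n0' n1' hs.
have [ea la] := near_j_q2 ja t0 t1; have [eb lb] := near_j_q2 jb t0 t1.
have [na _ _ _] := ja; have [nb _ _ _] := jb.
set A := Quat 0 0 (q2 Ta) 0; set B := Quat 0 0 (q2 Tb) 0.
have zl : qle z 1 by apply: qle_unit; rewrite /qnorm z2 z3; lra.
have Tbl : qle (qconj Tb) 1 by apply: qle_unit; rewrite qnorm_conj nb.
have Al : qle A 1.
  have /and4P[_ _ h _] : qle Ta 1 by apply: qle_unit; rewrite na.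
  by apply/and4P; split; rewrite /= ?normr0.
have E : qsub z' (qmul A (qmul z (qconj B))) =
   qadd (qmul (qsub Ta A) (qmul z (qconj Tb))) (qmul A (qmul z (qconj (qsub Tb B)))).
  rewrite zE /A /B; move: Ta Tb z {ja jb zE z2 z3 z1 n0 n1 hs ea la eb lb na nb A B zl Tbl Al} => [a0 a1 a2 a3] [b0 b1 b2 b3] [c0 c1 c2 c3].
  by rewrite /qsub /qadd /qmul /qconj /=; congr Quat; ring.
have L : qle (qsub z' (qmul A (qmul z (qconj B)))) (32 * t).
  rewrite E; have lb' : qle (qconj (qsub Tb B)) t.
    by move: lb => /and4P[h0 h1 h2 h3]; apply/and4P; split; rewrite //= normrN.
  apply: (qle_trans (qle_add (qle_mul la (qle_mul zl Tbl)) (qle_mul Al (qle_mul zl lb')))).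
  by rewrite !mulr1 !mul1r; lra.
have e0 : q0 (qmul A (qmul z (qconj B))) = q2 Ta * q2 Tb * q0 z by rewrite /= z2 z3; ring.
have e1 : q1 (qmul A (qmul z (qconj B))) = - (q2 Ta * q2 Tb * q1 z) by rewrite /= z2 z3; ring.
move: L => /and4P[L0 L1 _ _].
have S0 p q : q0 (qsub p q) = q0 p - q0 q by [].
have S1 p q : q1 (qsub p q) = q1 p - q1 q by [].
rewrite S0 e0 in L0; rewrite S1 e1 in L1.
have a0 : q2 Ta != 0 by rewrite -normr_gt0; lra.
have b0 : q2 Tb != 0 by rewrite -normr_gt0; lra.
have ab : 9 / 10 <= `|q2 Ta * q2 Tb|.
  by rewrite normrM; nra.
have [h|h] := leP (1 / 2) `|q1 z|.
  rewrite (sg_close L1); last by rewrite normrN normrM; nra.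
  rewrite sgN ?mulf_neq0 // !sgM ?mulf_neq0 //.
have h' : 1 / 2 <= `|q0 z|.
  rewrite leNgt; apply/negP => h0.
  have s0 : q0 z ^+ 2 <= 1 / 4.
    by rewrite -[q0 z ^+ 2]real_normK ?num_real //; have := normr_ge0 (q0 z); nra.
  have s1 : q1 z ^+ 2 <= 1 / 4.
    by rewrite -[q1 z ^+ 2]real_normK ?num_real //; have := normr_ge0 (q1 z); nra.
  by lra.
have := sg_close L0; rewrite !sgM ?mulf_neq0 // => /(_ _) e.
have {}e : (q0 z' < 0) = (q2 Ta < 0) (+) (q2 Tb < 0) (+) (q0 z < 0).
  by apply: e; rewrite !normrM -normrM; nra.
move: hs; rewrite e; case: (q2 Ta < 0); case: (q2 Tb < 0); case: (q0 z < 0);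
  by case: (q1 z < 0); case: (q1 z' < 0).
Qed.

(* Three arguments in (0, pi/2) with sum below pi/2. *)
Lemma im_of_product (a1 b1 a2 b2 a3 b3 : R) : 0 < a1 -> 0 < b1 -> 0 < a2 -> 0 < b2 ->
  0 < a3 -> 0 < b3 -> a1 ^+ 2 + b1 ^+ 2 = 1 -> a2 ^+ 2 + b2 ^+ 2 = 1 -> a3 ^+ 2 + b3 ^+ 2 = 1 ->
  0 < a1 * (a2 * a3 - b2 * b3) - b1 * (a2 * b3 + b2 * a3) ->
  b1 <= b1 * (a2 * a3 - b2 * b3) + a1 * (a2 * b3 + b2 * a3).
Proof.
move=> p1 r1 p2 r2 p3 r3 u1 u2 u3.
have U : (a2 * a3 - b2 * b3) ^+ 2 + (a2 * b3 + b2 * a3) ^+ 2 = 1.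
  transitivity ((a2 ^+ 2 + b2 ^+ 2) * (a3 ^+ 2 + b3 ^+ 2)); first by ring.
  by rewrite u2 u3 mulr1.
have B0 : 0 < a2 * b3 + b2 * a3 by rewrite addr_gt0 // mulr_gt0.
move: (a2 * a3 - b2 * b3) (a2 * b3 + b2 * a3) U B0 => A B U B0 h.
have A0 : 0 < A.
  rewrite ltNge; apply/negP => A0.
  have : a1 * A <= 0 by rewrite pmulr_rle0.
  have h1 : 0 < b1 * B by rewrite mulr_gt0.
  by lra.
have A1 : A <= 1 by rewrite leNgt; apply/negP => A1; nra.
have h2 : b1 * B ^+ 2 < a1 * A * B by rewrite expr2 mulrA ltr_pM2r //; lra.
have e2 : B ^+ 2 = (1 - A) * (1 + A) by lra.
rewrite e2 in h2.
rewrite leNgt; apply/negP => h3.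
have h4 : a1 * B < b1 * (1 - A) by lra.
have : a1 * B * A <= b1 * (1 - A) * A by rewrite ler_pM2r // ltW.
have : 0 <= b1 * (1 - A) by apply: mulr_ge0; [exact: ltW | lra].
by lra.
Qed.

(** [g] is the product with [T] replaced by [q2 T] times the second unit. It is a multiple of a
    rotation about the third axis, so the three factors of a hexagon nearly commute and their angles
    add. *)
Lemma half_turn_product (m T : quat) (t : R) : q0 m = 0 -> q3 m = 0 ->
  q1 m ^+ 2 + q2 m ^+ 2 = 1 -> near_j T t -> 0 <= t ->
  let g := qscale (- q2 T) (Quat (- q2 m) 0 0 (q1 m)) in
  qle (qsub (qmul m (qconj T)) g) (2 * t) /\ qle g 1.
Proof.
move=> m0 m3 m1 [n h0 h1 h3] t0 g.
have M (x : R) : x ^+ 2 <= 1 -> `|x| <= 1.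
  by move=> hx; rewrite -(@ler_pXn2r _ 2%N) ?nnegrE // real_normK ?num_real // expr1n.
have c1 : `|q1 m| <= 1 by apply: M; have := sqr_ge0 (q2 m); lra.
have c2 : `|q2 m| <= 1 by apply: M; have := sqr_ge0 (q1 m); lra.
have T2 : `|q2 T| <= 1.
  by have /and4P[] : qle T 1 by apply: qle_unit; rewrite n.
have P (x y : R) : `|x| <= 1 -> `|y| <= t -> `|x * y| <= t.
  by move=> hx hy; rewrite normrM -[t]mul1r ler_pM.
have PN (x y : R) : `|x| <= 1 -> `|y| <= t -> - t <= x * y <= t.
  by move=> hx hy; rewrite -ler_norml; apply: P.
have a := PN _ _ c1 h0; have b := PN _ _ c1 h1; have c := PN _ _ c1 h3.
have d := PN _ _ c2 h0; have e := PN _ _ c2 h1; have f := PN _ _ c2 h3.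
have gl : qle g 1.
  apply/and4P; split; rewrite /g /= ?mulr0 ?normr0 // normrM ?normrN -[1]mul1r;
  by rewrite ler_pM // ?normrN.
split=> //; apply/and4P; split; rewrite /g /= ?m0 ?m3; rewrite ler_norml;
  case/andP: a => ? ?; case/andP: b => ? ?; case/andP: c => ? ?;
  case/andP: d => ? ?; case/andP: e => ? ?; case/andP: f => ? ?; clear m1 c1 c2 T2 gl h0 h1 h3; apply/andP; split; lra.
Qed.

(** One telescoping term per factor; each is a product of three quaternions, and each multiplication
    costs a factor 4, hence 3 * 16 = 48. *)
Lemma product_close (p1 p2 p3 g1 g2 g3 : quat) (t : R) : 0 <= t -> t <= 1 ->
  qle p1 1 -> qle p2 1 -> qle p3 1 -> qle g1 1 -> qle g2 1 -> qle g3 1 ->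
  qle (qsub p1 g1) t -> qle (qsub p2 g2) t -> qle (qsub p3 g3) t ->
  qle (qsub (qmul p1 (qmul p2 p3)) (qmul g1 (qmul g2 g3))) (48 * t).
Proof.
move=> t0 t1 a1 a2 a3 b1 b2 b3 d1 d2 d3.
have -> : qsub (qmul p1 (qmul p2 p3)) (qmul g1 (qmul g2 g3)) =
  qadd (qmul (qsub p1 g1) (qmul p2 p3))
    (qadd (qmul g1 (qmul (qsub p2 g2) p3)) (qmul g1 (qmul g2 (qsub p3 g3)))).
  move: p1 p2 p3 g1 g2 g3 {a1 a2 a3 b1 b2 b3 d1 d2 d3}
    => [a0 a1 a2 a3] [b0 b1 b2 b3] [c0 c1 c2 c3] [d0 d1 d2 d3] [f0 f1 f2 f3] [h0 h1 h2 h3].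
  by rewrite /qsub /qadd /qmul /=; congr Quat; ring.
apply: (qle_trans (qle_add (qle_mul d1 (qle_mul a2 a3))
  (qle_add (qle_mul b1 (qle_mul d2 a3)) (qle_mul b1 (qle_mul b2 d3))))).
by rewrite !mulr1 !mul1r; lra.
Qed.

Lemma product_lower (t a b c : R) : 0 <= t -> t <= 1 / 10000 -> 1 - t <= a -> 1 - t <= b ->
  1 - t <= c -> 1 / 2 <= a * b * c.
Proof.
move=> t0 t1 ha hb hc; have p : 0 <= 1 - t by lra.
have h12 : (1 - t) * (1 - t) <= a * b by apply: ler_pM.
have h123 : (1 - t) * (1 - t) * (1 - t) <= a * b * c by apply: ler_pM => //; apply: mulr_ge0.
by apply: le_trans h123; clear ha hb hc h12; nra.
Qed.

(** [A] must be negative: a positive [A] makes [B] at least [b] and so [G3] too large for the bound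
    on [w3], and [A = 0] makes [w0] too small. Then [G0], and with it [w0], has the sign of [Y]. *)
Lemma final_sign (w0 w3 G0 G3 Y A B b t : R) : 0 <= t -> t <= 1 / 10000 ->
  `|w0 - G0| <= 48 * (2 * t) -> `|w3 - G3| <= 48 * (2 * t) -> `|w3| <= t ->
  1 / 2 <= `|w0| -> 1 / 2 <= `|Y| -> G0 = Y * - A -> G3 = - (Y * B) ->
  (0 < A -> b <= B) -> 400 * t < b -> (w0 < 0) = (Y < 0).
Proof.
move=> t0 t1 C0 C3 W3 W0 Y1 G0E G3E I mar.
have A0 : A < 0.
  case: (ltgtP A 0) => // hA.
    have hB : b <= `|B| by apply: le_trans (I hA) (ler_norm _).
    have h : `|G3| <= 97 * t.
      have -> : G3 = w3 - (w3 - G3) by ring.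
      apply: (le_trans (ler_normB _ _)); move: (`|w3|) (`|w3 - G3|) C3 W3 => x y; clear; lra.
    rewrite G3E normrN normrM in h.
    have h2 : 1 / 2 * b <= `|Y| * `|B|.
      by apply: ler_pM => //; move: mar t0; clear; lra.
    by move: h h2 mar t0; move: (`|Y| * `|B|) => z; clear; lra.
  by move: C0 W0 t1; rewrite G0E hA oppr0 mulr0 subr0; move: (`|w0|) => z; clear; lra.
have As : 0 < - A by rewrite oppr_gt0.
have G0l : 48 * (2 * t) < `|G0|.
  have -> : G0 = w0 - (w0 - G0) by ring.
  apply: lt_le_trans (lerB_dist _ _); move: (`|w0|) (`|w0 - G0|) C0 W0 t1 => x y; clear; lra.
by rewrite (sg_close C0 G0l) G0E pmulr_llt0.
Qed.

(* The angles of a triangle sum to pi: the product of the three corner and three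
   half-turn steps is a rotation by pi up to sign. *)
Lemma hexagon_sign (m1 m2 m3 T1 T2 T3 W : quat) (t : R) : 0 <= t -> t <= 1 / 10000 ->
  q0 m1 = 0 -> q3 m1 = 0 -> q1 m1 ^+ 2 + q2 m1 ^+ 2 = 1 -> q1 m1 * q2 m1 < 0 ->
  q0 m2 = 0 -> q3 m2 = 0 -> q1 m2 ^+ 2 + q2 m2 ^+ 2 = 1 -> q1 m2 * q2 m2 < 0 ->
  q0 m3 = 0 -> q3 m3 = 0 -> q1 m3 ^+ 2 + q2 m3 ^+ 2 = 1 -> q1 m3 * q2 m3 < 0 ->
  near_j T1 t -> near_j T2 t -> near_j T3 t ->
  400 * t < `|q1 m1| -> `|q3 W| <= t -> 1 / 2 <= `|q0 W| ->
  W = qmul (qmul m1 (qconj T1)) (qmul (qmul m2 (qconj T2)) (qmul m3 (qconj T3))) ->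
  (q1 m1 < 0) (+) (q2 T1 < 0) (+) (q1 m2 < 0) (+) (q2 T2 < 0) (+)
  (q1 m3 < 0) (+) (q2 T3 < 0) = (q0 W < 0).
Proof.
move=> t0 t1 m10 m13 m1n m1s m20 m23 m2n m2s m30 m33 m3n m3s j1 j2 j3 mar W3 W0 WE.
have [l1 g1] := half_turn_product m10 m13 m1n j1 t0.
have [l2 g2] := half_turn_product m20 m23 m2n j2 t0.
have [l3 g3] := half_turn_product m30 m33 m3n j3 t0.
have t1' : t <= 1 / 1000 by move: t1; clear; lra.
have [e1 _] := near_j_q2 j1 t0 t1'; have [e2 _] := near_j_q2 j2 t0 t1'.
have [e3 _] := near_j_q2 j3 t0 t1'.
have U m T : q0 m = 0 -> q3 m = 0 -> q1 m ^+ 2 + q2 m ^+ 2 = 1 -> near_j T t -> qle (qmul m (qconj T)) 1.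
  move=> h0 h3 h1 [n _ _ _]; apply: qle_unit; rewrite qnormM qnorm_conj n mulr1.
  by rewrite /qnorm h0 h3; move: h1; clear; lra.
have tt : 2 * t <= 1 by move: t1; clear; lra.
have tt0 : 0 <= 2 * t by move: t0; clear; lra.
have := product_close tt0 tt (U _ _ m10 m13 m1n j1) (U _ _ m20 m23 m2n j2) (U _ _ m30 m33 m3n j3) g1 g2 g3 l1 l2 l3.
rewrite -WE => /and4P[]; rewrite /= !mulr0 !subr0 !addr0 ?add0r => C0 _ _ C3.
move: (q0 W) (q3 W) W3 W0 C0 C3 => w0 w3 W3 W0 C0 C3.
move: (q2 T1) (q2 T2) (q2 T3) e1 e2 e3 C0 C3 => x1 x2 x3 e1 e2 e3.
move: (q1 m1) (q2 m1) m1n m1s mar => c1 d1 m1n m1s mar.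
move: (q1 m2) (q2 m2) m2n m2s => c2 d2 m2n m2s.
move: (q1 m3) (q2 m3) m3n m3s => c3 d3 m3n m3s.
clear U tt tt0 t1' l1 l2 l3 g1 g2 g3 j1 j2 j3 m10 m13 m20 m23 m30 m33 WE.
move=> C0 C3.
(* Splits off the sign of the lift, so that the remaining half-angles lie strictly between 0 and
   pi/2, as [im_of_product] demands. *)
have S (c d : R) : c * d < 0 -> exists s b a, [/\ c = s * b, d = - (s * a), 0 < b, 0 < a & `|s| = 1].
  move=> h; have c0 : c != 0 by apply: contraTneq h => ->; rewrite mul0r ltxx.
  have d0 : d != 0 by apply: contraTneq h => ->; rewrite mulr0 ltxx.
  exists (Num.sg c), `|c|, `|d|; rewrite !normr_gt0 c0 d0 normr_sg c0 -numEsg; split=> //.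
  case: (ltgtP c 0) c0 => // hc _.
    have d1' : 0 < d by rewrite -(nmulr_rlt0 _ hc).
    by rewrite ltr0_sg // gtr0_norm //; ring.
  have d1' : d < 0 by rewrite -(pmulr_rlt0 _ hc).
  by rewrite gtr0_sg // ltr0_norm //; ring.
have [k1 [b1 [a1 [E1 F1 p1 r1 n1]]]] := S _ _ m1s.
have [k2 [b2 [a2 [E2 F2 p2 r2 n2]]]] := S _ _ m2s.
have [k3 [b3 [a3 [E3 F3 p3 r3 n3]]]] := S _ _ m3s.
subst c1 d1 c2 d2 c3 d3.
have Q (k b a : R) : `|k| = 1 -> (k * b) ^+ 2 + (- (k * a)) ^+ 2 = 1 -> a ^+ 2 + b ^+ 2 = 1.
  move=> hk; have k1' : k ^+ 2 = 1 by rewrite -[k ^+ 2]real_normK ?num_real // hk expr1n.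
  by rewrite sqrrN !exprMn k1' !mul1r addrC.
have [U1 U2 U3] := And3 (Q _ _ _ n1 m1n) (Q _ _ _ n2 m2n) (Q _ _ _ n3 m3n).
have I := im_of_product r1 p1 r2 p2 r3 p3 U1 U2 U3.
have nb : `|k1 * b1| = b1 by rewrite normrM n1 mul1r gtr0_norm.
rewrite nb in mar.
set A := a1 * (a2 * a3 - b2 * b3) - b1 * (a2 * b3 + b2 * a3) in I.
set B := b1 * (a2 * a3 - b2 * b3) + a1 * (a2 * b3 + b2 * a3) in I.
pose s := k1 * k2 * k3; pose X := x1 * x2 * x3.
set G0 := (X in `|w0 - X|) in C0; set G3 := (X in `|w3 - X|) in C3.
have G0E : G0 = X * s * - A by rewrite /G0 /A /s /X; ring.
have G3E : G3 = - (X * s * B) by rewrite /G3 /B /s /X; ring.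
have s1 : `|s| = 1 by rewrite /s !normrM n1 n2 n3 !mulr1.
have X1 : 1 / 2 <= `|X| by rewrite /X !normrM; apply: (product_lower t0 t1).
have xn (x : R) : 1 - t <= `|x| -> x != 0.
  by move=> h; rewrite -normr_gt0; apply: lt_le_trans h; move: t1; clear; lra.
have [x10 x20 x30] := And3 (xn _ e1) (xn _ e2) (xn _ e3).
have kn (k : R) : `|k| = 1 -> k != 0 by move=> h; rewrite -normr_gt0 h.
have [k10 k20 k30] := And3 (kn _ n1) (kn _ n2) (kn _ n3).
have <- : (X * s < 0) = (k1 * b1 < 0) (+) (x1 < 0) (+) (k2 * b2 < 0) (+) (x2 < 0) (+)
  (k3 * b3 < 0) (+) (x3 < 0).
  rewrite /X /s (pmulr_llt0 _ p1) (pmulr_llt0 _ p2) (pmulr_llt0 _ p3) !sgM ?mulf_neq0 //.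
  by case: (k1 < 0); case: (k2 < 0); case: (k3 < 0); case: (x1 < 0); case: (x2 < 0); case: (x3 < 0).
have Y1 : 1 / 2 <= `|X * s| by rewrite normrM s1 mulr1.
exact/esym/(final_sign t0 t1 C0 C3 W3 W0 Y1 G0E G3E I mar).
Qed.

End Estimates.

End Config.

(** * Points seen from several tangent spaces satisfy the combinatorial axioms *)

Module Config2.

Import Core Geo Config.
Set Implicit Arguments.
Unset Strict Implicit.
Unset Printing Implicit Defensive.
Import Order.TTheory GRing.Theory Num.Theory.
Local Open Scope ring_scope.

Lemma small_thousandth (R : rcfType) (t : R) : t <= 1 / 10000 -> t <= 1 / 1000 /\ 0 < 1 - t.
Proof. by move=> h; split; lra. Qed.

Lemma le_sum_of_squares (R : rcfType) (a b c d : R) : a ^+ 2 + b ^+ 2 + c ^+ 2 <= d -> c ^+ 2 <= d.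
Proof. by have := sqr_ge0 a; have := sqr_ge0 b; move=> h1 h2 h3; lra. Qed.

Section Configuration.

Variable R : rcfType.
Local Notation vec := (vec R).
Local Notation quat := (quat R).
Variables (n : nat) (adj near : rel 'I_n) (y : 'I_n -> 'I_n -> vec).
Variables (qq : 'I_n -> 'I_n -> quat) (H : 'I_n -> 'I_n -> 'I_n -> quat) (t : R).
Implicit Types (a b c d e i u v : 'I_n).

(** [y v a] is the point a as seen in the tangent space at v. The views from different base points
    are not the same configuration, which is why all later quantities carry a base index. *)
Definition pos v a := vsub (y v a) (y v v).
Definition det4 i a b c d :=
  det3 (vsub (y i b) (y i a)) (vsub (y i c) (y i a)) (vsub (y i d) (y i a)).
(** Both the edge and the normal of the triangle vua change sign when the edge is read from its
    other end. This is therefore nearly plus or minus the second quaternion unit, and its sign is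
    the bit [ga]. *)
Definition half_turn v u a := qmul (qconj (H u v a)) (qmul (qq u v) (H v u a)).
Definition holonomy v u a := qmul (qq v a) (qmul (qq a u) (qq u v)).
Definition near_seq (s : seq 'I_n) := all (fun i => all (near i) s) s.

(** Each tetrahedron is measured in the view from its first vertex; [det_near] makes the choice
    immaterial among near points. *)
Definition geo_system : system n := System near
  (fun a b c d => det4 a a b c d < 0)
  (fun v u a b => q1 (qmul (qconj (H v u a)) (H v u b)) < 0)
  (fun v a b => q1 (qmul (qconj (H v a b)) (H v b a)) < 0)
  (fun v u a => q2 (half_turn v u a) < 0).

Hypothesis adjC : symmetric adj.
Hypothesis star : forall v a b, adj v a -> adj v b -> near_seq [:: v; a; b].
Hypothesis det_near : forall i a b c d, near_seq [:: i; a; b; c; d] ->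
  uniq [:: a; b; c; d] ->
  det4 i a b c d != 0 /\ (det4 i a b c d < 0) = (det4 a a b c d < 0).
Hypothesis cross_near : forall v a b, near_seq [:: v; a; b] -> uniq [:: v; a; b] ->
  0 < dot (cross (pos v b) (pos v a)) (cross (pos v b) (pos v a)).
Hypothesis H_frame : forall v u a, uniq [:: v; u; a] -> adj v u -> adj v a ->
  frame (H v u a) (pos v u) (cross (pos v a) (pos v u)).
Hypothesis t_ge0 : 0 <= t.
Hypothesis t_small : t <= 1 / 10000.
Hypothesis qq_unit : forall u v, qnorm (qq u v) = 1.
Hypothesis qq_conj : forall u v, qq v u = qconj (qq u v).
Hypothesis half_turn_near : forall v u a, uniq [:: v; u; a] -> adj v u -> adj v a -> adj u a ->
  near_j (half_turn v u a) t.
Hypothesis meets_near_seq : forall a b e x z w, uniq [:: a; b; e; x; z; w] ->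
  adj a b -> adj a e -> adj b e -> adj x z -> adj x w -> adj z w ->
  near_seq [:: a; b; x; z; w] -> meets geo_system a b x z w ->
  near_seq [:: a; b; e; x; z; w].

Lemma near_seqP s : reflect {in s &, forall i j, near i j} (near_seq s).
Proof.
by apply: (iffP allP) => [h i j /h/allP h' /h'|h i hi]; last by apply/allP => j; apply: h.
Qed.

Lemma near_seq_sub s1 s2 : {subset s1 <= s2} -> near_seq s2 -> near_seq s1.
Proof. by move=> h /near_seqP h2; apply/near_seqP => i j hi hj; apply: h2; apply: h. Qed.

Lemma star3 v a b c : adj v a -> adj v b -> adj v c -> near_seq [:: v; v; a; b; c].
Proof.
move=> ha hb hc; have P x z : x \in [:: v; a; b; c] -> z \in [:: v; a; b; c] ->
    near_seq [:: v; x; z].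
  move=> hx hz; have S w : w \in [:: v; a; b; c] -> w = v \/ adj v w.
    by rewrite !inE => /or4P[] /eqP->; auto.
  case: (S x hx) => [->|ax]; case: (S z hz) => [->|az].
  - by apply: (near_seq_sub _ (star ha ha)) => w; rewrite !inE; case: (w == v); rewrite ?orbF.
  - by apply: (near_seq_sub _ (star az az)) => w; rewrite !inE; case: (w == v); case: (w == z).
  - by apply: (near_seq_sub _ (star ax ax)) => w; rewrite !inE; case: (w == v); case: (w == x).
  - exact: star.
apply/near_seqP => i j hi hj.
have hi' : i \in [:: v; a; b; c] by move: hi; rewrite !inE; case: (i == v).
have hj' : j \in [:: v; a; b; c] by move: hj; rewrite !inE; case: (j == v).
by move/near_seqP: (P _ _ hi' hj'); apply; rewrite !inE eqxx ?orbT.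
Qed.

Lemma det4_swap12 i a b c d : det4 i b a c d = - det4 i a b c d.
Proof. by rewrite /det4; move: (y i a) (y i b) (y i c) (y i d) => A B C D; rewrite /vsub; vec_ring. Qed.
Lemma det4_swap23 i a b c d : det4 i a c b d = - det4 i a b c d.
Proof. by rewrite /det4; move: (y i a) (y i b) (y i c) (y i d) => A B C D; rewrite /vsub; vec_ring. Qed.
Lemma det4_swap34 i a b c d : det4 i a b d c = - det4 i a b c d.
Proof. by rewrite /det4; move: (y i a) (y i b) (y i c) (y i d) => A B C D; rewrite /vsub; vec_ring. Qed.

Lemma det4_pluecker (i a b c d e f : 'I_n) :
  det4 i a b c d * det4 i a b e f - det4 i a b c e * det4 i a b d f
  + det4 i a b c f * det4 i a b d e = 0.
Proof.
rewrite /det4; move: (y i a) (y i b) (y i c) (y i d) (y i e) (y i f) => A B C D E F.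
rewrite /vsub; vec_ring.
Qed.

Lemma cross_pos v a b : uniq [:: v; a; b] -> adj v a -> adj v b ->
  0 < dot (cross (pos v b) (pos v a)) (cross (pos v b) (pos v a)).
Proof. by move=> U va vb; apply: cross_near => //; apply: star. Qed.

Lemma geo_link_system v : link_axioms (nbr adj v) (link geo_system v).
Proof.
have N a b : nbr adj v a -> nbr adj v b -> a != b -> [/\ uniq [:: v; a; b], adj v a & adj v b].
  by case/andP=> h1 h2 /andP[h3 h4] h5; rewrite /= !inE negb_or h2 h4 h5.
apply: (@geo_link_axioms R n (nbr adj v) (pos v) (H v)).
- move=> a b c /and4P[/andP[a1 a2] /andP[b1 b2] /andP[c1 c2] _] U.
  have U4 : uniq [:: v; a; b; c] by move: U; rewrite /= !inE !negb_or a2 b2 c2.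
  by have [] := det_near (star3 a1 b1 c1) U4.
- by move=> a b Pa Pb ab; have [] := N _ _ Pa Pb ab; apply: cross_pos.
- by move=> a b Pa Pb ab; have [? ? ?] := N _ _ Pa Pb ab; apply: H_frame.
Qed.

Lemma near4 i a b c d : near_seq [:: a; b; c; d] -> i \in [:: a; b; c; d] -> uniq [:: a; b; c; d] ->
  det4 i a b c d != 0 /\ (det4 i a b c d < 0) = (det4 a a b c d < 0).
Proof.
move=> h hi U; apply: det_near => //; apply: near_seq_sub h => j.
by rewrite in_cons => /orP[/eqP->|].
Qed.

Lemma geo_ori_alt a b c d : near_seq [:: a; b; c; d] -> uniq [:: a; b; c; d] ->
  [/\ (det4 b b a c d < 0) = ~~ (det4 a a b c d < 0),
      (det4 a a c b d < 0) = ~~ (det4 a a b c d < 0) &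
      (det4 a a b d c < 0) = ~~ (det4 a a b c d < 0)].
Proof.
move=> h U; have hb : b \in [:: a; b; c; d] by rewrite !inE eqxx orbT.
have ha : a \in [:: a; b; c; d] by rewrite !inE eqxx.
have [d0 e0] := near4 h hb U; have [d1 _] := near4 h ha U.
by split; [rewrite det4_swap12 sgN // e0 | rewrite det4_swap23 sgN | rewrite det4_swap34 sgN].
Qed.

Lemma geo_ori_gp a b e x z w : near_seq [:: a; b; e; x; z; w] ->
  uniq [:: a; b; e; x; z; w] -> six_ok (fun a b c d => det4 a a b c d < 0) a b e x z w.
Proof.
move=> h; rewrite /= !inE !negb_or !andbT.
case/and5P=> /and5P[ab ae ax az aw] /and4P[be bx bz bw] /and3P[ex ez ew] /andP[xz xw] zw.
have D i1 i2 i3 i4 : all (mem [:: a; b; e; x; z; w]) [:: i1; i2; i3; i4] -> uniq [:: i1; i2; i3; i4] ->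
    det4 a i1 i2 i3 i4 != 0 /\ (det4 i1 i1 i2 i3 i4 < 0) = (det4 a i1 i2 i3 i4 < 0).
  move=> /allP S U; have [|d0 d1] := @det_near a i1 i2 i3 i4 _ U; last by [].
  apply: near_seq_sub h => j; rewrite in_cons => /orP[/eqP->|/S//].
  by rewrite mem_head.
have nz i1 i2 i3 i4 : all (mem [:: a; b; e; x; z; w]) [:: i1; i2; i3; i4] -> uniq [:: i1; i2; i3; i4] ->
  det4 a i1 i2 i3 i4 != 0 by move=> s u; case: (D _ _ _ _ s u).
have E i1 i2 i3 i4 : all (mem [:: a; b; e; x; z; w]) [:: i1; i2; i3; i4] -> uniq [:: i1; i2; i3; i4] ->
  (det4 i1 i1 i2 i3 i4 < 0) = (det4 a i1 i2 i3 i4 < 0) by move=> s u; case: (D _ _ _ _ s u).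
rewrite /six_ok.
rewrite !(E b e x) ?(E b e z) ?(E b x z) ?(E e x z);
 rewrite /= ?inE ?negb_or ?eqxx ?orbT ?ab ?ae ?ax ?az ?aw ?be ?bx ?bz ?bw ?ex ?ez ?ew ?xz ?xw ?zw //.
repeat (apply/andP; split); apply: gp_okP;
 try (apply: nz; rewrite /= ?inE ?negb_or ?eqxx ?orbT ?ab ?ae ?ax ?az ?aw ?be ?bx ?bz ?bw ?ex ?ez ?ew ?xz ?xw ?zw //);
 rewrite /det4; move: (y a a) (y a b) (y a e) (y a x) (y a z) (y a w) => A B E' X Z W; clear; rewrite /vsub; vec_ring.
Qed.

Lemma half_turn_conj v u a : half_turn u v a = qconj (half_turn v u a).
Proof.
rewrite /half_turn qq_conj; move: (qq u v) (H v u a) (H u v a) => q h k.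
by rewrite !qconjM !qconjK qmulA.
Qed.

Lemma half_turn_q2 v u a : uniq [:: v; u; a] -> adj v u -> adj v a -> adj u a ->
  q2 (half_turn v u a) != 0.
Proof.
move=> U h1 h2 h3; have [t1 t2] := small_thousandth t_small.
have [e _] := near_j_q2 (half_turn_near U h1 h2 h3) t_ge0 t1.
by rewrite -normr_gt0; apply: lt_le_trans e.
Qed.

Lemma geo_ga_alt v u a : uniq [:: v; u; a] -> adj v u -> adj v a -> adj u a ->
  (q2 (half_turn u v a) < 0) = ~~ (q2 (half_turn v u a) < 0).
Proof. by move=> U h1 h2 h3; rewrite half_turn_conj -sgN ?half_turn_q2. Qed.

Lemma H_norm v u a : uniq [:: v; u; a] -> adj v u -> adj v a -> qnorm (H v u a) = 1.
Proof. by move=> U h1 h2; case: (H_frame U h1 h2). Qed.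

Lemma uniq_swap12 (u v a : 'I_n) : uniq [:: v; u; a] -> uniq [:: u; v; a].
Proof.
by rewrite /= !inE !negb_or !andbT => /andP[/andP[h1 h2] h3]; rewrite eq_sym h1 h2 h3.
Qed.

(** The frame changes at v and u are conjugate through the two half-turns, so [flip_bits] applies;
    its sign hypothesis is the change of orientation of the tetrahedron when v and u are
    exchanged. *)
Lemma geo_chi_flip v u a b : uniq [:: v; u; a; b] -> adj v u -> adj v a ->
  adj u a -> adj v b -> adj u b ->
  (q1 (qmul (qconj (H u v a)) (H u v b)) < 0) =
  ~~ ((q2 (half_turn v u a) < 0) (+) (q2 (half_turn v u b) < 0) (+)
      (q1 (qmul (qconj (H v u a)) (H v u b)) < 0)).
Proof.
move=> U vu va ua vb ub.
have [uv av au bv bu] : [/\ adj u v, adj a v, adj a u, adj b v & adj b u].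
  by rewrite (adjC u v) (adjC a v) (adjC a u) (adjC b v) (adjC b u).
move: (U); rewrite /= !inE !negb_or !andbT => /and3P[/and3P[nvu nva nvb] /andP[nua nub] nab].
have Uva : uniq [:: v; u; a] by rewrite /= !inE negb_or nvu nva nua.
have Uvb : uniq [:: v; u; b] by rewrite /= !inE negb_or nvu nvb nub.
have Uu : uniq [:: u; v; a; b] by rewrite /= !inE !negb_or (eq_sym u v) nvu nva nvb nua nub nab.
have [t1 t2] := small_thousandth t_small.
have L := geo_link_system.
have pr (w x : 'I_n) : uniq [:: w; x; a; b] -> adj w x -> adj w a -> adj w b ->
   [/\ q2 (qmul (qconj (H w x a)) (H w x b)) = 0, q3 (qmul (qconj (H w x a)) (H w x b)) = 0,
    q0 (qmul (qconj (H w x a)) (H w x b)) ^+ 2 + q1 (qmul (qconj (H w x a)) (H w x b)) ^+ 2 = 1,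
    q0 (qmul (qconj (H w x a)) (H w x b)) != 0 & q1 (qmul (qconj (H w x a)) (H w x b)) != 0] /\
    (det4 w w x a b < 0) = (q0 (qmul (qconj (H w x a)) (H w x b)) < 0) (+)
        (q1 (qmul (qconj (H w x a)) (H w x b)) < 0).
  move=> W wx wa wb.
  have D1 a1 b1 c1 : all (nbr adj w) [:: a1; b1; c1] -> uniq [:: a1; b1; c1] ->
      det3 (pos w a1) (pos w b1) (pos w c1) != 0.
    move=> /and4P[/andP[a1' a2] /andP[b1' b2] /andP[c1' c2] _] V.
    have U4 : uniq [:: w; a1; b1; c1] by move: V; rewrite /= !inE !negb_or a2 b2 c2.
    by have [] := det_near (star3 a1' b1' c1') U4.
  have N a1 b1 : nbr adj w a1 -> nbr adj w b1 -> a1 != b1 -> [/\ uniq [:: w; a1; b1], adj w a1 & adj w b1].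
    by case/andP=> h1 h2 /andP[h3 h4] h5; rewrite /= !inE negb_or h2 h4 h5.
  have D2 a1 b1 : nbr adj w a1 -> nbr adj w b1 -> a1 != b1 ->
    0 < dot (cross (pos w b1) (pos w a1)) (cross (pos w b1) (pos w a1)).
    by move=> Pa Pb ab; have [] := N _ _ Pa Pb ab; apply: cross_pos.
  have D3 a1 b1 : nbr adj w a1 -> nbr adj w b1 -> a1 != b1 ->
    frame (H w a1 b1) (pos w a1) (cross (pos w b1) (pos w a1)).
    by move=> Pa Pb ab; have [? ? ?] := N _ _ Pa Pb ab; apply: H_frame.
  move: W; rewrite /= !inE !negb_or !andbT => /and3P[/and3P[nwx nwa nwb] /andP[nxa nxb] _].
  have Pall : all (nbr adj w) [:: x; a; b] by rewrite /= /nbr wx wa wb nwx nwa nwb.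
  have Uall : uniq [:: x; a; b] by rewrite /= !inE !negb_or nxa nxb nab.
  have [h _] := pair_bits D1 D2 D3 Pall Uall.
  split; first exact: h.
  exact: (pair_bits_sign D1 D2 D3 Pall Uall).
have [[x2 x3 xn x0 x1] xs] := pr _ _ U vu va vb.
have [[w2 w3 wn w0 w1] ws] := pr _ _ Uu uv ua ub.
have jA := half_turn_near Uva vu va ua; have jB := half_turn_near Uvb vu vb ub.
apply: (flip_bits jA jB t_ge0 t1 _ x2 x3 xn x0 x1 w0 w1).
  rewrite /half_turn; have := H_norm Uva vu va; have := H_norm Uvb vu vb; have := qq_unit u v.
  move: (qq u v) (H u v a) (H u v b) (H v u a) (H v u b) => q A B C D hq hD hC.
  rewrite !qconjM !qconjK -!qmulA; congr (qmul _ _).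
  by rewrite (qmulA C) qmulV // mul1q (qmulA D) qmulV // mul1q qmulA qmulV // mul1q.
rewrite -xs -ws; have N4 : near_seq [:: v; u; a; b].
  by apply: near_seq_sub (star3 vu va vb) => j; rewrite !inE; case: (j == v).
by have [h _ _] := geo_ori_alt N4 U.
Qed.

Lemma geo_system_axioms : system_axioms adj geo_system.
Proof.
split.
- exact: star.
- exact: geo_ori_alt.
- exact: geo_ori_gp.
- exact: geo_link_system.
- exact: geo_ga_alt.
- exact: geo_chi_flip.
- exact: meets_near_seq.
Qed.

Hypothesis holonomy_real : forall v u a, uniq [:: v; u; a] -> adj v u -> adj v a -> adj u a ->
  1 / 2 <= `|q0 (holonomy v u a)| /\
  q1 (holonomy v u a) ^+ 2 + q2 (holonomy v u a) ^+ 2 + q3 (holonomy v u a) ^+ 2 <= t ^+ 2.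
Hypothesis corner_wide : forall v u a, uniq [:: v; u; a] -> adj v u -> adj v a -> adj u a ->
  400 * t < `|q1 (qmul (qconj (H v u a)) (H v a u))|.

Lemma qconj_form (p h : quat) : qnorm h = 1 -> let w := qmul (qconj h) (qmul p h) in
  q0 w = q0 p /\ q1 w ^+ 2 + q2 w ^+ 2 + q3 w ^+ 2 = q1 p ^+ 2 + q2 p ^+ 2 + q3 p ^+ 2.
Proof.
case: p h => [p0 p1 p2 p3] [h0 h1 h2 h3]; rewrite /qnorm /= => e.
split.
  transitivity (p0 * (h0 ^+ 2 + h1 ^+ 2 + h2 ^+ 2 + h3 ^+ 2)); first by ring.
  by rewrite e mulr1.
transitivity ((p1 ^+ 2 + p2 ^+ 2 + p3 ^+ 2) * (h0 ^+ 2 + h1 ^+ 2 + h2 ^+ 2 + h3 ^+ 2) ^+ 2); first by ring.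
by rewrite e expr1n mulr1.
Qed.

(** Inserting the frames writes the holonomy, conjugated by [H v u a], as the product of three
    corner changes and three inverse half-turns. Conjugation does not affect the real part, whose
    sign [hexagon_sign] determines. *)
Lemma geo_hexagon v u a : uniq [:: v; u; a] -> adj v u -> adj v a -> adj u a ->
  hexagon geo_system v u a = (q0 (holonomy v u a) < 0).
Proof.
move=> U vu va ua.
have [uv av au] : [/\ adj u v, adj a v & adj a u] by rewrite (adjC u v) (adjC a v) (adjC a u).
have [nvu nva nua] : [/\ v != u, v != a & u != a].
  by move: U; rewrite /= !inE negb_or !andbT => /andP[/andP[]].
have [nuv nav nau] : [/\ u != v, a != v & a != u] by rewrite (eq_sym u v) (eq_sym a v) (eq_sym a u).
have U1 : uniq [:: v; a; u] by rewrite /= !inE negb_or nva nvu nau.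
have U2 : uniq [:: a; v; u] by rewrite /= !inE negb_or nav nau nvu.
have U3 : uniq [:: a; u; v] by rewrite /= !inE negb_or nau nav nuv.
have U4 : uniq [:: u; a; v] by rewrite /= !inE negb_or nua nuv nav.
have U5 : uniq [:: u; v; a] by rewrite /= !inE negb_or nuv nua nva.
have F p q r : uniq [:: p; q; r] -> uniq [:: p; r; q] -> adj p q -> adj p r ->
  let z := qmul (qconj (H p q r)) (H p r q) in
  [/\ q0 z = 0, q3 z = 0, q1 z ^+ 2 + q2 z ^+ 2 = 1 & q1 z * q2 z < 0].
  move=> V W pq pr z; have c := cross_pos V pq pr.
  have [r0 p0] := dot_gt0_of_cross c.
  have [z0 z3 z1 E] := frame_flip (H_frame V pq pr) (H_frame W pr pq) p0 r0 c.
  split => //; have K : 0 < 2 * (vnorm (pos p q) * vnorm (pos p r)).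
    by rewrite mulr_gt0 // mulr_gt0 // vnorm_gt0.
  by rewrite -(pmulr_rlt0 _ K) E oppr_lt0 vnorm_gt0.
have [a0 a3 an as'] := F _ _ _ U U1 vu va.
have [b0 b3 bn bs] := F _ _ _ U2 U3 av au.
have [c0 c3 cn cs] := F _ _ _ U4 U5 ua uv.
have hn := H_norm U vu va.
have [Q0 Q123] := qconj_form (holonomy v u a) hn.
have [W0 W1] := holonomy_real U vu va ua.
have W3 : `|q3 (qmul (qconj (H v u a)) (qmul (holonomy v u a) (H v u a)))| <= t.
  have := W1; rewrite -Q123; set w := qmul _ _; clearbody w => h.
  rewrite -(@ler_pXn2r _ 2%N) ?nnegrE // real_normK ?num_real //.
  exact: le_sum_of_squares h.
rewrite -Q0 in W0; rewrite -Q0.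
have E := hexagon_sign t_ge0 t_small a0 a3 an as' b0 b3 bn bs c0 c3 cn cs
  (half_turn_near U1 va vu au) (half_turn_near U3 au av uv) (half_turn_near U5 uv ua va)
  (corner_wide U vu va ua) W3 W0.
rewrite -E /hexagon //=.
rewrite /half_turn /holonomy; have := H_norm U1 va vu.
have := H_norm U2 av au; have := H_norm U3 au av; have := H_norm U4 ua uv; have := H_norm U5 uv ua.
rewrite (qq_conj v a) (qq_conj a u) (qq_conj u v).
move: (H v u a) (H v a u) (H a v u) (H a u v) (H u a v) (H u v a) => A B C D E' F' hF hE hD hC hB.
rewrite !qconjM !qconjK -!qmulA; congr (qmul _ _).
rewrite (qmulA B) qmulV // mul1q; congr (qmul _ _).
rewrite (qmulA C) qmulV // mul1q (qmulA D) qmulV // mul1q; congr (qmul _ _).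
by rewrite (qmulA E') qmulV // mul1q (qmulA F') qmulV // mul1q.
Qed.

End Configuration.

End Config2.

(** * Metric configurations, and the vanishing of the sign class on cycles *)

Module Config3.

Import Core Geo Config Config2.
Set Implicit Arguments.
Unset Strict Implicit.
Unset Printing Implicit Defensive.
Import Order.TTheory GRing.Theory Num.Theory.
Local Open Scope ring_scope.

Section Holonomy.

Variable R : rcfType.
Local Notation vec := (vec R).
Local Notation quat := (quat R).

(** For a unit quaternion T the cosine between [e1] and its image is 2 (T0^2 + T1^2) - 1, and for
    [e3] it is 2 (T0^2 + T3^2) - 1. The two bounds 1 - 2 t^2 are thus bounds t on T0, T1 and T3. *)
Lemma half_turn_of_frames (A B q : quat) (u n u' n' : vec) (t : R) :
  frame A u n -> frame B u' n' -> qnorm q = 1 -> 0 <= t ->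
  0 < vnorm u -> 0 < vnorm n -> 0 < vnorm u' -> 0 < vnorm n' ->
  dot (rot q u) u' <= - (1 - 2 * t ^+ 2) * (vnorm u * vnorm u') ->
  dot (rot q n) n' <= - (1 - 2 * t ^+ 2) * (vnorm n * vnorm n') ->
  near_j (qmul (qconj B) (qmul q A)) t.
Proof.
move=> [A1 Au An] [B1 Bu Bn] q1' t0 pu pn pu' pn'.
set T := qmul _ _.
have T1 : qnorm T = 1 by rewrite /T !qnormM qnorm_conj A1 B1 q1' !mulr1.
have E e : dot (rot q (rot A e)) (rot B e) = dot (rot T e) e.
  rewrite /T !rotM [RHS]dot_rot_conj qconjK //.
have Du : dot (rot q u) u' = vnorm u * vnorm u' * dot (rot T (@e1 R)) (@e1 R).
  by rewrite {1}Au {1}Bu rot_scale dotZl dotZr E mulrA.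
have Dn : dot (rot q n) n' = vnorm n * vnorm n' * dot (rot T (@e3 R)) (@e3 R).
  by rewrite {1}An {1}Bn rot_scale dotZl dotZr E mulrA.
rewrite Du Dn (mulrC (- _) (vnorm u * _)) (mulrC (- _) (vnorm n * _)) !ler_pM2l ?mulr_gt0 // => h1 h3.
clear E Du Dn; clearbody T; case: T T1 h1 h3 => T0 Tx T2 T3; rewrite /qnorm /dot /=.
rewrite /near_j /qnorm /= => T1 h1 h3.
have S (x : R) : x ^+ 2 <= t ^+ 2 -> `|x| <= t.
  by move=> h; rewrite -(@ler_pXn2r _ 2%N) ?nnegrE // real_normK ?num_real.
have := (sqr_ge0 T0, sqr_ge0 Tx, sqr_ge0 T2, sqr_ge0 T3).
case=> -[[k0 k1] k2] k3; split=> //; apply: S; move: T1 h1 h3 k0 k1 k2 k3; clear; nra.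
Qed.

(** The sine of the corner angle is 2 |q1 q2|, and |q2| is at most one; hence 800 becomes 400. *)
Lemma corner_wide_of_frames (A B : quat) (u b : vec) (t : R) :
  frame A u (cross b u) -> frame B b (cross u b) ->
  0 < dot (cross b u) (cross b u) -> 800 * t * (vnorm u * vnorm b) < vnorm (cross b u) ->
  400 * t < `|q1 (qmul (qconj A) B)|.
Proof.
move=> fA fB c0; have [b0 u0] := dot_gt0_of_cross c0.
have [_ _ zn E] := frame_flip fA fB u0 b0 c0.
move: (qmul _ _) zn E => z zn E h.
have K : 0 < vnorm u * vnorm b by rewrite mulr_gt0 // vnorm_gt0.
have {}h : 400 * t < `|q1 z * q2 z|.
  have E' : 2 * (vnorm u * vnorm b) * `|q1 z * q2 z| = vnorm (cross b u).
    rewrite -[LHS]ger0_norm; last by rewrite mulr_ge0 // mulr_ge0 // ltW.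
    rewrite normrM normr_id -normrM E normrN ger0_norm //; exact: vnorm_ge0.
  rewrite -(ltr_pM2l K) -(ltr_pM2l (ltr0Sn R 1)); move: h; rewrite -E'.
  by move: (`|_|) (vnorm u * vnorm b) => x w; clear; rewrite !mulrA; lra.
apply: lt_le_trans h _; rewrite normrM ger_pMr.
  by rewrite -(@ler_pXn2r _ 2%N) ?nnegrE // real_normK ?num_real // expr1n -zn lerDr sqr_ge0.
rewrite normr_gt0; apply: contraTneq K => z0; move: E; rewrite z0 mul0r mulr0 => /esym/eqP.
by rewrite oppr_eq0 gt_eqF // vnorm_gt0.
Qed.

Lemma dot_gt0_vz (w : vec) : vz w != 0 -> 0 < dot w w.
Proof.
move=> h; have : 0 < vz w * vz w by rewrite -expr2 exprn_even_gt0.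
rewrite /dot -!expr2; have := sqr_ge0 (vx w); have := sqr_ge0 (vy w); lra.
Qed.

Section CycleSum.

Variables (n : nat) (adj : rel 'I_n) (c : 'I_n -> 'I_n -> 'I_n -> bool).
Hypothesis adjC : symmetric adj.
Hypothesis c12 : forall a b x, c a b x = c b a x.
Hypothesis c23 : forall a b x, c a b x = c a x b.
Hypothesis c_uniq : forall a b x, c a b x -> uniq [:: a; b; x].
Hypothesis c_adj : forall a b x, c a b x -> adj a b.
Hypothesis c_cycle : forall a b, \big[addb/false]_x c a b x = false.

Lemma xorT_eq (G G' : 'I_n -> 'I_n -> 'I_n -> bool) :
  (forall v u a, uniq [:: v; u; a] -> adj v u -> adj v a -> adj u a -> G v u a = G' v u a) ->
  xorT c G = xorT c G'.
Proof.
move=> E; apply: eq_bigr => i _; apply: eq_bigr => j _; apply: eq_bigr => k _.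
case hc: (c i j k) => /=; last by rewrite !andbF.
congr (_ && _); apply: E; first exact: c_uniq.
- exact: c_adj hc.
- by apply: (@c_adj _ _ j); rewrite -c23.
- by apply: (@c_adj _ _ i); rewrite -c23 -c12.
Qed.

(** [t] measures how badly the transitions [qq] match the different views. An edge and a normal
    reverse when read from the other end, hence the minus signs in [cf_edge] and [cf_normal];
    [cf_wide] excludes triangles too thin for that precision. *)
Record configuration (near : rel 'I_n) (y : 'I_n -> 'I_n -> vec) (qq : 'I_n -> 'I_n -> quat)
  (t : R) : Prop := IsConfiguration {
  cf_star : forall v a b, adj v a -> adj v b -> near_seq near [:: v; a; b];
  cf_det : forall i a b c d, near_seq near [:: i; a; b; c; d] -> uniq [:: a; b; c; d] ->
    det4 y i a b c d != 0 /\ (det4 y i a b c d < 0) = (det4 y a a b c d < 0);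
  cf_cross : forall v a b, near_seq near [:: v; a; b] -> uniq [:: v; a; b] ->
    0 < dot (cross (pos y v b) (pos y v a)) (cross (pos y v b) (pos y v a));
  cf_t : 0 <= t <= 1 / 10000;
  cf_unit : forall u v, qnorm (qq u v) = 1;
  cf_conj : forall u v, qq v u = qconj (qq u v);
  cf_edge : forall v u a, uniq [:: v; u; a] -> adj v u -> adj v a -> adj u a ->
    dot (rot (qq u v) (pos y v u)) (pos y u v) <=
      - (1 - 2 * t ^+ 2) * (vnorm (pos y v u) * vnorm (pos y u v));
  cf_normal : forall v u a, uniq [:: v; u; a] -> adj v u -> adj v a -> adj u a ->
    dot (rot (qq u v) (cross (pos y v a) (pos y v u))) (cross (pos y u a) (pos y u v)) <=
      - (1 - 2 * t ^+ 2) * (vnorm (cross (pos y v a) (pos y v u)) *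
                            vnorm (cross (pos y u a) (pos y u v)));
  cf_wide : forall v u a, uniq [:: v; u; a] -> adj v u -> adj v a -> adj u a ->
    800 * t * (vnorm (pos y v u) * vnorm (pos y v a)) < vnorm (cross (pos y v a) (pos y v u));
  cf_holonomy : forall v u a, uniq [:: v; u; a] -> adj v u -> adj v a -> adj u a ->
    1 / 2 <= `|q0 (holonomy qq v u a)| /\
    q1 (holonomy qq v u a) ^+ 2 + q2 (holonomy qq v u a) ^+ 2 + q3 (holonomy qq v u a) ^+ 2
      <= t ^+ 2;
  cf_meets : forall a b e x z w, uniq [:: a; b; e; x; z; w] ->
    adj a b -> adj a e -> adj b e -> adj x z -> adj x w -> adj z w ->
    near_seq near [:: a; b; x; z; w] ->
    [&& (det4 y a a x z w < 0) != (det4 y b b x z w < 0),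
        (det4 y a a b x z < 0) == (det4 y a a b z w < 0) &
        (det4 y a a b x z < 0) == (det4 y a a b w x < 0)] ->
    near_seq near [:: a; b; e; x; z; w] }.

Lemma configuration_system near y qq t : configuration near y qq t ->
  exists2 S, system_axioms adj S &
    forall v u a, uniq [:: v; u; a] -> adj v u -> adj v a -> adj u a ->
      hexagon S v u a = (q0 (holonomy qq v u a) < 0).
Proof.
move=> C; have /andP[t0 t1] := cf_t C.
have crs v a b : uniq [:: v; a; b] -> adj v a -> adj v b ->
  0 < dot (cross (pos y v b) (pos y v a)) (cross (pos y v b) (pos y v a)).
  by move=> U va vb; apply: (cf_cross C) => //; apply: (cf_star C).
have /fin_all_exists[H3 HH] (p : 'I_n * 'I_n * 'I_n) : exists q,
   uniq [:: p.1.1; p.1.2; p.2] -> adj p.1.1 p.1.2 -> adj p.1.1 p.2 ->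
   frame q (pos y p.1.1 p.1.2) (cross (pos y p.1.1 p.2) (pos y p.1.1 p.1.2)).
  case: p => -[v u] a; rewrite [X in uniq X]/= [p in p.1.1]/=.
  case h: [&& uniq [:: v; u; a], adj v u & adj v a]; last first.
    by exists (@qone R) => /= h1 h2 h3; move: h; rewrite /= h1 h2 h3.
  have /and3P[U h1 h2] := h; have c0 := crs _ _ _ U h1 h2.
  have [_ u0] := dot_gt0_of_cross c0.
  have [q Hq] : exists q, frame q (pos y v u) (cross (pos y v a) (pos y v u)).
    by apply: frame_exists => //; move: (pos y v a) (pos y v u) => ? ?; clear; vec_ring.
  by exists q.
pose H v u a := H3 (v, u, a).
have HF v u a : uniq [:: v; u; a] -> adj v u -> adj v a ->
   frame (H v u a) (pos y v u) (cross (pos y v a) (pos y v u)) by exact: (HH (v, u, a)).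
have jj v u a : uniq [:: v; u; a] -> adj v u -> adj v a -> adj u a -> near_j (half_turn qq H v u a) t.
  move=> U vu va ua; have uv : adj u v by rewrite adjC.
  have U' : uniq [:: u; v; a] by exact: uniq_swap12.
  have c1 := crs _ _ _ U vu va; have c2 := crs _ _ _ U' uv ua.
  have [_ d1] := dot_gt0_of_cross c1; have [_ d2] := dot_gt0_of_cross c2.
  apply: (half_turn_of_frames (HF _ _ _ U vu va) (HF _ _ _ U' uv ua)); rewrite ?vnorm_gt0 //.
  - exact: (cf_unit C).
  - exact: (cf_edge C U vu va ua).
  - exact: (cf_normal C U vu va ua).
exists (geo_system near y qq H).
  apply: geo_system_axioms HF _ _ (cf_unit C) (cf_conj C) jj _; rewrite ?cf_t //; try exact: t0; try exact: t1.
  - exact: (cf_star C).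
  - exact: (cf_det C).
  - exact: (cf_cross C).
  - by move=> *; apply: (cf_meets C).
move=> v u a; apply: (geo_hexagon adjC (cf_star C) (cf_cross C) HF t0 t1 (cf_conj C) jj).
  exact: (cf_holonomy C).
move=> {}v {}u {}a U vu va ua.
have U' : uniq [:: v; a; u].
  by move: U; rewrite /= !inE !negb_or !andbT => /andP[/andP[h1 h2] h3]; rewrite h1 h2 eq_sym h3.
apply: (corner_wide_of_frames (HF _ _ _ U vu va) (HF _ _ _ U' va vu)); first exact: crs.
exact: (cf_wide C).
Qed.

(** On the moment curve any four points are affinely independent, so it provides an exact model
    ([t = 0]) in a single 3-space for any number of points. *)
Definition moment (i : 'I_n) : vec := let x : R := i%:R in Vec x (x ^+ 2) (x ^+ 3).

Lemma moment_det (a b x d : 'I_n) : uniq [:: a; b; x; d] ->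
  det3 (vsub (moment b) (moment a)) (vsub (moment x) (moment a)) (vsub (moment d) (moment a)) != 0.
Proof.
rewrite /= !inE !negb_or !andbT => /and3P[/and3P[h1 h2 h3] /andP[h4 h5] h6].
have N (i j : 'I_n) : i != j -> (j%:R - i%:R : R) != 0.
  by move=> ij; rewrite subr_eq0 eqr_nat eq_sym.
have -> : det3 (vsub (moment b) (moment a)) (vsub (moment x) (moment a)) (vsub (moment d) (moment a)) =
  (b%:R - a%:R) * (x%:R - a%:R) * (d%:R - a%:R) * (x%:R - b%:R) * (d%:R - b%:R) * (d%:R - x%:R) :> R.
  by rewrite /det3 /dot /cross /vsub /=; ring.
by rewrite !mulf_neq0 // N.
Qed.

Lemma moment_cross (v a b : 'I_n) : uniq [:: v; a; b] ->
  0 < dot (cross (vsub (moment b) (moment v)) (vsub (moment a) (moment v)))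
          (cross (vsub (moment b) (moment v)) (vsub (moment a) (moment v))).
Proof.
rewrite /= !inE !negb_or !andbT => /andP[/andP[h1 h2] h3].
have N (i j : 'I_n) : i != j -> (j%:R - i%:R : R) != 0.
  by move=> ij; rewrite subr_eq0 eqr_nat eq_sym.
set w := cross _ _.
have h : vz w != 0.
  have -> : vz w = (b%:R - v%:R) * (a%:R - v%:R) * (a%:R - b%:R) by rewrite /w /moment /=; ring.
  by rewrite !mulf_neq0 ?N // eq_sym.
exact: dot_gt0_vz.
Qed.

Lemma moment_configuration :
  configuration (fun _ _ => true) (fun _ => moment) (fun _ _ => @qone R) 0.
Proof.
split=> //.
- by move=> i a b x d _ U; split=> //; exact: moment_det.
- by move=> v a b _; apply: moment_cross.
- by rewrite lexx divr_ge0.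
- by move=> *; rewrite /qnorm /= !expr0n /= !addr0 expr1n.
- by move=> *; rewrite /qconj /qone /= oppr0.
- move=> v u a _ _ _ _; rewrite rot1 expr0n mulr0 subr0 mulN1r /pos.
  have -> : vsub (moment v) (moment u) = vscale (-1) (vsub (moment u) (moment v)).
    by rewrite /vsub /vscale /=; congr Vec; ring.
  set w := vsub (moment u) (moment v).
  have -> : vnorm (vscale (-1) w) = vnorm w by rewrite /vnorm; congr Num.sqrt; clearbody w; vec_ring.
  by rewrite dotZr mulN1r -expr2 vnorm2.
- move=> v u a _ _ _ _; rewrite rot1 expr0n mulr0 subr0 mulN1r /pos.
  have -> : cross (vsub (moment a) (moment u)) (vsub (moment v) (moment u)) =
     vscale (-1) (cross (vsub (moment a) (moment v)) (vsub (moment u) (moment v))).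
    by move: (moment a) (moment v) (moment u) => ? ? ?; clear; rewrite /vsub; vec_ring.
  set w := cross _ _.
  have -> : vnorm (vscale (-1) w) = vnorm w by rewrite /vnorm; congr Num.sqrt; clearbody w; vec_ring.
  by rewrite dotZr mulN1r -expr2 vnorm2.
- by move=> v u a U _ _ _; rewrite mulr0 mul0r vnorm_gt0 //; apply: moment_cross.
- move=> v u a _ _ _ _; rewrite /holonomy !mul1q /= normr1 expr0n /= !addr0 lexx.
  by split=> //; lra.
Qed.

(** The hexagon sum is the same for all systems on the cycle [c]. On the moment curve all
    transitions are one, so each holonomy has positive real part and the sum is zero. *)
Theorem holonomy_cycle near y qq t : configuration near y qq t ->
  xorT c (fun v u a => q0 (holonomy qq v u a) < 0) = false.
Proof.
move=> C; have [S HS E] := configuration_system C.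
have [S' HS' E'] := configuration_system moment_configuration.
rewrite -(xorT_eq E) (hexagon_sum_eq adjC c12 c23 c_uniq c_adj c_cycle HS HS') (xorT_eq E').
rewrite /xorT big1 // => i _; rewrite big1 // => j _; rewrite big1 // => k _.
by rewrite /holonomy !mul1q /= ltNge ler01 !andbF.
Qed.

End CycleSum.

End Holonomy.

End Config3.

(** * Duality over F_2: a cochain that vanishes on cycles is a coboundary *)

Module Sign.

Import Core.
Set Implicit Arguments.
Unset Strict Implicit.
Unset Printing Implicit Defensive.
Import GRing.Theory.
Local Open Scope ring_scope.

Section Signs.

Lemma F2_xor (I : finType) (F : I -> bool) :
  ((\big[addb/false]_i F i)%:R : 'F_2) = \sum_i (F i)%:R.
Proof. by apply: (big_morph (fun b : bool => b%:R : 'F_2)) => [[] []|]; apply/val_inj. Qed.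

Lemma F2_bool (x : 'F_2) : x = (x != 0)%:R.
Proof. by case: x => [[|[|m]] hm] //; apply: val_inj. Qed.

Lemma F2_inj (a b : bool) : (a%:R : 'F_2) = b%:R -> a = b.
Proof. by case: a b => [] [] // /(congr1 val). Qed.

(** The row space of a matrix is the annihilator of its kernel; the columns of [cokermx] are the
    kernel vectors on which [w] is tested. *)
Lemma F2_duality (I J : finType) (B : I -> J -> bool) (w : J -> bool) :
  (forall z : J -> bool, (forall i, \big[addb/false]_j (B i j && z j) = false) ->
     \big[addb/false]_j (w j && z j) = false) ->
  exists e : I -> bool, forall j, \big[addb/false]_i (e i && B i j) = w j.
Proof.
move=> h.
pose A : 'M['F_2]_(#|I|, #|J|) := \matrix_(i, j) (B (enum_val i) (enum_val j))%:R.
pose v : 'rV['F_2]_(#|J|) := \row_j (w (enum_val j))%:R.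
have Mb (a b : bool) : (a%:R * b%:R : 'F_2) = (a && b)%:R.
  by case: a; rewrite ?mul1r ?mul0r.
have re (K : finType) (f : K -> 'F_2) : \sum_(k < #|K|) f (enum_val k) = \sum_k f k.
  by rewrite -(@big_enum_val _ _ _ K (mem K) f); apply: eq_bigl => k.
have : (v <= A)%MS.
  rewrite submxE; apply/eqP/rowP => k; rewrite mxE [RHS]mxE.
  pose z j := cokermx A (enum_rank j) k != 0.
  have zE j : cokermx A j k = (z (enum_val j))%:R by rewrite /z enum_valK -F2_bool.
  transitivity (\sum_(j < #|J|) (w (enum_val j) && z (enum_val j))%:R : 'F_2).
    by apply: eq_bigr => j _; rewrite mxE zE Mb.
  rewrite (re _ (fun j => (w j && z j)%:R)) -F2_xor h // => i.
  apply: F2_inj; rewrite F2_xor -(re _ (fun j => (B i j && z j)%:R)).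
  have := congr1 (fun M : 'M['F_2]_(_, _) => M (enum_rank i) k) (mulmx_coker A).
  rewrite !mxE => e; rewrite -[RHS]e; apply: eq_bigr => j _.
  by rewrite mxE zE Mb enum_rankK.
case/submxP => D DE; exists (fun i => D 0 (enum_rank i) != 0) => j.
apply: F2_inj; rewrite F2_xor -re.
have := congr1 (fun M : 'rV['F_2]_(_) => M 0 (enum_rank j)) DE.
rewrite !mxE enum_rankK => ->; apply: eq_bigr => i _.
by rewrite mxE enum_rankK enum_valK -Mb -F2_bool.
Qed.

Section Coboundary.

Variables (n : nat) (adj : rel 'I_n) (W : 'I_n -> 'I_n -> 'I_n -> bool).
Hypothesis adjC : symmetric adj.
Hypothesis closedW : forall c : 'I_n -> 'I_n -> 'I_n -> bool,
  (forall a b x, c a b x = c b a x) -> (forall a b x, c a b x = c a x b) ->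
  (forall a b x, c a b x -> uniq [:: a; b; x]) -> (forall a b x, c a b x -> adj a b) ->
  (forall a b, \big[addb/false]_x c a b x = false) -> xorT c W = false.

Let T (a b x : 'I_n) := [&& ordlt a b, ordlt b x, adj a b, adj b x & adj a x].

Lemma sorted_cochain : exists e : 'I_n * 'I_n -> bool, forall a b x, T a b x ->
  e (a, b) (+) e (b, x) (+) e (a, x) = W a b x.
Proof.
pose B (p : 'I_n * 'I_n) (s : 'I_n * 'I_n * 'I_n) := T s.1.1 s.1.2 s.2 &&
  ((p == (s.1.1, s.1.2)) (+) (p == (s.1.2, s.2)) (+) (p == (s.1.1, s.2))).
pose w s := T s.1.1 s.1.2 s.2 && W s.1.1 s.1.2 s.2.
have [z Hz|e He] := @F2_duality _ _ B w; last first.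
  exists e => a b x abx; have := He (a, b, x); rewrite /w /B /= abx /= => <-.
  have pick (q : 'I_n * 'I_n) : \big[addb/false]_p (e p && (p == q)) = e q.
    rewrite (bigD1 q) //= eqxx andbT big1 ?addbF // => p /negbTE->; exact: andbF.
  rewrite -(pick (a, b)) -(pick (b, x)) -(pick (a, x)) -!big_split /=.
  by apply: eq_bigr => p _; rewrite -!andb_addr.
pose zz a b x := T a b x && z (a, b, x).
(* A kernel vector of the incidence matrix lives on increasing triples; [closedW] speaks of
   symmetric functions, hence the symmetrisation. *)
pose c a b x := zz a b x (+) zz a x b (+) zz b a x (+) zz b x a (+) zz x a b (+) zz x b a.
have zT a b x : zz a b x -> T a b x by case/andP.
have TU a b x : T a b x -> uniq [:: a; b; x].
  case/and3P; rewrite /ordlt /= !inE !negb_or andbT => ab bx _.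
  by rewrite -!val_eqE /= !neq_ltn ab bx (ltn_trans ab bx).
have TN (a b x : 'I_n) : (b <= a)%N || (x <= b)%N || (x <= a)%N -> zz a b x = false.
  move=> hn; apply/negP => /zT /and3P[]; rewrite /ordlt => ab bx _.
  move: hn; rewrite leqNgt ab leqNgt bx /= leqNgt; by rewrite (ltn_trans ab bx).
have c12 a b x : c a b x = c b a x.
  by rewrite /c; case: (zz a b x); case: (zz a x b); case: (zz b a x); case: (zz b x a); case: (zz x a b); case: (zz x b a).
have c23 a b x : c a b x = c a x b.
  by rewrite /c; case: (zz a b x); case: (zz a x b); case: (zz b a x); case: (zz b x a); case: (zz x a b); case: (zz x b a).
have cor a b x : c a b x -> [|| T a b x, T a x b, T b a x, T b x a, T x a b | T x b a].
  have nz p q r : T p q r = false -> zz p q r = false by rewrite /zz => ->.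
  move=> hc; apply/negPn/negP; rewrite !negb_or.
  case/and5P=> /negbTE/nz h1 /negbTE/nz h2 /negbTE/nz h3 /negbTE/nz h4 /andP[/negbTE/nz h5 /negbTE/nz h6].
  by move: hc; rewrite /c h1 h2 h3 h4 h5 h6.
have cu a b x : c a b x -> uniq [:: a; b; x].
  move/cor; case/or3P => [/TU//|/TU|/or4P[]/TU]; rewrite /= !inE !negb_or !andbT => /andP[/andP[h1 h2] h3];
  by rewrite ?(eq_sym a b) ?(eq_sym a x) ?(eq_sym b x) ?h1 ?h2 ?h3 // eq_sym ?h1 ?h2 ?h3 // eq_sym ?h1 ?h2 ?h3.
have ca a b x : c a b x -> adj a b.
  by move/cor; case/or3P => [|| /or4P[]] /and5P[_ _ h1 h2 h3]; rewrite // adjC.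
have pick (K : finType) (g : K -> bool) k : \big[addb/false]_i ((k == i) && g i) = g k.
  rewrite (bigD1 k) //= eqxx /= big1 ?addbF // => i; by rewrite eq_sym => /negbTE->.
have cc' a b : ordlt a b -> \big[addb/false]_x c a b x = false.
  move=> ab; rewrite -[RHS](Hz (a, b)).
  transitivity (\big[addb/false]_x (zz a b x (+) zz x a b (+) zz a x b)).
    apply: eq_bigr => x _; rewrite /c (TN b a x) ?(ltnW ab) // (TN b x a) ?(TN x b a) ?(ltnW ab) ?orbT //.
    by case: (zz a b x); case: (zz a x b); case: (zz x a b).
  transitivity (\big[addb/false]_i \big[addb/false]_j \big[addb/false]_k (B (a, b) (i, j, k) && z (i, j, k))).
    2: by rewrite (pair_bigA _ (fun i j => \big[addb/false]_k _)) /= (pair_bigA _ (fun p k => B _ (p.1, p.2, k) && _)) /=; apply: eq_bigr => -[[? ?] ?].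
  transitivity ((\big[addb/false]_i \big[addb/false]_j \big[addb/false]_k ((a == i) && ((b == j) && zz i j k)))
    (+) (\big[addb/false]_i \big[addb/false]_j \big[addb/false]_k ((a == j) && ((b == k) && zz i j k)))
    (+) (\big[addb/false]_i \big[addb/false]_j \big[addb/false]_k ((a == i) && ((b == k) && zz i j k)))); last first.
    rewrite -!big_split; apply: eq_bigr => i _; rewrite -!big_split; apply: eq_bigr => j _.
    rewrite -!big_split; apply: eq_bigr => k _; rewrite /B /zz /= !xpair_eqE.
    by case: (T i j k); case: (a == i); case: (b == j); case: (a == j); case: (b == k); case: (z _).
  rewrite !big_split /=; congr (_ (+) _ (+) _).
  - rewrite -(pick _ (fun i => \big[addb/false]_k zz i b k) a); apply: eq_bigr => i _.
    rewrite -(pick _ (fun j => \big[addb/false]_k zz i j k) b) big_distrr /=; apply: eq_bigr => j _.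
    by rewrite !big_distrr /=.
  - apply: eq_bigr => i _; rewrite -(pick _ (fun j => zz i j b) a); apply: eq_bigr => j _.
    by rewrite -(pick _ (fun k => zz i j k) b) big_distrr.
  - rewrite -(pick _ (fun i => \big[addb/false]_j zz i j b) a); apply: eq_bigr => i _.
    rewrite big_distrr /=; apply: eq_bigr => j _.
    by rewrite -(pick _ (fun k => zz i j k) b) big_distrr.
have cc a b : \big[addb/false]_x c a b x = false.
  have [ab|] := ltnP a b; first exact: cc'.
  rewrite leq_eqVlt => /orP[/eqP ba|ba].
    by apply: big1 => x _; apply/negP => /cu; rewrite (val_inj ba) /= !inE eqxx.
  rewrite -[RHS](cc' _ _ ba); apply: eq_bigr => x _; exact: c12.
rewrite -[RHS](closedW c12 c23 cu ca cc).
rewrite /xorT (pair_bigA _ (fun i j => \big[addb/false]_k _)) /=.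
rewrite (pair_bigA _ (fun p k => (ordlt p.1 p.2 && ordlt p.2 k) && (c p.1 p.2 k && W p.1 p.2 k))) /=.
apply: eq_bigr => -[[a b] x] _ /=; rewrite /w /=.
case hT: (T a b x) => /=.
  have /and3P[ab bx _] := hT; rewrite ab bx /= andbC; congr (_ && _).
  rewrite /ordlt in ab bx.
  by rewrite /c {1}/zz hT !TN ?(ltnW ab) ?(ltnW bx) ?orbT ?(ltnW (ltn_trans ab bx)) ?orbT //= !addbF.
case ab: (ordlt a b) => //=; case bx: (ordlt b x) => //=.
have -> : c a b x = false; last by [].
rewrite /ordlt in ab bx.
by rewrite /c {1}/zz hT !TN ?(ltnW ab) ?(ltnW bx) ?orbT ?(ltnW (ltn_trans ab bx)) ?orbT //= !addbF.
Qed.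

End Coboundary.
End Signs.

End Sign.

(** * Orthonormal triads in R^N and the comparison of their spans *)

Module Euclid.

Import Core Geo.
Set Implicit Arguments.
Unset Strict Implicit.
Unset Printing Implicit Defensive.
Import Order.TTheory GRing.Theory Num.Theory.
Local Open Scope ring_scope.

Section VecNorm.

Variable R : rcfType.
Local Notation vec := (vec R).
Implicit Types (u v w : vec).

Lemma ler_sqr_norm (x y : R) : 0 <= y -> x ^+ 2 <= y ^+ 2 -> `|x| <= y.
Proof. by move=> y0 h; rewrite -(@ler_pXn2r _ 2%N) ?nnegrE // real_normK ?num_real. Qed.

Lemma dot_le u v : `|dot u v| <= vnorm u * vnorm v.
Proof.
apply: ler_sqr_norm; first by rewrite mulr_ge0 ?vnorm_ge0.
by rewrite exprMn !vnorm2 -subr_ge0 -lagrange dot_ge0.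
Qed.

Lemma vnorm_cross_le u v : vnorm (cross u v) <= vnorm u * vnorm v.
Proof.
rewrite -(@ler_pXn2r _ 2%N) ?nnegrE ?vnorm_ge0 ?mulr_ge0 ?vnorm_ge0 //.
by rewrite exprMn !vnorm2 lagrange gerBl sqr_ge0.
Qed.

Lemma vnormD u v : vnorm (vadd u v) <= vnorm u + vnorm v.
Proof.
rewrite -(@ler_pXn2r _ 2%N) ?nnegrE ?vnorm_ge0 ?addr_ge0 ?vnorm_ge0 //.
have -> : vnorm (vadd u v) ^+ 2 = vnorm u ^+ 2 + vnorm v ^+ 2 + 2 * dot u v.
  by rewrite !vnorm2; vec_ring.
have := le_trans (ler_norm _) (dot_le u v); lra.
Qed.

Lemma vnormZ k u : vnorm (vscale k u) = `|k| * vnorm u.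
Proof.
rewrite /vnorm; have -> : dot (vscale k u) (vscale k u) = k ^+ 2 * dot u u by vec_ring.
by rewrite sqrtrM ?sqr_ge0 // sqrtr_sqr.
Qed.

Lemma vsub_split u v w : vsub u w = vadd (vsub u v) (vsub v w).
Proof. by move: u v w => [? ? ?] [? ? ?] [? ? ?]; rewrite /vsub /vadd /=; congr Vec; ring. Qed.

Lemma vnormB u v w : vnorm (vsub u w) <= vnorm (vsub u v) + vnorm (vsub v w).
Proof. by rewrite (vsub_split u v w) vnormD. Qed.

Lemma vnorm_subC u v : vnorm (vsub u v) = vnorm (vsub v u).
Proof. by rewrite /vnorm; congr Num.sqrt; move: u v => [? ? ?] [? ? ?]; rewrite /dot /vsub /=; ring. Qed.

Lemma vnorm_le_add u v : vnorm u <= vnorm v + vnorm (vsub u v).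
Proof.
have -> : u = vadd v (vsub u v) by move: u v => [? ? ?] [? ? ?]; rewrite /vsub /vadd /=; congr Vec; ring.
by apply: le_trans (vnormD _ _) _; rewrite lerD2l; have -> : vsub (vadd v (vsub u v)) v = vsub u v
  by move: u v => [? ? ?] [? ? ?]; rewrite /vsub /vadd /=; congr Vec; ring.
Qed.

Lemma vnorm_comp u : [/\ `|vx u| <= vnorm u, `|vy u| <= vnorm u & `|vz u| <= vnorm u].
Proof.
by split; apply: ler_sqr_norm; rewrite ?vnorm_ge0 // vnorm2 /dot -!expr2;
  have := sqr_ge0 (vx u); have := sqr_ge0 (vy u); have := sqr_ge0 (vz u); lra.
Qed.

Lemma vnorm_rot (q : quat R) u : qnorm q = 1 -> vnorm (rot q u) = vnorm u.
Proof. by move=> h; rewrite /vnorm dot_rot h expr1n mul1r. Qed.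

End VecNorm.

Section Inner.

Variables (R : rcfType) (N : nat).
Local Notation vec := (vec R).
Local Notation E := 'rV[R]_N.
Implicit Types (u w z : E).

Definition ip u w := \sum_k u 0 k * w 0 k.
Definition nm u := Num.sqrt (ip u u).

Lemma ipC u w : ip u w = ip w u.
Proof. by apply: eq_bigr => k _; rewrite mulrC. Qed.
Lemma ipDl u w z : ip (u + w) z = ip u z + ip w z.
Proof. by rewrite -big_split; apply: eq_bigr => k _; rewrite mxE mulrDl. Qed.
Lemma ipZl a u w : ip (a *: u) w = a * ip u w.
Proof. by rewrite /ip big_distrr; apply: eq_bigr => k _; rewrite mxE /= mulrA. Qed.
Lemma ipDr u w z : ip z (u + w) = ip z u + ip z w.
Proof. by rewrite ipC ipDl !(ipC z). Qed.
Lemma ipZr a u w : ip u (a *: w) = a * ip u w.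
Proof. by rewrite ipC ipZl ipC. Qed.
Lemma ipNl u w : ip (- u) w = - ip u w.
Proof. by rewrite -scaleN1r ipZl mulN1r. Qed.
Lemma ipNr u w : ip u (- w) = - ip u w.
Proof. by rewrite ipC ipNl ipC. Qed.
Lemma ip0l u : ip 0 u = 0. Proof. by rewrite -(scale0r 0) ipZl mul0r. Qed.
Lemma ip_sub2 (a b c d : E) : ip (a - b) (c - d) = ip a c - ip a d - ip b c + ip b d.
Proof. by rewrite ipDl !ipDr !ipNl !ipNr opprK addrA. Qed.
Lemma ip_ge0 u : 0 <= ip u u.
Proof. by apply: sumr_ge0 => k _; rewrite -expr2 sqr_ge0. Qed.
Lemma nm_ge0 u : 0 <= nm u. Proof. exact: sqrtr_ge0. Qed.
Lemma nm2 u : nm u ^+ 2 = ip u u. Proof. by rewrite sqr_sqrtr ?ip_ge0. Qed.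
Lemma nm_eq0 u : (nm u == 0) = (u == 0).
Proof.
apply/eqP/eqP => [h|->]; last by rewrite /nm ip0l sqrtr0.
have : ip u u = 0 by rewrite -nm2 h expr0n.
move/eqP; rewrite psumr_eq0; last by move=> k _; rewrite -expr2 sqr_ge0.
move=> /allP H; apply/rowP => k; rewrite mxE.
by have := H k (mem_index_enum _); rewrite /= mulf_eq0 orbb => /eqP.
Qed.
Lemma nm0 : nm 0 = 0. Proof. by apply/eqP; rewrite nm_eq0. Qed.
Lemma nm_gt0 u : (0 < nm u) = (u != 0). Proof. by rewrite lt_def nm_ge0 nm_eq0 andbT. Qed.

Lemma nmZ a u : nm (a *: u) = `|a| * nm u.
Proof. by rewrite /nm ipZl ipZr mulrA -expr2 sqrtrM ?sqr_ge0 // sqrtr_sqr. Qed.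
Lemma nmN u : nm (- u) = nm u.
Proof. by rewrite -scaleN1r nmZ normrN normr1 mul1r. Qed.

Lemma ip_le u w : ip u w <= nm u * nm w.
Proof.
have [->|u0] := eqVneq u 0; first by rewrite ip0l mulr_ge0 ?nm_ge0.
have [->|w0] := eqVneq w 0; first by rewrite ipC ip0l mulr_ge0 ?nm_ge0.
have pu : 0 < nm u by rewrite nm_gt0.
have pw : 0 < nm w by rewrite nm_gt0.
have := ip_ge0 (nm w *: u - nm u *: w).
rewrite ipDl !ipDr !ipNl !ipNr !ipZl !ipZr (ipC w u) -!nm2.
have -> : nm w * (nm w * nm u ^+ 2) - nm w * (nm u * ip u w)
   + (- (nm u * (nm w * ip u w)) - - (nm u * (nm u * nm w ^+ 2))) =
   (2 * (nm u * nm w)) * (nm u * nm w - ip u w) by ring.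
by rewrite pmulr_rge0 ?subr_ge0 // mulr_gt0 // mulr_gt0.
Qed.

Lemma ip_norm_le u w : `|ip u w| <= nm u * nm w.
Proof.
by rewrite ler_norml ip_le andbT lerNl -ipNl (le_trans (ip_le _ _)) // nmN.
Qed.

Lemma nmD u w : nm (u + w) <= nm u + nm w.
Proof.
rewrite -(@ler_pXn2r _ 2%N) ?nnegrE ?nm_ge0 ?addr_ge0 ?nm_ge0 //.
rewrite nm2 ipDl !ipDr (ipC w u) -!nm2.
have := ip_le u w; move: (ip u w) (nm u) (nm w) => x a b; lra.
Qed.

Lemma nmB u w z : nm (u - z) <= nm (u - w) + nm (w - z).
Proof. by have -> : u - z = (u - w) + (w - z); [rewrite addrA subrK | exact: nmD]. Qed.
Lemma nm_subC u w : nm (u - w) = nm (w - u).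
Proof. by rewrite -nmN opprB. Qed.

Record triad := Triad { t1 : E; t2 : E; t3 : E }.
Implicit Types (F G : triad) (v : vec).

Definition orthonormal F := [/\ ip (t1 F) (t1 F) = 1, ip (t2 F) (t2 F) = 1, ip (t3 F) (t3 F) = 1,
  ip (t1 F) (t2 F) = 0 & ip (t1 F) (t3 F) = 0 /\ ip (t2 F) (t3 F) = 0].
Definition proj F w := Vec (ip (t1 F) w) (ip (t2 F) w) (ip (t3 F) w).
Definition emb F v := vx v *: t1 F + vy v *: t2 F + vz v *: t3 F.

Lemma projD F u w : proj F (u + w) = vadd (proj F u) (proj F w).
Proof. by rewrite /proj /vadd /= !ipDr. Qed.
Lemma projB F u w : proj F (u - w) = vsub (proj F u) (proj F w).
Proof. by rewrite /proj /vsub /= !ipDr !ipNr. Qed.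
Lemma projZ F a u : proj F (a *: u) = vscale a (proj F u).
Proof. by rewrite /proj /vscale /= !ipZr. Qed.
Lemma embD F (u v : vec) : emb F (vadd u v) = emb F u + emb F v.
Proof. by rewrite /emb /= !scalerDl [RHS]addrACA; congr (_ + _); rewrite addrACA. Qed.
Lemma embZ F a v : emb F (vscale a v) = a *: emb F v.
Proof. by rewrite /emb /= !scalerDr !scalerA. Qed.
Lemma embB F (u v : vec) : emb F (vsub u v) = emb F u - emb F v.
Proof.
have -> : vsub u v = vadd u (vscale (-1) v) by move: u v => [? ? ?] [? ? ?]; rewrite /vsub /vadd /=; congr Vec; ring.
by rewrite embD embZ scaleN1r.
Qed.
Lemma ip_emb F w v : ip w (emb F v) = dot (proj F w) v.
Proof. by rewrite /emb !ipDr !ipZr /dot /= !(ipC w); ring. Qed.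
Lemma projK F v : orthonormal F -> proj F (emb F v) = v.
Proof.
case: F v => f1 f2 f3 [a b c]; rewrite /orthonormal /proj /emb /= => -[e1 e2 e3 e12 [e13 e23]].
rewrite !ipDr !ipZr e1 e2 e3 e12 e13 e23 (ipC f2 f1) (ipC f3 f1) (ipC f3 f2) e12 e13 e23.
by congr Vec; ring.
Qed.
Lemma ip_emb2 F (u v : vec) : orthonormal F -> ip (emb F u) (emb F v) = dot u v.
Proof. by move=> h; rewrite ip_emb projK. Qed.
Lemma nm_emb F v : orthonormal F -> nm (emb F v) = vnorm v.
Proof. by move=> h; rewrite /nm ip_emb2. Qed.
Lemma vnorm_proj F w : orthonormal F -> vnorm (proj F w) <= nm w.
Proof.
move=> h; have [->|p0] := eqVneq (vnorm (proj F w)) 0; first exact: nm_ge0.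
have p1 : 0 < vnorm (proj F w) by rewrite lt_def p0 vnorm_ge0.
rewrite -(ler_pM2l p1) -expr2 vnorm2 -ip_emb mulrC -(nm_emb (proj F w) h).
by rewrite ip_le.
Qed.

Definition off F w := nm (w - emb F (proj F w)).

Lemma off_ge0 F w : 0 <= off F w. Proof. exact: nm_ge0. Qed.
Lemma offE F w : orthonormal F -> off F w ^+ 2 = nm w ^+ 2 - vnorm (proj F w) ^+ 2.
Proof.
move=> h; rewrite /off !nm2 ip_sub2 ip_emb2 // (ipC _ w) ip_emb -vnorm2; ring.
Qed.
Lemma off_le F w : orthonormal F -> off F w <= nm w.
Proof.
move=> h; rewrite -(@ler_pXn2r _ 2%N) ?nnegrE ?nm_ge0 //.
by rewrite offE // gerBl sqr_ge0.
Qed.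
Lemma offD F u w : off F (u + w) <= off F u + off F w.
Proof. by rewrite /off projD embD opprD addrACA nmD. Qed.
Lemma offZ F a w : off F (a *: w) = `|a| * off F w.
Proof. by rewrite /off projZ embZ -scalerBr nmZ. Qed.
Lemma offN F w : off F (- w) = off F w.
Proof. by rewrite -scaleN1r offZ normrN normr1 mul1r. Qed.
Lemma proj_lower F w : orthonormal F -> nm w - off F w <= vnorm (proj F w).
Proof.
move=> h; rewrite lerBlDr -(nm_emb (proj F w) h) addrC.
by have := nmD (w - emb F (proj F w)) (emb F (proj F w)); rewrite subrK.
Qed.

(* [G]-tangent vectors lie up to the relative error [e] in the span of [F]. *)
Definition tilt F G e := forall v, off F (emb G v) <= e * vnorm v.

Lemma off_tilt F G e w : orthonormal F -> orthonormal G -> 0 <= e -> tilt F G e ->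
  off F w <= off G w + e * nm w.
Proof.
move=> hF hG e0 h; rewrite -{1}(subrK (emb G (proj G w)) w).
apply: le_trans (offD _ _ _) _; apply: lerD; first exact: off_le.
by apply: le_trans (h _) _; rewrite ler_wpM2l // vnorm_proj.
Qed.

(** The orthogonal projection from the span of [G] to the span of [F], in coordinates; nearly a
    rotation when the spans are close and equally oriented. *)
Definition turn F G v := proj F (emb G v).

Lemma turn_dot F G (u v : vec) : dot u (turn F G v) = ip (emb F u) (emb G v).
Proof. by rewrite ipC ip_emb dotC. Qed.

Lemma proj_turn F G w : orthonormal F -> orthonormal G ->
  vnorm (vsub (proj F w) (turn F G (proj G w))) <= off G w.
Proof. by move=> hF hG; rewrite /turn -projB vnorm_proj. Qed.

Lemma turn_turn F G v z e : orthonormal F -> orthonormal G -> 0 <= e ->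
  off G z <= e -> vnorm (vsub (turn F G (proj G z)) (proj F z)) <= e.
Proof. by move=> hF hG e0 h; rewrite vnorm_subC (le_trans (proj_turn z hF hG)). Qed.

(** The loss of inner product is the inner product of the components normal to [F], each of order
    [e]. The defect is therefore of second order. *)
Lemma turn_gram F G e (u v : vec) : orthonormal F -> orthonormal G -> 0 <= e -> tilt F G e ->
  `|dot (turn F G u) (turn F G v) - dot u v| <= e ^+ 2 * (vnorm u * vnorm v).
Proof.
move=> hF hG e0 h.
have -> : dot (turn F G u) (turn F G v) - dot u v =
   - ip (emb G u - emb F (turn F G u)) (emb G v - emb F (turn F G v)).
  rewrite ip_sub2 !(ip_emb2 _ _ hG) !(ip_emb2 _ _ hF) (ipC _ (emb G v)) !ip_emb -/(turn F G u) -/(turn F G v).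
  by rewrite (dotC (turn F G v)); ring.
rewrite normrN; apply: (le_trans (ip_norm_le _ _)).
rewrite expr2 mulrACA; apply: ler_pM; rewrite ?nm_ge0 //; exact: h.
Qed.

End Inner.

End Euclid.

(** * Nearly orthogonal maps and their lifts to unit quaternions *)

Module Net.

Import Core Geo Config Config2 Config3 Euclid.
Set Implicit Arguments.
Unset Strict Implicit.
Unset Printing Implicit Defensive.
Import Order.TTheory GRing.Theory Num.Theory.
Local Open Scope ring_scope.

Section Rotations.

Variable R : rcfType.
Local Notation vec := (vec R).
Local Notation quat := (quat R).

Lemma norm_lower (x b : R) : 0 <= x -> 0 <= b -> b ^+ 2 <= x ^+ 2 -> b <= x.
Proof. by move=> x0 b0; rewrite ler_pXn2r ?nnegrE. Qed.

(** [N1], [D2] and [D3] are the diagonal entries of the triangular factor in a QR decomposition; [n]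
    and [d] are the products of the first two and of all three. *)
Lemma gram_frame (N1 n d e D2 D3 : R) : 0 <= e -> e <= 1 / 100 ->
  0 <= N1 -> 0 <= n -> 0 <= d -> 1 - e <= N1 ^+ 2 -> N1 ^+ 2 <= 1 + e ->
  1 - 3 * e <= n ^+ 2 -> n ^+ 2 <= 1 + 3 * e -> 1 - 10 * e <= d ^+ 2 ->
  D2 * N1 = n -> D3 * n = d -> 3 - 30 * e <= N1 + D2 + D3.
Proof.
move=> e0 e1 N0 n0 d0 N1l N1u nl nu dl E2 E3.
have a1 : 1 - e <= N1 by apply: norm_lower => //; nra.
have a2 : N1 <= 1 + e by apply: norm_lower => //; nra.
have b1 : 1 - 3 * e <= n by apply: norm_lower => //; nra.
have b2 : n <= 1 + 3 * e by apply: norm_lower => //; nra.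
have c1 : 1 - 10 * e <= d by apply: norm_lower => //; nra.
have h2 : 1 - 5 * e <= D2.
  rewrite leNgt; apply/negP => h; have : D2 * N1 < 1 - 3 * e by nra.
  by rewrite E2; lra.
have h3 : 1 - 14 * e <= D3.
  rewrite leNgt; apply/negP => h; have : D3 * n < 1 - 10 * e by nra.
  by rewrite E3; lra.
lra.
Qed.

Lemma gram_bounds (a b c x y z e : R) : 0 <= e -> e <= 1 / 100 ->
  `|a - 1| <= e -> `|b - 1| <= e -> `|c - 1| <= e -> `|x| <= e -> `|y| <= e -> `|z| <= e ->
  [/\ 1 - 3 * e <= a * b - x ^+ 2, a * b - x ^+ 2 <= 1 + 3 * e &
   1 - 10 * e <= a * b * c + 2 * x * y * z - a * z ^+ 2 - b * y ^+ 2 - c * x ^+ 2].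
Proof.
rewrite !ler_norml => e0 e1 /andP[a1 a2] /andP[b1 b2] /andP[c1 c2] /andP[x1 x2] /andP[y1 y2] /andP[z1 z2].
have S (w : R) : - e <= w -> w <= e -> w ^+ 2 <= e / 100.
  move=> h1 h2; have h : w ^+ 2 <= e ^+ 2.
    by rewrite -[w ^+ 2]real_normK ?num_real // lerXn2r ?nnegrE // ler_norml h1 h2.
  by apply: le_trans h _; rewrite expr2; nra.
have x3 := S _ x1 x2; have y3 := S _ y1 y2; have z3 := S _ z1 z2.
have ab1 : 1 - 2 * e <= a * b by nra.
have ab2 : a * b <= 1 + 21 / 10 * e by nra.
have x4 := sqr_ge0 x; have y4 := sqr_ge0 y; have z4 := sqr_ge0 z.
have abc : 1 - 4 * e <= a * b * c.
  have : (1 - 2 * e) * (1 - e) <= a * b * c by apply: ler_pM; lra.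
  by apply: le_trans; nra.
have P (p q : R) : 0 <= q -> q <= e / 100 -> 1 - e <= p + 1 -> p - 1 <= e -> p * q <= e / 50.
  by move=> q0 q1 p1 p2; nra.
have h1 := P a _ z4 z3; have h2 := P b _ y4 y3; have h3 := P c _ x4 x3.
have xy : `|2 * x * y * z| <= e.
  have -> : 2 * x * y * z = 2 * (x * y) * z by ring.
  rewrite !normrM (@ger0_norm _ 2) //.
  have := normr_ge0 x; have := normr_ge0 y; have := normr_ge0 z.
  have : `|x| <= e by rewrite ler_norml x1 x2.
  have : `|y| <= e by rewrite ler_norml y1 y2.
  have : `|z| <= e by rewrite ler_norml z1 z2.
  move: (`|x|) (`|y|) (`|z|) => X Y Z hZ hY hX Z0 Y0 X0.
  have hXY : X * Y <= e * e by apply: ler_pM.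
  have hXYZ : X * Y * Z <= e * e * e by apply: ler_pM => //; apply: mulr_ge0.
  have e2 : e * e <= 1 / 10 by nra.
  have : e * e * e <= e / 10 by nra.
  by lra.
move: xy; rewrite ler_norml => /andP[xy1 xy2].
split; lra.
Qed.

(** The rotation is the Gram-Schmidt frame of the three vectors. As |g - r|^2 = |g|^2 + 1 - 2 g.r
    for unit r, it suffices that the sum of the three inner products, the diagonal of the triangular
    factor, is close to 3. *)
Lemma rotation_near (g1 g2 g3 : vec) (e : R) : 0 <= e -> e <= 1 / 100 ->
  `|dot g1 g1 - 1| <= e -> `|dot g2 g2 - 1| <= e -> `|dot g3 g3 - 1| <= e ->
  `|dot g1 g2| <= e -> `|dot g1 g3| <= e -> `|dot g2 g3| <= e -> 0 < det3 g1 g2 g3 ->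
  exists2 q : quat, qnorm q = 1 &
    [/\ dot (vsub g1 (rot q (@e1 R))) (vsub g1 (rot q (@e1 R))) <= 100 * e,
        dot (vsub g2 (rot q (Vec 0 1 0))) (vsub g2 (rot q (Vec 0 1 0))) <= 100 * e &
        dot (vsub g3 (rot q (@e3 R))) (vsub g3 (rot q (@e3 R))) <= 100 * e].
Proof.
move=> ege ele h11 h22 h33 h12 h13 h23 d0.
have [B1 B2 B3] := gram_bounds ege ele h11 h22 h33 h12 h13 h23.
pose n := cross g1 g2.
have nn : dot n n = dot g1 g1 * dot g2 g2 - dot g1 g2 ^+ 2 by exact: lagrange.
have dd : det3 g1 g2 g3 ^+ 2 = dot g1 g1 * dot g2 g2 * dot g3 g3 +
   2 * dot g1 g2 * dot g1 g3 * dot g2 g3 - dot g1 g1 * dot g2 g3 ^+ 2 -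
   dot g2 g2 * dot g1 g3 ^+ 2 - dot g3 g3 * dot g1 g2 ^+ 2.
  by clear; move: g1 g2 g3 => ? ? ?; vec_ring.
have dn : dot n g3 = det3 g1 g2 g3 by rewrite /n; clear; move: g1 g2 g3 => ? ? ?; vec_ring.
rewrite -nn in B1 B2; rewrite -dd in B3.
move: (h11) (h22) (h33); rewrite !ler_norml => /andP[k1 k2] /andP[k3 k4] /andP[k5 k6].
have g10 : 0 < dot g1 g1 by lra.
have n0 : 0 < dot n n by lra.
have [q Hq] : exists q, frame q g1 n.
  by apply: frame_exists => //; rewrite /n; clear; move: g1 g2 => ? ?; vec_ring.
have [q1' gq nq] := Hq; exists q => //.
set r1 := rot q (@e1 R) in gq *; set r3 := rot q (@e3 R) in nq *; set r2 := rot q _.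
have r11 : dot r1 r1 = 1 by rewrite dot_rot q1' expr1n mul1r /dot /=; ring.
have r33 : dot r3 r3 = 1 by rewrite dot_rot q1' expr1n mul1r /dot /=; ring.
have r22 : dot r2 r2 = 1 by rewrite dot_rot q1' expr1n mul1r /dot /=; ring.
have r2E : r2 = cross r3 r1.
  by rewrite /r3 /r1 cross_rot q1' scale1; congr rot; rewrite /cross /e1 /e3 /=; congr Vec; ring.
have N0 := vnorm_gt0 g10; have M0 := vnorm_gt0 n0.
have D1 : dot g1 r1 = vnorm g1 by rewrite {1}gq dotZl r11 mulr1.
have D2 : dot g2 r2 * vnorm g1 = vnorm n.
  apply: (mulIf (lt0r_neq0 M0)); rewrite -expr2 vnorm2.
  have -> : dot n n = dot g2 (cross n g1) by rewrite /n; clear; move: g1 g2 => ? ?; vec_ring.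
  by rewrite {2}nq {2}gq crossZl crossZr !dotZr -r2E; clear; ring.
have D3 : dot g3 r3 * vnorm n = det3 g1 g2 g3.
  by rewrite -dn {2}nq dotZl (dotC r3) mulrC.
have F : 3 - 30 * e <= vnorm g1 + dot g2 r2 + dot g3 r3.
  apply: (gram_frame ege ele _ _ (ltW d0) _ _ _ _ B3 D2 D3); rewrite ?vnorm_ge0 // vnorm2 //; lra.
have X u r : dot r r = 1 -> dot (vsub u r) (vsub u r) = dot u u + 1 - 2 * dot u r.
  move=> rr; transitivity (dot u u + dot r r - 2 * dot u r); last by rewrite rr.
  by clear; move: u r => ? ?; rewrite /vsub; vec_ring.
have C u r : dot u u - 1 <= e -> dot r r = 1 -> dot u r <= 1 + e.
  move=> hu hr; have := dot_ge0 (vsub u r); rewrite X //; move: hu ege; clear; lra.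
have c1 := C g1 r1 k2 r11; have c2 := C g2 r2 k4 r22; have c3 := C g3 r3 k6 r33.
rewrite !X //; split; move: F c1 c2 c3 D1 k2 k4 k6 ege; clear; lra.
Qed.

(** The cosine between [e1] and its image is 1 - 2 (q2^2 + q3^2), and for [e3] it is 1 - 2 (q1^2 +
    q2^2); the two together bound the whole imaginary part. *)
Lemma rot_error (q : quat) (e : R) : qnorm q = 1 ->
  (forall v, vnorm (vsub (rot q v) v) <= e * vnorm v) ->
  q1 q ^+ 2 + q2 q ^+ 2 + q3 q ^+ 2 <= e.
Proof.
move=> q1' h; have D v : dot v v = 1 -> 1 - e <= dot (rot q v) v.
  move=> v1; have v2 : vnorm v = 1 by rewrite /vnorm v1 sqrtr1.
  have := dot_le (vsub (rot q v) v) v; have := h v; rewrite v2 !mulr1 => a b.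
  have : - e <= dot (vsub (rot q v) v) v.
    by have := le_trans b a; rewrite ler_norml => /andP[].
  have -> : dot (vsub (rot q v) v) v = dot (rot q v) v - dot v v.
    by move: (rot q v) => w; clear; rewrite /vsub; vec_ring.
  by rewrite v1; clear; lra.
have := D (@e1 R); have := D (@e3 R); clear D h; case: q q1' => a b c d.
rewrite /qnorm /dot /e1 /e3 /= => q1' D3 D1.
have {}D1 := D1 ltac:(clear; ring); have {}D3 := D3 ltac:(clear; ring).
have := sqr_ge0 b; have := sqr_ge0 c; have := sqr_ge0 d.
move: q1' D1 D3; clear; nra.
Qed.

Variable N : nat.
Implicit Types (F G H : triad R N).

Definition close_turn F G (q : quat) (e : R) :=
  forall v, vnorm (vsub (turn F G v) (rot q v)) <= e * vnorm v.

Lemma close_turn_exists F G (e : R) : orthonormal F -> orthonormal G -> 0 <= e -> e <= 1 / 10 ->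
  tilt F G e -> 0 < det3 (turn F G (@e1 R)) (turn F G (Vec 0 1 0)) (turn F G (@e3 R)) ->
  exists2 q, qnorm q = 1 & close_turn F G q (30 * e).
Proof.
move=> hF hG e0 e1' tl d0.
have e20 : 0 <= e ^+ 2 by rewrite sqr_ge0.
have e21 : e ^+ 2 <= 1 / 100 by rewrite expr2; nra.
have T u v : `|dot (turn F G u) (turn F G v) - dot u v| <= e ^+ 2 * (vnorm u * vnorm v).
  exact: turn_gram.
have n1 : vnorm (@e1 R) = 1 by rewrite /vnorm /dot /= !mulr0 !addr0 mulr1 sqrtr1.
have n3 : vnorm (@e3 R) = 1 by rewrite /vnorm /dot /= !mulr0 !add0r mulr1 sqrtr1.
have n2 : vnorm (Vec 0 1 0 : vec) = 1 by rewrite /vnorm /dot /= !mulr0 add0r addr0 mulr1 sqrtr1.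
have [d12 d13 d23] : [/\ dot (@e1 R) (Vec 0 1 0) = 0, dot (@e1 R) (@e3 R) = 0 & dot (Vec 0 1 0) (@e3 R) = 0].
  by rewrite /dot /= !(mul0r, mulr0, addr0).
have [d11 d22 d33] : [/\ dot (@e1 R) (@e1 R) = 1, dot (Vec 0 1 0) (Vec 0 1 0) = 1 :> R & dot (@e3 R) (@e3 R) = 1].
  by rewrite /dot /= !(mul0r, mulr0, addr0, add0r, mulr1).
have [|||||||q q1' [c1 c2 c3]] := rotation_near (g1 := turn F G (@e1 R)) (g2 := turn F G (Vec 0 1 0))
   (g3 := turn F G (@e3 R)) e20 e21; last first.
  exists q => // v.
  (* The Gram defect is e^2, so each basis vector is moved by at most 10 e, and three of them give
     30 e. *)
  have S u : dot u u <= 100 * e ^+ 2 -> vnorm u <= 10 * e.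
    move=> h; apply: norm_lower; rewrite ?vnorm_ge0 ?mulr_ge0 // vnorm2.
    by apply: le_trans h _; rewrite exprMn; clear; lra.
  have {}c1 := S _ c1; have {}c2 := S _ c2; have {}c3 := S _ c3.
  set d1 := vsub _ _ in c1; set d2 := vsub _ _ in c2; set d3 := vsub _ _ in c3.
  have -> : vsub (turn F G v) (rot q v) =
     vadd (vscale (vx v) d1) (vadd (vscale (vy v) d2) (vscale (vz v) d3)).
    have tE : turn F G v = vadd (vscale (vx v) (turn F G (@e1 R)))
         (vadd (vscale (vy v) (turn F G (Vec 0 1 0))) (vscale (vz v) (turn F G (@e3 R)))).
      rewrite /turn -!projZ -!projD -!embZ -!embD; congr (proj F (emb G _)).
      by case: v => a b c; rewrite /vadd /vscale /=; congr Vec; ring.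
    rewrite tE /d1 /d2 /d3; clear.
    move: (turn F G _) (turn F G _) (turn F G _) v => [? ? ?] [? ? ?] [? ? ?] [? ? ?].
    by case: q => ? ? ? ?; rewrite /vsub /vadd /vscale /rot /=; congr Vec; ring.
  have [a1 a2 a3] := vnorm_comp v.
  have P (x : R) (d : vec) : `|x| <= vnorm v -> vnorm d <= 10 * e -> vnorm (vscale x d) <= vnorm v * (10 * e).
    by move=> h1 h2; rewrite vnormZ; apply: ler_pM; rewrite ?normr_ge0 ?vnorm_ge0.
  apply: (le_trans (vnormD _ _)); have := P _ _ a1 c1.
  have := le_trans (vnormD (vscale (vy v) d2) (vscale (vz v) d3)) (lerD (P _ _ a2 c2) (P _ _ a3 c3)).
  by move: (vnorm (vadd _ _)) (vnorm (vscale _ _)) (vnorm v) => A B C; clear; lra.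
- exact: d0.
- by have := T (Vec 0 1 0) (@e3 R); rewrite n2 n3 !mulr1 d23 subr0.
- by have := T (@e1 R) (@e3 R); rewrite n1 n3 !mulr1 d13 subr0.
- by have := T (@e1 R) (Vec 0 1 0); rewrite n1 n2 !mulr1 d12 subr0.
- by have := T (@e3 R) (@e3 R); rewrite n3 !mulr1 d33.
- by have := T (Vec 0 1 0) (Vec 0 1 0); rewrite n2 !mulr1 d22.
- by have := T (@e1 R) (@e1 R); rewrite n1 !mulr1 d11.
Qed.

(** [turn G F] and [rot (qconj q)] are the adjoints of [turn F G] and [rot q], and an operator has
    the same norm as its adjoint; this is tested on the error vector [d]. *)
Lemma close_turnC F G q e : close_turn F G q e -> close_turn G F (qconj q) e.
Proof.
move=> h v; set d := vsub _ _.
have E : dot d d = dot v (vsub (turn F G d) (rot q d)).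
  have L (u a b : vec) : dot u (vsub a b) = dot u a - dot u b by clear; move: u a b => ? ? ?; rewrite /vsub; vec_ring.
  by rewrite L {2}/d L turn_dot turn_dot ipC -dot_rot_conj dotC.
have [d0|d0] := eqVneq (vnorm d) 0; first by rewrite d0 (le_trans (vnorm_ge0 _) (h v)).
have dp : 0 < vnorm d by rewrite lt_def d0 vnorm_ge0.
rewrite -(ler_pM2l dp) -expr2 vnorm2 E; apply: (le_trans (le_trans (ler_norm _) (dot_le _ _))).
have -> : vnorm d * (e * vnorm v) = vnorm v * (e * vnorm d) by ring.
by apply: ler_wpM2l; [exact: vnorm_ge0 | exact: h].
Qed.

(** Four errors of size [e]: one for each of the three lifts, and one for passing through the span
    of [G] instead of projecting directly. *)
Lemma close_turn_trans F G H q1' q2' q3' (e : R) : orthonormal F -> orthonormal G -> orthonormal H ->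
  0 <= e -> e <= 1 -> qnorm q1' = 1 -> qnorm q2' = 1 ->
  close_turn F G q1' e -> close_turn G H q2' e -> close_turn F H q3' e -> tilt G H e ->
  forall v, vnorm (vsub (rot (qmul q1' q2') v) (rot q3' v)) <= 4 * e * vnorm v.
Proof.
move=> hF hG hH e0 e1' n1 n2 c1 c2 c3 tl v.
have k1 : vnorm (vsub (rot q1' (rot q2' v)) (turn F G (rot q2' v))) <= e * vnorm v.
  by rewrite vnorm_subC -(vnorm_rot v n2); apply: c1.
have k2 : vnorm (vsub (turn F G (rot q2' v)) (turn F G (turn G H v))) <= e * vnorm v.
  rewrite /turn -projB -embB; apply: le_trans (vnorm_proj _ hF) _.
  by rewrite nm_emb // vnorm_subC; apply: c2.
have k3 : vnorm (vsub (turn F G (turn G H v)) (turn F H v)) <= e * vnorm v.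
  rewrite /turn -projB; apply: le_trans (vnorm_proj _ hF) _.
  by rewrite nm_subC; apply: tl.
have k4 := c3 v.
rewrite rotM; apply: (le_trans (vnormB _ (turn F G (rot q2' v)) _)).
have := vnormB (turn F G (rot q2' v)) (turn F G (turn G H v)) (rot q3' v).
have := vnormB (turn F G (turn G H v)) (turn F H v) (rot q3' v).
move: k1 k2 k3 k4; move: (vnorm (vsub _ _)) (vnorm (vsub _ _)) (vnorm (vsub _ _)) (vnorm (vsub _ _)) (vnorm (vsub _ _)) (vnorm (vsub _ _)) (vnorm v) => a b c d f g h; clear; lra.
Qed.

End Rotations.

End Net.

(** * General position by choosing among finitely many perturbations *)

Module Generic.

Import Core Geo Euclid.
Set Implicit Arguments.
Unset Strict Implicit.
Unset Printing Implicit Defensive.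
Import Order.TTheory GRing.Theory Num.Theory.
Local Open Scope ring_scope.

Section Candidates.

Variable R : rcfType.
Local Notation vec := (vec R).

(** Integer points of the moment curve, shrunk to length at most 1/10. Their determinants are
    bounded below, so this finite set is not contained in a thin slab around any plane. *)
Definition curve (M : nat) (k : 'I_M) : vec :=
  let x : R := k%:R in vscale (30 * M%:R ^+ 3)^-1 (Vec x (x ^+ 2) (x ^+ 3)).

Lemma scale_curve_gt0 M : (0 < M)%N -> 0 < (30 * M%:R ^+ 3)^-1 :> R.
Proof. by move=> M0; rewrite invr_gt0 mulr_gt0 // exprn_gt0 // ltr0n. Qed.

Lemma vnorm_curve M (k : 'I_M) : vnorm (curve k) <= 1 / 10.
Proof.
have M0 : (0 < M)%N by apply: leq_ltn_trans (ltn_ord k).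
have c0 := scale_curve_gt0 M0.
rewrite /curve vnormZ gtr0_norm // mulrC ler_pdivrMr ?mulr_gt0 ?exprn_gt0 ?ltr0n //.
set x : R := k%:R; set m : R := M%:R.
have x0 : 0 <= x by rewrite ler0n.
have xm : x <= m by rewrite ler_nat ltnW.
have m1 : 1 <= m by rewrite ler1n.
have m3 j : (j <= 3)%N -> x ^+ j <= m ^+ 3.
  move=> j3; apply: le_trans (_ : m ^+ j <= _); first by rewrite lerXn2r ?nnegrE // (le_trans x0).
  by rewrite ler_weXn2l.
have -> : 1 / 10 * (30 * m ^+ 3) = 3 * m ^+ 3 by field.
have mm : 0 <= m ^+ 3 by rewrite exprn_ge0 // (le_trans x0).
rewrite -(@ler_pXn2r _ 2%N) ?nnegrE ?vnorm_ge0 ?mulr_ge0 // vnorm2 /dot /=.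
have y1 := m3 1%N isT; have y2 := m3 2%N isT; have y3 := m3 3%N isT.
rewrite expr1 in y1.
have P (u w : R) : 0 <= u -> u <= w -> u * u <= w ^+ 2 by move=> u0 uw; rewrite expr2 ler_pM.
have := P _ _ x0 y1; have := P _ _ (exprn_ge0 2 x0) y2; have := P _ _ (exprn_ge0 3 x0) y3.
have := sqr_ge0 (m ^+ 3); move: (m ^+ 3) (x ^+ 2) (x ^+ 3) => a b c; lra.
Qed.

(** A Vandermonde determinant: its factors are differences of distinct integers, so only the cube of
    the scale is lost. *)
Lemma curve_det M (a b c d : 'I_M) : uniq [:: a; b; c; d] ->
  (30 * M%:R ^+ 3)^-1 ^+ 3 <=
  `|det3 (vsub (curve b) (curve a)) (vsub (curve c) (curve a)) (vsub (curve d) (curve a))| :> R.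
Proof.
move=> U; have M0 : (0 < M)%N by apply: leq_ltn_trans (ltn_ord a).
have c0 := scale_curve_gt0 M0; move: U.
rewrite /= !inE !negb_or !andbT => /and3P[/and3P[h1 h2 h3] /andP[h4 h5] h6].
have -> : det3 (vsub (curve b) (curve a)) (vsub (curve c) (curve a)) (vsub (curve d) (curve a)) =
  (30 * M%:R ^+ 3)^-1 ^+ 3 * ((b%:R - a%:R) * (c%:R - a%:R) * (d%:R - a%:R) *
    (c%:R - b%:R) * (d%:R - b%:R) * (d%:R - c%:R)).
  by rewrite /det3 /dot /cross /vsub /curve /vscale /=; ring.
have D (i j : 'I_M) : i != j -> 1 <= `|j%:R - i%:R| :> R.
  rewrite -val_eqE neq_ltn => /orP[] h; last rewrite distrC;
    by rewrite -natrB ?(ltnW h) // normr_nat ler1n subn_gt0.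
have P (x y : R) : 1 <= `|x| -> 1 <= `|y| -> 1 <= `|x * y|.
  by move=> hx hy; rewrite normrM -[1]mulr1 ler_pM.
rewrite normrM (gtr0_norm (exprn_gt0 3 c0)); apply: ler_peMr; first by rewrite exprn_ge0 // ltW.
by do 5 (apply: (P); last exact: D); exact: D.
Qed.

Lemma vec_of_dots (n d1 d2 d3 : vec) (t : R) : 0 <= t ->
  `|dot n d1| <= t -> `|dot n d2| <= t -> `|dot n d3| <= t ->
  vnorm d1 <= 1 -> vnorm d2 <= 1 -> vnorm d3 <= 1 ->
  `|det3 d1 d2 d3| * vnorm n <= 3 * t.
Proof.
move=> t0 h1 h2 h3 k1 k2 k3; rewrite -vnormZ.
have -> : vscale (det3 d1 d2 d3) n = vadd (vscale (dot n d1) (cross d2 d3))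
   (vadd (vscale (dot n d2) (cross d3 d1)) (vscale (dot n d3) (cross d1 d2))).
  by clear; move: n d1 d2 d3 => ? ? ? ?; vec_ring.
have C (u w : vec) : vnorm u <= 1 -> vnorm w <= 1 -> vnorm (cross u w) <= 1.
  move=> hu hw; apply: (le_trans (vnorm_cross_le _ _)).
  by rewrite -[1]mulr1 ler_pM ?vnorm_ge0.
have P (x : R) (u : vec) : `|x| <= t -> vnorm u <= 1 -> vnorm (vscale x u) <= t.
  by move=> hx hu; rewrite vnormZ -[t]mulr1 ler_pM ?vnorm_ge0.
apply: (le_trans (vnormD _ _)); have := P _ _ h1 (C _ _ k2 k3).
have := le_trans (vnormD _ _) (lerD (P _ _ h2 (C _ _ k3 k1)) (P _ _ h3 (C _ _ k1 k2))).
by move: (vnorm _) (vnorm _) => a b; clear; lra.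
Qed.

Lemma few_small_values M (al th nu : R) (n : vec) : 0 <= th ->
  nu <= vnorm n -> 6 * th < nu * (30 * M%:R ^+ 3)^-1 ^+ 3 ->
  (#|[set k : 'I_M | (`|al + dot n (curve k)| < th)%R]| <= 3)%N.
Proof.
move=> th0 nun small; rewrite leqNgt; apply/negP.
set A := [set k | _] => h.
have [a [b [c [d [U hA]]]]] : exists a b c d : 'I_M, uniq [:: a; b; c; d] /\ {subset [:: a; b; c; d] <= A}.
  case E: (enum A) => [|a [|b [|c [|d s]]]]; move: h; rewrite cardE E // => _.
  exists a, b, c, d; split.
    have := enum_uniq A; rewrite E -[_ :: _]/([:: a; b; c; d] ++ s) cat_uniq => /andP[] //.
  move=> x hx; rewrite -mem_enum E -[_ :: _]/([:: a; b; c; d] ++ s) mem_cat hx //.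
have S x y : x \in [:: a; b; c; d] -> y \in [:: a; b; c; d] ->
   `|dot n (vsub (curve x) (curve y))| <= 2 * th.
  move=> /hA; rewrite inE => hx /hA; rewrite inE => hy.
  have -> : dot n (vsub (curve x) (curve y)) = (al + dot n (curve x)) - (al + dot n (curve y)).
    by move: (curve x) (curve y) => p q; rewrite /dot /vsub /=; ring.
  apply: (le_trans (ler_normB _ _)); move: (ltW hx) (ltW hy); clear; lra.
have V (x y : 'I_M) : vnorm (vsub (curve x) (curve y)) <= 1.
  have -> : vsub (curve x) (curve y) = vadd (curve x) (vscale (-1) (curve y)).
    by move: (curve x) (curve y) => p q; rewrite /vadd /vsub /vscale /=; congr Vec; ring.
  apply: (le_trans (vnormD _ _)); rewrite vnormZ normrN normr1 mul1r.
  by have := vnorm_curve x; have := vnorm_curve y; clear; lra.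
have := vec_of_dots _ (S b a _ _) (S c a _ _) (S d a _ _) (V b a) (V c a) (V d a).
rewrite !inE !eqxx !orbT mulr_ge0 // => /(_ isT isT isT isT isT isT isT) h3.
have h4 := curve_det U.
have M0 : (0 < M)%N by apply: leq_ltn_trans (ltn_ord a).
have c0 := scale_curve_gt0 M0.
have h5 : (30 * M%:R ^+ 3)^-1 ^+ 3 * nu <= 3 * (2 * th).
  apply: le_trans h3; have [nu0|nu0] := leP 0 nu; first by rewrite ler_pM // exprn_ge0 // ltW.
  apply: (@le_trans _ _ 0); first by rewrite pmulr_rle0 ?exprn_gt0 // ltW.
  by rewrite mulr_ge0 ?vnorm_ge0.
by move: h5 small; rewrite mulrC; move: (nu * _) => w; clear; lra.
Qed.

(** Replaces a small vector product with [u] by one small affine function with large gradient, to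
    which [few_small_values] applies. *)
Lemma cross_component (u : vec) : exists2 m : vec, vnorm m = 1 & vnorm u <= 2 * vnorm (cross m u).
Proof.
have [h|h] := leP (dot u u) (2 * (vy u ^+ 2 + vz u ^+ 2)).
  exists (@e1 R); first by rewrite /vnorm /dot /= !mulr0 !addr0 mulr1 sqrtr1.
  rewrite -(@ler_pXn2r _ 2%N) ?nnegrE ?vnorm_ge0 ?mulr_ge0 ?vnorm_ge0 // exprMn !vnorm2.
  apply: (le_trans h); rewrite /dot /cross /=; case: (u) => a b c /=.
  by have := sqr_ge0 b; have := sqr_ge0 c; lra.
exists (@e3 R); first by rewrite /vnorm /dot /= !mulr0 !add0r mulr1 sqrtr1.
rewrite -(@ler_pXn2r _ 2%N) ?nnegrE ?vnorm_ge0 ?mulr_ge0 ?vnorm_ge0 // exprMn !vnorm2.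
move: h; rewrite /dot /cross /=; case: (u) => a b c /=.
by have := sqr_ge0 b; have := sqr_ge0 c; have := sqr_ge0 a; lra.
Qed.

End Candidates.

Lemma card_bigcup_bound (T C : finType) (A : {set T}) (bad : T -> {set C}) (m : nat) :
  (forall t, t \in A -> #|bad t| <= m)%N -> (#|A| * m < #|C|)%N ->
  exists c, forall t, t \in A -> c \notin bad t.
Proof.
move=> hb hA; have : (#|\bigcup_(t in A) bad t| <= #|A| * m)%N.
  rewrite -sum_nat_const; apply: (@leq_trans (\sum_(t in A) #|bad t|)); last exact: leq_sum.
  elim/big_rec2: _ => [|t p q _ IH]; first by rewrite cards0.
  by apply: (leq_trans (leq_card_setU _ _)); rewrite leq_add2l.
move=> h; case: (pickP (fun c => c \notin \bigcup_(t in A) bad t)) => [c hc|hc].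
  exists c => t tA; apply: contra hc => hc'; by apply/bigcupP; exists t.
have : (#|C| <= #|\bigcup_(t in A) bad t|)%N.
  by rewrite -cardsT; apply: subset_leq_card; apply/subsetP => c _; have := hc c; case: (c \in _).
by rewrite leqNgt (leq_ltn_trans h hA).
Qed.

Lemma greedy (n : nat) (T : Type) (t0 : T) (good : 'I_n -> ('I_n -> T) -> Prop) :
  (forall (i : 'I_n) (f g : 'I_n -> T), (forall j : 'I_n, (j <= i)%N -> f j = g j) -> good i f -> good i g) ->
  (forall (i : 'I_n) (f : 'I_n -> T), (forall j : 'I_n, (j < i)%N -> good j f) ->
     exists c, good i (fun j => if j == i then c else f j)) ->
  exists f, forall i, good i f.
Proof.
move=> loc ext; suff: forall k, exists f, forall i : 'I_n, (i < k)%N -> good i f.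
  by move=> /(_ n)[f hf]; exists f => i; apply: hf.
elim=> [|k [f hf]]; first by exists (fun _ => t0).
case: (ltnP k n) => kn; last first.
  by exists f => i _; apply: hf; apply: leq_trans kn.
pose i0 := Ordinal kn; have [c hc] := ext i0 f (fun j hj => hf j hj).
exists (fun j => if j == i0 then c else f j) => i; rewrite ltnS leq_eqVlt => /orP[/eqP e|h].
  by have -> : i = i0 by apply: val_inj.
apply: loc (hf i h) => j ji; case: eqP => // e; move: ji; rewrite e /= leqNgt h //.
Qed.

End Generic.

(** * A perturbed net with lower bounds for areas and volumes *)

Module SpinNet.

Import Core Geo Config Config2 Config3 Euclid Net Generic.
Set Implicit Arguments.
Unset Strict Implicit.
Unset Printing Implicit Defensive.
Import Order.TTheory GRing.Theory Num.Theory.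
Local Open Scope ring_scope.

(** Reduces to triples whose last index is the largest, the case recorded by [robust_at] when that
    point was chosen. *)
Lemma sort3 (n : nat) (P : 'I_n -> 'I_n -> 'I_n -> Prop) :
  (forall a b c, P a b c -> P b a c) -> (forall a b c, P a b c -> P a c b) ->
  (forall a b c : 'I_n, (a < c)%N -> (b < c)%N -> a != b -> P a b c) ->
  forall a b c, uniq [:: a; b; c] -> P a b c.
Proof.
move=> s12 s23 h; have ltP (i j : 'I_n) : i != j -> (i < j)%N || (j < i)%N by rewrite -val_eqE neq_ltn.
have L (a b c : 'I_n) : (a < b)%N -> uniq [:: a; b; c] -> P a b c.
  move=> lab; rewrite /= !inE !negb_or !andbT => /andP[/andP[ab ac] bc].
  case/orP: (ltP _ _ bc) => hh; first by apply: h => //; apply: ltn_trans lab hh.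
  exact/s23/h.
move=> a b c U; move: (U); rewrite /= !inE !negb_or !andbT => /andP[/andP[ab ac] bc].
case/orP: (ltP _ _ ab) => hh; first exact: L.
by apply: s12; apply: L; rewrite //= !inE !negb_or eq_sym ab ac bc.
Qed.

Lemma sort4 (n : nat) (P : 'I_n -> 'I_n -> 'I_n -> 'I_n -> Prop) :
  (forall a b c d, P a b c d -> P b a c d) -> (forall a b c d, P a b c d -> P a c b d) ->
  (forall a b c d, P a b c d -> P a b d c) ->
  (forall a b c d : 'I_n, (a < d)%N -> (b < d)%N -> (c < d)%N -> uniq [:: a; b; c] -> P a b c d) ->
  forall a b c d, uniq [:: a; b; c; d] -> P a b c d.
Proof.
move=> s12 s23 s34 h.
have ltP (i j : 'I_n) : i != j -> (i < j)%N || (j < i)%N by rewrite -val_eqE neq_ltn.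
have L1 (a b c d : 'I_n) : (a < c)%N -> (b < c)%N -> uniq [:: a; b; c; d] -> P a b c d.
  move=> lac lbc; rewrite /= !inE !negb_or !andbT => /and3P[/and3P[ab ac ad] /andP[bc bd] cd].
  case/orP: (ltP _ _ cd) => hh.
    by apply: h; rewrite ?(ltn_trans lac hh) ?(ltn_trans lbc hh) //= !inE !negb_or ab ac bc.
  by apply: s34; apply: h; rewrite //= !inE !negb_or ab ad bd.
have L2 (a b c d : 'I_n) : (a < b)%N -> uniq [:: a; b; c; d] -> P a b c d.
  move=> lab U; move: (U); rewrite /= !inE !negb_or !andbT => /and3P[/and3P[ab ac ad] /andP[bc bd] cd].
  case/orP: (ltP _ _ bc) => hh; first by apply: L1 => //; apply: ltn_trans lab hh.
  by apply: s23; apply: L1; rewrite //= !inE !negb_or ac ab ad (eq_sym c b) bc cd bd.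
move=> a b c d U; move: (U); rewrite /= !inE !negb_or !andbT => /and3P[/and3P[ab ac ad] /andP[bc bd] cd].
case/orP: (ltP _ _ ab) => hh; first exact: L2.
by apply: s12; apply: L2; rewrite //= !inE !negb_or (eq_sym b a) ab ac ad bc bd cd.
Qed.

Lemma margin_bounds (R : rcfType) (k : R) : 0 < k -> k <= 1 ->
  k ^+ 2 / 2000 <= k / 100 /\ k / 100 <= 1 / 100.
Proof.
move=> k0 k1; have k2 : k ^+ 2 <= k by rewrite expr2 ger_pMr.
by split; lra.
Qed.

Lemma scale_bounds (R : rcfType) (e w1 w l : R) : 0 <= e -> 40 * l ^+ 3 * e * 6 <= w ->
  w <= w1 -> w1 <= 1 / 100 -> 20 <= l ->
  [/\ e <= 1 / 100, 2 * l * (40 * l * e) <= w1 & 3 * l ^+ 2 * (40 * l * e) <= w / 2].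
Proof.
move=> e0 es h1 h2 l20.
have l2 : 1 <= l ^+ 2 by rewrite expr2; nra.
have le0 : 0 <= l * e by rewrite mulr_ge0 //; lra.
have l2e : l * e <= l ^+ 3 * e by rewrite exprS mulrAC ler_peMr.
have l3e : l ^+ 2 * e <= l ^+ 3 * e.
  have -> : l ^+ 3 * e = l * (l ^+ 2 * e) by ring.
  by apply: ler_peMl; rewrite ?mulr_ge0 ?sqr_ge0 //; lra.
have ee : e <= l * e by apply: ler_peMl => //; lra.
have {}es : 240 * (l ^+ 3 * e) <= w by apply: le_trans es; rewrite le_eqVlt; apply/orP; left; apply/eqP; ring.
split; first by move: es h1 h2 ee l2e; clear; lra.
- have -> : 2 * l * (40 * l * e) = 80 * (l ^+ 2 * e) by ring.
  by move: es h1 h2 ee l2e l3e l2 e0; move: (l ^+ 3 * e) => z; clear; lra.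
- have -> : 3 * l ^+ 2 * (40 * l * e) = 120 * (l ^+ 3 * e) by ring.
  by move: es; clear; lra.
Qed.

Lemma side_turn_bound (R : rcfType) (a b c d o e le : R) : b <= o -> c <= d -> o <= 3 * e ->
  d <= 30 * le -> e <= le -> a <= b + c -> 0 <= e -> a <= 40 * le.
Proof. lra. Qed.

Lemma cross_diff (R : rcfType) (u v u' v' : vec R) (l e : R) : vnorm u <= l -> vnorm v' <= l ->
  vnorm (vsub u u') <= e -> vnorm (vsub v v') <= e ->
  vnorm (vsub (cross u v) (cross u' v')) <= 2 * l * e.
Proof.
move=> h1 h2 h3 h4.
have -> : vsub (cross u v) (cross u' v') = vadd (cross u (vsub v v')) (cross (vsub u u') v').
  by move: u v u' v' {h1 h2 h3 h4} => [? ? ?] [? ? ?] [? ? ?] [? ? ?]; rewrite /vsub /cross /vadd /=; congr Vec; ring.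
apply: (le_trans (vnormD _ _)).
have := le_trans (vnorm_cross_le u (vsub v v')) (ler_pM (vnorm_ge0 _) (vnorm_ge0 _) h1 h4).
have := le_trans (vnorm_cross_le (vsub u u') v') (ler_pM (vnorm_ge0 _) (vnorm_ge0 _) h3 h2).
rewrite (mulrC e l) -mulrA => a b; apply: le_trans (lerD b a) _; lra.
Qed.

Lemma det_diff (R : rcfType) (u v w u' v' w' : vec R) (l e : R) : 0 <= l -> 0 <= e ->
  vnorm u <= l -> vnorm v <= l -> vnorm v' <= l -> vnorm w' <= l ->
  vnorm (vsub u u') <= e -> vnorm (vsub v v') <= e -> vnorm (vsub w w') <= e ->
  `|det3 u v w - det3 u' v' w'| <= 3 * l ^+ 2 * e.
Proof.
move=> l0 e0 lu lv lv' lw' du dv dw.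
have -> : det3 u v w - det3 u' v' w' = dot (vsub u u') (cross v' w') + dot u (vsub (cross v w) (cross v' w')).
  move: u v w u' v' w' {du dv dw lv' lw' lu lv} => [? ? ?] [? ? ?] [? ? ?] [? ? ?] [? ? ?] [? ? ?].
  by rewrite /det3 /dot /vsub /cross /=; ring.
apply: (le_trans (ler_normD _ _)).
have c1 : `|dot (vsub u u') (cross v' w')| <= e * (l * l).
  apply: (le_trans (dot_le _ _)); apply: ler_pM; rewrite ?vnorm_ge0 //.
  by apply: (le_trans (vnorm_cross_le _ _)); apply: ler_pM; rewrite ?vnorm_ge0.
have c2 : `|dot u (vsub (cross v w) (cross v' w'))| <= l * (2 * l * e).
  by apply: (le_trans (dot_le _ _)); apply: ler_pM; rewrite ?vnorm_ge0 //; apply: cross_diff.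
apply: le_trans (lerD c1 c2) _; rewrite le_eqVlt; apply/orP; left; apply/eqP; ring.
Qed.

Section Robust.

Variables (R : rcfType) (n N K : nat) (x : 'I_n -> 'rV[R]_N) (F : 'I_n -> triad R N) (r eta : R).
Local Notation vec := (vec R).
Local Notation quat := (quat R).

Definition near i j := nm (x i - x j) <= 10 * r.
Local Notation M := (6 * K ^ 3).+1.
(** The bound of [curve_det] for 6 m^3 + 1 candidates. The area margin [nu1] is linear and the
    volume margin [margin_of] quadratic in it: volumes are controlled by [few_small_values] with an
    area as gradient. *)
Definition kappa_of (m : nat) : R := (30 * ((6 * m ^ 3).+1)%:R ^+ 3)^-1 ^+ 3.
Local Notation kappa := (kappa_of K).
Local Notation nu1 := (kappa / 100).
Definition margin_of m := kappa_of m ^+ 2 / 2000.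
Local Notation nu := (margin_of K).
Local Notation L := (20 * r).

Hypothesis hF : forall i, orthonormal (F i).
Hypothesis sep : forall i j, i != j -> 1 <= nm (x i - x j).
Hypothesis tiltH : forall i j, near i j -> tilt (F i) (F j) eta.
Hypothesis offH : forall i j, near i j -> off (F i) (x j - x i) <= eta.
Hypothesis detH : forall i j, near i j ->
  0 < det3 (turn (F i) (F j) (@e1 R)) (turn (F i) (F j) (Vec 0 1 0)) (turn (F i) (F j) (@e3 R)).
Hypothesis cardH : forall i, (#|[set j | near i j]| <= K)%N.
Hypothesis r1 : 1 <= r.
Hypothesis eta0 : 0 <= eta.
Hypothesis eta_small : 40 * L ^+ 3 * eta * 6 <= nu.

Lemma nearC : symmetric near. Proof. by move=> i j; rewrite /near nm_subC. Qed.
Lemma near_refl i : near i i.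
Proof. by rewrite /near subrr nm0 mulr_ge0 // (le_trans ler01). Qed.

Lemma kappa_gt0 : 0 < kappa. Proof. by rewrite exprn_gt0 // scale_curve_gt0. Qed.
Lemma kappa_le1 : kappa <= 1.
Proof.
rewrite /kappa_of exprn_ile1 ?invr_ge0 ?mulr_ge0 ?exprn_ge0 // invf_le1 ?mulr_gt0 ?exprn_gt0 ?ltr0n //.
have : 1 <= ((6 * K ^ 3).+1)%:R ^+ 3 :> R by rewrite exprn_ege1 // ler1n.
by lra.
Qed.
Lemma nu_gt0 : 0 < nu. Proof. by rewrite divr_gt0 // exprn_gt0 // kappa_gt0. Qed.
Lemma nu_le : nu <= nu1 /\ nu1 <= 1 / 100.
Proof.
have := kappa_le1; have := kappa_gt0; rewrite /margin_of; move: (kappa_of K) => k k0 k1.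
exact: margin_bounds.
Qed.
Lemma L_ge : 20 <= L. Proof. by have := r1; lra. Qed.

Lemma eta_bounds : [/\ eta <= 1 / 100, 2 * L * (40 * L * eta) <= nu1 & 3 * L ^+ 2 * (40 * L * eta) <= nu / 2].
Proof. by have [h1 h2] := nu_le; apply: (scale_bounds eta0 eta_small h1 h2 L_ge). Qed.

Lemma close_near i j : near i j -> exists2 q : quat, qnorm q = 1 & close_turn (F i) (F j) q (30 * eta).
Proof.
move=> nij; have [e1' _ _] := eta_bounds; apply: close_turn_exists => //.
- by apply: le_trans e1' _; lra.
- exact: tiltH.
- exact: detH.
Qed.

Section Perturbed.

Variable g : 'I_n -> 'I_M.
Definition ypt i := x i + emb (F i) (curve R (g i)).
Definition yy i j := proj (F i) (ypt j).
Definition side i a b := vsub (yy i b) (yy i a).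

Lemma sideE i a b : side i a b = proj (F i) (ypt b - ypt a).
Proof. by rewrite /side /yy projB. Qed.

Lemma ypt_close i : nm (ypt i - x i) <= 1 / 10.
Proof. by rewrite /ypt addrC addKr nm_emb // vnorm_curve. Qed.

Lemma ypt_upper a b : nm (ypt b - ypt a) <= nm (x b - x a) + 1 / 5.
Proof.
have := nmB (ypt b) (x b) (ypt a); have := nmB (x b) (x a) (ypt a).
rewrite (nm_subC (x a)); have := ypt_close a; have := ypt_close b; lra.
Qed.

Lemma ypt_lower a b : nm (x b - x a) - 1 / 5 <= nm (ypt b - ypt a).
Proof.
have := nmB (x b) (ypt b) (x a); have := nmB (ypt b) (ypt a) (x a).
rewrite (nm_subC (x b) (ypt b)); have := ypt_close a; have := ypt_close b; lra.
Qed.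

Lemma ypt_le_L a b : near a b -> nm (ypt b - ypt a) <= L.
Proof.
rewrite nearC => h; apply: (le_trans (ypt_upper a b)); move: h; rewrite /near.
by have := r1; lra.
Qed.

Lemma off_ypt i a b : near i a -> near i b -> off (F i) (ypt b - ypt a) <= 3 * eta.
Proof.
move=> ia ib.
have -> : ypt b - ypt a = (x b - x i) + - (x a - x i) + (emb (F b) (curve R (g b)) + - emb (F a) (curve R (g a))).
  rewrite /ypt opprB [x b - x i + _]addrA subrK opprD; exact: addrACA.
apply: (le_trans (offD _ _ _)); have := offD (F i) (x b - x i) (- (x a - x i)).
have := offD (F i) (emb (F b) (curve R (g b))) (- emb (F a) (curve R (g a))); rewrite !offN.
have := offH ia; have := offH ib; have := tiltH ia (curve R (g a)); have := tiltH ib (curve R (g b)).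
have := ler_wpM2l eta0 (vnorm_curve R (g a)); have := ler_wpM2l eta0 (vnorm_curve R (g b)).
have := eta0; move: (off _ _) (off _ _) (off _ _) (off _ _) (off _ _) (off _ _) => *; lra.
Qed.

Lemma side_le i a b : near i a -> near i b -> near a b -> vnorm (side i a b) <= L.
Proof. by move=> ia ib ab; rewrite sideE (le_trans (vnorm_proj _ (hF i))) // ypt_le_L. Qed.

Lemma side_lower i a b : near i a -> near i b -> a != b -> 1 / 2 <= vnorm (side i a b).
Proof.
move=> ia ib ab; rewrite sideE; apply: le_trans (proj_lower _ (hF i)).
have := off_ypt ia ib; have := ypt_lower a b; rewrite (nm_subC (x b)).
have := sep ab; have [] := eta_bounds; move: (nm _) (nm _) (off _ _) => *; lra.
Qed.

Lemma side_turn i j a b q : close_turn (F i) (F j) q (30 * eta) -> near j a -> near j b -> near a b ->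
  vnorm (vsub (side i a b) (rot q (side j a b))) <= 40 * L * eta.
Proof.
move=> cq ja jb ab; rewrite !sideE; set w := ypt b - ypt a.
have h1 := proj_turn w (hF i) (hF j); have h2 := cq (proj (F j) w).
have h3 : vnorm (proj (F j) w) <= L by apply: le_trans (vnorm_proj _ (hF j)) (ypt_le_L ab).
have h4 := off_ypt ja jb; have := vnormB (proj (F i) w) (turn (F i) (F j) (proj (F j) w)) (rot q (proj (F j) w)).
have h5 : 30 * eta * vnorm (proj (F j) w) <= 30 * eta * L by rewrite ler_wpM2l // mulr_ge0.
have h6 : eta <= L * eta by rewrite ler_peMl //; have := L_ge; lra.
move=> h7; move: h4 h5; rewrite -/w => h4 h5.
have E : 30 * eta * L = 30 * (L * eta) by ring.
have -> : 40 * L * eta = 40 * (L * eta) by ring.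
by rewrite E in h5; move: h1 h2 h4 h5 h6 h7 eta0; apply: side_turn_bound.
Qed.

Definition area i a b c := cross (side i a b) (side i a c).
Definition vol i a b c d := det3 (side i a b) (side i a c) (side i a d).

Lemma area_turn i j a b c : near_seq near [:: i; j; a; b; c] ->
  vnorm (area j a b c) - nu1 <= vnorm (area i a b c).
Proof.
move=> /near_seqP h; have H p q : p \in [:: i; j; a; b; c] -> q \in [:: i; j; a; b; c] -> near p q by move=> hp hq; apply: h.
have [q q1' cq] := close_near (H i j ltac:(by rewrite !inE eqxx) ltac:(by rewrite !inE eqxx orbT)).
have hb : vnorm (vsub (side i a b) (rot q (side j a b))) <= 40 * L * eta.
  by apply: side_turn => //; apply: H; rewrite !inE eqxx ?orbT.
have hc : vnorm (vsub (side i a c) (rot q (side j a c))) <= 40 * L * eta.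
  by apply: side_turn => //; apply: H; rewrite !inE eqxx ?orbT.
have l1 : vnorm (side i a b) <= L by apply: side_le; apply: H; rewrite !inE eqxx ?orbT.
have l2 : vnorm (rot q (side j a c)) <= L.
  by rewrite vnorm_rot //; apply: side_le; apply: H; rewrite !inE eqxx ?orbT.
have := cross_diff l1 l2 hb hc; rewrite cross_rot q1' scale1 => d.
have := vnorm_le_add (rot q (area j a b c)) (area i a b c); rewrite vnorm_rot // vnorm_subC.
have [_ e2 _] := eta_bounds; move: d; rewrite -!/(area _ _ _ _); move: (vnorm _) (vnorm _) (vnorm _) => *; lra.
Qed.

Lemma vol_turn i j a b c d : near_seq near [:: i; j; a; b; c; d] ->
  `|vol i a b c d - vol j a b c d| <= nu / 2.
Proof.
move=> /near_seqP h; have H p q : p \in [:: i; j; a; b; c; d] -> q \in [:: i; j; a; b; c; d] -> near p q by move=> hp hq; apply: h.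
have [q q1' cq] := close_near (H i j ltac:(by rewrite !inE eqxx) ltac:(by rewrite !inE eqxx orbT)).
have S e : e \in [:: i; j; a; b; c; d] -> vnorm (vsub (side i a e) (rot q (side j a e))) <= 40 * L * eta.
  by move=> he; apply: side_turn => //; apply: H; rewrite ?he // !inE eqxx ?orbT.
have l1 k e : k \in [:: i; j; a; b; c; d] -> e \in [:: i; j; a; b; c; d] -> vnorm (side k a e) <= L.
  by move=> hk he; apply: side_le; apply: H; rewrite ?he ?hk // !inE eqxx ?orbT.
have E : vol j a b c d = det3 (rot q (side j a b)) (rot q (side j a c)) (rot q (side j a d)).
  by rewrite /vol /det3 cross_rot q1' scale1 dot_rot q1' expr1n mul1r.
have [ii jj] : i \in [:: i; j; a; b; c; d] /\ j \in [:: i; j; a; b; c; d] by rewrite !inE !eqxx ?orbT.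
have [bb cc dd] : [/\ b \in [:: i; j; a; b; c; d], c \in [:: i; j; a; b; c; d] & d \in [:: i; j; a; b; c; d]].
  by rewrite !inE !eqxx ?orbT.
rewrite E /vol.
have := (S _ bb, S _ cc, S _ dd); have := (l1 _ _ ii bb, l1 _ _ ii cc).
have := (l1 _ _ jj cc, l1 _ _ jj dd); rewrite -(vnorm_rot (side j a c) q1') -(vnorm_rot (side j a d) q1').
move: (side i a b) (side i a c) (side i a d) (rot q (side j a b)) (rot q (side j a c)) (rot q (side j a d)).
move=> u v w u' v' w' [lv' lw'] [lu lv] [[du dv] dw].
have [_ _ e3'] := eta_bounds; apply: le_trans e3'; apply: det_diff => //.
- by have := L_ge; lra.
- by rewrite !mulr_ge0 //; have := r1; lra.
Qed.

Lemma area_swap i a b c : vnorm (area i b a c) = vnorm (area i a b c) /\ vnorm (area i a c b) = vnorm (area i a b c).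
Proof.
rewrite /area /side /vnorm; move: (yy i a) (yy i b) (yy i c) => A B C.
by split; congr Num.sqrt; rewrite /vsub; clear; vec_ring.
Qed.

Lemma vol_swap i a b c d : [/\ `|vol i b a c d| = `|vol i a b c d|, `|vol i a c b d| = `|vol i a b c d| &
  `|vol i a b d c| = `|vol i a b c d| ].
Proof.
by rewrite /vol /side; have := (@det4_swap12 R n yy i a b c d, @det4_swap23 R n yy i a b c d, @det4_swap34 R n yy i a b c d);
 rewrite /det4 => -[[-> ->] ->]; rewrite !normrN.
Qed.

(** Involves only indices up to i, so it can be arranged when the candidate for i is chosen, in the
    view from i. The margins are doubled because [area_turn] and [vol_turn] consume part of them
    when the view changes. *)
Definition robust_at (i : 'I_n) :=
  (forall a b : 'I_n, (a < i)%N -> (b < i)%N -> a != b -> near_seq near [:: i; a; b] ->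
     2 * nu1 <= vnorm (area i a b i)) /\
  (forall a b c : 'I_n, (a < i)%N -> (b < i)%N -> (c < i)%N -> uniq [:: a; b; c] ->
     near_seq near [:: i; a; b; c] -> 2 * nu <= `|vol i a b c i|).

Lemma robust_area (k : nat) (v : 'I_n) : (forall i : 'I_n, (i < k)%N -> robust_at i) ->
  forall a b c : 'I_n, uniq [:: a; b; c] -> (a < k)%N -> (b < k)%N -> (c < k)%N ->
  near_seq near [:: v; a; b; c] -> nu1 <= vnorm (area v a b c).
Proof.
move=> h; apply: (@sort3 n).
- move=> a b c; have [-> _] := area_swap v a b c => H hb ha hc ns; apply: H => //.
  by apply: near_seq_sub ns => z; rewrite !inE; case: (z == v); case: (z == a); case: (z == b).
- move=> a b c; have [_ ->] := area_swap v a b c => H ha hc hb ns; apply: H => //.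
  by apply: near_seq_sub ns => z; rewrite !inE; case: (z == v); case: (z == a); case: (z == b); case: (z == c).
- move=> a b c ac bc ab ka kb kc ns; have [h1 _] := h c kc.
  have ns1 : near_seq near [:: v; c; a; b; c].
    by apply: near_seq_sub ns => z; rewrite !inE; case: (z == v); case: (z == a); case: (z == b); case: (z == c).
  have ns2 : near_seq near [:: c; a; b].
    by apply: near_seq_sub ns => z; rewrite !inE; case: (z == v); case: (z == a); case: (z == b); case: (z == c).
  have := h1 a b ac bc ab ns2; have := area_turn ns1; move: (vnorm _) (vnorm _) => *; lra.
Qed.

Lemma robust_vol (v : 'I_n) : (forall i : 'I_n, robust_at i) ->
  forall a b c d : 'I_n, uniq [:: a; b; c; d] ->
  near_seq near [:: v; a; b; c; d] -> nu <= `|vol v a b c d|.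
Proof.
move=> h; apply: (@sort4 n).
- move=> a b c d; have [-> _ _] := vol_swap v a b c d => H ns; apply: H.
  by apply: near_seq_sub ns => z; rewrite !inE; case: (z == v); case: (z == a); case: (z == b).
- move=> a b c d; have [_ -> _] := vol_swap v a b c d => H ns; apply: H.
  by apply: near_seq_sub ns => z; rewrite !inE; case: (z == v); case: (z == a); case: (z == b); case: (z == c).
- move=> a b c d; have [_ _ ->] := vol_swap v a b c d => H ns; apply: H.
  by apply: near_seq_sub ns => z; rewrite !inE; case: (z == v); case: (z == a); case: (z == b); case: (z == c); case: (z == d).
- move=> a b c d ad bd cd U ns; have [_ h1] := h d.
  have ns1 : near_seq near [:: v; d; a; b; c; d].
    by apply: near_seq_sub ns => z; rewrite !inE; case: (z == v); case: (z == a); case: (z == b); case: (z == c); case: (z == d).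
  have ns2 : near_seq near [:: d; a; b; c].
    by apply: near_seq_sub ns => z; rewrite !inE; case: (z == v); case: (z == a); case: (z == b); case: (z == c); case: (z == d).
  have := h1 a b c ad bd cd U ns2; have := vol_turn ns1; have := nu_gt0.
  have := lerB_dist (vol d a b c d) (vol v a b c d); rewrite distrC.
  move: (`|_|) (`|_|) (`|_|) => *; lra.
Qed.

End Perturbed.

Lemma ypt_local g h a : g a = h a -> ypt g a = ypt h a.
Proof. by rewrite /ypt => ->. Qed.

Lemma robust_local (i : 'I_n) (g h : 'I_n -> 'I_M) : (forall j : 'I_n, (j <= i)%N -> g j = h j) ->
  robust_at g i -> robust_at h i.
Proof.
move=> e [h1 h2]; have Y (a : 'I_n) : (a <= i)%N -> ypt g a = ypt h a by move=> ai; apply/ypt_local/e.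
have Si (a b : 'I_n) : (a <= i)%N -> (b <= i)%N -> side g i a b = side h i a b.
  by move=> ai bi; rewrite /side /yy !Y.
split=> [a b ai bi ab ns | a b c ai bi ci U ns].
  by have := h1 a b ai bi ab ns; rewrite /area !Si // ltnW.
by have := h2 a b c ai bi ci U ns; rewrite /vol !Si // ltnW.
Qed.

Lemma few_bad_areas (u w : vec) : 1 / 2 <= vnorm u ->
  (#|[set k : 'I_M | (vnorm (cross u (vadd w (curve R k))) < 2 * nu1)%R]| <= 3)%N.
Proof.
move=> u2; have [m m1 mu] := cross_component u.
have k0 := kappa_gt0.
apply: leq_trans (@few_small_values R M (dot m (cross u w)) (2 * nu1) (1 / 4) (cross m u) _ _ _).
- apply: subset_leq_card; apply/subsetP => k; rewrite !inE; apply: le_lt_trans.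
  have -> : dot m (cross u w) + dot (cross m u) (curve R k) = dot m (cross u (vadd w (curve R k))).
    by move: (curve R k) => c; move: m u w c {m1 mu u2} => [? ? ?] [? ? ?] [? ? ?] [? ? ?]; rewrite /dot /cross /vadd /=; ring.
  by apply: (le_trans (dot_le _ _)); rewrite m1 mul1r.
- by move: k0; move: (kappa_of K) => k k0; lra.
- by move: u2 mu; move: (vnorm _) (vnorm _) => a b; lra.
- rewrite -/(kappa_of K); move: k0; move: (kappa_of K) => k k0; lra.
Qed.

Lemma few_bad_vols (u v w : vec) : nu1 <= vnorm (cross u v) ->
  (#|[set k : 'I_M | (`|det3 u v (vadd w (curve R k))| < 2 * nu)%R]| <= 3)%N.
Proof.
move=> n1; have k0 := kappa_gt0.
apply: leq_trans (@few_small_values R M (det3 u v w) (2 * nu) nu1 (cross u v) _ n1 _).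
- apply: subset_leq_card; apply/subsetP => k; rewrite !inE; apply: le_lt_trans.
  have -> : det3 u v w + dot (cross u v) (curve R k) = det3 u v (vadd w (curve R k)); last by [].
  by move: (curve R k) => c; move: u v w c {n1} => [? ? ?] [? ? ?] [? ? ?] [? ? ?]; rewrite /det3 /dot /cross /vadd /=; ring.
- by rewrite mulr_ge0 // ltW // nu_gt0.
- rewrite -/(kappa_of K) /margin_of; move: k0; move: (kappa_of K) => k k0.
  have k2 : 0 < k ^+ 2 by rewrite exprn_gt0.
  have -> : k / 100 * k = k ^+ 2 / 100 by rewrite mulrAC expr2.
  by move: k2; move: (k ^+ 2) => z; lra.
Qed.

(** There are at most K^3 triples of neighbours, and each excludes at most three candidates through
    an area and three through a volume. One of the 6 K^3 + 1 candidates survives. *)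
Lemma robust_extend (i : 'I_n) (g : 'I_n -> 'I_M) : (forall j : 'I_n, (j < i)%N -> robust_at g j) ->
  exists c, robust_at (fun j => if j == i then c else g j) i.
Proof.
move=> hg; pose w a := proj (F i) (x i - ypt g a).
pose ok1 (a b : 'I_n) := [&& (a < i)%N, (b < i)%N, a != b & near_seq near [:: i; a; b]].
pose ok2 (a b c : 'I_n) := [&& (a < i)%N, (b < i)%N, (c < i)%N, uniq [:: a; b; c] & near_seq near [:: i; a; b; c]].
pose bad (t : 'I_n * 'I_n * 'I_n) : {set 'I_M} :=
  (if ok1 t.1.1 t.1.2 then [set k | vnorm (cross (side g i t.1.1 t.1.2) (vadd (w t.1.1) (curve R k))) < 2 * nu1] else set0) :|:
  (if ok2 t.1.1 t.1.2 t.2 then [set k | (`|det3 (side g i t.1.1 t.1.2) (side g i t.1.1 t.2) (vadd (w t.1.1) (curve R k))| < 2 * nu)%R] else set0).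
pose nb := [set j | near i j].
have [|| c hc] := @card_bigcup_bound _ 'I_M (setX (setX nb nb) nb) bad 6.
- move=> [[a b] c] _; rewrite /bad /=.
  apply: (leq_trans (leq_card_setU _ _)); apply: (@leq_add _ _ 3 3).
    case: ifP => [/and4P[ai bi ab /near_seqP ns]|_]; last by rewrite cards0.
    by apply: few_bad_areas; apply: side_lower => //; apply: ns; rewrite !inE eqxx ?orbT.
  case: ifP => [/and5P[ai bi ci U ns]|_]; last by rewrite cards0.
  by apply: few_bad_vols; apply: (robust_area hg).
- rewrite !cardsX card_ord ltnS mulnC leq_mul2l /=.
  have -> : (K ^ 3 = K * K * K)%N by rewrite !expnS expn0 muln1 mulnA.
  by rewrite !leq_mul // cardH.
exists c; set g' := (fun j => _).
have gi : ypt g' i = x i + emb (F i) (curve R c) by rewrite /ypt /g' eqxx.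
have ga (a : 'I_n) : (a < i)%N -> ypt g' a = ypt g a.
  by move=> ai; apply: ypt_local; rewrite /g' ifN // -val_eqE neq_ltn ai.
have S1 (a b : 'I_n) : (a < i)%N -> (b < i)%N -> side g' i a b = side g i a b.
  by move=> ai bi; rewrite /side /yy !ga.
have S2 (a : 'I_n) : (a < i)%N -> side g' i a i = vadd (w a) (curve R c).
  by move=> ai; rewrite sideE gi ga // addrAC projD projK.
split=> [a b ai bi ab ns|a b d ai bi di U ns].
  rewrite /area S1 // S2 // leNgt; apply/negP => bd.
  have /near_seqP Nr := ns; have tA : (a, b, b) \in setX (setX nb nb) nb.
    by rewrite !inE /= !Nr ?inE ?eqxx ?orbT.
  by have := hc _ tA; rewrite /bad /= /ok1 ai bi ab ns !inE bd.
rewrite /vol (S1 a b) // (S1 a d) // S2 // leNgt; apply/negP => bd.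
have /near_seqP Nr := ns; have tA : (a, b, d) \in setX (setX nb nb) nb.
  by rewrite !inE /= !Nr ?inE ?eqxx ?orbT.
by have := hc _ tA; rewrite /bad /= /ok2 ai bi di U ns !inE bd orbT.
Qed.

Lemma robust_exists : exists g : 'I_n -> 'I_M, forall i, robust_at g i.
Proof. apply: (greedy ord0); [exact: robust_local | exact: robust_extend]. Qed.

End Robust.

End SpinNet.

(** * Transition quaternions with a small cocycle defect *)

Module Spin.

Import Core Geo Config Config2 Config3 Sign Euclid Net Generic SpinNet.
Set Implicit Arguments.
Unset Strict Implicit.
Unset Printing Implicit Defensive.
Import Order.TTheory GRing.Theory Num.Theory.
Local Open Scope ring_scope.

Section SpinLemmas.

Variable R : rcfType.
Local Notation vec := (vec R).
Local Notation quat := (quat R).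

(** Converts distance estimates into the cosine form of [cf_edge] and [cf_normal]. *)
Lemma antiparallel (X Z : vec) (e t : R) : vnorm (vsub X Z) <= e -> e <= t ^+ 2 * vnorm Z ->
  t ^+ 2 <= 1 / 2 -> 0 <= e -> (1 - 2 * t ^+ 2) * (vnorm X * vnorm Z) <= dot X Z.
Proof.
move=> h1 h2 t1 e0; have E : dot X Z = vnorm Z ^+ 2 + dot (vsub X Z) Z.
  by rewrite vnorm2; move: X Z {h1 h2} => [? ? ?] [? ? ?]; rewrite /dot /vsub /=; ring.
have a1 := dot_le (vsub X Z) Z.
have a2 : - (e * vnorm Z) <= dot (vsub X Z) Z.
  have : `|dot (vsub X Z) Z| <= e * vnorm Z by apply: (le_trans a1); rewrite ler_wpM2r ?vnorm_ge0.
  by rewrite ler_norml => /andP[].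
have a3 : vnorm X <= vnorm Z + e by have := vnorm_le_add X Z; move: h1; clear; lra.
rewrite E; have z0 := vnorm_ge0 Z; have x0 := vnorm_ge0 X.
move: (dot _ _) (vnorm Z) (vnorm X) (t ^+ 2) (sqr_ge0 t) a2 a3 h2 t1 e0 z0 x0 => d z x w w0 a2 a3 h2 t1 e0 z0 x0.
clear -a2 a3 h2 t1 e0 z0 x0 w0.
have b1 : (1 - 2 * w) * x <= (1 - 2 * w) * (z + e) by apply: ler_wpM2l => //; lra.
have b2 : (1 - 2 * w) * (z + e) <= z - e by nra.
have b3 : (1 - 2 * w) * x * z <= (z - e) * z by apply: ler_wpM2r => //; apply: le_trans b1 b2.
by rewrite mulrA; apply: (le_trans b3); lra.
Qed.

Lemma small_square (t : R) : 0 <= t -> t <= 1 / 10000 -> t ^+ 2 <= 1 / 2.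
Proof. by move=> t0 t1; rewrite expr2; nra. Qed.

Lemma qnorm_imag (q : quat) (e : R) : qnorm q = 1 -> e <= 1 / 2 ->
  q1 q ^+ 2 + q2 q ^+ 2 + q3 q ^+ 2 <= e -> 1 / 2 <= `|q0 q|.
Proof.
rewrite /qnorm => n e2 h; apply: norm_lower => //; first by lra.
rewrite real_normK ?num_real //; have -> : (1 / 2) ^+ 2 = 1 / 4 :> R by field.
lra.
Qed.

Lemma qnear_one (q : quat) (s : R) : qnorm q = 1 -> 0 <= s -> s <= 1 -> 0 < q0 q ->
  q1 q ^+ 2 + q2 q ^+ 2 + q3 q ^+ 2 <= s ^+ 2 -> qle (qsub q (@qone R)) s.
Proof.
case: q => a b c d; rewrite /qnorm /= => n s0 s1 a0 h.
have b0 := sqr_ge0 b; have c0 := sqr_ge0 c; have d0 := sqr_ge0 d.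
have s2 : s ^+ 2 <= s by rewrite expr2 -[X in _ <= X]mul1r ler_wpM2r.
apply/and4P; split; rewrite /= ?subr0.
- have a1 : a <= 1 by rewrite leNgt; apply/negP => a1; nra.
  rewrite distrC ger0_norm ?subr_ge0 // lerBlDr -lerBlDl; apply: norm_lower; [lra | lra |].
  have -> : (1 - s) ^+ 2 = 1 - 2 * s + s ^+ 2 by ring.
  lra.
- by apply: ler_sqr_norm => //; lra.
- by apply: ler_sqr_norm => //; lra.
- by apply: ler_sqr_norm => //; lra.
Qed.

(** [V] writes X - A, up to the factor [dB - dA], as a combination of the three given edges. The
    sign conditions make each coefficient at most that factor in absolute value. *)
Lemma segment_meets (A B X Z W : vec) (l : R) :
  let D P Q S T := det3 (vsub Q P) (vsub S P) (vsub T P) in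
  D A X Z W != 0 -> D B X Z W != 0 -> D A B X Z != 0 -> D A B Z W != 0 -> D A B W X != 0 ->
  (D A X Z W < 0) != (D B X Z W < 0) -> (D A B X Z < 0) == (D A B Z W < 0) ->
  (D A B X Z < 0) == (D A B W X < 0) ->
  vnorm (vsub B A) <= l -> vnorm (vsub Z X) <= l -> vnorm (vsub W X) <= l ->
  vnorm (vsub X A) <= 3 * l.
Proof.
move=> D; set dA := D A X Z W; set dB := D B X Z W; set d1 := D A B X Z; set d2 := D A B Z W.
set d3 := D A B W X => nA nB n1 n2 n3 sAB s12 s13 hB hZ hW.
have S : dB - dA = - (d1 + d2 + d3).
  by rewrite /dA /dB /d1 /d2 /d3 /D; clear; move: A B X Z W => [? ? ?] [? ? ?] [? ? ?] [? ? ?] [? ? ?];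
   rewrite /det3 /dot /cross /vsub /=; ring.
have V : vscale (dB - dA) (vsub X A) = vadd (vscale (- dA) (vsub B A)) (vadd (vscale d3 (vsub Z X)) (vscale d1 (vsub W X))).
  by rewrite /dA /dB /d1 /d3 /D; clear; move: A B X Z W => [? ? ?] [? ? ?] [? ? ?] [? ? ?] [? ? ?];
   rewrite /det3 /dot /cross /vsub /vscale /vadd /=; congr Vec; ring.
have K1 : [/\ `|dA| <= `|dB - dA|, `|d3| <= `|dB - dA|, `|d1| <= `|dB - dA| & 0 < `|dB - dA|].
  move: nA nB n1 n2 n3 sAB s12 s13 S; clear; move: dA dB d1 d2 d3 => a b c d e.
  case: (ltgtP a 0) => // ha _; case: (ltgtP b 0) => // hb _; case: (ltgtP c 0) => // hc _;
   case: (ltgtP d 0) => // hd _; case: (ltgtP e 0) => // he _ //= _ //= _ //= _ S; try (by exfalso; lra).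
    have h : 0 < b - a by lra.
    rewrite (ltr0_norm ha) (ltr0_norm hc) (ltr0_norm he) (gtr0_norm h); split; lra.
  have h : b - a < 0 by lra.
  rewrite (gtr0_norm ha) (gtr0_norm hc) (gtr0_norm he) (ltr0_norm h); split; lra.
have [k1 k3 k4 k0] := K1; have l0 : 0 <= l by apply: le_trans hB; exact: vnorm_ge0.
rewrite -(ler_pM2l k0) -vnormZ V; apply: (le_trans (vnormD _ _)).
have P (y : R) (u : vec) : `|y| <= `|dB - dA| -> vnorm u <= l -> vnorm (vscale y u) <= `|dB - dA| * l.
  by move=> a b; rewrite vnormZ ler_pM ?vnorm_ge0.
have k1' : `|- dA| <= `|dB - dA| by rewrite normrN.
have := lerD (P _ _ k1' hB) (le_trans (vnormD _ _) (lerD (P _ _ k3 hZ) (P _ _ k4 hW))).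
by move/le_trans; apply; rewrite le_eqVlt; apply/orP; left; apply/eqP; ring.
Qed.

End SpinLemmas.

Section Spin.

Variables (R : rcfType) (n N K : nat) (x : 'I_n -> 'rV[R]_N) (F : 'I_n -> triad R N) (r eta t w : R).
Local Notation vec := (vec R).
Local Notation quat := (quat R).
Local Notation nearx := (near x r).
Local Notation M := (6 * K ^ 3).+1.
Local Notation nu1 := (kappa_of R K / 100).
Local Notation nu := (margin_of R K).
Local Notation L := (20 * r).

Hypothesis hF : forall i, orthonormal (F i).
Hypothesis sep : forall i j, i != j -> 1 <= nm (x i - x j).
Hypothesis tiltH : forall i j, nearx i j -> tilt (F i) (F j) eta.
Hypothesis offH : forall i j, nearx i j -> off (F i) (x j - x i) <= eta.
Hypothesis detH : forall i j, nearx i j ->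
  0 < det3 (turn (F i) (F j) (@e1 R)) (turn (F i) (F j) (Vec 0 1 0)) (turn (F i) (F j) (@e3 R)).
Hypothesis cardH : forall i, (#|[set j | nearx i j]| <= K)%N.
Hypothesis r1 : 1 <= r.
Hypothesis eta0 : 0 <= eta.
Hypothesis eta_small : 40 * L ^+ 3 * eta * 6 <= nu.
Hypothesis t0 : 0 <= t.
Hypothesis t_small : t <= 1 / 10000.
Hypothesis t_wide : 800 * t * (L * L) < nu1.
Hypothesis eta_t : 120 * eta <= t ^+ 2.
Hypothesis eta_nu : 2 * L * (40 * L * eta) <= t ^+ 2 * nu1.
Hypothesis w0 : 0 <= w.
Hypothesis w1 : w <= 1.
Hypothesis eta_w : 120 * eta <= (w / 4) ^+ 2.

Let adj : rel 'I_n := fun i j => nm (x i - x j) <= r.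

Lemma adjC' : symmetric adj. Proof. by move=> i j; rewrite /adj nm_subC. Qed.

Lemma adj_near i j : adj i j -> nearx i j.
Proof. by rewrite /adj /near => h; apply: (le_trans h); have := r1; lra. Qed.

(** Lifts are chosen for i < j only and conjugated for the opposite pairs, so that inversion is
    exact and not merely approximate. *)
Lemma transition_exists : exists q : 'I_n -> 'I_n -> quat,
  [/\ forall i j, qnorm (q i j) = 1, forall i j, q j i = qconj (q i j),
      forall i, q i i = @qone R &
      forall i j, nearx i j -> close_turn (F i) (F j) (q i j) (30 * eta)].
Proof.
have close := close_near hF tiltH detH r1 eta0 eta_small.
have /fin_all_exists[c Hc] (p : 'I_n * 'I_n) : exists q : quat,
    qnorm q = 1 /\ (nearx p.1 p.2 -> close_turn (F p.1) (F p.2) q (30 * eta)).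
  case h: (nearx p.1 p.2); first by have [q q1' cq] := close _ _ h; exists q.
  by exists (@qone R); split=> //; rewrite /qnorm /= !expr0n expr1n /= !addr0.
have one1 : qnorm (@qone R) = 1 by rewrite /qnorm /= !expr0n expr1n /= !addr0.
have conj1 : qconj (@qone R) = @qone R by rewrite /qconj /qone /= oppr0.
exists (fun i j : 'I_n => if (i < j)%N then c (i, j) else if (j < i)%N then qconj (c (j, i)) else @qone R).
split=> [i j|i j|i|i j nij].
- by case: ltnP => _; [|case: ltnP => _]; rewrite ?qnorm_conj ?(proj1 (Hc _)).
- by case: (ltngtP i j) => _; rewrite ?qconjK.
- by rewrite ltnn.
- case: (ltngtP i j) => hij; first exact: (proj2 (Hc (i, j)) nij).
    by apply: close_turnC; apply: (proj2 (Hc (j, i))); rewrite /= nearC.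
  move/val_inj: hij nij => <- _ v; rewrite rot1 /turn projK //.
  have -> : vsub v v = vscale 0 v by case: v => a b d; rewrite /vsub /vscale /=; congr Vec; ring.
  by rewrite vnormZ normr0 mul0r !mulr_ge0 // vnorm_ge0.
Qed.

Lemma pos_side (g : 'I_n -> 'I_M) u a : pos (yy x F g) u a = side x F g u u a.
Proof. by []. Qed.

Lemma area_normal (g : 'I_n -> 'I_M) u v a :
  cross (pos (yy x F g) u a) (pos (yy x F g) u v) = vscale (-1) (area x F g u v a u).
Proof.
rewrite /pos /area /side; move: (yy x F g u u) (yy x F g u v) (yy x F g u a) => [? ? ?] [? ? ?] [? ? ?].
by rewrite /cross /vsub /vscale /=; congr Vec; ring.
Qed.

(** By [close_turn_trans] the holonomy moves vectors by at most 4 * 30 [eta]; [rot_error] cannot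
    distinguish the two lifts, so only the imaginary part is bounded. *)
Lemma holonomy_imag (q : 'I_n -> 'I_n -> quat) : (forall i j, qnorm (q i j) = 1) -> (forall i j, q j i = qconj (q i j)) ->
  (forall i j, nearx i j -> close_turn (F i) (F j) (q i j) (30 * eta)) ->
  forall v u a, adj v u -> adj v a -> adj u a ->
  q1 (holonomy q v u a) ^+ 2 + q2 (holonomy q v u a) ^+ 2 + q3 (holonomy q v u a) ^+ 2 <= 120 * eta.
Proof.
move=> qu qc qt v u a vu va ua; have [e1' _ _] := eta_bounds r1 eta0 eta_small.
apply: rot_error => [|z]; first by rewrite /holonomy !qnormM !qu !mulr1.
rewrite /holonomy qmulA rotM.
have nvu := adj_near vu; have nva := adj_near va; have nau : nearx a u by rewrite nearC; apply: adj_near.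
have tl : tilt (F a) (F u) (30 * eta).
  move=> y; apply: (le_trans (tiltH nau y)); rewrite ler_wpM2r ?vnorm_ge0 //; have := eta0; lra.
have e30 : 0 <= 30 * eta by rewrite mulr_ge0.
have e31 : 30 * eta <= 1 by move: e1'; lra.
have := close_turn_trans (hF v) (hF a) (hF u) e30 e31 (qu v a) (qu a u) (qt _ _ nva) (qt _ _ nau) (qt _ _ nvu) tl (rot (q u v) z).
rewrite (vnorm_rot _ (qu u v)) (qc u v) rotM -rotM -[X in vsub _ X]rotM qmulVl // rot1 rotM.
by have -> : 4 * (30 * eta) = 120 * eta by ring.
Qed.

Lemma spin_configuration (q : 'I_n -> 'I_n -> quat) :
  (forall i j, qnorm (q i j) = 1) -> (forall i j, q j i = qconj (q i j)) ->
  (forall i j, nearx i j -> close_turn (F i) (F j) (q i j) (30 * eta)) ->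
  exists y, configuration adj nearx y q t.
Proof.
move=> qu qc qt.
have [g Hg] := robust_exists hF sep tiltH offH detH cardH r1 eta0 eta_small.
have [e1' e2' e3'] := eta_bounds r1 eta0 eta_small.
have n1 : 0 < nu1 by rewrite divr_gt0 // kappa_gt0.
have nn : 0 < nu by exact: nu_gt0.
have tt : t ^+ 2 <= 1 / 2 by apply: small_square.
have l0 : 0 <= L by have := r1; lra.
have e0 : 0 <= 40 * L * eta by rewrite !mulr_ge0 //; have := r1; lra.
have star v a b : adj v a -> adj v b -> near_seq nearx [:: v; a; b].
  move=> va vb; have ab : nearx a b.
    rewrite /near; have := nmB (x a) (x v) (x b); move: va vb; rewrite /adj (nm_subC (x v) (x a)).
    have := r1; move: (nm _) (nm _) (nm _) => *; lra.
  by rewrite /near_seq /= !(near_refl, nearC x r a v, nearC x r b v, nearC x r b a, adj_near va, adj_near vb, ab).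
have Ar v a b c : uniq [:: a; b; c] -> near_seq nearx [:: v; a; b; c] -> nu1 <= vnorm (area x F g v a b c).
  move=> U ns; apply: (robust_area hF tiltH offH detH r1 eta0 eta_small (k := n)) => //.
have Dt i a b c d : near_seq nearx [:: i; a; b; c; d] -> uniq [:: a; b; c; d] ->
    det4 (yy x F g) i a b c d != 0 /\ (det4 (yy x F g) i a b c d < 0) = (det4 (yy x F g) a a b c d < 0).
  move=> ns U.
  have h1 := robust_vol hF tiltH offH detH r1 eta0 eta_small Hg U ns.
  have ns2 : near_seq nearx [:: i; a; a; b; c; d].
    by apply: near_seq_sub ns => z; rewrite !inE; case: (z == a).
  have ns3 : near_seq nearx [:: a; a; b; c; d].
    by apply: near_seq_sub ns => z; rewrite !inE; case: (z == a); rewrite ?orbT // => ->; rewrite ?orbT.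
  have h2 := robust_vol hF tiltH offH detH r1 eta0 eta_small Hg U ns3.
  have h3 := vol_turn hF tiltH offH detH r1 eta0 eta_small g ns2.
  split; first by rewrite -normr_gt0; apply: lt_le_trans h1.
  by apply: (sg_close h3); apply: lt_le_trans h2; lra.
exists (yy x F g); split => //.
- move=> v a b ns U.
  have -> : cross (pos (yy x F g) v b) (pos (yy x F g) v a) = area x F g v v b a by [].
  rewrite -vnorm2 exprn_gt0 //; apply: lt_le_trans n1 _; apply: Ar.
    by move: U; rewrite /= !inE !negb_or !andbT => /andP[/andP[h1 h2] h3]; rewrite h1 h2 eq_sym h3.
  by apply: near_seq_sub ns => z; rewrite !inE; case: (z == v); case: (z == a); case: (z == b).
- by rewrite t0 t_small.
- move=> v u a U vu va ua; have /near_seqP N' := star _ _ _ vu va.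
  have H i j : i \in [:: v; u; a] -> j \in [:: v; u; a] -> nearx i j by move=> hi hj; apply: N'.
  have [vi ui] : v \in [:: v; u; a] /\ u \in [:: v; u; a] by rewrite !inE !eqxx ?orbT.
  have S := side_turn hF tiltH offH r1 eta0 g (qt u v (H _ _ ui vi)) (H _ _ vi vi) (H _ _ vi ui) (H _ _ vi ui).
  rewrite vnorm_subC in S.
  have -> : pos (yy x F g) u v = vscale (-1) (side x F g u v u).
    by rewrite /pos /side /vsub /vscale /=; congr Vec; ring.
  rewrite dotZr mulN1r mulNr lerN2 vnormZ normrN normr1 mul1r -(vnorm_rot (pos (yy x F g) v u) (qu u v)).
  apply: (antiparallel S) => //.
  have vu' : v != u by move: U; rewrite /= !inE negb_or => /andP[/andP[]].
  have := side_lower hF sep tiltH offH r1 eta0 eta_small g (H _ _ ui vi) (H _ _ ui ui) vu'.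
  move=> hs; have [_ nu1s] := nu_le R K.
  apply: (@le_trans _ _ (2 * L * (40 * L * eta))).
    by apply: ler_peMl => //; have := r1; lra.
  apply: (le_trans eta_nu); apply: ler_wpM2l; first exact: sqr_ge0.
  by move: hs nu1s; move: (vnorm _) => z; lra.
- move=> v u a U vu va ua; have ns := star _ _ _ vu va; have /near_seqP N' := ns.
  have H i j : i \in [:: v; u; a] -> j \in [:: v; u; a] -> nearx i j by move=> hi hj; apply: N'.
  have [vi ui ai] : [/\ v \in [:: v; u; a], u \in [:: v; u; a] & a \in [:: v; u; a]] by rewrite !inE !eqxx ?orbT.
  have S1 := side_turn hF tiltH offH r1 eta0 g (qt u v (H _ _ ui vi)) (H _ _ vi vi) (H _ _ vi ui) (H _ _ vi ui).
  have S2 := side_turn hF tiltH offH r1 eta0 g (qt u v (H _ _ ui vi)) (H _ _ vi vi) (H _ _ vi ai) (H _ _ vi ai).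
  have L1 : vnorm (rot (q u v) (side x F g v v u)) <= L.
    by rewrite vnorm_rot //; apply: (side_le hF r1 g); apply: H.
  have L2 : vnorm (side x F g u v a) <= L by apply: (side_le hF r1 g); apply: H.
  have S := cross_diff L2 L1 S2 S1.
  rewrite cross_rot qu scale1 vnorm_subC in S.
  rewrite (area_normal g u v a) dotZr mulN1r mulNr lerN2 vnormZ normrN normr1 mul1r.
  rewrite -(vnorm_rot (cross (pos (yy x F g) v a) (pos (yy x F g) v u)) (qu u v)).
  apply: (antiparallel S) => //; last by apply: mulr_ge0 => //; apply: mulr_ge0.
  apply: (le_trans eta_nu); apply: ler_wpM2l; first exact: sqr_ge0.
  apply: Ar.
    by move: U; rewrite /= !inE !negb_or !andbT => /andP[/andP[h1 h2] h3]; rewrite h1 h2 eq_sym h3.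
  by apply: near_seq_sub ns => z; rewrite !inE; case: (z == v); case: (z == a); case: (z == u).
- move=> v u a U vu va ua; have ns := star _ _ _ vu va; have /near_seqP N' := ns.
  have H i j : i \in [:: v; u; a] -> j \in [:: v; u; a] -> nearx i j by move=> hi hj; apply: N'.
  have [vi ui ai] : [/\ v \in [:: v; u; a], u \in [:: v; u; a] & a \in [:: v; u; a]] by rewrite !inE !eqxx ?orbT.
  have L1 : vnorm (pos (yy x F g) v u) <= L by apply: (side_le hF r1 g); apply: H.
  have L2 : vnorm (pos (yy x F g) v a) <= L by apply: (side_le hF r1 g); apply: H.
  apply: (@le_lt_trans _ _ (800 * t * (L * L))).
    by apply: ler_wpM2l; [rewrite mulr_ge0 | apply: ler_pM; rewrite ?vnorm_ge0].
  apply: (lt_le_trans t_wide).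
  have -> : cross (pos (yy x F g) v a) (pos (yy x F g) v u) = area x F g v v a u by [].
  apply: Ar.
    by move: U; rewrite /= !inE !negb_or !andbT => /andP[/andP[h1 h2] h3]; rewrite h1 h2 eq_sym h3.
  by apply: near_seq_sub ns => z; rewrite !inE; case: (z == v); case: (z == a); case: (z == u).
- move=> v u a U vu va ua.
  have hn : qnorm (holonomy q v u a) = 1 by rewrite /holonomy !qnormM !qu !mulr1.
  have im := holonomy_imag qu qc qt vu va ua.
  split; last exact: le_trans im eta_t.
  by apply: (qnorm_imag hn _ im); apply: le_trans eta_t tt.
- move=> a b e p z v U ab ae be pz pv zv ns /and3P[s1 s2 s3].
  have /near_seqP N' := ns; have H i j : i \in [:: a; b; p; z; v] -> j \in [:: a; b; p; z; v] -> nearx i j by move=> hi hj; apply: N'.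
  have DD i k l m o : all (mem [:: a; b; p; z; v]) [:: i; k; l; m; o] -> uniq [:: k; l; m; o] ->
    det4 (yy x F g) i k l m o != 0 /\ (det4 (yy x F g) i k l m o < 0) = (det4 (yy x F g) k k l m o < 0).
    by move=> /allP h1; apply: Dt; apply: near_seq_sub ns => y /h1.
  move: U; rewrite /= !inE !negb_or !andbT.
  case/and5P=> /and5P[nab nae nap naz nav] /and4P[nbe nbp nbz nbv] _ /andP[npz npv] nzv.
  have [|| x1 y1] := DD a a p z v; rewrite /= ?inE ?eqxx ?orbT // ?negb_or ?nap ?naz ?nav ?npz ?npv ?nzv //.
  have [|| x2 y2] := DD a b p z v; rewrite /= ?inE ?eqxx ?orbT // ?negb_or ?nbp ?nbz ?nbv ?npz ?npv ?nzv //.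
  have [|| x3 _] := DD a a b p z; rewrite /= ?inE ?eqxx ?orbT // ?negb_or ?nab ?nap ?naz ?nbp ?nbz ?npz //.
  have [|| x4 _] := DD a a b z v; rewrite /= ?inE ?eqxx ?orbT // ?negb_or ?nab ?naz ?nav ?nbz ?nbv ?nzv //.
  have [|| x5 _] := DD a a b v p; rewrite /= ?inE ?eqxx ?orbT // ?negb_or ?nab ?nav ?nap ?nbv ?nbp ?(eq_sym v p) ?npv //.
  have B i j : adj i j -> i \in [:: a; b; p; z; v] -> vnorm (side x F g a i j) <= r + 1 / 5.
    move=> ij hi; rewrite sideE; apply: (le_trans (vnorm_proj _ (hF a))).
    by apply: (le_trans (ypt_upper x hF g i j)); rewrite lerD2r nm_subC.
  have [aa bb pp] : [/\ a \in [:: a; b; p; z; v], b \in [:: a; b; p; z; v] & p \in [:: a; b; p; z; v]] by rewrite !inE !eqxx ?orbT.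
  have M := @segment_meets R (yy x F g a a) (yy x F g a b) (yy x F g a p) (yy x F g a z) (yy x F g a v) (r + 1 / 5).
  have {M}hM : vnorm (side x F g a a p) <= 3 * (r + 1 / 5).
    by apply: M => //; [rewrite -y2 in s1; exact: s1 | exact: B | exact: B | exact: B].
  have ap : nm (x p - x a) <= 4 * r.
    have := off_ypt tiltH offH eta0 g (H _ _ aa aa) (H _ _ aa pp).
    have := proj_lower (ypt x F g p - ypt x F g a) (hF a); rewrite -sideE.
    have := ypt_lower x hF g a p; move: hM; have := r1; move: e1'.
    move: (vnorm _) (off _ _) (nm _) (nm _) => *; lra.
  have T i j k l m : nm (x i - x j) <= l -> nm (x j - x k) <= m -> nm (x i - x k) <= l + m.
    by move=> h1 h2; apply: (le_trans (nmB _ (x j) _)); apply: lerD.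
  have Sx i j l : nm (x i - x j) <= l -> nm (x j - x i) <= l by rewrite nm_subC.
  have sA i : i \in [:: a; b; e] -> nm (x i - x a) <= r.
    rewrite !inE => /or3P[] /eqP->; [by rewrite subrr nm0; have := r1; lra | exact: Sx | exact: Sx].
  have sP i : i \in [:: p; z; v] -> nm (x i - x a) <= 5 * r.
    have -> : 5 * r = r + 4 * r by ring.
    rewrite !inE => /or3P[] /eqP->; last by apply: (T _ p) => //; apply: Sx.
      by apply: (T _ p) => //; rewrite subrr nm0; have := r1; lra.
    by apply: (T _ p) => //; apply: Sx.
  have sQ i : i \in [:: a; b; e; p; z; v] -> nm (x i - x a) <= 5 * r.
    move=> hi; have : (i \in [:: a; b; e]) || (i \in [:: p; z; v]) by rewrite -mem_cat.
    case/orP => [/sA h1|/sP //]; by apply: (le_trans h1); have := r1; lra.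
  (* The origin of the radius 10 r in [near]: when a segment meets a triangle, all vertices of both
     triangles lie within 5 r of [a]. *)
  apply/near_seqP => i j hi hj; rewrite /near.
  have -> : 10 * r = 5 * r + 5 * r by ring.
  by apply: (T _ a); [exact: sQ | apply: Sx; exact: sQ].
Qed.

Lemma qnorm_sign (b : bool) (p : quat) : qnorm (qscale ((-1) ^+ b) p) = qnorm p.
Proof. by case: b; rewrite /qnorm /=; ring. Qed.

Lemma rot_sign (b : bool) (p : quat) v : rot (qscale ((-1) ^+ b) p) v = rot p v.
Proof. by case: b; case: p => ? ? ? ?; case: v => ? ? ?; rewrite /rot /=; congr Vec; ring. Qed.

(** Exchanging two vertices inverts the holonomy up to a cyclic permutation of its factors; neither
    operation changes the real part. *)
Lemma holonomy_swap (q : 'I_n -> 'I_n -> quat) : (forall i j, q j i = qconj (q i j)) -> forall v u a : 'I_n,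
  q0 (holonomy q u v a) = q0 (holonomy q v u a) /\ q0 (holonomy q v a u) = q0 (holonomy q v u a).
Proof.
move=> qc v u a; rewrite /holonomy (qc v u) (qc a v) (qc u a).
case: (q v u) => ? ? ? ?; case: (q a v) => ? ? ? ?; case: (q u a) => ? ? ? ?.
by rewrite /qmul /qconj /=; split; ring.
Qed.

Lemma spin_signs (q : 'I_n -> 'I_n -> quat) :
  (forall i j, qnorm (q i j) = 1) -> (forall i j, q j i = qconj (q i j)) ->
  (forall i j, nearx i j -> close_turn (F i) (F j) (q i j) (30 * eta)) ->
  exists e : 'I_n -> 'I_n -> bool, (forall i j, e i j = e j i) /\
    forall v u a, uniq [:: v; u; a] -> adj v u -> adj v a -> adj u a ->
      e v u (+) e v a (+) e u a = (q0 (holonomy q v u a) < 0).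
Proof.
move=> qu qc qt; have [y C] := spin_configuration qu qc qt.
have [e He] := sorted_cochain adjC' (fun c c12 c23 cu ca cc => holonomy_cycle adjC' c12 c23 cu ca cc C).
pose e' (i j : 'I_n) := if (i < j)%N then e (i, j) else e (j, i).
have eC i j : e' i j = e' j i.
  by rewrite /e'; case: (ltngtP i j) => // /val_inj ->.
exists e'; split => // v u a U; move: v u a U; apply: sort3.
- move=> v u a H uv ua va; rewrite (proj1 (holonomy_swap qc v u a)) -H // 1?adjC' //.
  by rewrite (eC u v) addbAC.
- move=> v u a H va vu au; rewrite (proj2 (holonomy_swap qc v u a)) -H // 1?adjC' //.
  by rewrite (eC a u) (addbC (e' v a)).
- move=> v u a va ua nvu avu ava aua.
  have [vu|uv] : (v < u)%N \/ (u < v)%N by move: nvu; rewrite -val_eqE neq_ltn => /orP.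
    by rewrite -He /e' /ordlt ?vu ?va ?ua ?avu ?ava ?aua //= addbAC.
  rewrite -(proj1 (holonomy_swap qc v u a)) -He /e' /ordlt ?uv ?va ?ua ?(adjC' u v) ?avu ?ava ?aua //=.
  by rewrite ltnNge (ltnW uv) /= addbAC.
Qed.

(** Every holonomy is close to 1 or to -1. The signs from [spin_signs] make all the real parts
    positive, so every holonomy of three distinct adjacent points is close to 1. *)
Lemma spin_cocycle : exists q : 'I_n -> 'I_n -> quat,
  [/\ forall i j, qnorm (q i j) = 1, forall i, q i i = @qone R,
      forall i j, nearx i j -> close_turn (F i) (F j) (q i j) (30 * eta) &
      forall i j k, adj i j -> adj j k -> adj i k -> qle (qsub (qmul (q i j) (q j k)) (q i k)) w].
Proof.
have [q [qu qc q1' qt]] := transition_exists; have [e [eC He]] := spin_signs qu qc qt.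
pose q' i j := if i == j then @qone R else qscale ((-1) ^+ e i j) (q i j).
have q'E i j : i != j -> q' i j = qscale ((-1) ^+ e i j) (q i j) by rewrite /q' => /negbTE ->.
have q'c i j : q' j i = qconj (q' i j).
  rewrite /q' eq_sym; case: eqP => _; first by rewrite /qconj /qone /= oppr0.
  by rewrite eC qc; rewrite /qscale /qconj /=; congr Quat; ring.
have q'u i j : qnorm (q' i j) = 1.
  by rewrite /q'; case: eqP => _; rewrite ?qnorm_sign // /qnorm /= !expr0n expr1n /= !addr0.
have q't i j : nearx i j -> close_turn (F i) (F j) (q' i j) (30 * eta).
  move=> nij v; have := qt _ _ nij v; rewrite /q'; case: eqP => [<-|_]; last by rewrite rot_sign.
  by rewrite q1'.
have q'1 i : q' i i = @qone R by rewrite /q' eqxx.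
have zero p : qle (qsub p p) w.
  by apply/and4P; split; rewrite /= subrr normr0.
exists q'; split => // i j k ij jk ik.
have [<-|nij] := eqVneq i j; first by rewrite q'1 mul1q.
have [<-|njk] := eqVneq j k; first by rewrite q'1 qmul1.
have [<-|nik] := eqVneq i k; first by rewrite (q'c i j) qmulV // q'1.
have U : uniq [:: i; k; j] by rewrite /= !inE negb_or nik nij eq_sym njk.
have kj : adj k j by rewrite adjC'.
have im := holonomy_imag q'u q'c q't ik ij kj.
have hn : qnorm (holonomy q' i k j) = 1 by rewrite /holonomy !qnormM !q'u !mulr1.
have im0 := holonomy_imag qu qc qt ik ij kj.
have hn0 : qnorm (holonomy q i k j) = 1 by rewrite /holonomy !qnormM !qu !mulr1.
have tt : 120 * eta <= 1 / 2 by apply: (le_trans eta_t); apply: small_square.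
have big := qnorm_imag hn0 tt im0.
have pos : 0 < q0 (holonomy q' i k j).
  have E : q0 (holonomy q' i k j) = (-1) ^+ (e i k (+) e i j (+) e k j) * q0 (holonomy q i k j).
    rewrite /holonomy !q'E // 1?eq_sym // !signr_addb (eC j k) (eC k i); case: (q i j) => ? ? ? ?; case: (q j k) => ? ? ? ?; case: (q k i) => ? ? ? ?.
    by rewrite /qmul /qscale /=; ring.
  rewrite E He //; case: (ltrgtP (q0 (holonomy q i k j)) 0) big => // h big.
  - by rewrite expr1 mulN1r oppr_gt0.
  - by rewrite expr0 mul1r.
  - by move: big; rewrite h normr0; lra.
have w4 : 0 <= w / 4 by apply: divr_ge0.
have w41 : w / 4 <= 1 by have := w1; lra.
have H := qnear_one hn w4 w41 pos (le_trans im eta_w).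
have -> : qsub (qmul (q' i j) (q' j k)) (q' i k) =
    qmul (qsub (holonomy q' i k j) (@qone R)) (q' i k).
  have -> : qmul (q' i j) (q' j k) = qmul (holonomy q' i k j) (q' i k).
    by rewrite /holonomy -!qmulA (q'c i k) qmulVl // qmul1.
  move: (holonomy q' i k j) (q' i k) => [? ? ? ?] [? ? ? ?].
  by rewrite /qsub /qmul /=; congr Quat; ring.
have u1 : qnorm (q' i k) <= 1 by rewrite q'u.
have := qle_mul H (qle_unit u1).
by rewrite mulr1 mulrCA divff ?mulr1 // pnatr_eq0.
Qed.

End Spin.

(** [t] is dictated by the thinness of triangles. Then 2000 l^3 [eta] is set to a product of t^2,
    nu1, nu and w^2; as all factors are at most one, it lies below each of the required bounds. *)
Lemma choose_constants (R : rcfType) (l nu1 nu w : R) : 20 <= l -> 0 < nu1 -> nu1 <= 1 / 100 ->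
  0 < nu -> nu <= nu1 -> 0 < w -> w <= 1 -> exists t eta,
  [/\ 0 < t, t <= 1 / 10000, 800 * t * (l * l) < nu1, 0 < eta &
   [/\ 120 * eta <= t ^+ 2, 2 * l * (40 * l * eta) <= t ^+ 2 * nu1,
     40 * l ^+ 3 * eta * 6 <= nu, 120 * eta <= (w / 4) ^+ 2 & 30 * eta <= w]].
Proof.
move=> l20 nu10 nu11 nu0 nun w0 w1.
have l0 : 0 < l by lra.
have ll0 : 0 < l * l by rewrite mulr_gt0.
have ll1 : 400 <= l * l by nra.
have [t tE] : exists t, 1600 * (l * l) * t = nu1.
  by exists (nu1 / (1600 * (l * l))); rewrite mulrC divfK // gt_eqF // mulr_gt0.
have c0 : 0 < 1600 * (l * l) by rewrite mulr_gt0.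
have t0 : 0 < t by rewrite -(pmulr_rgt0 _ c0) tE.
have t1 : t <= 1 / 10000.
  have : 400 * t <= l * l * t by rewrite ler_pM2r.
  by move: tE nu11; rewrite -mulrA; move: (l * l * t) => z; clear; lra.
have l3 : 0 < l ^+ 3 by rewrite exprn_gt0.
have t20 : 0 < t ^+ 2 by rewrite exprn_gt0.
have w20 : 0 < w ^+ 2 by rewrite exprn_gt0.
have [eta eE] : exists eta, 2000 * (l ^+ 3 * eta) = t ^+ 2 * nu1 * nu * w ^+ 2.
  by exists (t ^+ 2 * nu1 * nu * w ^+ 2 / (2000 * l ^+ 3)); rewrite mulrA mulrC divfK // gt_eqF // mulr_gt0.
have p0 : 0 < t ^+ 2 * nu1 * nu * w ^+ 2 by do 3 (apply: mulr_gt0 => //).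
have e0 : 0 < eta by move: p0; rewrite -eE pmulr_rgt0 // pmulr_rgt0.
have t11 : t <= 1 by move: t1; clear; lra.
have t21 : t ^+ 2 <= 1 by rewrite exprn_ile1 // ltW.
have w21 : w ^+ 2 <= 1 by rewrite exprn_ile1 // ltW.
have nu1l : nu1 <= 1 by move: nu11; clear; lra.
have nul : nu <= 1 by move: nun nu11; clear; lra.
have bnd (a b c d : R) : 0 < a -> a <= 1 -> 0 < b -> b <= 1 -> 0 < c -> c <= 1 -> 0 < d -> a * b * c * d <= d.
  move=> a0 a1 b0 b1 {}c0 c1 d0; apply: ler_piMl; first exact: ltW.
  by apply: mulr_ile1 => //; [rewrite mulr_ge0 // ltW | exact: ltW | rewrite mulr_ile1 // ltW].
have b1 : 2000 * (l ^+ 3 * eta) <= nu.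
  rewrite eE; have -> : t ^+ 2 * nu1 * nu * w ^+ 2 = t ^+ 2 * nu1 * w ^+ 2 * nu by ring.
  exact: bnd.
have b2 : 2000 * (l ^+ 3 * eta) <= w ^+ 2 by rewrite eE; exact: bnd.
have tn0 : 0 < t ^+ 2 * nu1 by rewrite mulr_gt0.
have b3 : 2000 * (l ^+ 3 * eta) <= t ^+ 2 * nu1.
  rewrite eE -mulrA; apply: ler_piMr; first exact: ltW.
  by rewrite mulr_ile1 // ltW.
have b4 : 2000 * (l ^+ 3 * eta) <= t ^+ 2.
  by apply: (le_trans b3); apply: ler_piMr => //; exact: ltW.
have le1 : eta <= l ^+ 3 * eta.
  apply: ler_peMl; first exact: ltW.
  by rewrite exprn_ege1 //; move: l20; clear; lra.
have le2 : l * (l * eta) <= l ^+ 3 * eta.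
  have -> : l ^+ 3 * eta = l * (l * (l * eta)) by ring.
  rewrite ler_pM2l //; apply: ler_peMl; last by move: l20; clear; lra.
  by rewrite mulr_ge0 // ltW.
have w2 : w ^+ 2 <= w by rewrite expr2 ger_pMr.
exists t, eta; clear bnd; split => //.
  have -> : 800 * t * (l * l) = 800 * (l * l * t) by ring.
  have : 0 < l * l * t by rewrite mulr_gt0.
  by move: tE; rewrite -mulrA; move: (l * l * t) => z; clear; lra.
split.
- by move: b4 le1 e0; move: (l ^+ 3 * eta) => z; clear; lra.
- have -> : 2 * l * (40 * l * eta) = 80 * (l * (l * eta)) by ring.
  by move: b3 le1 le2 e0; move: (l ^+ 3 * eta) (l * (l * eta)) => z z'; clear; lra.
- have -> : 40 * l ^+ 3 * eta * 6 = 240 * (l ^+ 3 * eta) by ring.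
  by move: b1 le1 e0; move: (l ^+ 3 * eta) => z; clear; lra.
- have -> : (w / 4) ^+ 2 = w ^+ 2 / 16 by field.
  by move: b2 le1 e0; move: (l ^+ 3 * eta) => z; clear; lra.
- by move: b2 w2 le1 e0; move: (l ^+ 3 * eta) => z; clear; lra.
Qed.

(** The order of the quantifiers matters: [eta] depends on [r], [w] and [K] and not on the net,
    which is refined only after [eta] is known. *)
Theorem spin_net (R : rcfType) (r w : R) (K : nat) : 1 <= r -> 0 < w ->
  exists2 eta, 0 < eta & forall n N (x : 'I_n -> 'rV[R]_N) (F : 'I_n -> triad R N),
  (forall i, orthonormal (F i)) -> (forall i j, i != j -> 1 <= nm (x i - x j)) ->
  (forall i, #|[set j | near x r i j]| <= K)%N ->
  (forall i j, near x r i j -> [/\ tilt (F i) (F j) eta, off (F i) (x j - x i) <= eta &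
     0 < det3 (turn (F i) (F j) (@e1 R)) (turn (F i) (F j) (Vec 0 1 0)) (turn (F i) (F j) (@e3 R))]) ->
  exists q : 'I_n -> 'I_n -> quat R,
  [/\ forall i j, qnorm (q i j) = 1, forall i, q i i = @qone R,
      forall i j, near x r i j -> close_turn (F i) (F j) (q i j) w &
      forall i j k, nm (x i - x j) <= r -> nm (x j - x k) <= r -> nm (x i - x k) <= r ->
        qle (qsub (qmul (q i j) (q j k)) (q i k)) w].
Proof.
move=> r1 w0; pose w' := Num.min w 1.
have w'0 : 0 < w' by rewrite lt_min w0 ltr01.
have w'1 : w' <= 1 by rewrite ge_min lexx orbT.
have w'w : w' <= w by rewrite ge_min lexx.
have k0 := kappa_gt0 R K; have [nun nu11] := nu_le R K.
have nu0 := nu_gt0 R K.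
have nu10 : 0 < kappa_of R K / 100 by rewrite divr_gt0.
have l20 : 20 <= 20 * r by lra.
have [t [eta [t0 t1 tw e0 [c1 c2 c3 c4 c5]]]] := choose_constants l20 nu10 nu11 nu0 nun w'0 w'1.
exists eta => // n N x F hF sep card H.
have tl i j : near x r i j -> tilt (F i) (F j) eta by move=> /H[].
have of' i j : near x r i j -> off (F i) (x j - x i) <= eta by move=> /H[].
have dt i j : near x r i j ->
  0 < det3 (turn (F i) (F j) (@e1 R)) (turn (F i) (F j) (Vec 0 1 0)) (turn (F i) (F j) (@e3 R)) by move=> /H[].
have [q [q1' q2' q3' q4']] := @spin_cocycle R n N K x F r eta t w' hF sep tl of' dt card r1 (ltW e0) c3 (ltW t0) t1 tw c1 c2 (ltW w'0) w'1 c4.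
exists q; split => // [i j nij v|i j k ij jk ik].
  apply: (le_trans (q3' _ _ nij v)); apply: ler_wpM2r; first exact: vnorm_ge0.
  exact: le_trans c5 w'w.
by apply: (@qle_trans _ _ w') => //; apply: q4'.
Qed.

End Spin.

From mathcomp Require Import all_classical all_reals.

(** * A quantitative dimension count: 3-dimensional families in a 4-dimensional fibre *)

Module Frame.

Import Core Geo Config Config2 Config3 Sign Euclid Net Generic SpinNet Spin.
Set Implicit Arguments.
Unset Strict Implicit.
Unset Printing Implicit Defensive.
Import Order.TTheory GRing.Theory Num.Theory.
Local Open Scope ring_scope.

Section Avoid.

Variable R : realType.
Local Notation vec := (vec R).
Local Notation quat := (quat R).

Lemma truncn_eq_close (x y : R) : 0 <= x -> 0 <= y -> Num.truncn x = Num.truncn y -> `|x - y| < 1.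
Proof.
move=> x0 y0 e; have /andP[a1 a2] := truncn_itv x0; have /andP[b1 b2] := truncn_itv y0.
rewrite e -(addn1 (Num.truncn y)) natrD in a1 a2; rewrite -(addn1 (Num.truncn y)) natrD in b2.
by rewrite ltr_norml; apply/andP; split; lra.
Qed.

Lemma truncn_lt (x : R) (m : nat) : 0 <= x -> x <= m%:R -> (Num.truncn x < m.+1)%N.
Proof.
move=> x0 xm; have /andP[a1 _] := truncn_itv x0.
by rewrite ltnS -(ler_nat R); apply: le_trans xm.
Qed.

Definition cell (k : nat) (z : R) : 'I_k.+1 := inord (Num.truncn ((z + 1) * k%:R / 2)).

Lemma cell_close k (z z' : R) : (0 < k)%N -> `|z| <= 1 -> `|z'| <= 1 -> cell k z = cell k z' ->
  `|z - z'| <= 2 / k%:R.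
Proof.
rewrite !ler_norml => k0 /andP[z1 z2] /andP[z3 z4] /(congr1 val) /=.
have kp : 0 < k%:R :> R by rewrite ltr0n.
have B (y : R) : -1 <= y -> y <= 1 -> 0 <= (y + 1) * k%:R / 2 /\ (y + 1) * k%:R / 2 <= k%:R.
  move=> y1 y2; split; first by apply: divr_ge0 => //; apply: mulr_ge0; [lra | exact: ltW].
  rewrite ler_pdivrMr // mulrC ler_pM2l //; lra.
have [a1 a2] := B _ z1 z2; have [b1 b2] := B _ z3 z4.
rewrite !inordK ?truncn_lt // => /(truncn_eq_close a1 b1).
have -> : (z + 1) * k%:R / 2 - (z' + 1) * k%:R / 2 = (z - z') * (k%:R / 2) by field.
rewrite normrM (@gtr0_norm _ (k%:R / 2)) ?divr_gt0 // -ltr_pdivlMr ?divr_gt0 // => /ltW h.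
by rewrite -ler_norml; apply: (le_trans h); rewrite mul1r invf_div.
Qed.

Lemma vnorm_le_comps (u : vec) (t : R) : `|vx u| <= t -> `|vy u| <= t -> `|vz u| <= t -> vnorm u <= 3 * t.
Proof.
move=> h1 h2 h3; have t0 : 0 <= t by apply: le_trans h1; exact: normr_ge0.
rewrite -(@ler_pXn2r _ 2%N) ?nnegrE ?vnorm_ge0 ?mulr_ge0 // vnorm2 /dot.
have S (y : R) : `|y| <= t -> y * y <= t ^+ 2.
  by move=> hy; rewrite -expr2 -[y ^+ 2]real_normK ?num_real // lerXn2r ?nnegrE.
have := S _ h1; have := S _ h2; have := S _ h3; have := sqr_ge0 t; rewrite exprMn; lra.
Qed.

(** A pigeonhole form of Sard's argument. If each of n^4 shifts on a grid produced an almost zero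
    somewhere, two of the points would share one of (k+1)^3 cells; there [s] and [psi] hardly vary,
    which contradicts the distance between the two shifts. *)
Lemma avoid_zero (B c0 rho : R) : 0 < B -> 0 < c0 -> 0 < rho -> rho <= 1 ->
  exists2 kp, 0 < kp & forall (T : Type) (core : T -> Prop) (z : T -> vec) (s : T -> quat) (psi : T -> R),
  (forall p, core p -> [/\ `|vx (z p)| <= 1, `|vy (z p)| <= 1, `|vz (z p)| <= 1 & c0 <= psi p]) ->
  (forall p p', core p -> core p' -> qle (qsub (s p) (s p')) (B * vnorm (vsub (z p) (z p'))) /\
      `|psi p - psi p'| <= B * vnorm (vsub (z p) (z p'))) ->
  exists a : quat, qle a rho /\ forall p, core p -> ~~ qle (qadd (s p) (qscale (psi p) a)) kp.
Proof.
move=> B0 c00 rho0 rho1.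
(* Cells of side 2/k keep the variation below a quarter of [c0 * rho / n], which needs t >= 24 B /
   (c0 rho). The count n^4 > (2 t n)^3 >= (k+1)^3 needs n > 8 t^3. *)
pose t := (Num.truncn (24 * B / (c0 * rho))).+1; pose n := (8 * t ^ 3).+1; pose k := (t * n)%N.
have cr0 : 0 < c0 * rho by rewrite mulr_gt0.
have tB : 24 * B <= c0 * rho * t%:R.
  rewrite -ler_pdivrMl // mulrC; have x0 : 0 <= 24 * B / (c0 * rho) by rewrite divr_ge0 ?ltW // mulr_gt0.
  by have /andP[_ /ltW] := truncn_itv x0.
have n0 : 0 < n%:R :> R by rewrite ltr0n.
have t0 : 0 < t%:R :> R by rewrite ltr0n.
have k0 : (0 < k)%N by rewrite muln_gt0.
have kE : k%:R = t%:R * n%:R :> R by rewrite natrM.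
have kp0 : 0 < k%:R :> R by rewrite ltr0n.
exists (c0 * rho / (8 * n%:R)); first by rewrite divr_gt0 // mulr_gt0.
move=> T core z s psi hz hl; apply: contrapT => hne.
pose cand (c : 'I_n * 'I_n * 'I_n * 'I_n) : quat :=
  qscale (rho / n%:R) (Quat c.1.1.1%:R c.1.1.2%:R c.1.2%:R c.2%:R).
have bnd (i : 'I_n) : `|rho / n%:R * i%:R| <= rho.
  have q0' : 0 <= rho / n%:R by apply: divr_ge0; apply: ltW.
  rewrite ger0_norm; last exact: mulr_ge0.
  rewrite mulrAC ler_pdivrMr // ler_pM2l // ler_nat; exact: ltnW.
have cl c : qle (cand c) rho by apply/and4P; split; exact: bnd.
have wit c : exists p, core p /\ qle (qadd (s p) (qscale (psi p) (cand c))) (c0 * rho / (8 * n%:R)).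
  apply: contrapT => h; apply: hne; exists (cand c); split => // p cp.
  by apply/negP => hq; apply: h; exists p.
have [g Hg] := fin_all_exists wit.
pose f c := (cell k (vx (z (g c))), cell k (vy (z (g c))), cell k (vz (z (g c)))).
have : ~~ injectiveb f.
  apply/negP => /injectiveP/leq_card; rewrite !card_prod !card_ord leqNgt => /negP; apply.
  have h1 : (k.+1 <= 2 * (t * n))%N by rewrite mul2n -addnn -/k -addn1 leq_add2l.
  have h2 : (k.+1 * k.+1 * k.+1 <= 2 * (t * n) * (2 * (t * n)) * (2 * (t * n)))%N by rewrite !leq_mul.
  apply: (leq_ltn_trans h2); have -> : (2 * (t * n) * (2 * (t * n)) * (2 * (t * n)) = 8 * t ^ 3 * (n * n * n))%N.
    by ring.
  have -> : (n * n * n * n = n * (n * n * n))%N by ring.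
  by rewrite ltn_pmul2r // !muln_gt0.
case/injectivePn => c [c' cc' fe]; have [[e1' e2'] e3'] : (cell k (vx (z (g c))) = cell k (vx (z (g c'))) /\
   cell k (vy (z (g c))) = cell k (vy (z (g c')))) /\ cell k (vz (z (g c))) = cell k (vz (z (g c'))).
  by case: fe => -> -> ->.
have [cp hp] := Hg c; have [cp' hp'] := Hg c'.
have [x1 y1 z1 pc] := hz _ cp; have [x2 y2 z2 _] := hz _ cp'.
have d : vnorm (vsub (z (g c)) (z (g c'))) <= 3 * (2 / k%:R).
  by apply: vnorm_le_comps; apply: cell_close.
have [ls lp] := hl _ _ cp cp'.
have Bd : B * vnorm (vsub (z (g c)) (z (g c'))) <= c0 * rho / (4 * n%:R).
  apply: (@le_trans _ _ (B * (3 * (2 / k%:R)))); first by rewrite ler_pM2l.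
  rewrite kE -subr_ge0; have -> : c0 * rho / (4 * n%:R) - B * (3 * (2 / (t%:R * n%:R))) =
     (c0 * rho * t%:R - 24 * B) / (4 * (t%:R * n%:R)) by field; rewrite !gt_eqF.
  by rewrite divr_ge0 ?subr_ge0 // !mulr_ge0 // ltW.
have ls' := qle_trans ls Bd; have lp' := le_trans lp Bd.
have main (u v i i' ci ci' : R) : ci = i * (rho / n%:R) -> ci' = i' * (rho / n%:R) -> `|ci'| <= rho ->
   1 <= `|i - i'| -> `|u + psi (g c) * ci| <= c0 * rho / (8 * n%:R) ->
   `|v + psi (g c') * ci'| <= c0 * rho / (8 * n%:R) -> `|u - v| <= c0 * rho / (4 * n%:R) -> False.
  move=> E E' cb ii hu hv huv.
  have q0' : 0 < rho / n%:R by rewrite divr_gt0.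
  have h1 : c0 * (rho / n%:R) <= `|psi (g c) * (ci - ci')|.
    rewrite E E' -mulrBl normrM (gtr0_norm (lt_le_trans c00 pc)) normrM (gtr0_norm q0').
    apply: ler_pM => //; [exact: ltW | exact: ltW |].
    by rewrite -[X in X <= _]mul1r ler_pM2r.
  have h2 : psi (g c) * (ci - ci') = (u + psi (g c) * ci) - (v + psi (g c') * ci') - (u - v) - (psi (g c) - psi (g c')) * ci' by ring.
  have h3 : `|(psi (g c) - psi (g c')) * ci'| <= c0 * rho / (4 * n%:R).
    rewrite normrM -[X in _ <= X]mulr1; apply: ler_pM => //; exact: le_trans cb rho1.
  have h4 : `|psi (g c) * (ci - ci')| <= 3 / 4 * (c0 * (rho / n%:R)).
    rewrite h2; apply: (le_trans (ler_normB _ _)).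
    have := le_trans (ler_normB (u + psi (g c) * ci - (v + psi (g c') * ci')) (u - v)) (lerD (le_trans (ler_normB _ _) (lerD hu hv)) huv).
    have -> : c0 * rho / (8 * n%:R) = c0 * (rho / n%:R) / 8 by field; rewrite gt_eqF.
    have E4 : c0 * rho / (4 * n%:R) = c0 * (rho / n%:R) / 4 by field; rewrite gt_eqF.
    move: h3; rewrite E4; move: (`|_|) (`|_|) (c0 * _) => a b e; lra.
  have : 0 < c0 * (rho / n%:R) by rewrite mulr_gt0.
  by move: h1 h4; move: (`|_|) (c0 * _) => a b; lra.
have D (i j : 'I_n) : i != j -> 1 <= `|i%:R - j%:R| :> R.
  rewrite -val_eqE neq_ltn => /orP[] h; first rewrite distrC;
    by rewrite -natrB ?(ltnW h) // normr_nat ler1n subn_gt0.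
have ne : [|| c.1.1.1 != c'.1.1.1, c.1.1.2 != c'.1.1.2, c.1.2 != c'.1.2 | c.2 != c'.2].
  move: cc'; case: (c) (c') => [[[? ?] ?] ?] [[[? ?] ?] ?] /=; rewrite !xpair_eqE !negb_and.
  by rewrite -!orbA.
case/and4P: hp => p0 p1 p2 p3; case/and4P: hp' => p0' p1' p2' p3'.
case/and4P: ls' => l0 l1 l2 l3; case/and4P: (cl c') => b0 b1 b2 b3.
case/or4P: ne => /D ii.
- by apply: (main _ _ _ _ _ _ _ _ b0 ii p0 p0' l0); rewrite /= mulrC.
- by apply: (main _ _ _ _ _ _ _ _ b1 ii p1 p1' l1); rewrite /= mulrC.
- by apply: (main _ _ _ _ _ _ _ _ b2 ii p2 p2' l2); rewrite /= mulrC.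
- by apply: (main _ _ _ _ _ _ _ _ b3 ii p3 p3' l3); rewrite /= mulrC.
Qed.

End Avoid.

End Frame.

(** * A section of the quaternion bundle bounded away from zero *)

Module Frame2.

Import Core Geo Config Config2 Config3 Sign Euclid Net Generic SpinNet Spin Frame.
Set Implicit Arguments.
Unset Strict Implicit.
Unset Printing Implicit Defensive.
Import Order.TTheory GRing.Theory Num.Theory.
Local Open Scope ring_scope.

(** Points of one colour are not near each other, so their coefficients can be corrected
    simultaneously, and the number of rounds does not depend on the net. *)
Lemma proper_coloring (n K : nat) (e : rel 'I_n) : symmetric e ->
  (forall i, #|[set j | e i j]| <= K)%N ->
  exists f : 'I_n -> 'I_K.+1, forall i j, e i j -> i != j -> f i != f j.
Proof.
move=> eC hK; have [|i f hf|f hf] := @greedy n 'I_K.+1 ord0 (fun i f => forall j : 'I_n, (j < i)%N -> e i j -> f j != f i).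
- by move=> i f g fg h j ji ij; rewrite -!fg // ?h // ltnW.
- have [c hc] : exists c, c \notin f @: [set j | e i j].
    case: (pickP (fun c => c \notin f @: [set j | e i j])) => [c|h]; first by exists c.
    have : (#|'I_K.+1| <= #|f @: [set j | e i j]|)%N.
      by rewrite -cardsT; apply: subset_leq_card; apply/fintype.subsetP => c _; apply/negPn; rewrite h.
    by rewrite card_ord leqNgt ltnS (leq_trans (leq_imset_card _ _) (hK i)).
  exists c => j ji ij; rewrite eqxx ifN; last by rewrite -val_eqE neq_ltn ji.
  by apply: contraNneq hc => <-; apply: imset_f; rewrite inE.
exists f => i j ij; rewrite -val_eqE neq_ltn => /orP[] h; first by apply: hf; rewrite // eC.
by rewrite eq_sym; exact: hf.
Qed.

Section Quaternions.

Variable R : realType.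
Local Notation vec := (vec R).
Local Notation quat := (quat R).

Definition qzero : quat := Quat 0 0 0 0.
Definition qsum (I : finType) (f : I -> quat) : quat :=
  Quat (\sum_j q0 (f j)) (\sum_j q1 (f j)) (\sum_j q2 (f j)) (\sum_j q3 (f j)).

Lemma sum_le_card (I : finType) (A : {set I}) (f : I -> R) t :
  (forall j, j \notin A -> f j = 0) -> (forall j, j \in A -> `|f j| <= t) ->
  `|\sum_j f j| <= #|A|%:R * t.
Proof.
move=> h0 h1; rewrite (bigID (mem A)) /= [X in _ + X]big1 // addr0.
apply: (le_trans (ler_norm_sum _ _ _)); rewrite mulr_natl -sumr_const.
exact: ler_sum.
Qed.

Lemma qle_qsum (I : finType) (A : {set I}) (f : I -> quat) t :
  (forall j, j \notin A -> f j = qzero) -> (forall j, j \in A -> qle (f j) t) ->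
  qle (qsum f) (#|A|%:R * t).
Proof.
move=> h0 h1; by apply/and4P; split; (apply: sum_le_card => j jA; [rewrite h0 | case/and4P: (h1 _ jA)]).
Qed.

Lemma qle_scale (k : R) (p : quat) (s t : R) : `|k| <= s -> qle p t -> qle (qscale k p) (s * t).
Proof. by move=> ks /and4P[h0 h1 h2 h3]; apply/and4P; split; rewrite normrM ler_pM. Qed.

Lemma qle0 t : 0 <= t -> qle qzero t.
Proof. by move=> h; apply/and4P; split; rewrite /= normr0. Qed.

Lemma not_qle_add (p d : quat) (s t u : R) : ~~ qle p s -> qle d t -> u + t <= s -> ~~ qle (qadd p d) u.
Proof.
move=> np hd us; apply: contra np => h.
have -> : p = qadd (qadd p d) (qscale (-1) d).
  by move: p d {h hd} => [? ? ? ?] [? ? ? ?]; rewrite /qadd /qscale /=; congr Quat; ring.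
apply: qle_trans us; apply: qle_add => //; rewrite -[t]mul1r; apply: qle_scale => //.
by rewrite normrN normr1.
Qed.

(** The constants refer to the image rescaled so that the net has spacing one; they stay the same
    when the mesh shrinks. [nd_flat] makes the set [P] near a net point a graph over the tangent
    space, which is where dimension three enters. *)
Record net_data (K : nat) (Lam c0 : R) (n N : nat) (x : 'I_n -> 'rV[R]_N) (F : 'I_n -> triad R N)
  (P : 'rV[R]_N -> Prop) (psi : 'I_n -> 'rV[R]_N -> R) : Prop := NetData {
  nd_orth : forall i, orthonormal (F i);
  nd_card : forall i, (#|[set j | near x 4 i j]| <= K)%N;
  nd_flat : forall i p p', P p -> P p' -> nm (p - x i) <= 40 -> nm (p' - x i) <= 40 ->
    nm (p - p') <= 2 * vnorm (proj (F i) (p - p'));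
  nd_psi01 : forall j p, P p -> 0 <= psi j p <= 1;
  nd_psi_supp : forall j p, P p -> psi j p != 0 -> nm (p - x j) <= 2;
  nd_psi_core : forall j p, P p -> nm (p - x j) <= 1 -> c0 <= psi j p;
  nd_psi_lip : forall j p p', P p -> P p' -> nm (p - x j) <= 50 -> nm (p' - x j) <= 50 ->
    `|psi j p - psi j p'| <= Lam * nm (p - p') }.

Section NetSection.

Variables (K : nat) (Lam c0 : R).
Hypothesis Lam0 : 0 < Lam.
Hypothesis c00 : 0 < c0.

(** The section with coefficients [a], read in the trivialisation at l. As [q] is only nearly a
    cocycle, the readings at different l agree only approximately. *)
Definition sect n N (psi : 'I_n -> 'rV[R]_N -> R) (q : 'I_n -> 'I_n -> quat) a l p :=
  qsum (fun j => qscale (psi j p) (qmul (q l j) (a j))).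

Section Local.

Variables (n N : nat) (x : 'I_n -> 'rV[R]_N) (F : 'I_n -> triad R N) (P : 'rV[R]_N -> Prop).
Variables (psi : 'I_n -> 'rV[R]_N -> R) (q : 'I_n -> 'I_n -> quat).
Hypothesis D : net_data K Lam c0 x F P psi.
Hypothesis qu : forall i j, qnorm (q i j) = 1.

Lemma nm_tri (a b c : 'rV[R]_N) (s t : R) : nm (a - b) <= s -> nm (c - b) <= t -> nm (a - c) <= s + t.
Proof. by move=> h1 h2; apply: (le_trans (nmB _ b _)); apply: lerD => //; rewrite nm_subC. Qed.

Lemma term_le j l p (b : quat) t : P p -> qle b t -> 0 <= t -> qle (qscale (psi j p) (qmul (q l j) b)) (4 * t).
Proof.
move=> Pp hb t0; rewrite -[4 * t]mul1r; apply: qle_scale.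
  by have /andP[h0 h1] := nd_psi01 D j Pp; rewrite ger0_norm.
have u1 : qnorm (q l j) <= 1 by rewrite qu.
by have := qle_mul (qle_unit u1) hb; rewrite mul1r.
Qed.

Lemma far_zero j l p (b : quat) d : P p -> nm (p - x l) <= d -> d <= 38 -> ~~ near x 4 l j ->
  qscale (psi j p) (qmul (q l j) b) = qzero.
Proof.
move=> Pp pl d38 nn; have -> : psi j p = 0; last by rewrite /qscale /qzero !mul0r.
apply/eqP; apply: contraNT nn => /(nd_psi_supp D Pp) pj.
have := @nm_tri (x l) p (x j) d 2; rewrite (nm_subC _ p) (nm_subC _ p) => /(_ pl pj) h.
by rewrite /near; apply: (le_trans h); lra.
Qed.

Lemma sect_le (a : 'I_n -> quat) (C : pred 'I_n) l p t d : P p -> nm (p - x l) <= d -> d <= 38 -> 0 <= t ->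
  (forall j, C j -> qle (a j) t) ->
  qle (qsum (fun j => if C j then qscale (psi j p) (qmul (q l j) (a j)) else qzero)) (K%:R * (4 * t)).
Proof.
move=> Pp pl d38 t0 ha; have t40 : 0 <= 4 * t by rewrite mulr_ge0.
apply: (@qle_trans _ _ (#|[set j | near x 4 l j]|%:R * (4 * t))); last first.
  by rewrite ler_wpM2r // ler_nat (nd_card D).
apply: qle_qsum => j; rewrite inE => hj; case: ifP => Cj //; first exact: far_zero pl d38 hj.
  by apply: term_le => //; apply: ha.
exact: qle0.
Qed.

Lemma sect_lip (a : 'I_n -> quat) l p p' : P p -> P p' -> nm (p - x l) <= 1 -> nm (p' - x l) <= 1 ->
  (forall j, qle (a j) 1) ->
  qle (qsub (sect psi q a l p) (sect psi q a l p')) (K%:R * (4 * Lam * nm (p - p'))).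
Proof.
move=> Pp Pp' pl pl' ha.
have t0 : 0 <= 4 * Lam * nm (p - p') by rewrite !mulr_ge0 ?nm_ge0 // ltW.
have -> : qsub (sect psi q a l p) (sect psi q a l p') =
   qsum (fun j => qscale (psi j p - psi j p') (qmul (q l j) (a j))).
  rewrite /sect /qsum /qsub; cbn [q0 q1 q2 q3]; congr Quat; rewrite -sumrB; apply: eq_bigr => j _;
  by case: (qmul _ _) => ? ? ? ?; rewrite /qscale /= mulrBl.
apply: (@qle_trans _ _ (#|[set j | near x 4 l j]|%:R * (4 * Lam * nm (p - p')))); last first.
  by rewrite ler_wpM2r // ler_nat (nd_card D).
apply: qle_qsum => j; rewrite inE => hj.
  have psi0 z : P z -> nm (z - x l) <= 1 -> psi j z = 0.
    move=> Pz zl; apply/eqP; apply: contraNT hj => /(nd_psi_supp D Pz) zj.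
    have := @nm_tri (x l) z (x j) 1 2; rewrite (nm_subC _ z) (nm_subC _ z) => /(_ zl zj) h.
    by rewrite /near; apply: (le_trans h); lra.
  by rewrite !psi0 // subrr /qscale /qzero !mul0r.
have u1 : qnorm (q l j) <= 1 by rewrite qu.
have := qle_mul (qle_unit u1) (ha j); rewrite !mulr1 => h4.
have {}hj : nm (x l - x j) <= 40 by move: hj; rewrite /near => h; apply: (le_trans h); lra.
have -> : 4 * Lam * nm (p - p') = (Lam * nm (p - p')) * 4 by ring.
apply: qle_scale => //; apply: (nd_psi_lip D) => //.
  have := @nm_tri p (x l) (x j) 1 40 pl; rewrite nm_subC => /(_ hj) h; apply: (le_trans h); lra.
have := @nm_tri p' (x l) (x j) 1 40 pl'; rewrite nm_subC => /(_ hj) h; apply: (le_trans h); lra.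
Qed.

End Local.

(** One colour is treated at a time. Near a point l of colour c the only new coefficient is that of
    l itself, and [avoid_zero] chooses it. Near points of earlier colours the change is at most 4 K
    rho, and [rho] is so small that half of the previous lower bound survives. *)
Lemma nonvanishing_step (c : nat) : exists2 kp, 0 < kp & forall n N (x : 'I_n -> 'rV[R]_N)
  (F : 'I_n -> triad R N) (P : 'rV[R]_N -> Prop) psi (q : 'I_n -> 'I_n -> quat) (col : 'I_n -> nat),
  net_data K Lam c0 x F P psi -> (forall i j, qnorm (q i j) = 1) -> (forall i, q i i = @qone R) ->
  (forall i j, near x 4 i j -> i != j -> col i != col j) ->
  exists a : 'I_n -> quat, [/\ forall l, qle (a l) 1, forall l, (c <= col l)%N -> a l = qzero &
    forall l p, (col l < c)%N -> P p -> nm (p - x l) <= 1 -> ~~ qle (sect psi q a l p) kp].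
Proof.
elim: c => [|c [k k0 IH]].
  by exists 1 => // n N x F P psi q col D qu q1' hcol; exists (fun _ => qzero); split => // l; exact: qle0.
have K0 : 0 < K%:R + 1 :> R by rewrite ltr_wpDl.
pose rho := Num.min 1 (k / (8 * (K%:R + 1))).
have r0 : 0 < rho by rewrite lt_min ltr01 divr_gt0 // mulr_gt0.
have r1 : rho <= 1 by rewrite ge_min lexx.
have rk : K%:R * (4 * rho) <= k / 2.
  have h : rho <= k / (8 * (K%:R + 1)) by rewrite ge_min lexx orbT.
  apply: (@le_trans _ _ ((K%:R + 1) * (4 * (k / (8 * (K%:R + 1)))))); last first.
    by rewrite le_eqVlt; apply/orP; left; apply/eqP; field; rewrite gt_eqF.
  by apply: ler_pM => //; [rewrite mulr_ge0 // ltW | rewrite lerDl | rewrite ler_pM2l].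
have B0 : 0 < 8 * (K%:R + 1) * Lam by rewrite !mulr_gt0.
have [k' k'0 AV] := avoid_zero B0 c00 r0 r1.
exists (Num.min k' (k / 2)); first by rewrite lt_min k'0 divr_gt0.
move=> n N x F P psi q col D qu q11 hcol.
have [a [a1 a0 as']] := IH n N x F P psi q col D qu q11 hcol.
have /fin_all_exists[b Hb] l : exists b : quat, qle b rho /\
    forall p, P p /\ nm (p - x l) <= 1 -> ~~ qle (qadd (sect psi q a l p) (qscale (psi l p) b)) k'.
  apply: (AV _ (fun p => P p /\ nm (p - x l) <= 1) (fun p => proj (F l) (p - x l))).
    move=> p [Pp pl]; have [v1 v2 v3] := vnorm_comp (proj (F l) (p - x l)).
    have v : vnorm (proj (F l) (p - x l)) <= 1 by apply: le_trans pl; apply: vnorm_proj; exact: (nd_orth D).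
    by split; [exact: le_trans v1 v | exact: le_trans v2 v | exact: le_trans v3 v | exact: (nd_psi_core D)].
  move=> p p' [Pp pl] [Pp' pl'].
  have -> : vsub (proj (F l) (p - x l)) (proj (F l) (p' - x l)) = proj (F l) (p - p').
    by rewrite -projB opprB addrA subrK.
  have fl : nm (p - p') <= 2 * vnorm (proj (F l) (p - p')).
    by apply: (nd_flat D) => //; [apply: (le_trans pl) | apply: (le_trans pl')]; lra.
  have v0 := vnorm_ge0 (proj (F l) (p - p')); have n0 := nm_ge0 (p - p').
  have Ln : Lam * nm (p - p') <= 2 * (Lam * vnorm (proj (F l) (p - p'))).
    by rewrite mulrCA ler_pM2l.
  have Kn : 0 <= K%:R :> R by [].
  have Lv : 0 <= Lam * vnorm (proj (F l) (p - p')) by rewrite mulr_ge0 // ltW.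
  split.
    apply: qle_trans (sect_lip D qu Pp Pp' pl pl' a1) _.
    have -> : 8 * (K%:R + 1) * Lam * vnorm (proj (F l) (p - p')) =
      K%:R * (8 * (Lam * vnorm (proj (F l) (p - p')))) + 8 * (Lam * vnorm (proj (F l) (p - p'))) by ring.
    apply: (@le_trans _ _ (K%:R * (8 * (Lam * vnorm (proj (F l) (p - p')))))).
      by apply: ler_wpM2l => //; rewrite -mulrA; move: Ln; move: (Lam * _) (Lam * _) => u v; lra.
    by rewrite lerDl mulr_ge0.
  apply: le_trans (nd_psi_lip D Pp Pp' _ _) _; [apply: (le_trans pl); lra | apply: (le_trans pl'); lra |].
  apply: (le_trans Ln).
  have -> : 8 * (K%:R + 1) * Lam * vnorm (proj (F l) (p - p')) =
      2 * (Lam * vnorm (proj (F l) (p - p'))) + (K%:R * (8 * (Lam * vnorm (proj (F l) (p - p')))) + 6 * (Lam * vnorm (proj (F l) (p - p')))) by ring.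
  rewrite lerDl; apply: addr_ge0; first by apply: mulr_ge0 => //; apply: mulr_ge0.
  exact: mulr_ge0.
exists (fun l => if col l == c then b l else a l); split => [l|l cl|l p].
- by case: ifP => _ //; apply: qle_trans r1; exact: (proj1 (Hb l)).
- by rewrite ifN ?gtn_eqF // a0 // ltnW.
rewrite ltnS leq_eqVlt => lc Pp pl.
have sE : sect psi q (fun l => if col l == c then b l else a l) l p =
  qadd (sect psi q a l p) (qsum (fun j => if col j == c then qscale (psi j p) (qmul (q l j) (b j)) else qzero)).
  rewrite /sect /qsum /qadd; cbn [q0 q1 q2 q3]; congr Quat; rewrite -big_split; apply: eq_bigr => j _ /=;
  by case: eqP => [h|_]; [rewrite a0 ?h //|]; rewrite /qzero /=; ring.
rewrite sE; case/orP: lc => [/eqP lc|lc].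
  have -> : qsum (fun j => if col j == c then qscale (psi j p) (qmul (q l j) (b j)) else qzero) = qscale (psi l p) (b l).
    have Z (g : quat -> R) : g qzero = 0 -> \sum_j g (if col j == c then qscale (psi j p) (qmul (q l j) (b j)) else qzero) = g (qscale (psi l p) (b l)).
      move=> g0; rewrite (bigD1 l) //= lc eqxx q11 mul1q big1 ?addr0 // => j jl.
      case: eqP => // jc; have -> : psi j p = 0; last by rewrite -[RHS]g0; congr g; rewrite /qscale /qzero !mul0r.
      apply/eqP/negP => /negP /(nd_psi_supp D Pp) pj.
      have := nm_tri (a := x l) (b := p) (c := x j) (s := 1) (t := 2); rewrite (nm_subC _ p) (nm_subC _ p) => /(_ pl pj) h.
      have nl : near x 4 l j by rewrite /near; apply: (le_trans h); lra.
      have lj : l != j by rewrite eq_sym.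
      by have := hcol _ _ nl lj; rewrite lc jc eqxx.
    by rewrite /qsum; case E : (qscale _ _) => [x0 x1 x2 x3]; congr Quat; rewrite Z // E.
  have := proj2 (Hb l) p (conj Pp pl); apply: contra => h; apply: (qle_trans h).
  by rewrite ge_min lexx.
have d38 : (1 : R) <= 38 by lra.
have hd := sect_le D qu (C := fun j => col j == c) Pp pl d38 (ltW r0) (fun j _ => proj1 (Hb j)).
apply: (not_qle_add (as' l p lc Pp pl) hd).
have : Num.min k' (k / 2) <= k / 2 by rewrite ge_min lexx orbT.
by move: rk; lra.
Qed.

Theorem nonvanishing_section : exists2 kp, 0 < kp & forall n N (x : 'I_n -> 'rV[R]_N)
  (F : 'I_n -> triad R N) (P : 'rV[R]_N -> Prop) psi (q : 'I_n -> 'I_n -> quat),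
  net_data K Lam c0 x F P psi -> (forall i j, qnorm (q i j) = 1) -> (forall i, q i i = @qone R) ->
  exists a : 'I_n -> quat, (forall l, qle (a l) 1) /\
    forall l p, P p -> nm (p - x l) <= 1 -> ~~ qle (sect psi q a l p) kp.
Proof.
have [k k0 H] := nonvanishing_step K.+1; exists k => // n N x F P psi q D qu q11.
have [f Hf] := proper_coloring (@nearC R n N x 4) (nd_card D).
have [|a [a1 _ as']] := H n N x F P psi q (fun i => f i : nat) D qu q11.
  by move=> i j nij ij; exact: Hf.
by exists a; split => // l p; apply: as'; exact: ltn_ord.
Qed.

End NetSection.

End Quaternions.

End Frame2.

(** * From the section to linearly independent vectors *)

Module Frame3.

Import Core Geo Config Config2 Config3 Sign Euclid Net Generic SpinNet Spin Frame Frame2.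
Set Implicit Arguments.
Unset Strict Implicit.
Unset Printing Implicit Defensive.
Import Order.TTheory GRing.Theory Num.Theory.
Local Open Scope ring_scope.

Section Framing.

Variable R : realType.
Local Notation vec := (vec R).
Local Notation quat := (quat R).

Lemma vnorm_rot_gen (q : quat) v : vnorm (rot q v) = qnorm q * vnorm v.
Proof. by rewrite /vnorm dot_rot sqrtrM ?sqr_ge0 // sqrtr_sqr ger0_norm // qnorm_ge0. Qed.

Lemma qnorm_le (q : quat) S : qle q S -> qnorm q <= 4 * S ^+ 2.
Proof.
case/and4P => h0 h1 h2 h3; have sq (y : R) : `|y| <= S -> y ^+ 2 <= S ^+ 2.
  by move=> hy; rewrite -[y ^+ 2]real_normK ?num_real // lerXn2r ?nnegrE // (le_trans _ hy).
rewrite /qnorm; have := sq _ h0; have := sq _ h1; have := sq _ h2; have := sq _ h3; lra.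
Qed.

Lemma qnorm_gt (q : quat) k : 0 <= k -> ~~ qle q k -> k ^+ 2 <= qnorm q.
Proof.
move=> k0; rewrite /qle !negb_and -!ltNge /qnorm.
have sq (y : R) : k < `|y| -> k ^+ 2 <= y ^+ 2.
  by move=> hy; rewrite -[y ^+ 2]real_normK ?num_real // lerXn2r ?nnegrE // ltW.
have := sqr_ge0 (q0 q); have := sqr_ge0 (q1 q); have := sqr_ge0 (q2 q); have := sqr_ge0 (q3 q).
by move=> ? ? ? ? /or4P[] /sq; lra.
Qed.

Lemma rot_close (p q : quat) (S d : R) v : 0 <= S -> 0 <= d -> qle p S -> qle q S ->
  qle (qsub p q) d -> vnorm (vsub (rot p v) (rot q v)) <= 72 * S * d * vnorm v.
Proof.
move=> S0 d0; case: p q => a0 a1 a2 a3 [b0 b1 b2 b3] /and4P[/= A0 A1 A2 A3] /and4P[/= B0 B1 B2 B3] /and4P[/= D0 D1 D2 D3].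
have P (a b a' b' : R) : `|a| <= S -> `|b'| <= S -> `|a - a'| <= d -> `|b - b'| <= d -> `|a * b - a' * b'| <= 2 * S * d.
  move=> h1 h2 h3 h4; have -> : a * b - a' * b' = a * (b - b') + (a - a') * b' by ring.
  apply: (le_trans (ler_normD _ _)); rewrite !normrM.
  have := ler_pM (normr_ge0 _) (normr_ge0 _) h1 h4; have := ler_pM (normr_ge0 _) (normr_ge0 _) h3 h2.
  by rewrite (mulrC d) -mulrA; move: (_ * _) (_ * _) (S * d) => x y z; lra.
have [v1 v2 v3] := vnorm_comp v; have n0 := vnorm_ge0 v.
have sd : 0 <= S * d by rewrite mulr_ge0.
have lin (x y z m1 m2 m3 : R) : `|m1| <= 8 * S * d -> `|m2| <= 8 * S * d -> `|m3| <= 8 * S * d ->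
   `|x| <= vnorm v -> `|y| <= vnorm v -> `|z| <= vnorm v ->
   `|m1 * x + m2 * y + m3 * z| <= 24 * S * d * vnorm v.
  move=> h1 h2 h3 hx hy hz.
  have := ler_pM (normr_ge0 _) (normr_ge0 _) h1 hx; have := ler_pM (normr_ge0 _) (normr_ge0 _) h2 hy.
  have := ler_pM (normr_ge0 _) (normr_ge0 _) h3 hz; rewrite -!normrM => k3 k2 k1.
  apply: (le_trans (ler_normD _ _)); have := le_trans (ler_normD (m1 * x) (m2 * y)) (lerD k1 k2).
  move: k3; rewrite -!(mulrA _ d) -!(mulrA _ S); move: (S * (d * _)) => w; lra.
have four (x y z t : R) : `|x| <= 2 * S * d -> `|y| <= 2 * S * d -> `|z| <= 2 * S * d -> `|t| <= 2 * S * d ->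
  [/\ `|x + y - z - t| <= 8 * S * d, `|x - y + z - t| <= 8 * S * d & `|x - y - z + t| <= 8 * S * d] /\
  [/\ `|2 * (x + y)| <= 8 * S * d & `|2 * (x - y)| <= 8 * S * d].
  by rewrite !ler_norml => /andP[? ?] /andP[? ?] /andP[? ?] /andP[? ?]; do 2 split; lra.
set k := 24 * S * d * vnorm v.
have -> : 72 * S * d * vnorm v = 3 * k by rewrite /k; ring.
have [[F1 F2 F3] _] := four _ _ _ _ (P a0 a0 b0 b0 A0 B0 D0 D0) (P a1 a1 b1 b1 A1 B1 D1 D1)
    (P a2 a2 b2 b2 A2 B2 D2 D2) (P a3 a3 b3 b3 A3 B3 D3 D3).
have [_ [G1 H1]] := four _ _ _ _ (P a1 a2 b1 b2 A1 B2 D1 D2) (P a0 a3 b0 b3 A0 B3 D0 D3)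
    (P a2 a2 b2 b2 A2 B2 D2 D2) (P a3 a3 b3 b3 A3 B3 D3 D3).
have [_ [G2 H2]] := four _ _ _ _ (P a1 a3 b1 b3 A1 B3 D1 D3) (P a0 a2 b0 b2 A0 B2 D0 D2)
    (P a2 a2 b2 b2 A2 B2 D2 D2) (P a3 a3 b3 b3 A3 B3 D3 D3).
have [_ [G3 H3]] := four _ _ _ _ (P a2 a3 b2 b3 A2 B3 D2 D3) (P a0 a1 b0 b1 A0 B1 D0 D1)
    (P a2 a2 b2 b2 A2 B2 D2 D2) (P a3 a3 b3 b3 A3 B3 D3 D3).
have L1 := lin _ _ _ _ _ _ F1 H1 G2 v1 v2 v3.
have L2 := lin _ _ _ _ _ _ G1 F2 H3 v1 v2 v3.
have L3 := lin _ _ _ _ _ _ H2 G3 F3 v1 v2 v3.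
apply: vnorm_le_comps; [move: L1 | move: L2 | move: L3]; apply: le_trans;
 rewrite le_eqVlt; apply/orP; left; apply/eqP; congr `|_|; rewrite /rot /vsub /=; ring.
Qed.

Lemma emb_close N (Z F : triad R N) (th : R) v : 0 <= th ->
  nm (t1 Z - t1 F) <= th -> nm (t2 Z - t2 F) <= th -> nm (t3 Z - t3 F) <= th ->
  nm (emb Z v - emb F v) <= 3 * th * vnorm v.
Proof.
move=> th0 h1 h2 h3; have [v1 v2 v3] := vnorm_comp v.
have -> : emb Z v - emb F v = vx v *: (t1 Z - t1 F) + vy v *: (t2 Z - t2 F) + vz v *: (t3 Z - t3 F).
  by apply/rowP => k; rewrite /emb !mxE; ring.
have P (x : R) (u : 'rV[R]_N) : `|x| <= vnorm v -> nm u <= th -> nm (x *: u) <= vnorm v * th.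
  by move=> a b; rewrite nmZ ler_pM ?nm_ge0.
apply: (le_trans (nmD _ _)).
have := le_trans (nmD _ _) (lerD (P _ _ v1 h1) (P _ _ v2 h2)); have := P _ _ v3 h3.
by rewrite -mulrA (mulrC th); move: (nm _) (nm _) (_ * th) => a b c; lra.
Qed.

Lemma vnorm_sum N (F : triad R N) (I : finType) (f : I -> 'rV[R]_N) (psi : I -> R) (E : R) (r : vec) :
  (forall j, 0 <= psi j) ->
  (forall j, psi j != 0 -> vnorm (vsub (proj F (f j)) r) <= E) ->
  vnorm (vsub (proj F (\sum_j psi j *: f j)) (vscale (\sum_j psi j) r)) <= (\sum_j psi j) * E.
Proof.
move=> p0 h; rewrite -!big_enum /=; elim: (enum I) => [|j s IH]; first rewrite !big_nil.
  have -> : vsub (proj F 0) (vscale 0 r) = vscale 0 r.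
    rewrite -(scale0r (0 : 'rV[R]_N)) projZ /vsub /vscale /=; congr Vec; ring.
  by rewrite vnormZ normr0 !mul0r.
rewrite !big_cons projD projZ.
have -> : vsub (vadd (vscale (psi j) (proj F (f j))) (proj F (\sum_(j0 <- s) psi j0 *: f j0)))
    (vscale (psi j + \sum_(j0 <- s) psi j0) r) = vadd (vscale (psi j) (vsub (proj F (f j)) r))
    (vsub (proj F (\sum_(j0 <- s) psi j0 *: f j0)) (vscale (\sum_(j0 <- s) psi j0) r)).
  move: (proj F (f j)) (proj F _) (\sum_(j0 <- s) psi j0) => [? ? ?] [? ? ?] c.
  by rewrite /vsub /vadd /vscale /=; congr Vec; ring.
apply: (le_trans (vnormD _ _)); rewrite mulrDl; apply: lerD => //.
rewrite vnormZ ger0_norm //; have [->|pj] := eqVneq (psi j) 0; first by rewrite !mul0r.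
by rewrite ler_wpM2l // h.
Qed.

(** Each local frame is turned by the section as read in that frame. Seen from a net point i near p,
    all the turned vectors are close to [rot] of the reading at i, because [q] is nearly a cocycle.
    A weighted sum with weights of one sign therefore cannot cancel, since that reading is bounded
    away from zero. *)
Theorem discrete_framing (K : nat) (Lam c0 : R) : 0 < Lam -> 0 < c0 ->
  exists2 th, 0 < th & forall n N (x : 'I_n -> 'rV[R]_N) (F : 'I_n -> triad R N) (P : 'rV[R]_N -> Prop) psi,
  net_data K Lam c0 x F P psi -> (forall i j, i != j -> 1 <= nm (x i - x j)) ->
  (forall p, P p -> exists i, nm (p - x i) <= 1) ->
  (forall i j, near x 4 i j -> [/\ tilt (F i) (F j) th, off (F i) (x j - x i) <= th &
     0 < det3 (turn (F i) (F j) (@e1 R)) (turn (F i) (F j) (Vec 0 1 0)) (turn (F i) (F j) (@e3 R))]) ->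
  exists (q : 'I_n -> 'I_n -> quat) (a : 'I_n -> quat), forall p, P p -> forall Z : 'I_n -> triad R N,
    (forall j, psi j p != 0 -> [/\ nm (t1 (Z j) - t1 (F j)) <= th, nm (t2 (Z j) - t2 (F j)) <= th &
        nm (t3 (Z j) - t3 (F j)) <= th]) ->
    forall v, \sum_j psi j p *: emb (Z j) (rot (sect psi q a j p) v) = 0 -> vnorm v = 0.
Proof.
move=> Lam0 c00; have [k k0 NV] := nonvanishing_section K Lam0 c00.
pose S : R := 16 * (K%:R + 1).
have K1 : 1 <= K%:R + 1 :> R by rewrite lerDr.
have S1 : 16 <= S by rewrite /S; lra.
have SS0 : 0 < S ^+ 2 by rewrite exprn_gt0 //; lra.
(* [S] bounds all readings of the section; with this [w] the accumulated error stays below 9/10 of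
   k^2, the lower bound for [qnorm] of the section. *)
pose w : R := k ^+ 2 / (400 * S ^+ 2).
have w0 : 0 < w by rewrite divr_gt0 ?exprn_gt0 // mulr_gt0.
have wE : 400 * S ^+ 2 * w = k ^+ 2 by rewrite /w mulrC divfK // gt_eqF // mulr_gt0.
have r41 : 1 <= 4 :> R by lra.
have [eta eta0 SN] := @spin_net R 4 w K r41 w0.
exists (Num.min eta w) => [|n N x F P psi D sep mx H]; first by rewrite lt_min eta0.
have mE : Num.min eta w <= eta by rewrite ge_min lexx.
have mw : Num.min eta w <= w by rewrite ge_min lexx orbT.
have [q [qu q11 qt qc]] : exists q : 'I_n -> 'I_n -> quat,
  [/\ forall i j, qnorm (q i j) = 1, forall i, q i i = @qone R,
      forall i j, near x 4 i j -> close_turn (F i) (F j) (q i j) w &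
      forall i j k, nm (x i - x j) <= 4 -> nm (x j - x k) <= 4 -> nm (x i - x k) <= 4 ->
        qle (qsub (qmul (q i j) (q j k)) (q i k)) w].
  apply: SN => //; first exact: (nd_orth D).
    exact: (nd_card D).
  move=> i j /H[h1 h2 h3]; split => //; last exact: le_trans h2 mE.
  by move=> u; apply: (le_trans (h1 u)); rewrite ler_wpM2r ?vnorm_ge0.
have [a [a1 as']] := NV n N x F P psi q D qu q11.
exists q, a => p Pp Z HZ v D0.
have [i pi] := mx p Pp.
pose s j := sect psi q a j p; pose Psi := \sum_j psi j p.
have psi0 j : 0 <= psi j p by have /andP[] := nd_psi01 D j Pp.
have ci : c0 <= psi i p by apply: (nd_psi_core D).
have Psi0 : 0 < Psi.
  by apply: (lt_le_trans c00); apply: (le_trans ci); rewrite /Psi (bigD1 i) //= lerDl sumr_ge0.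
have near3 j : psi j p != 0 -> nm (x i - x j) <= 3.
  move=> /(nd_psi_supp D Pp) pj; have -> : 3 = 1 + 2 :> R by ring.
  by apply: (nm_tri (b := p)); [rewrite nm_subC | rewrite nm_subC].
have near4 j l : psi j p != 0 -> psi l p != 0 -> nm (x j - x l) <= 4.
  move=> /(nd_psi_supp D Pp) pj /(nd_psi_supp D Pp) pl; have -> : 4 = 2 + 2 :> R by ring.
  by apply: (nm_tri (b := p)); [rewrite nm_subC | rewrite nm_subC].
have sl j : psi j p != 0 -> qle (s j) (4 * K%:R).
  move=> /(nd_psi_supp D Pp) pj; have d38 : 2 <= 38 :> R by lra.
  have := sect_le D qu (C := xpredT) Pp pj d38 ler01 (fun j _ => a1 j).
  by rewrite mulr1 mulrC; apply.
have si : qle (s i) (4 * K%:R) by apply: sl; rewrite gt_eqF // (lt_le_trans c00).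
have K0 : 0 <= K%:R :> R by [].
have err j : psi j p != 0 -> vnorm (vsub (proj (F i) (emb (Z j) (rot (s j) v))) (rot (s i) v)) <= k ^+ 2 * (9 / 10) * vnorm v.
  move=> pj; have nj := near3 j pj; have sj := sl j pj.
  have nij : near x 4 i j by rewrite /near; apply: (le_trans nj); lra.
  have [z1 z2 z3] := HZ j pj.
  have hFi := nd_orth D i.
  have m0 : 0 <= w by exact: ltW.
  have E1 : nm (emb (Z j) (rot (s j) v) - emb (F j) (rot (s j) v)) <= 3 * w * vnorm (rot (s j) v).
    by apply: emb_close => //; [exact: le_trans z1 mw | exact: le_trans z2 mw | exact: le_trans z3 mw].
  have E1' : vnorm (vsub (proj (F i) (emb (Z j) (rot (s j) v))) (turn (F i) (F j) (rot (s j) v))) <= 3 * w * vnorm (rot (s j) v).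
    by rewrite /turn -projB; apply: le_trans (vnorm_proj _ hFi) E1.
  have E2 := qt _ _ nij (rot (s j) v).
  have sS : 4 * K%:R <= S by rewrite /S; lra.
  have u1 : qnorm (q i j) <= 1 by rewrite qu.
  have qs : qle (qmul (q i j) (s j)) S.
    apply: (qle_trans (qle_mul (qle_unit u1) sj)); rewrite mul1r /S; lra.
  have dq : qle (qsub (qmul (q i j) (s j)) (s i)) (K%:R * (4 * w)).
    have -> : qsub (qmul (q i j) (s j)) (s i) = qsum (fun l => qscale (psi l p) (qmul (qsub (qmul (q i j) (q j l)) (q i l)) (a l))).
      rewrite /s /sect /qsum /qsub; cbn [q0 q1 q2 q3 qmul]; congr Quat;
      rewrite ?mulr_sumr -?(sumrB, big_split); apply: eq_bigr => l _ /=; ring.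
    apply: (@qle_trans _ _ (#|[set l | near x 4 i l]|%:R * (4 * w))); last first.
      by apply: ler_wpM2r; [rewrite mulr_ge0 | rewrite ler_nat (nd_card D)].
    apply: qle_qsum => l; rewrite inE => hl.
      have -> : psi l p = 0; last by rewrite /qscale /qzero !mul0r.
      apply/eqP; apply: contraNT hl => /near3 h; rewrite /near; apply: (le_trans h); lra.
    have [->|pl] := eqVneq (psi l p) 0; first by rewrite /qscale !mul0r; apply: qle0; rewrite mulr_ge0.
    have h34 (y : R) : y <= 3 -> y <= 4 by lra.
    have := qle_mul (qc i j l (h34 _ nj) (near4 j l pj pl) (h34 _ (near3 l pl))) (a1 l).
    rewrite mulr1 -[X in qle (qscale _ _) X]mul1r; apply: qle_scale.
    by have /andP[h0 h1] := nd_psi01 D l Pp; rewrite ger0_norm.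
  have S0 : 0 <= S by lra.
  have dq' : qle (qsub (qmul (q i j) (s j)) (s i)) (S * w).
    by apply: (qle_trans dq); rewrite mulrA ler_pM2r // /S; lra.
  have E3 := rot_close v S0 (mulr_ge0 S0 m0) qs (qle_trans si sS) dq'.
  rewrite rotM in E3.
  have nr : vnorm (rot (s j) v) <= 4 * S ^+ 2 * vnorm v.
    by rewrite vnorm_rot_gen ler_wpM2r ?vnorm_ge0 // qnorm_le // (qle_trans sj).
  apply: (le_trans (vnormB _ (turn (F i) (F j) (rot (s j) v)) _)).
  have E4 := vnormB (turn (F i) (F j) (rot (s j) v)) (rot (q i j) (rot (s j) v)) (rot (s i) v).
  have nw : w * vnorm (rot (s j) v) <= 4 * (S ^+ 2 * w * vnorm v).
    have -> : 4 * (S ^+ 2 * w * vnorm v) = w * (4 * S ^+ 2 * vnorm v) by ring.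
    by rewrite ler_pM2l.
  have E3' : 72 * S * (S * w) * vnorm v = 72 * (S ^+ 2 * w * vnorm v) by ring.
  rewrite -wE; have -> : 400 * S ^+ 2 * w * (9 / 10) * vnorm v = 360 * (S ^+ 2 * w * vnorm v) by field.
  have X0 : 0 <= S ^+ 2 * w * vnorm v by apply: mulr_ge0; [apply: mulr_ge0; apply: ltW | exact: vnorm_ge0].
  rewrite E3' in E3; rewrite -mulrA in E1'.
  move: E1' E2 E3 E4 nw X0; move: (vnorm (vsub _ _)) (vnorm (vsub _ _)) (vnorm (vsub _ _)) (vnorm (vsub _ _)) (w * _) (S ^+ 2 * w * vnorm v) => A B C G W X; lra.
have := vnorm_sum psi0 err; rewrite D0 -/Psi.
have -> : vsub (proj (F i) 0) (vscale Psi (rot (s i) v)) = vscale (- Psi) (rot (s i) v).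
  rewrite -(scale0r (0 : 'rV[R]_N)) projZ /vsub /vscale /=; congr Vec; ring.
rewrite vnormZ normrN gtr0_norm // ler_pM2l // vnorm_rot_gen => h.
apply/eqP; rewrite eq_le vnorm_ge0 andbT leNgt; apply/negP => v0.
move: h; rewrite ler_pM2r //; have := qnorm_gt (ltW k0) (as' i p Pp pi).
have : 0 < k ^+ 2 by rewrite exprn_gt0.
by rewrite -/(s i); move: (qnorm _) (k ^+ 2) => A B; lra.
Qed.

End Framing.

End Frame3.

From mathcomp Require Import all_analysis.

(** * Flat functions on the line *)

Module Bump.

Set Implicit Arguments.
Unset Strict Implicit.
Unset Printing Implicit Defensive.
Import Order.TTheory GRing.Theory Num.Theory numFieldNormedType.Exports.
Local Open Scope classical_set_scope.
Local Open Scope ring_scope.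

Section Bump.

Variable R : realType.
Implicit Types u : R.

(** The powers of 1/u are part of the family so that derivatives are combinations of its members. *)
Definition bump (n : nat) u : R := if 0 < u then u^-1 ^+ n * expR (- u^-1) else 0.

Lemma bump_ge0 n u : 0 <= bump n u.
Proof. by rewrite /bump; case: ltP => // u0; rewrite mulr_ge0 ?expR_ge0 // exprn_ge0 // invr_ge0 ltW. Qed.

Lemma bump_gt0 n u : 0 < u -> 0 < bump n u.
Proof. by move=> u0; rewrite /bump u0 mulr_gt0 ?expR_gt0 // exprn_gt0 // invr_gt0. Qed.

Lemma bump_le0 n u : u <= 0 -> bump n u = 0.
Proof. by rewrite /bump ltNge => ->. Qed.

(** One term of the exponential series, of degree n + 2, beats the power of 1/u and leaves a factor
    u^2; this makes the derivative at 0 vanish. *)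
Lemma bump_bound n u : bump n u <= n.+2`!%:R * u ^+ 2.
Proof.
have f0 : 0 < n.+2`!%:R :> R by rewrite ltr0n fact_gt0.
rewrite /bump; case: ltP => u0; last by rewrite mulr_ge0 ?sqr_ge0 // ltW.
have v0 : 0 < u^-1 by rewrite invr_gt0.
have h := expR_ge1Dxn n.+1 (ltW v0).
rewrite expRN ler_pdivrMr ?expR_gt0 //.
have h2 : u^-1 ^+ n.+2 <= n.+2`!%:R * expR u^-1.
  rewrite -ler_pdivrMl // mulrC; apply: le_trans h; lra.
rewrite -mulrA mulrCA -ler_pdivrMl ?exprn_gt0 //.
apply: le_trans h2; rewrite le_eqVlt; apply/orP; left; apply/eqP.
by rewrite -exprVn -exprD addnC addn2.
Qed.

Lemma is_derive_bump n u : is_derive u (1 : R) (bump n) (bump n.+2 u - n%:R * bump n.+1 u).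
Proof.
case: (ltgtP u 0) => [u0|u0|->].
- rewrite (bump_le0 n.+2) ?(bump_le0 n.+1) ?ltW // mulr0 subr0.
  apply: (@near_eq_is_derive _ _ _ (cst 0)).
    near=> z; rewrite bump_le0 // ltW //; near: z; exact: lt_nbhsl.
- have un : u != 0 by rewrite gt_eqF.
  pose V : R -> R := fun z => z^-1.
  have dV : is_derive u (1 : R) V (- u ^- 2 *: 1) by apply: is_deriveV.
  apply: (@near_eq_is_derive _ _ _ ((V ^+ n) * (expR \o (- V)))).
    near=> z; rewrite /bump ifT ?fctE //; near: z; exact: lt_nbhsr.
  have dE : is_derive u (1 : R) (expR \o (- V)) (expR (- u^-1) * - (- u ^- 2 *: 1)).
    by apply: is_derive1_comp; rewrite fctE; exact: is_derive_expR.
  apply: is_derive_eq; rewrite /bump u0 ?fctE /V.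
  rewrite -![_ *: _]/(_ * _) mulr1 opprK; case: n => [|m].
    by rewrite !mul0r !expr0 !mulr0 !mul1r subr0 addr0 mulrC exprVn.
  by rewrite [m.+1.-1]/=; rewrite !exprS; field.
- rewrite !bump_le0 // mulr0 subr0.
  have L : (fun h => h^-1 *: ((bump n \o shift 0) (h *: 1) - bump n 0)) @ 0^' --> (0 : R).
    apply/cvgr0Pnorm_le => e e0; near=> h.
    have h0 : h != 0 by near: h; exact: nbhs_dnbhs_neq.
    rewrite /= scaler1 addr0 (bump_le0 n (lexx 0)) subr0 normrZ normfV.
    rewrite ler_pdivrMl ?normr_gt0 // (ger0_norm (bump_ge0 _ _)).
    apply: (le_trans (bump_bound _ _)); rewrite -(real_normK (num_real h)) expr2 mulrA mulrC ler_pM2l ?normr_gt0 //.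
    have hc : `|h| <= e / n.+2`!%:R.
      by near: h; apply: dnbhs0_le; rewrite divr_gt0 // ltr0n fact_gt0.
    by rewrite mulrC; move: hc; rewrite ler_pdivlMr ?ltr0n ?fact_gt0.
  have dv : derivable (bump n) 0 1 by apply/cvg_ex; exists 0.
  by apply: DeriveDef => //; apply: cvg_lim.
Unshelve. all: by end_near. Qed.

End Bump.

End Bump.

Require Import Defs.

(** * A calculus of smooth functions on open sets *)

Module Smooth.

Import Bump.
Set Implicit Arguments.
Unset Strict Implicit.
Unset Printing Implicit Defensive.
Import Order.TTheory GRing.Theory Num.Theory numFieldNormedType.Exports.
Local Open Scope classical_set_scope.
Local Open Scope ring_scope.

Section NearEq.

Variables (R : realType) (V W : normedModType R).

Lemma differentiable_near_eq (f g : V -> W) x :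
  (\near x, f x = g x) -> differentiable f x -> differentiable g x.
Proof.
move=> fg df; have [dc de] := (diff_locallyP _ _).1 df.
have e : g \o shift x = cst (g x) + 'd f x +o_ 0 id.
  apply/eqaddoP => eps e0.
  have := (eqaddoP _ _ _ _).1 de _ e0; move=> h; near=> z.
  have E1 : g (z + x) = f (z + x).
    apply/esym; near: z; have := fg; rewrite (near_shift 0 x) /= => H.
    by apply: filterS H => z /=; rewrite subr0 addrC.
  have E2 : g x = f x by apply/esym; exact: (nbhs_singleton fg).
  have -> : (g \o shift x - (cst (g x) + 'd f x)) z = (f \o shift x - (cst (f x) + 'd f x)) z.
    by rewrite !fctE /= E1 E2.
  by near: z; exact: h.
apply/diff_locallyP; have E := @diff_unique _ _ _ g ('d f x) x dc e.
by rewrite E.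
Unshelve. all: by end_near. Qed.

End NearEq.

Section SmoothFun.

Variable R : realType.

(** The scalar counterpart of [Ck_on], for which products can be formed; [smooth_on] is recovered
    coordinate by coordinate. *)
Fixpoint Cs m (k : nat) (U : set 'rV[R]_m) (g : 'rV[R]_m -> R) : Prop :=
  match k with
  | 0%N => forall x, U x -> {for x, continuous g}
  | k'.+1 => (forall x, U x -> differentiable g x) /\ (forall v, Cs k' U (fun x => 'D_v g x))
  end.

Definition smooth_fun m (U : set 'rV[R]_m) g := forall k, Cs k U g.

Section Fixed.

Variables (m : nat) (U : set 'rV[R]_m).
Hypothesis Uo : open U.
Implicit Types f g h : 'rV[R]_m -> R.

Lemma near_eq_on (T : Type) (f g : 'rV[R]_m -> T) x : (forall x, U x -> f x = g x) -> U x -> \near x, f x = g x.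
Proof.
move=> fg Ux; have nU : nbhs x U by apply: open_nbhs_nbhs; split.
by apply: filterS nU => z; exact: fg.
Qed.

Lemma Cs_eq k f g : (forall x, U x -> f x = g x) -> Cs k U f -> Cs k U g.
Proof.
elim: k f g => [|k IH] f g fg /=.
  move=> cf x Ux; have ne := near_eq_on fg Ux.
  rewrite /prop_for /continuous_at -(fg x Ux); apply: cvg_trans (near_eq_cvg ne) _; exact: cf.
move=> [df Df]; split=> [x Ux|v]; first by apply: differentiable_near_eq (df x Ux); exact: near_eq_on.
apply: IH (Df v) => x Ux; apply: near_eq_derive; exact: near_eq_on.
Qed.

Lemma smooth_fun_eq f g : (forall x, U x -> f x = g x) -> smooth_fun U f -> smooth_fun U g.
Proof. by move=> fg sf k; apply: Cs_eq (sf k). Qed.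

Lemma smooth_fun_derive f v : smooth_fun U f -> smooth_fun U (fun x => 'D_v f x).
Proof. by move=> sf k; have [_] := sf k.+1; apply. Qed.

Lemma smooth_fun_differentiable f x : smooth_fun U f -> U x -> differentiable f x.
Proof. by move=> sf; have [h _] := sf 1%N; apply: h. Qed.

(** A class of differentiable functions closed under directional derivatives consists of smooth
    functions, so smoothness of all orders follows from one differentiation step. *)
Lemma smooth_fun_coind (C : ('rV[R]_m -> R) -> Prop) :
  (forall g, C g -> (forall x, U x -> differentiable g x) /\
     forall v, exists2 h, C h & forall x, U x -> 'D_v g x = h x) ->
  forall g, C g -> smooth_fun U g.
Proof.
move=> H g Cg k; elim: k g Cg => [|k IH] g Cg /=; have [dg Dg] := H g Cg.
  by move=> x Ux; apply: differentiable_continuous; exact: dg.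
split=> // v; have [h Ch e] := Dg v; apply: Cs_eq (IH h Ch) => x Ux; exact/esym/e.
Qed.

(** Expressions built from smooth functions. Differentiating an expression gives an expression, by
    the product and chain rules and [is_derive_bump], so a single application of [smooth_fun_coind]
    covers all these operations. *)
Inductive alg : ('rV[R]_m -> R) -> Prop :=
| A_base g : smooth_fun U g -> alg g
| A_cst c : alg (fun _ => c)
| A_add f g : alg f -> alg g -> alg (fun x => f x + g x)
| A_mul f g : alg f -> alg g -> alg (fun x => f x * g x)
| A_bump n g : alg g -> alg (fun x => bump n (g x))
| A_comp p (U' : set 'rV[R]_p) (f : 'rV[R]_p -> R) (phi : 'rV[R]_m -> 'rV[R]_p) : smooth_fun U' f ->
    (forall x, U x -> U' (phi x)) -> (forall i, alg (fun x => phi x 0 i)) -> alg (fun x => f (phi x))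
| A_eq f g : (forall x, U x -> f x = g x) -> alg f -> alg g.

Lemma alg_sum (I : Type) (r : seq I) (F : I -> 'rV[R]_m -> R) :
  (forall i, alg (F i)) -> alg (fun x => \sum_(i <- r) F i x).
Proof.
move=> h; elim: r => [|i r IH].
  by apply: A_eq (A_cst 0) => x _; rewrite big_nil.
by apply: A_eq (A_add (h i) IH) => x _; rewrite big_cons.
Qed.

Lemma row_coord_sum p (phi : 'rV[R]_m -> 'rV[R]_p) :
  phi = \sum_(i < p) (fun x => phi x 0 i *: delta_mx 0 i).
Proof. by apply/funext => x; rewrite fct_sumE {1}(row_sum_delta (phi x)). Qed.

Lemma differentiable_row p (phi : 'rV[R]_m -> 'rV[R]_p) x :
  (forall i, differentiable (fun x => phi x 0 i) x) -> differentiable phi x.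
Proof.
by move=> h; rewrite (row_coord_sum phi); apply: differentiable_sum => i; apply: differentiableZl.
Qed.

Lemma derive_row p (phi : 'rV[R]_m -> 'rV[R]_p) x v i :
  derivable phi x v -> ('D_v phi x) 0 i = 'D_v (fun x => phi x 0 i) x.
Proof. by move=> d; rewrite derive_mx // mxE. Qed.

Lemma derive_comp_row p (f : 'rV[R]_p -> R) (phi : 'rV[R]_m -> 'rV[R]_p) x v :
  differentiable phi x -> differentiable f (phi x) ->
  'D_v (fun x => f (phi x)) x = \sum_i 'D_(delta_mx 0 i) f (phi x) * 'D_v (fun x => phi x 0 i) x.
Proof.
move=> dp df; have dc : differentiable (f \o phi) x by exact: differentiable_comp.
rewrite -[fun x => f (phi x)]/(f \o phi) (deriveE _ dc) diff_comp //= -(deriveE _ dp).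
rewrite {1}(row_sum_delta ('D_v phi x)) linear_sum; apply: eq_bigr => i _ /=.
rewrite linearZ /= -(deriveE _ df) derive_row; last exact: diff_derivable.
exact: mulrC.
Qed.

Lemma alg_step g : alg g -> (forall x, U x -> differentiable g x) /\
     forall v, exists2 h, alg h & forall x, U x -> 'D_v g x = h x.
Proof.
elim=> {g} [g sg|c|f g af [df Df] ag [dg Dg]|f g af [df Df] ag [dg Dg]|n g ag [dg Dg]|p U' f phi sf mp ap IH|f g fg af [df Df]].
- split=> [x|v]; first exact: smooth_fun_differentiable.
  by exists (fun x => 'D_v g x) => //; apply: A_base; exact: smooth_fun_derive.
- split=> [x _|v]; first exact: differentiable_cst.
  by exists (fun _ => 0); [exact: A_cst | move=> x _; exact: derive_cst].
- split=> [x Ux|v]; first by apply: differentiableD; [exact: df | exact: dg].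
  have [f' af' ef] := Df v; have [g' ag' eg] := Dg v.
  exists (fun x => f' x + g' x) => [|x Ux]; first exact: A_add.
  by rewrite (@deriveD _ _ _ f g) ?ef ?eg //; apply: diff_derivable; [exact: df | exact: dg].
- split=> [x Ux|v]; first by apply: differentiableM; [exact: df | exact: dg].
  have [f' af' ef] := Df v; have [g' ag' eg] := Dg v.
  exists (fun x => f x * g' x + g x * f' x) => [|x Ux]; first by apply: A_add; exact: A_mul.
  by rewrite (@deriveM _ _ f g) ?ef ?eg //; apply: diff_derivable; [exact: df | exact: dg].
- have db (u : R) : differentiable (bump n : R -> R) u.
    by apply/derivable1_diffP; case: (is_derive_bump n u).
  have dc x : U x -> differentiable (bump n \o g) x.
    by move=> Ux; apply: differentiable_comp; [exact: dg | exact: db].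
  split=> // v; have [g' ag' eg] := Dg v.
  exists (fun x => g' x * (bump n.+2 (g x) + - n%:R * bump n.+1 (g x))) => [|x Ux].
    apply: A_mul => //; apply: A_add; first exact: A_bump.
    by apply: A_mul; [exact: A_cst | exact: A_bump].
  rewrite -[fun x => bump n (g x)]/(bump n \o g) (deriveE _ (dc x Ux)) diff_comp //=; [|exact: dg].
  rewrite -(deriveE _ (dg x Ux)) eg // deriv1E; last by case: (is_derive_bump n (g x)).
  by rewrite derive1E; case: (is_derive_bump n (g x)) => _ ->; rewrite mulNr.
- have dp x : U x -> differentiable phi x.
    by move=> Ux; apply: differentiable_row => i; exact: (proj1 (IH i)).
  have df x : U x -> differentiable f (phi x).
    by move=> Ux; have [h _] := sf 1%N; apply: h; exact: mp.
  split=> [x Ux|v]; first by apply: (@differentiable_comp _ _ _ _ phi f); [exact: dp | exact: df].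
  have [h ah eh] : exists2 h : 'I_p -> 'rV[R]_m -> R, (forall i, alg (h i)) & forall i x, U x -> 'D_v (fun x => phi x 0 i) x = h i x.
    have /choice[h Hh] i : exists h, alg h /\ forall x, U x -> 'D_v (fun x => phi x 0 i) x = h x.
      by have [h a e] := proj2 (IH i) v; exists h.
    by exists h => i; have [] := Hh i.
  exists (fun x => \sum_i 'D_(delta_mx 0 i) f (phi x) * h i x) => [|x Ux].
    apply: alg_sum => i; apply: A_mul => //; apply: (@A_comp _ U' (fun y => 'D_(delta_mx 0 i) f y)) => //.
    by move=> k; have [_] := sf k.+1; apply.
  by rewrite derive_comp_row; [apply: eq_bigr => i _; rewrite eh | exact: dp | exact: df].
- split=> [x Ux|v]; first by apply: differentiable_near_eq (df x Ux); exact: near_eq_on.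
  have [h ah eh] := Df v; exists h => // x Ux; rewrite -eh //.
  by apply/esym/near_eq_derive; exact: near_eq_on.
Qed.

Lemma alg_smooth g : alg g -> smooth_fun U g.
Proof. exact: (smooth_fun_coind alg_step). Qed.

Lemma smooth_on_coord n (f : 'rV[R]_m -> 'rV[R]_n) i : smooth_on U f -> smooth_fun U (fun x => f x 0 i).
Proof.
move=> sf k; have {sf} := sf k; elim: k f => [|k IH] f /=.
  move=> cf x Ux; apply: (@continuous_comp _ _ _ f (fun M : 'rV[R]_n => M 0 i)); first exact: cf.
  exact: coord_continuous.
move=> [df Df]; have dfi x : U x -> differentiable (fun x => f x 0 i) x.
  move=> Ux; apply: (@differentiable_comp _ _ _ _ f (fun M : 'rV[R]_n => M 0 i)); first exact: df.
  exact: differentiable_coord.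
split=> // v; apply: Cs_eq (IH _ (Df v)) => x Ux.
by rewrite derive_row //; apply: diff_derivable; exact: df.
Qed.

Lemma smooth_on_of_coord n (f : 'rV[R]_m -> 'rV[R]_n) :
  (forall i, smooth_fun U (fun x => f x 0 i)) -> smooth_on U f.
Proof.
move=> sf k; elim: k f sf => [|k IH] f sf /=.
  move=> x Ux; apply: differentiable_continuous; apply: differentiable_row => i.
  exact: smooth_fun_differentiable (sf i) Ux.
have df x : U x -> differentiable f x.
  by move=> Ux; apply: differentiable_row => i; exact: smooth_fun_differentiable (sf i) Ux.
split=> // v; apply: IH => i; apply: smooth_fun_eq (smooth_fun_derive v (sf i)) => x Ux.
by rewrite derive_row //; apply: diff_derivable; exact: df.
Qed.

End Fixed.

Lemma smooth_fun_sub m (U U' : set 'rV[R]_m) g : U `<=` U' -> smooth_fun U' g -> smooth_fun U g.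
Proof.
move=> UU sg k; have {sg} := sg k; elim: k g => [|k IH] g /=; first by move=> h x /UU; apply: h.
by move=> [d D]; split=> [x /UU|v]; [apply: d | apply: IH].
Qed.

Lemma smooth_fun_cover m (U : set 'rV[R]_m) g :
  (forall x, U x -> exists2 U', U' x & smooth_fun U' g) -> smooth_fun U g.
Proof.
move=> h k; have {}h x : U x -> exists2 U' : set 'rV[R]_m, U' x & Cs k U' g.
  by move=> /h[U' Ux s]; exists U' => //; exact: s.
elim: k g h => [|k IH] g h /=; first by move=> x /h[U' Ux s]; exact: s.
split=> [x /h[U' Ux [d _]]|v]; first exact: d.
by apply: IH => x /h[U' Ux [_ D]]; exists U' => //; exact: D.
Qed.

End SmoothFun.

End Smooth.

(** * Bump functions supported in charts *)

Module Embed.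

Import Bump Smooth.
Set Implicit Arguments.
Unset Strict Implicit.
Unset Printing Implicit Defensive.
Import Order.TTheory GRing.Theory Num.Theory numFieldNormedType.Exports.
Local Open Scope classical_set_scope.
Local Open Scope ring_scope.

Section Charts.

Variables (R : realType) (n : nat) (M : topologicalType).
Implicit Types c d : chart R n M.

Lemma chart_inv_cvg c x : target c x -> chart_inv c @ x --> chart_inv c x.
Proof.
have := @chart_inv_continuous R n M c; rewrite continuous_open_subspace; last exact: target_open.
by move=> h tx; apply: h; rewrite inE.
Qed.

Lemma chart_map_cvg c p : source c p -> chart_map c @ p --> chart_map c p.
Proof.
have := @chart_map_continuous R n M c; rewrite continuous_open_subspace; last exact: source_open.
by move=> h tx; apply: h; rewrite inE.
Qed.

Lemma open_preimage_inv c (V : set M) : open V -> open (target c `&` chart_inv c @^-1` V).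
Proof.
move=> Vo; rewrite openE => x [tx vx]; apply: filterI.
  by apply: open_nbhs_nbhs; split => //; exact: target_open.
by apply: (chart_inv_cvg tx); apply: open_nbhs_nbhs.
Qed.

Lemma open_preimage_map c (V : set 'rV[R]_n) : open V -> open (source c `&` chart_map c @^-1` V).
Proof.
move=> Vo; rewrite openE => x [tx vx]; apply: filterI.
  by apply: open_nbhs_nbhs; split => //; exact: source_open.
by apply: (chart_map_cvg tx); apply: open_nbhs_nbhs.
Qed.

Lemma open_overlap c d : open (overlap c d).
Proof. by apply: open_preimage_inv; exact: source_open. Qed.

Lemma overlap_map c d p : source c p -> source d p -> overlap c d (chart_map c p).
Proof. by move=> cp dp; split; [exact: chart_map_target | rewrite /preimage /= chart_mapK]. Qed.

Lemma transition_map c d p : source c p -> transition c d (chart_map c p) = chart_map d p.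
Proof. by move=> cp; rewrite /transition /= chart_mapK. Qed.

Lemma transition_overlap c d x : overlap c d x -> overlap d c (transition c d x).
Proof.
move=> [tx dx]; split; first exact: chart_map_target.
by rewrite /preimage /transition /= chart_mapK //; exact: chart_inv_source.
Qed.

Section Bumps.

Variables (c : chart R n M) (x0 : 'rV[R]_n) (rho : R).

Definition box : set 'rV[R]_n := [set x | forall i, `[x0 0 i - rho, x0 0 i + rho]%classic (x 0 i)].
Definition chart_bump (p : M) : R :=
  if `[< source c p >] then \prod_i bump 0 (rho ^+ 2 - (chart_map c p 0 i - x0 0 i) ^+ 2) else 0.

Hypothesis M_hausdorff : hausdorff_space M.
Hypothesis rho_gt0 : 0 < rho.
Hypothesis box_target : box `<=` target c.

Lemma chart_bump_ge0 p : 0 <= chart_bump p.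
Proof. by rewrite /chart_bump; case: ifP => // _; apply: prodr_ge0 => i _; exact: bump_ge0. Qed.

Lemma chart_bump_source p : chart_bump p != 0 -> source c p.
Proof. by rewrite /chart_bump; case: asboolP => //; rewrite eqxx. Qed.

Lemma chart_bump_box p : source c p -> chart_bump p != 0 -> box (chart_map c p).
Proof.
move=> cp; rewrite /chart_bump asboolT // => h i; rewrite /= in_itv /=.
have : bump 0 (rho ^+ 2 - (chart_map c p 0 i - x0 0 i) ^+ 2) != 0.
  by apply: contraNneq h => e; rewrite (bigD1 i) //= e mul0r.
rewrite /bump; case: ltP => [h1 _|]; last by rewrite eqxx.
have : `|chart_map c p 0 i - x0 0 i| <= rho.
  rewrite -(@ler_pXn2r _ 2%N) ?nnegrE ?(ltW rho_gt0) // real_normK ?num_real //; lra.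
by rewrite ler_norml => /andP[h2 h3]; apply/andP; split; lra.
Qed.

Lemma closed_chart_box : closed (chart_inv c @` box).
Proof.
apply: compact_closed => //; apply: continuous_compact.
  apply: continuous_subspaceW box_target _; exact: chart_inv_continuous.
apply: (@rV_compact R n (fun i => `[x0 0 i - rho, x0 0 i + rho]%classic)) => i; exact: segment_compact.
Qed.

Lemma chart_bump_zero p : ~ (chart_inv c @` box) p -> chart_bump p = 0.
Proof.
move=> h; apply/eqP/negP => /negP nz; apply: h; have cp := chart_bump_source nz.
by exists (chart_map c p); [exact: chart_bump_box | exact: chart_mapK].
Qed.

(** [G] is smooth on the overlap only. The product is smooth on the whole target because near every
    other point the bump vanishes identically. *)
Lemma smooth_chart_bump (d : chart R n M) (G : 'rV[R]_n -> R) : compatible d c ->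
  smooth_fun (overlap d c) G ->
  smooth_fun (target d) (fun x => chart_bump (chart_inv d x) * G x).
Proof.
move=> [sm _] sG; apply: smooth_fun_cover => x tx.
have [sx|nsx] := pselect (source c (chart_inv d x)).
  exists (overlap d c); first by split.
  refine (alg_smooth (@open_overlap d c) _).
  apply: A_mul; last exact: A_base.
  apply: (@A_eq _ _ _ (fun x => \prod_i bump 0 (rho ^+ 2 + (transition d c x 0 i + - x0 0 i) * (- 1 * (transition d c x 0 i + - x0 0 i))))).
    move=> z [tz sz]; rewrite /chart_bump asboolT //; apply: eq_bigr => i _.
    by rewrite /transition /= mulN1r mulrN expr2.
  have alg_prod (I : Type) (r : seq I) (F : I -> 'rV[R]_n -> R) :
     (forall i, alg (overlap d c) (F i)) -> alg (overlap d c) (fun x => \prod_(i <- r) F i x).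
    move=> h; elim: r => [|i r IH].
      by apply: A_eq (A_cst _ 1) => z _; rewrite big_nil.
    by apply: A_eq (A_mul (h i) IH) => z _; rewrite big_cons.
  apply: alg_prod => i; apply: A_bump; apply: A_add; first exact: A_cst.
  have t1 : alg (overlap d c) (fun x => transition d c x 0 i + - x0 0 i).
    apply: A_add; last exact: A_cst.
    by apply: A_base; apply: smooth_on_coord => //; exact: open_overlap.
  by apply: A_mul => //; apply: A_mul => //; exact: A_cst.
have Vo : open (target d `&` chart_inv d @^-1` (~` (chart_inv c @` box))).
  by apply: open_preimage_inv; apply: closed_openC; exact: closed_chart_box.
exists (target d `&` chart_inv d @^-1` (~` (chart_inv c @` box))).
  split=> // -[y by_ e]; apply: nsx; rewrite -e; apply: chart_inv_source; exact: box_target.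
refine (alg_smooth Vo _); apply: A_eq (A_cst _ 0) => z [_ nz].
by rewrite chart_bump_zero // mul0r.
Qed.

End Bumps.

Lemma box_exists c p : source c p -> exists2 rho, 0 < rho & box (chart_map c p) rho `<=` target c.
Proof.
move=> cp; have := @target_open R n M c; rewrite openE => /(_ _ (chart_map_target cp)) /nbhs_ballP[e /= e0 H].
exists (e / 2); first by rewrite divr_gt0.
move=> x hx; apply: H; rewrite -ball_normE /= ; apply: (@le_lt_trans _ _ (e / 2)); last by lra.
have e2 : 0 <= e / 2 by rewrite divr_ge0 // ltW.
rewrite [leLHS]/Num.Def.normr /= mx_normrE (bigmax_le _ e2) //= => -[i j] _ /=.
rewrite (ord1 i) !mxE; have := hx j; rewrite /= in_itv /= => /andP[h1 h2].
by rewrite ler_norml; apply/andP; split; lra.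
Qed.

End Charts.

End Embed.

(** * Strict differentiability of smooth maps *)

Module Strict.

Import Bump Smooth Embed.
Set Implicit Arguments.
Unset Strict Implicit.
Unset Printing Implicit Defensive.
Import Order.TTheory GRing.Theory Num.Theory numFieldNormedType.Exports.
Local Open Scope classical_set_scope.
Local Open Scope ring_scope.

Lemma finite_radius (R : realType) (K : finType) (P : K -> R -> Prop) :
  (forall k r s, 0 < s -> s <= r -> P k r -> P k s) -> (forall k, exists2 r, 0 < r & P k r) ->
  exists2 r, 0 < r & forall k, P k r.
Proof.
move=> mono ex; have : \forall r \near (0 : R)^'+, forall k, P k r.
  apply: filter_forall => k; have [r r0 Pr] := ex k.
  near=> s; apply: (mono k r); [near: s; exact: nbhs_right_gt | near: s; exact: nbhs_right_le | exact: Pr].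
move=> h; have [r [r0 hr]] : exists r : R, 0 < r /\ forall k, P k r.
  apply: (@filter_ex _ ((0 : R)^'+)); apply: filterI h; exact: nbhs_right_gt.
by exists r.
Unshelve. all: by end_near. Qed.

Section Strict.

Variables (R : realType) (m : nat).
Implicit Types (x y v : 'rV[R]_m) (g : 'rV[R]_m -> R).

Lemma row_coord_le x i : `|x 0 i| <= `|x|.
Proof. by rewrite [leRHS]/Num.Def.normr /= mx_normrE; exact: (le_bigmax _ _ (0, i)). Qed.

Lemma row_norm_le x (t : R) : 0 <= t -> (forall i, `|x 0 i| <= t) -> `|x| <= t.
Proof.
move=> t0 h; rewrite [leLHS]/Num.Def.normr /= mx_normrE (bigmax_le _ t0) //= => -[i j] _ /=.
by rewrite (ord1 i).
Qed.

Lemma derive_partials g x v : differentiable g x ->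
  'D_v g x = \sum_i v 0 i * 'D_(delta_mx 0 i) g x.
Proof.
move=> dg; rewrite (deriveE _ dg) {1}(row_sum_delta v) linear_sum; apply: eq_bigr => i _ /=.
by rewrite linearZ /= (deriveE _ dg).
Qed.

Lemma segment_derive g x h (s : R) : differentiable g (x + s *: h) ->
  is_derive s (1 : R) (fun s => g (x + s *: h)) ('D_h g (x + s *: h)).
Proof.
move=> dg; have dv : derivable g (x + s *: h) h by exact: diff_derivable.
have E : (fun t : R => t^-1 *: (((fun s => g (x + s *: h)) \o shift s) (t *: 1) - g (x + s *: h))) =
   (fun t : R => t^-1 *: ((g \o shift (x + s *: h)) (t *: h) - g (x + s *: h))).
  apply/funext => t; congr (_ *: (_ - _)) => /=; congr g.
  by rewrite scalerDl addrCA -[t *: 1 as X in X *: h]/(t * 1) mulr1.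
by apply: DeriveDef; rewrite /derivable /derive E.
Qed.

(** Continuity of the partial derivatives gives the first bound on a ball; the mean value theorem on
    the segment from x to y gives the second, uniformly in both ends. *)
Lemma strict_scalar (U : set 'rV[R]_m) g x0 (e : R) : open U -> smooth_fun U g -> U x0 -> 0 < e ->
  exists2 r, 0 < r & (forall x, `|x - x0| < r -> U x) /\
   forall x, `|x - x0| < r ->
   (forall v, `|'D_v g x - 'D_v g x0| <= e * `|v|) /\
   forall y, `|y - x0| < r -> `|g y - g x - 'D_(y - x) g x0| <= e * `|y - x|.
Proof.
move=> Uo sg Ux0 e0; pose e' := e / m.+1%:R.
have e'0 : 0 < e' by rewrite divr_gt0.
have [r r0 [rU rD]] : exists2 r, 0 < r & (forall x, `|x - x0| < r -> U x) /\
   forall x, `|x - x0| < r -> forall i, `|'D_(delta_mx 0 i) g x - 'D_(delta_mx 0 i) g x0| <= e'.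
  have F0 : Filter (nbhs x0) := nbhs_filter x0.
  have H : \forall x \near x0, U x /\ forall i, `|'D_(delta_mx 0 i) g x - 'D_(delta_mx 0 i) g x0| <= e'.
    have H1 : \forall x \near x0, U x by apply: open_nbhs_nbhs; split.
    have H2 : \forall x \near x0, forall i, `|'D_(delta_mx 0 i) g x - 'D_(delta_mx 0 i) g x0| <= e'.
      apply: (@filter_forall _ _ (fun i x => `|'D_(delta_mx 0 i) g x - 'D_(delta_mx 0 i) g x0| <= e') _ (nbhs_filter x0)) => i.
      have c : {for x0, continuous (fun x => 'D_(delta_mx 0 i) g x)}.
        by have [_ D] := sg 1%N; exact: D.
      have H3 : \forall z \near x0, `|'D_(delta_mx 0 i) g x0 - 'D_(delta_mx 0 i) g z| <= e'.
        by apply: (@cvgr_dist_le R _ _ (nbhs x0) F0 (fun x => 'D_(delta_mx 0 i) g x)).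
      by apply: (@filterS _ _ F0 _ _ _ H3) => z; rewrite distrC.
    by apply: (@filterS2 _ _ F0 _ _ _ _ H1 H2) => z.
  have /nbhs_ballP[r /= r0 Hr] := H; exists r => //; split=> x xr.
    by case: (Hr x) => //; rewrite -ball_normE /= distrC.
  by case: (Hr x) => //; rewrite -ball_normE /= distrC.
have dg x : `|x - x0| < r -> differentiable g x.
  by move=> /rU Ux; exact: smooth_fun_differentiable sg Ux.
have x0r : `|x0 - x0| < r by rewrite subrr normr0.
have Dv x v : `|x - x0| < r -> `|'D_v g x - 'D_v g x0| <= e * `|v|.
  move=> xr; rewrite !derive_partials; [|exact: dg|exact: dg].
  rewrite -sumrB; apply: (le_trans (ler_norm_sum _ _ _)).
  apply: (@le_trans _ _ (\sum_(i < m) (e' * `|v|))).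
    apply: ler_sum => i _; rewrite -mulrBr normrM mulrC ler_pM ?row_coord_le //; exact: rD.
  rewrite sumr_const card_ord -mulr_natl mulrA ler_wpM2r //.
  rewrite /e' mulrCA ger_pMr // ler_pdivrMr // mul1r ler_nat //.
exists r => //; split=> // x xr; split=> [v|y yr]; first exact: Dv.
have seg (s : R) : 0 <= s -> s <= 1 -> `|x + s *: (y - x) - x0| < r.
  move=> s0 s1; have -> : x + s *: (y - x) - x0 = (1 - s) *: (x - x0) + s *: (y - x0).
    by apply/rowP => i; rewrite !mxE; ring.
  apply: (le_lt_trans (ler_normD _ _)); rewrite !normrZ (ger0_norm s0) ger0_norm ?subr_ge0 //.
  have [->|s0'] := eqVneq s 0; first by rewrite mul0r addr0 subr0 mul1r.
  have sp : 0 < s by rewrite lt_def s0' s0.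
  have h1 : (1 - s) * `|x - x0| <= (1 - s) * r by rewrite ler_wpM2l ?subr_ge0 // ltW.
  have h2 : s * `|y - x0| < s * r by rewrite ltr_pM2l.
  by move: h1 h2; move: (`|x - x0|) (`|y - x0|) => a b; lra.
have D (s : R) : 0 <= s -> s <= 1 -> is_derive s (1 : R) (fun s => g (x + s *: (y - x))) ('D_(y - x) g (x + s *: (y - x))).
  by move=> s0 s1; apply: segment_derive; apply: dg; exact: seg.
have [s|| s] := @MVT_segment R (fun s => g (x + s *: (y - x))) (fun s => 'D_(y - x) g (x + s *: (y - x))) 0 1 ler01.
- by rewrite in_itv /= => /andP[s0 s1]; apply: D; exact: ltW.
- apply: derivable_within_continuous => s; rewrite in_itv /= => /andP[s0 s1].
  by case: (D s s0 s1).
rewrite in_itv /= => /andP[s0 s1]; rewrite scale1r scale0r addr0 subr0 mulr1.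
have -> : x + (y - x) = y by rewrite addrCA subrr addr0.
by move=> ->; apply: Dv; exact: seg.
Unshelve. all: by end_near. Qed.

End Strict.

End Strict.

(** * The manifold: oriented frames, flatness estimates, weights and the glued fields *)

Module Manifold.

Import Core Geo Config Euclid Net SpinNet Spin Frame Frame2 Frame3 Bump Smooth Embed Strict.
Set Implicit Arguments.
Unset Strict Implicit.
Unset Printing Implicit Defensive.
Import Order.TTheory GRing.Theory Num.Theory numFieldNormedType.Exports.
Local Open Scope classical_set_scope.
Local Open Scope ring_scope.

Section JacobianFacts.

Variable R : realType.

Lemma jacobian_comp m p q (f : 'rV[R]_m -> 'rV[R]_p) (g : 'rV[R]_p -> 'rV[R]_q) x :
  differentiable f x -> differentiable g (f x) ->
  'J (g \o f) x = 'J f x *m 'J g (f x).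
Proof.
move=> df dg; have dc : differentiable (g \o f) x by exact: differentiable_comp.
apply/row_matrixP => i; rewrite !rowE mulmxA -!deriveEjacobian // (deriveE _ dc) diff_comp //=.
by rewrite -(deriveE _ df) (deriveE _ dg).
Qed.

Lemma jacobian_near_eq m p (f g : 'rV[R]_m -> 'rV[R]_p) x :
  (\near x, f x = g x) -> differentiable f x -> 'J f x = 'J g x.
Proof.
move=> fg df; have dg := differentiable_near_eq fg df.
apply/row_matrixP => i; have E1 := deriveEjacobian (delta_mx 0 i) df; have E2 := deriveEjacobian (delta_mx 0 i) dg.
apply: etrans (rowE _ _) (etrans _ (esym (rowE _ _))).
exact: etrans (esym E1) (etrans (near_eq_derive _ fg) E2).
Qed.

Definition tri N (X : 'M[R]_(3, N)) : triad R N :=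
  Triad (row 0 X) (row 1 X) (row (2%:R : 'I_3) X).

Lemma gs_orthogonal N (s t u : 'rV[R]_N) : ip s s = 1 -> ip t t = 1 -> ip s t = 0 ->
  ip s (u - ip u s *: s - ip u t *: t) = 0 /\ ip t (u - ip u s *: s - ip u t *: t) = 0.
Proof.
move=> ss tt st; rewrite !ipDr !ipNr !ipZr ss tt st (ipC t s) st (ipC s u) (ipC t u); split; ring.
Qed.

(** The change of basis is lower triangular with the inverse norms on its diagonal, so
    orthonormalising preserves orientation. *)
Lemma gram_schmidt N (X : 'M[R]_(3, N)) : (forall v : 'rV[R]_3, v *m X = 0 -> v = 0) ->
  exists2 B : 'M[R]_3, 0 < \det B & orthonormal (tri (B *m X)).
Proof.
move=> inj; pose l (i : 'I_3) := row i X.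
pose k1 : 'I_3 := 1; pose k2 : 'I_3 := 2%:R.
pose w (a b c : R) : 'rV[R]_3 := \row_i (if i == 0 then a else if i == k1 then b else c).
have wX a b c : w a b c *m X = a *: l 0 + b *: l k1 + c *: l k2.
  rewrite (mulmx_sum_row (w a b c) X) !big_ord_recl big_ord0 addr0 addrA; congr (_ + _ + _);
  rewrite mxE /=; congr (_ *: row _ X); exact: val_inj.
have w0 a b c : w a b c = 0 -> [/\ a = 0, b = 0 & c = 0].
  move=> h; have e0 := congr1 (fun r : 'rV[R]_3 => r 0 0) h; have e1 := congr1 (fun r : 'rV[R]_3 => r 0 k1) h; have e2 := congr1 (fun r : 'rV[R]_3 => r 0 k2) h.
  by move: e0 e1 e2; rewrite !mxE /= => -> -> ->.
have unit_of (u : 'rV[R]_N) : u != 0 -> let t := (nm u)^-1 *: u in ip t t = 1.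
  move=> u0 t; rewrite /t ipZl ipZr -nm2 expr2; field; by rewrite gt_eqF // nm_gt0.
have n1 : l 0 != 0.
  apply/eqP => h; have := inj (w 1 0 0); rewrite wX h !scaler0 !scale0r !addr0 => /(_ erefl)/w0[/eqP].
  by rewrite oner_eq0.
set a1 := (nm (l 0))^-1; have a10 : 0 < a1 by rewrite invr_gt0 nm_gt0.
set t1' := a1 *: l 0; have t11 : ip t1' t1' = 1 by exact: unit_of.
set p2 := ip (l k1) t1'; set u2 := l k1 - p2 *: t1'.
have u2E : u2 = w (- (p2 * a1)) 1 0 *m X.
  by rewrite wX scale1r scale0r addr0 /u2 /t1' scalerA scaleNr addrC.
have u20 : u2 != 0.
  by apply/eqP => h; have := inj (w (- (p2 * a1)) 1 0); rewrite -u2E h => /(_ erefl)/w0[_ /eqP]; rewrite oner_eq0.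
set a2 := (nm u2)^-1; have a20 : 0 < a2 by rewrite invr_gt0 nm_gt0.
set t2' := a2 *: u2; have t22 : ip t2' t2' = 1 by exact: unit_of.
have t12 : ip t1' t2' = 0.
  by rewrite /t2' ipZr /u2 ipDr ipNr ipZr t11 mulr1 (ipC t1') -/p2 subrr mulr0.
set p3 := ip (l k2) t1'; set q3 := ip (l k2) t2'; set u3 := l k2 - p3 *: t1' - q3 *: t2'.
have t2E : t2' = w (a2 * - (p2 * a1)) a2 0 *m X.
  by rewrite wX scale0r addr0 /t2' u2E wX scale1r scale0r addr0 scalerDr scalerA.
have u3E : u3 = w (- (p3 * a1) - q3 * (a2 * - (p2 * a1))) (- (q3 * a2)) 1 *m X.
  rewrite wX /u3 t2E wX scale0r addr0 /t1' scale1r; apply/rowP => i; rewrite !mxE; ring.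
have u30 : u3 != 0.
  by apply/eqP => h; have := inj (w (- (p3 * a1) - q3 * (a2 * - (p2 * a1))) (- (q3 * a2)) 1); rewrite -u3E h => /(_ erefl)/w0[_ _ /eqP]; rewrite oner_eq0.
set a3 := (nm u3)^-1; have a30 : 0 < a3 by rewrite invr_gt0 nm_gt0.
set t3' := a3 *: u3; have t33 : ip t3' t3' = 1 by exact: unit_of.
have t13 : ip t1' t3' = 0.
  rewrite /t3' ipZr; have -> : ip t1' u3 = 0; [exact: (gs_orthogonal (l k2) t11 t22 t12).1 | by rewrite mulr0].
have t23 : ip t2' t3' = 0.
  rewrite /t3' ipZr; have -> : ip t2' u3 = 0; [exact: (gs_orthogonal (l k2) t11 t22 t12).2 | by rewrite mulr0].
pose r1 := w a1 0 0; pose r2 := w (a2 * - (p2 * a1)) a2 0.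
pose r3 := w (a3 * (- (p3 * a1) - q3 * (a2 * - (p2 * a1)))) (a3 * - (q3 * a2)) a3.
pose B : 'M[R]_3 := \matrix_(i, j) (if i == 0 then r1 0 j else if i == k1 then r2 0 j else r3 0 j).
have B1 : row 0 B = r1 by apply/rowP => j; rewrite !mxE.
have B2 : row k1 B = r2 by apply/rowP => j; rewrite !mxE.
have B3 : row k2 B = r3 by apply/rowP => j; rewrite !mxE.
exists B.
  have tB : is_trig_mx B.
    apply/is_trig_mxP => i j; rewrite !mxE; case: i => -[|[|[|i]]] hi //=; case: j => -[|[|[|j]]] hj //= _; rewrite -!val_eqE //=.
  rewrite (det_trig tB); apply: prodr_gt0 => i _; rewrite mxE; case: eqVneq => [->|i0]; first by rewrite mxE.
  case: eqVneq => [->|i1]; first by rewrite mxE.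
  by rewrite mxE (negbTE i0) (negbTE i1).
have T1 : row 0 (B *m X) = t1' by rewrite row_mul B1 wX !scale0r !addr0.
have T2 : row k1 (B *m X) = t2' by rewrite row_mul B2 -t2E.
have T3 : row k2 (B *m X) = t3'.
  by rewrite row_mul B3 wX /t3' u3E wX; apply/rowP => i; rewrite !mxE; ring.
by rewrite /tri /orthonormal /= T1 T2 T3; split.
Qed.

End JacobianFacts.

(** * Norm and determinant bounds for linear maps *)

Section LinearBounds.

Variable R : realType.
Local Notation vec := (vec R).

Lemma nm_bound N (u : 'rV[R]_N) (t : R) : 0 <= t -> (forall k, `|u 0 k| <= t) -> nm u <= (N%:R + 1) * t.
Proof.
move=> t0 h; have n0 : 0 <= N%:R :> R by exact: ler0n.
rewrite -(@ler_pXn2r _ 2%N) ?nnegrE ?nm_ge0 ?mulr_ge0 ?addr_ge0 // nm2 /ip.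
apply: (@le_trans _ _ (\sum_(k < N) t ^+ 2)).
  apply: ler_sum => k _; rewrite -expr2 -[leLHS]real_normK ?num_real // ler_pXn2r ?nnegrE //; exact: h.
rewrite sumr_const card_ord -[leLHS]mulr_natl exprMn ler_wpM2r ?sqr_ge0 //; nra.
Qed.

Lemma comp_le_nm N (u : 'rV[R]_N) k : `|u 0 k| <= nm u.
Proof.
apply: ler_sqr_norm; first exact: nm_ge0.
rewrite nm2 /ip (bigD1 k) //= -expr2 lerDl; apply: sumr_ge0 => j _; by rewrite -expr2 sqr_ge0.
Qed.

Definition rowv (v : vec) : 'rV[R]_3 := \row_i (if i == 0 then vx v else if i == 1 then vy v else vz v).
Definition vecr (u : 'rV[R]_3) : vec := Vec (u 0 0) (u 0 1) (u 0 (2%:R : 'I_3)).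

Lemma rowvK u : rowv (vecr u) = u.
Proof.
apply/rowP => -[[|[|[|i]]] hi] //; rewrite /rowv mxE /=; congr (u 0 _); exact: val_inj.
Qed.

Lemma vecrB u w : vecr (u - w) = vsub (vecr u) (vecr w).
Proof. by rewrite /vecr /vsub /= !mxE. Qed.

Lemma rowv_le v i : `|rowv v 0 i| <= vnorm v.
Proof. by have [h1 h2 h3] := vnorm_comp v; rewrite /rowv mxE; case: ifP => // _; case: ifP. Qed.

Lemma emb_tri N (X : 'M[R]_(3, N)) v : emb (tri X) v = rowv v *m X.
Proof.
apply/esym; rewrite mulmx_sum_row !big_ord_recl big_ord0 addr0 addrA /emb /tri; congr (_ + _ + _);
rewrite /rowv mxE /=; congr (_ *: row _ X); exact: val_inj.
Qed.

Lemma emb_basis N (F : triad R N) :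
  [/\ emb F (@e1 R) = t1 F, emb F (Vec 0 1 0) = t2 F & emb F (@e3 R) = t3 F].
Proof. by rewrite /emb /= !scale1r !scale0r !add0r !addr0. Qed.

Lemma off_emb N (F : triad R N) v : orthonormal F -> off F (emb F v) = 0.
Proof. by move=> o; rewrite /off projK // subrr; apply/eqP; rewrite nm_eq0. Qed.

Lemma off_near N (F : triad R N) z v : orthonormal F -> off F z <= nm (z - emb F v).
Proof.
move=> o; rewrite -{1}(subrK (emb F v) z); apply: le_trans (offD _ _ _) _.
by rewrite off_emb // addr0 off_le.
Qed.

Lemma nm_le_addB N (u w : 'rV[R]_N) : nm u <= nm w + nm (u - w).
Proof. by have := nmD w (u - w); rewrite addrC subrK. Qed.

Lemma sub1E N (a b : 'rV[R]_N) k : (a - b) 0 k = a 0 k - b 0 k.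
Proof. by rewrite !mxE. Qed.

Lemma sub2E N (a b w : 'rV[R]_N) k : (a - b - w) 0 k = a 0 k - b 0 k - w 0 k.
Proof. by rewrite !mxE. Qed.

(** In the orthonormalised basis the coordinates of [v] have the length of [v *m L]; the entries of
    the change of basis supply [C]. *)
Lemma inj_bound N (L : 'M[R]_(3, N)) : (forall v : 'rV[R]_3, v *m L = 0 -> v = 0) ->
  exists2 C, 0 < C & forall v : 'rV[R]_3, `|v| <= C * nm (v *m L).
Proof.
move=> inj; have [B B0 o] := gram_schmidt inj.
have uB : B \in unitmx by rewrite unitmxE unitfE gt_eqF.
pose C := 1 + \sum_i \sum_k `|B k i|.
have C1 : 0 < C by rewrite ltr_pwDl // sumr_ge0 // => i _; apply: sumr_ge0.
exists C => // v; pose w := vecr (v *m invmx B).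
have vE : v *m L = emb (tri (B *m L)) w by rewrite emb_tri rowvK mulmxA mulmxKV.
rewrite vE nm_emb //; apply: row_norm_le => [|i]; first by rewrite mulr_ge0 ?vnorm_ge0 // ltW.
have -> : v 0 i = \sum_k rowv w 0 k * B k i by rewrite -[in LHS](mulmxKV uB v) mxE rowvK.
apply: le_trans (ler_norm_sum _ _ _) _.
apply: (@le_trans _ _ (\sum_k `|B k i| * vnorm w)).
  by apply: ler_sum => k _; rewrite normrM mulrC ler_wpM2l // rowv_le.
rewrite -mulr_suml ler_wpM2r ?vnorm_ge0 //.
have : \sum_k `|B k i| <= \sum_j \sum_k `|B k j|.
  by rewrite [leRHS](bigD1 i) //= lerDl; apply: sumr_ge0 => j _; apply: sumr_ge0.
by rewrite /C; move: (\sum_k _) (\sum_j _) => s t; lra.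
Qed.

Lemma det3_mx (U : 'M[R]_3) :
  det3 (vecr (row 0 U)) (vecr (row 1 U)) (vecr (row (2%:R : 'I_3) U)) = \det U.
Proof.
pose f (i j : nat) := U (inord i) (inord j).
have -> : U = \matrix_(i < 3, j < 3) f i j by apply/matrixP => i j; rewrite !mxE /f !inord_val.
rewrite (expand_det_row _ ord0) !big_ord_recl big_ord0 /cofactor.
rewrite !(expand_det_row _ ord0) !big_ord_recl !big_ord0 /cofactor !det_mx11 !mxE /=.
rewrite /det3 /vecr /dot /cross /= !mxE /=; ring.
Qed.

Lemma gram_det (a b c : vec) : det3 a b c ^+ 2 = dot a a * dot b b * dot c c +
  2 * dot a b * dot a c * dot b c - dot a a * dot b c ^+ 2 - dot b b * dot a c ^+ 2 - dot c c * dot a b ^+ 2.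
Proof. vec_ring. Qed.

(* Lengths and angles force [det T ^ 2] close to 1, so its sign can be read off any matrix near [T]. *)
Lemma turn_det_gt0 N (F G : triad R N) (h : R) (V1 V2 V3 : vec) : orthonormal F -> orthonormal G ->
  0 <= h -> h <= 1 / 1000 -> tilt F G h -> 0 < det3 V1 V2 V3 ->
  vnorm (vsub (turn F G (@e1 R)) V1) <= h -> vnorm (vsub (turn F G (Vec 0 1 0)) V2) <= h ->
  vnorm (vsub (turn F G (@e3 R)) V3) <= h ->
  0 < det3 (turn F G (@e1 R)) (turn F G (Vec 0 1 0)) (turn F G (@e3 R)).
Proof.
move=> oF oG h0 h1 tl V0 d1 d2 d3.
have n1 : vnorm (@e1 R) = 1 by rewrite /vnorm /dot /= !mulr0 mulr1 !addr0 sqrtr1.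
have n2 : vnorm (Vec 0 1 0 : vec) = 1 by rewrite /vnorm /dot /= !mulr0 mulr1 add0r addr0 sqrtr1.
have n3 : vnorm (@e3 R) = 1 by rewrite /vnorm /dot /= !mulr0 mulr1 !add0r sqrtr1.
have gr := turn_gram _ _ oF oG h0 tl.
have T v : vnorm v = 1 -> vnorm (turn F G v) <= 1.
  by move=> v1; rewrite /turn; apply: le_trans (vnorm_proj _ oF) _; rewrite nm_emb // v1.
have h20 : 0 <= h ^+ 2 by exact: sqr_ge0.
have h21 : h ^+ 2 <= 1 / 100 by rewrite expr2; nra.
have := gr (@e1 R) (@e1 R); have := gr (Vec 0 1 0) (Vec 0 1 0); have := gr (@e3 R) (@e3 R).
have := gr (@e1 R) (Vec 0 1 0); have := gr (@e1 R) (@e3 R); have := gr (Vec 0 1 0) (@e3 R).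
have i1 := T _ n1; have i2 := T _ n2; have i3 := T _ n3; move: d1 d2 d3 i1 i2 i3.
move: (turn F G (@e1 R)) (turn F G (Vec 0 1 0)) (turn F G (@e3 R)) => a b c.
rewrite n1 n2 n3 /dot /= !mulr1 !mulr0 !addr0 !add0r !subr0 -!/(dot _ _).
move=> d1 d2 d3 i1 i2 i3 bc ac ab cc bb aa.
have [_ _] := gram_bounds h20 h21 aa bb cc ab ac bc; rewrite -gram_det => gd.
have W u v : vnorm u <= 1 -> vnorm (vsub u v) <= h -> vnorm v <= 2.
  by move=> hu huv; have := vnorm_le_add v u; rewrite vnorm_subC; lra.
have := det_diff (ler0n _ 2%N) h0 (le_trans i1 (ler1n _ 2%N)) (le_trans i2 (ler1n _ 2%N)) (W _ _ i2 d2) (W _ _ i3 d3) d1 d2 d3.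
rewrite ler_norml => /andP[dl _]; rewrite ltNge; apply/negP => neg.
have := V0; have : - (12 * h) <= det3 a b c by move: dl; rewrite expr2; lra.
move: (det3 a b c) gd neg => D gd neg lo _; nra.
Qed.

End LinearBounds.

(** * Estimates in one chart around a point *)

Section LocalEstimate.

Variable R : realType.

(** The embedding records a bump value and its product with each coordinate; the coordinate is
    recovered as their quotient as long as the bump value stays away from zero. *)
Lemma coord_close (x y k a D r Z : R) : 0 < a -> a / 2 < k -> 0 < r -> `|y| <= Z ->
  `|k * x - a * y| < D -> `|k - a| < D -> D <= r * a / (8 * (1 + Z)) -> `|x - y| <= r / 2.
Proof.
move=> a0 ka r0 yZ h1 h2 h3; have k0 : 0 < k by lra.
have Z0 : 0 <= Z by exact: le_trans yZ.
have b1 : k * `|x - y| <= D * (1 + Z).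
  rewrite -{1}(ger0_norm (ltW k0)) -normrM; have -> : k * (x - y) = (k * x - a * y) - (k - a) * y by ring.
  apply: le_trans (ler_normB _ _) _; rewrite normrM.
  have : `|k - a| * `|y| <= D * Z by apply: ler_pM => //; exact: ltW.
  by move: h1; move: (`|k * x - _|) (_ * `|y|) => s t; lra.
have b2 : D * (8 * (1 + Z)) <= r * a by rewrite -ler_pdivlMr //; lra.
have b3 : a / 2 * `|x - y| <= k * `|x - y| by apply: ler_wpM2r => //; exact: ltW.
have b4 : 0 < r * a by exact: mulr_gt0.
by rewrite -(ler_pM2l a0); move: b1 b2 b3; move: (`|x - y|) => s; lra.
Qed.

Lemma small_exists (t : R) : 0 < t -> exists h, [/\ 0 < h, h <= t & h <= 1 / 1000].
Proof.
move=> t0; have c : 0 < 1 / 1000 :> R by lra.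
exists (Num.min t (1 / 1000)); split; [by rewrite lt_min t0 c | by rewrite ge_min lexx | by rewrite ge_min lexx orbT].
Qed.

Lemma ratio_close (x y a h D : R) : 0 < a -> 0 < h -> h <= 1 / 1000 -> D <= a * h / 64 ->
  `|x - a| < D -> `|y - a| < D -> 0 < y /\ `|x / y - 1| <= h / 16.
Proof.
move=> a0 h0 h1 hD; rewrite !ltr_norml => /andP[x1 x2] /andP[y1 y2].
have ah : a * h <= a * (1 / 1000) by rewrite ler_wpM2l // ltW.
have y0 : a / 2 < y by lra.
have yp : 0 < y by lra.
split=> //; have -> : x / y - 1 = (x - y) / y by field; rewrite gt_eqF.
rewrite normrM normfV (gtr0_norm yp) ler_pdivrMr //.
have : h * (a / 2) <= h * y by rewrite ler_pM2l // ltW.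
by rewrite ler_norml => hy; apply/andP; split; lra.
Qed.

Lemma above_half (a h D k : R) : 0 < a -> a * h <= a * (1 / 1000) -> D <= a * h / 64 -> `|k - a| < D ->
  a / 2 < k /\ 0 < k.
Proof. by move=> a0 ah hD; rewrite ltr_norml => /andP[h1 _]; split; lra. Qed.

Lemma half_bounds (r : R) : 0 < r -> 0 < r / 2 /\ r / 2 < r.
Proof. by move=> r0; split; lra. Qed.

Lemma halves_lt (x y D : R) : x < D / 2 -> y < D / 2 -> x + y < D.
Proof. by move=> *; lra. Qed.

Lemma eps_close (del : R) : 0 < del -> del / 50 * 40 < del.
Proof. by move=> d0; lra. Qed.

Lemma flat_proj (h s o v : R) : h <= 1 / 1000 -> 0 <= s -> o <= h * s -> s - o <= v -> s <= 2 * v.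
Proof. move=> h1 s0 o1 sv; have : h * s <= 1 / 1000 * s by rewrite ler_wpM2r.
by lra.
Qed.

Lemma forty : 10 * 4 <= 40 :> R. Proof. by lra. Qed.
Lemma two40 : 2 <= 40 :> R. Proof. by lra. Qed.

Lemma small_le (h th : R) : 0 < h -> h <= th / 40 -> h <= th.
Proof. by move=> *; lra. Qed.

Lemma small_mul (h th s : R) : 0 < h -> h <= th / 40 -> 0 <= s -> s <= 40 -> h * s <= th.
Proof.
move=> h0 h1 s0 s1; have : h * s <= h * 40 by rewrite ler_pM2l.
by lra.
Qed.

Lemma jac_entry m N (f : 'rV[R]_m -> 'rV[R]_N) x v k : differentiable f x ->
  (v *m 'J f x) 0 k = 'D_v (fun y => f y 0 k) x.
Proof.
move=> df; apply: etrans (congr1 (fun r : 'rV[R]_N => r 0 k) (esym (deriveEjacobian v df))) _.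
by apply: derive_row; exact: diff_derivable.
Qed.

Lemma strict_map m N (U : set 'rV[R]_m) (f : 'rV[R]_m -> 'rV[R]_N) z (e : R) : open U -> smooth_on U f ->
  U z -> 0 < e -> exists2 r, 0 < r &
  (forall x, `|x - z| < r -> U x) /\
  forall x y, `|x - z| < r -> `|y - z| < r ->
   (forall v : 'rV[R]_m, nm (v *m 'J f x - v *m 'J f z) <= e * `|v|) /\
   nm (f y - f x - (y - x) *m 'J f z) <= e * `|y - x|.
Proof.
move=> Uo sf Uz e0; pose e' := e / (N%:R + 1).
have N1 : 0 < N%:R + 1 :> R by rewrite ltr_wpDl.
have e'0 : 0 < e' by rewrite divr_gt0.
have EE t : e * t = (N%:R + 1) * (e' * t).
  by rewrite mulrA; congr (_ * _); rewrite /e' mulrCA mulfV ?mulr1 // gt_eqF.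
have df x : U x -> differentiable f x by move=> Ux; have [h _] := sf 1%N; exact: h.
have [r1 r10 H1] : exists2 r, 0 < r & forall x, `|x - z| < r -> U x.
  have := Uo; rewrite openE => /(_ _ Uz) /nbhs_ballP[r /= r0 Hr]; exists r => // x xr.
  by apply: Hr; rewrite -ball_normE /= distrC.
pose P (k : 'I_N) r := forall x, `|x - z| < r ->
   (forall v : 'rV[R]_m, `|'D_v (fun y => f y 0 k) x - 'D_v (fun y => f y 0 k) z| <= e' * `|v|) /\
   forall y, `|y - z| < r -> `|f y 0 k - f x 0 k - 'D_(y - x) (fun y => f y 0 k) z| <= e' * `|y - x|.
have [||r r0 H] := @finite_radius R 'I_N P.
- move=> k r s _ sr h2 x xs; have [h3 h4] := h2 x (lt_le_trans xs sr).
  by split=> // y ys; apply: h4; exact: lt_le_trans ys sr.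
- move=> k; have [r r0 [_ h]] := strict_scalar Uo (smooth_on_coord Uo k sf) Uz e'0; by exists r.
exists (Num.min r1 r); first by rewrite lt_min r10 r0.
split=> [x|x y]; first by rewrite lt_min => /andP[h _]; exact: H1.
rewrite !lt_min => /andP[x1 x2] /andP[y1 y2]; have dx := df _ (H1 _ x1); have dz := df _ Uz.
have P0 (s : R) : 0 <= s -> 0 <= e' * s by move=> s0; apply: mulr_ge0 => //; exact: ltW.
split=> [v|]; rewrite EE.
  apply: nm_bound => [|k]; first exact: P0.
  have -> : (v *m 'J f x - v *m 'J f z) 0 k = 'D_v (fun y => f y 0 k) x - 'D_v (fun y => f y 0 k) z.
    apply: etrans (sub1E _ _ _) _.
    exact: (f_equal2 (fun s t : R => s - t) (jac_entry v k dx) (jac_entry v k dz)).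
  by have [h _] := H k x x2; exact: h.
apply: nm_bound => [|k]; first exact: P0.
have -> : (f y - f x - (y - x) *m 'J f z) 0 k = f y 0 k - f x 0 k - 'D_(y - x) (fun y => f y 0 k) z.
  apply: etrans (sub2E _ _ _ _) _.
  exact: (f_equal (fun t : R => f y 0 k - f x 0 k - t) (jac_entry (y - x) k dz)).
by have [_ h] := H k x x2; exact: h.
Qed.

Variables (N : nat) (J0 : 'M[R]_(3, N)) (C e h : R).
Hypothesis C0 : 0 < C.
Hypothesis e0 : 0 < e.
Hypothesis h0 : 0 < h.
Hypothesis h1 : h <= 1 / 1000.
Hypothesis eC : C * e = h / 8.
Hypothesis HC : forall u : 'rV[R]_3, `|u| <= C * nm (u *m J0).

Lemma absorb_real (U s : R) : 0 <= U -> U <= C * (s + e * U) -> 2 * (e * U) <= h / 2 * s.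
Proof.
move=> U0 b1; have b2 : C * (e * U) = h / 8 * U by rewrite mulrA eC.
have b3 : h * U <= 1 / 1000 * U by rewrite ler_wpM2r.
have b4 : U <= 2 * (C * s) by move: b1; rewrite mulrDr b2; move: (C * s) => t; lra.
have b5 : e * U <= e * (2 * (C * s)) by rewrite ler_pM2l.
have b6 : e * (2 * (C * s)) = 2 * (C * e) * s by ring.
by move: b5; rewrite b6 eC; move: (e * U) => t; lra.
Qed.

Lemma absorb (u : 'rV[R]_3) (s : R) : nm (u *m J0) <= s + e * `|u| -> 2 * (e * `|u|) <= h / 2 * s.
Proof. by move=> hs; apply: absorb_real => //; apply: le_trans (HC u) _; rewrite ler_pM2l. Qed.

Definition near_J0 (J : 'M[R]_(3, N)) := forall u : 'rV[R]_3, nm (u *m J - u *m J0) <= e * `|u|.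

Lemma near_pair J J' (u : 'rV[R]_3) : near_J0 J -> near_J0 J' -> nm (u *m J - u *m J') <= 2 * (e * `|u|).
Proof.
move=> nJ nJ'; apply: le_trans (nmB _ (u *m J0) _) _; rewrite [X in _ + X]nm_subC.
by have := lerD (nJ u) (nJ' u); rewrite -mulr2n mulr_natl.
Qed.

Lemma frame_rows F B J v : near_J0 J -> orthonormal F -> F = tri (B *m J) ->
  [/\ emb F v = rowv v *m B *m J, nm (rowv v *m B *m J) = vnorm v & 2 * (e * `|rowv v *m B|) <= h / 2 * vnorm v].
Proof.
move=> nJ oF FE; have eE : emb F v = rowv v *m B *m J by rewrite FE emb_tri mulmxA.
have nE : nm (rowv v *m B *m J) = vnorm v by rewrite -eE nm_emb.
split=> //; apply: absorb; rewrite -nE; apply: le_trans (nm_le_addB _ (rowv v *m B *m J)) _.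
by rewrite lerD2l nm_subC; exact: nJ.
Qed.

Lemma frame_span F (B : 'M[R]_3) (J : 'M[R]_(3, N)) (u : 'rV[R]_3) : B \in unitmx -> F = tri (B *m J) ->
  emb F (vecr (u *m invmx B)) = u *m J.
Proof. by move=> uB ->; rewrite emb_tri rowvK mulmxA mulmxKV. Qed.

Lemma half_le (s : R) : 0 <= s -> h / 2 * s <= h * s.
Proof. by move=> s0; rewrite ler_wpM2r //; have := h0; lra. Qed.

Lemma off_estimate F B J z (u : 'rV[R]_3) : near_J0 J -> orthonormal F -> B \in unitmx -> F = tri (B *m J) ->
  nm (z - u *m J0) <= e * `|u| -> off F z <= h * nm z.
Proof.
move=> nJ oF uB FE zu; apply: le_trans (half_le (nm_ge0 z)); apply: le_trans (absorb (u := u) _); last first.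
  by apply: le_trans (nm_le_addB _ z) _; rewrite lerD2l nm_subC.
apply: le_trans (off_near _ (vecr (u *m invmx B)) oF) _; rewrite (frame_span _ uB FE).
apply: le_trans (nmB _ (u *m J0) _) _; rewrite [X in _ + X]nm_subC.
by have := lerD zu (nJ u); rewrite -mulr2n mulr_natl.
Qed.

(** [J] belongs to a net point and [J'] to a point nearby: the combination of coordinate fields that
    gives the frame at one point almost gives it at the other. *)
Lemma field_estimate F B J J' (k : R) v : near_J0 J -> near_J0 J' -> orthonormal F -> F = tri (B *m J) ->
  `|k - 1| <= h / 16 -> nm (emb (tri (k *: (B *m J'))) v - emb F v) <= h * vnorm v.
Proof.
move=> nJ nJ' oF FE k1; have [eE nE uE] := frame_rows v nJ oF FE.
rewrite emb_tri -scalemxAr mulmxA eE; set u := rowv v *m B.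
have -> : k *: (u *m J') - u *m J = (k - 1) *: (u *m J') + (u *m J' - u *m J).
  by rewrite scalerBl scale1r addrA subrK.
apply: le_trans (nmD _ _) _; rewrite nmZ.
have v0 : 0 <= vnorm v := vnorm_ge0 v.
have hv1 : h * vnorm v <= 1 / 1000 * vnorm v by rewrite ler_wpM2r.
have f2 := le_trans (near_pair u nJ' nJ) uE.
have n2 : nm (u *m J') <= 2 * vnorm v.
  by apply: le_trans (nm_le_addB _ (u *m J)) _; rewrite nE; move: f2 hv1 v0; move: (nm _) (vnorm v) => s t; lra.
have : `|k - 1| * nm (u *m J') <= h / 16 * (2 * vnorm v) by apply: ler_pM => //; exact: nm_ge0.
have : 0 <= h * vnorm v by rewrite mulr_ge0 // ltW.
by move: f2; move: (nm (_ - _)) (_ * nm _) (vnorm v) => s t w; lra.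
Qed.

(** [turn F F'] is compared with the matrix B' B^-1, whose determinant is positive because both
    frames are oriented; [turn_det_gt0] transfers the sign. *)
Lemma turn_estimate F B J F' B' J' : near_J0 J -> near_J0 J' -> orthonormal F -> orthonormal F' ->
  0 < \det B -> 0 < \det B' -> F = tri (B *m J) -> F' = tri (B' *m J') ->
  tilt F F' h /\ 0 < det3 (turn F F' (@e1 R)) (turn F F' (Vec 0 1 0)) (turn F F' (@e3 R)).
Proof.
move=> nJ nJ' oF oF' B0 B'0 FE FE'.
have uB : B \in unitmx by rewrite unitmxE unitfE gt_eqF.
have G v : nm (emb F' v - emb F (vecr (rowv v *m B' *m invmx B))) <= h / 2 * vnorm v.
  have [-> _ uE] := frame_rows v nJ' oF' FE'; rewrite (frame_span _ uB FE).
  exact: le_trans (near_pair _ nJ' nJ) uE.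
have G1 v := le_trans (G v) (half_le (vnorm_ge0 v)).
have tl : tilt F F' h by move=> v; apply: le_trans (off_near _ _ oF) (G1 v).
split=> //.
have rE X (v : Geo.vec R) : rowv v *m B' *m X = rowv v *m (B' *m X) by rewrite mulmxA.
have [b1 b2 b3] := emb_basis (tri (B' *m invmx B)); rewrite !emb_tri -!rE /= in b1 b2 b3.
have T v : vnorm v = 1 -> vnorm (vsub (turn F F' v) (vecr (rowv v *m B' *m invmx B))) <= h.
  move=> v1; rewrite /turn -(projK (vecr _) oF) -projB; apply: le_trans (vnorm_proj _ oF) _.
  by have := G1 v; rewrite v1 mulr1.
have n1 : vnorm (@e1 R) = 1 by rewrite /vnorm /dot /= !mulr0 mulr1 !addr0 sqrtr1.
have n2 : vnorm (Vec 0 1 0 : Geo.vec R) = 1 by rewrite /vnorm /dot /= !mulr0 mulr1 add0r addr0 sqrtr1.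
have n3 : vnorm (@e3 R) = 1 by rewrite /vnorm /dot /= !mulr0 mulr1 !add0r sqrtr1.
apply: (turn_det_gt0 oF oF' (ltW h0) h1 tl _ (T _ n1) (T _ n2) (T _ n3)).
by rewrite b1 b2 b3 det3_mx det_mulmx det_inv mulr_gt0 // invr_gt0.
Qed.

End LocalEstimate.

(** * Weight functions of the net and its packing bound *)

Section Weights.

Variable R : realType.
Local Notation vec := (vec R).

Lemma bump0_le1 (u : R) : bump 0 u <= 1.
Proof.
rewrite /bump; case: ltP => u0; last exact: ler01.
by rewrite expr0 mul1r expR_le1 oppr_le0 invr_ge0 ltW.
Qed.

Lemma bump0_mono (s t : R) : s <= t -> bump 0 s <= bump 0 t.
Proof.
move=> st; case: (lerP s 0) => s0; first by rewrite (bump_le0 0 s0) bump_ge0.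
have t0 := lt_le_trans s0 st.
by rewrite /bump s0 t0 !expr0 !mul1r ler_expR lerN2 lef_pV2.
Qed.

Lemma bump2_le (u : R) : bump 2 u <= 4`!%:R.
Proof.
have f1 : 1 <= 4`!%:R :> R by rewrite ler1n fact_gt0.
have f0 : 0 <= 4`!%:R :> R := ler0n _ _.
case: (lerP u 0) => u0; first by rewrite bump_le0.
case: (lerP u 1) => u1.
  apply: le_trans (bump_bound 2 u) _; rewrite ler_piMr // expr_le1 //; exact: ltW.
rewrite /bump u0; apply: le_trans f1; apply: mulr_ile1; rewrite ?expR_ge0 ?exprn_ge0 ?invr_ge0 ?(ltW u0) //.
  by rewrite exprn_ile1 ?invr_ge0 ?(ltW u0) // invf_le1 // ltW.
by rewrite expR_le1 oppr_le0 invr_ge0 ltW.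
Qed.

Lemma bump0_lip (s t : R) : `|bump 0 s - bump 0 t| <= 4`!%:R * `|s - t|.
Proof.
wlog st : s t / t <= s => [H|].
  by case/orP: (le_total t s) => h; [exact: H | rewrite distrC (distrC s); exact: H].
have [x _||x _] := @MVT_segment R (bump 0) (bump 2) t s st.
- by have := is_derive_bump 0 x; rewrite mulr0n mul0r subr0.
- by apply: derivable_within_continuous => x _; case: (is_derive_bump 0 x).
move=> ->; rewrite normrM ler_wpM2r // ger0_norm ?bump_ge0 //; exact: bump2_le.
Qed.

(** Coordinates between -40 and 40 are cut into intervals of length 1/8, and 640 = 8 * 80. *)
Definition cells : nat := (Num.bound (640 : R)).+1.

(** Two net points whose projections share a cell have projections at distance at most 3/8, hence
    are at distance at most 3/4 by flatness, against the separation by one. *)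
Lemma packing_card N n (x : 'I_n -> 'rV[R]_N) (F : 'I_n -> triad R N) i : orthonormal (F i) ->
  (forall j k, j != k -> 1 <= nm (x j - x k)) ->
  (forall j k, nm (x j - x i) <= 40 -> nm (x k - x i) <= 40 ->
     nm (x j - x k) <= 2 * vnorm (proj (F i) (x j - x k))) ->
  (#|[set j | SpinNet.near x 4 i j]%SET| <= #|{: 'I_cells * 'I_cells * 'I_cells}|)%N.
Proof.
move=> o sep fl; pose z j := proj (F i) (x j - x i).
pose cl (t : R) : 'I_cells := inord (Num.truncn (8 * (t + 40))).
pose f j := (cl (vx (z j)), cl (vy (z j)), cl (vz (z j))).
set S := [set j | _]%SET; rewrite -(@card_in_imset _ _ f (mem S)); first exact: max_card.
have clE (t t' : R) : `|t| <= 40 -> `|t'| <= 40 -> cl t = cl t' -> `|t - t'| <= 1 / 8.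
  rewrite !ler_norml => /andP[a1 a2] /andP[b1 b2] /(congr1 val) /=.
  have B (s : R) : -40 <= s -> s <= 40 -> 0 <= 8 * (s + 40) /\ (Num.truncn (8 * (s + 40)%R) < cells)%N.
    move=> s1 s2; have s3 : 0 <= 8 * (s + 40) by lra.
    split=> //; apply: truncn_lt => //; apply: (@le_trans _ _ 640); first by lra.
    by apply: ltW; apply: archi_boundP; lra.
  have [a3 a4] := B t a1 a2; have [b3 b4] := B t' b1 b2; rewrite !inordK // => /(truncn_eq_close a3 b3).
  by rewrite ltr_norml => /andP[c1 c2]; apply/andP; split; lra.
move=> j k; rewrite !inE /SpinNet.near => hj hk e; apply/eqP/negP => /negP jk.
have nj : nm (x j - x i) <= 40 by rewrite nm_subC; exact: le_trans hj (forty R).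
have nk : nm (x k - x i) <= 40 by rewrite nm_subC; exact: le_trans hk (forty R).
have b l : nm (x l - x i) <= 40 -> [/\ `|vx (z l)| <= 40, `|vy (z l)| <= 40 & `|vz (z l)| <= 40].
  move=> hl; have h := le_trans (vnorm_proj (x l - x i) o) hl; have [h1 h2 h3] := vnorm_comp (z l).
  by split; [apply: le_trans h1 h | apply: le_trans h2 h | apply: le_trans h3 h].
have [x1 y1 z1] := b _ nj; have [x2 y2 z2] := b _ nk.
have [ex ey ez] : [/\ cl (vx (z j)) = cl (vx (z k)), cl (vy (z j)) = cl (vy (z k)) & cl (vz (z j)) = cl (vz (z k))].
  by move: e; rewrite /f => -[-> -> ->].
have V : vnorm (vsub (z j) (z k)) <= 3 * (1 / 8).
  by apply: vnorm_le_comps; [exact: clE x1 x2 ex | exact: clE y1 y2 ey | exact: clE z1 z2 ez].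
have w : x j - x k = (x j - x i) - (x k - x i) by rewrite opprB addrA subrK.
have := fl j k nj nk; rewrite {2}w projB -/(z j) -/(z k); have := sep j k jk.
move: V; move: (vnorm _) (nm _) => s t; lra.
Qed.

(** The weight lives at distance below 2 and is at least [bump 0 3] up to distance 1. In the
    Lipschitz constant, 4! bounds the derivative [bump 2], and 100 = 50 + 50 comes from the
    difference of the squared distances. *)
Lemma net_data_bump N n (x : 'I_n -> 'rV[R]_N) (F : 'I_n -> triad R N) (P : 'rV[R]_N -> Prop) :
  (forall i, orthonormal (F i)) -> (forall j k, j != k -> 1 <= nm (x j - x k)) -> (forall i, P (x i)) ->
  (forall i p p', P p -> P p' -> nm (p - x i) <= 40 -> nm (p' - x i) <= 40 ->
     nm (p - p') <= 2 * vnorm (proj (F i) (p - p'))) ->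
  net_data #|{: 'I_cells * 'I_cells * 'I_cells}| (4`!%:R * 100) (bump 0 3) x F P
    (fun j p => bump 0 (4 - nm (p - x j) ^+ 2)).
Proof.
move=> o sep Px fl; split=> //.
- by move=> i; apply: (packing_card (o i)) => // j k; apply: fl.
- by move=> j p _; rewrite bump_ge0 bump0_le1.
- move=> j p _ nz; rewrite leNgt; apply/negP => h; case/negP: nz; apply/eqP/bump_le0.
  by rewrite subr_le0; move: h; move: (nm _) => t h; nra.
- move=> j p _ h; apply: bump0_mono; have := nm_ge0 (p - x j); move: h; move: (nm _) => t h h'; nra.
move=> j p p' _ _ h h'; apply: le_trans (bump0_lip _ _) _; rewrite -mulrA ler_wpM2l ?ler0n //.
have a0 := nm_ge0 (p - x j); have b0 := nm_ge0 (p' - x j); have c0 := nm_ge0 (p - p').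
have k1 := nmB p p' (x j); have k2 := nmB p' p (x j); rewrite (nm_subC p' p) in k2.
move: h h' a0 b0 c0 k1 k2; move: (nm (p - x j)) (nm (p' - x j)) (nm (p - p')) => s t u h h' a0 b0 c0 k1 k2.
have -> : 4 - s ^+ 2 - (4 - t ^+ 2) = (t - s) * (t + s) by ring.
rewrite normrM mulrC (ger0_norm (addr_ge0 b0 a0)); apply: ler_pM => //; first exact: addr_ge0.
  by lra.
by rewrite ler_norml; apply/andP; split; lra.
Qed.

Lemma delta_mulE m n (B : 'M[R]_(m, n)) i j : (delta_mx 0 i *m B : 'rV[R]_n) 0 j = B i j.
Proof. by rewrite -rowE mxE. Qed.

Lemma scale_cond m n (s k : R) (X : 'rV[R]_n) (Y : 'rV[R]_m) (Z : 'M[R]_(m, n)) :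
  (k != 0 -> X = Y *m Z) -> (s * k) *: X = ((s * k) *: Y) *m Z.
Proof.
by move=> h; have [->|/h ->] := eqVneq k 0; [rewrite mulr0 !scale0r mul0mx | rewrite scalemxAl].
Qed.

Lemma diff_jac m n (f : 'rV[R]_m -> 'rV[R]_n) x v : differentiable f x -> 'd f x v = v *m 'J f x.
Proof. by move=> df; exact: etrans (esym (deriveE v df)) (deriveEjacobian v df). Qed.

Lemma rowv_rot_sum (q : quat R) (u : 'rV[R]_3) :
  rowv (rot q (vecr u)) = \sum_k u 0 k *: rowv (rot q (vecr (delta_mx 0 k))).
Proof.
pose g (u : 'rV[R]_3) := rowv (rot q (vecr u)).
have gD a b : g (a + b) = g a + g b.
  apply/rowP => i; rewrite /g /rowv /rot /vecr !mxE /= ?mxE; case: ifP => _; last case: ifP => _; ring.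
have gZ k a : g (k *: a) = k *: g a.
  apply/rowP => i; rewrite /g /rowv /rot /vecr !mxE /= ?mxE; case: ifP => _; last case: ifP => _; ring.
rewrite -!/(g _) {1}(row_sum_delta u) !big_ord_recl !big_ord0 !addr0 !gD !gZ.
by rewrite /g.
Qed.

Section Alg.

Variables (m : nat) (U : set 'rV[R]_m).
Implicit Types f g : 'rV[R]_m -> R.

Lemma alg_opp f : alg U f -> alg U (fun x => - f x).
Proof. by move=> af; apply: A_eq (A_mul (A_cst U (-1)) af) => x _; rewrite mulN1r. Qed.

Lemma alg_sqr f : alg U f -> alg U (fun x => f x ^+ 2).
Proof. by move=> af; apply: A_eq (A_mul af af) => x _; rewrite expr2. Qed.

Lemma alg_rot (f0 f1 f2 f3 : 'rV[R]_m -> R) (v : vec) i : alg U f0 -> alg U f1 -> alg U f2 -> alg U f3 ->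
  alg U (fun x => rowv (rot (Quat (f0 x) (f1 x) (f2 x) (f3 x)) v) 0 i).
Proof.
move=> a0 a1 a2 a3.
have S f g h (a b c : R) : alg U f -> alg U g -> alg U h -> alg U (fun x => f x * a + g x * b + h x * c).
  by move=> af ag ah; apply: A_add; [apply: A_add|]; apply: A_mul => //; exact: A_cst.
have Q f g h k : alg U f -> alg U g -> alg U h -> alg U k -> alg U (fun x => f x ^+ 2 + g x ^+ 2 - h x ^+ 2 - k x ^+ 2).
  by move=> af ag ah ak; apply: A_add; [apply: A_add; [apply: A_add|apply: alg_opp]|apply: alg_opp]; exact: alg_sqr.
have D f g h k : alg U f -> alg U g -> alg U h -> alg U k -> alg U (fun x => 2 * (f x * g x + h x * k x)).
  by move=> af ag ah ak; apply: A_mul; [exact: A_cst | apply: A_add; exact: A_mul].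
have E f g h k : alg U f -> alg U g -> alg U h -> alg U k -> alg U (fun x => 2 * (f x * g x - h x * k x)).
  by move=> af ag ah ak; apply: A_mul; [exact: A_cst | apply: A_add; [exact: A_mul | apply: alg_opp; exact: A_mul]].
have X : alg U (fun x => vx (rot (Quat (f0 x) (f1 x) (f2 x) (f3 x)) v)).
  apply: A_eq (S _ _ _ (vx v) (vy v) (vz v) (Q _ _ _ _ a0 a1 a2 a3) (E _ _ _ _ a1 a2 a0 a3) (D _ _ _ _ a1 a3 a0 a2)) => x _.
  by rewrite /rot /=; ring.
have Y : alg U (fun x => vy (rot (Quat (f0 x) (f1 x) (f2 x) (f3 x)) v)).
  apply: A_eq (S _ _ _ (vx v) (vy v) (vz v) (D _ _ _ _ a1 a2 a0 a3) (Q _ _ _ _ a0 a2 a1 a3) (E _ _ _ _ a2 a3 a0 a1)) => x _.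
  by rewrite /rot /=; ring.
have Z : alg U (fun x => vz (rot (Quat (f0 x) (f1 x) (f2 x) (f3 x)) v)).
  apply: A_eq (S _ _ _ (vx v) (vy v) (vz v) (E _ _ _ _ a1 a3 a0 a2) (D _ _ _ _ a2 a3 a0 a1) (Q _ _ _ _ a0 a3 a1 a2)) => x _.
  by rewrite /rot /=; ring.
case: (eqVneq i 0) => [->|i0]; first by apply: A_eq X => x _; rewrite /rowv mxE.
case: (eqVneq i 1) => [->|i1]; first by apply: A_eq Y => x _; rewrite /rowv mxE.
by apply: A_eq Z => x _; rewrite /rowv mxE (negbTE i0) (negbTE i1).
Qed.

Lemma alg_sect n N (psi : 'I_n -> 'rV[R]_N -> R) (q : 'I_n -> 'I_n -> quat R) (a : 'I_n -> quat R) l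
    (Y : 'rV[R]_m -> 'rV[R]_N) (v : vec) i :
  (forall j, alg U (fun x => psi j (Y x))) -> alg U (fun x => rowv (rot (sect psi q a l (Y x)) v) 0 i).
Proof.
move=> ap; have S (k : 'I_n -> R) : alg U (fun x => \sum_j psi j (Y x) * k j).
  by apply: alg_sum => j; apply: A_mul => //; exact: A_cst.
exact: (alg_rot v i (S (fun j => q0 (qmul (q l j) (a j)))) (S (fun j => q1 (qmul (q l j) (a j))))
  (S (fun j => q2 (qmul (q l j) (a j)))) (S (fun j => q3 (qmul (q l j) (a j))))).
Qed.

End Alg.

End Weights.

(** * The embedding, its uniform flatness and the global frame *)

Section Embedding.

Variables (R : realType) (M : smooth_manifold R 3).
Hypothesis Mc : closed_manifold M.
Variable A : set (chart R 3 M).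
Hypothesis AM : A `<=` atlas M.
Hypothesis Acov : covers A.
Hypothesis Aor : oriented A.

Lemma finite_cover (U : M -> set M) : (forall p, nbhs p (U p)) ->
  exists (n : nat) (f : 'I_n -> M), forall p, exists i, U (f i) p.
Proof.
move=> Un; have /compact_near_coveringP cov : compact [set: M] by exact: Mc.
(* Properties of all sufficiently large finite lists; along this filter the near-covering form of
   compactness is the extraction of a finite subcover. *)
pose F : set_system (seq M) := fun S => exists s : seq M, forall t : seq M, {subset s <= t} -> S t.
have FF : Filter F.
  split; first by exists [::].
    move=> P Q [s hs] [t ht]; exists (s ++ t) => r hr.
    by split; [apply: hs | apply: ht] => z hz; apply: hr; rewrite mem_cat hz ?orbT.
  by move=> P Q PQ [s hs]; exists s => t /hs/PQ.
have [|s hs] := cov _ F (fun (t : seq M) p => exists2 q, q \in t & U q p) FF.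
  move=> p _; exists (U p, [set t : seq M | p \in t]).
    split => //=; exists [:: p] => t ht; apply: ht; exact: mem_head.
  by move=> [q t] [/= Uq pt]; exists p.
pose T := in_tuple s.
exists (size s), (tnth T) => p; have [q qs Uq] := hs s (fun _ h => h) p I.
by have /(tnthP T)[i qi] := qs; exists i; rewrite -qi.
Qed.

Lemma finite_bumps : exists (L : nat) (c : 'I_L -> chart R 3 M) (x0 : 'I_L -> 'rV[R]_3) (rho : 'I_L -> R),
  [/\ forall i, A (c i), forall i, 0 < rho i, forall i, box (x0 i) (rho i) `<=` target (c i) &
   forall p, exists i, chart_bump (c i) (x0 i) (rho i) p != 0].
Proof.
have /choice[f Hf] (p : M) : exists t : chart R 3 M * R, [/\ A t.1, 0 < t.2,
   box (chart_map t.1 p) t.2 `<=` target t.1 & source t.1 p].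
  by have [c Ac cp] := Acov p; have [rho r0 hb] := box_exists cp; exists (c, rho).
pose U (p : M) := source (f p).1 `&` chart_map (f p).1 @^-1` (ball (chart_map (f p).1 p) (f p).2).
have [p|n [g hg]] := @finite_cover U.
  apply: open_nbhs_nbhs; split; first by apply: open_preimage_map; apply: ball_open; have [] := Hf p.
  by split; [have [] := Hf p | rewrite /preimage /=; apply: ballxx; have [] := Hf p].
exists n, (fun i => (f (g i)).1), (fun i => chart_map (f (g i)).1 (g i)), (fun i => (f (g i)).2).
split=> [i|i|i|p]; try by have [] := Hf (g i).
have [i [sp bp]] := hg p; exists i; move: sp bp; set q := g i => sp bp.
rewrite /chart_bump asboolT //; apply/prodf_neq0 => k _; rewrite gt_eqF // bump_gt0 // subr_gt0.
have [_ r0 _ _] := Hf q.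
have : `|chart_map (f q).1 p 0 k - chart_map (f q).1 q 0 k| < (f q).2.
  apply: le_lt_trans (_ : `|chart_map (f q).1 p - chart_map (f q).1 q| < _).
    by have := row_coord_le (chart_map (f q).1 p - chart_map (f q).1 q) k; rewrite !mxE.
  by move: bp; rewrite /preimage /= -ball_normE /= distrC.
by move=> h; rewrite -[X in X < _]real_normK ?num_real // ltr_pXn2r ?nnegrE // ltW.
Qed.

Variables (L : nat) (c : 'I_L -> chart R 3 M) (x0 : 'I_L -> 'rV[R]_3) (rho : 'I_L -> R).
Hypothesis Ac : forall i, A (c i).
Hypothesis rho0 : forall i, 0 < rho i.
Hypothesis boxc : forall i, box (x0 i) (rho i) `<=` target (c i).
Hypothesis bump_cover : forall p, exists i, chart_bump (c i) (x0 i) (rho i) p != 0.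

Definition chi i := chart_bump (c i) (x0 i) (rho i).
(** With [None] the embedding records the bump itself, with [Some k] the bump times the k-th
    coordinate. Where the bump is not zero, these determine the point and make the differential
    injective. *)
Definition gcoord (j : option 'I_3) (x : 'rV[R]_3) : R := if j is Some k then x 0 k else 1.
Notation T := ('I_L * option 'I_3)%type.
Definition Fc (t : T) (p : M) : R := chi t.1 p * gcoord t.2 (chart_map (c t.1) p).
Notation N := #|{: T}|.
Definition emb_map (p : M) : 'rV[R]_N := \row_k Fc (enum_val k) p.
Definition Floc (d : chart R 3 M) := emb_map \o chart_inv d.
Definition Jac (d : chart R 3 M) p := 'J (Floc d) (chart_map d p).

Lemma atlas_c i : atlas M (c i). Proof. exact/AM/Ac. Qed.

Lemma smooth_chi_mul i d (G : 'rV[R]_3 -> R) : atlas M d -> smooth_fun (overlap d (c i)) G ->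
  smooth_fun (target d) (fun x => chi i (chart_inv d x) * G x).
Proof.
move=> dM; apply: smooth_chart_bump; [exact: manifold_hausdorff | exact: rho0 | exact: boxc |].
by apply: atlas_compatible => //; exact: atlas_c.
Qed.

Lemma smooth_Fc t d : atlas M d -> smooth_fun (target d) (fun x => Fc t (chart_inv d x)).
Proof.
move=> dM; apply: (smooth_chi_mul (G := fun x => gcoord t.2 (transition d (c t.1) x)) dM).
case: t.2 => [k|] /=; last by apply: (alg_smooth (@open_overlap _ _ _ d (c t.1))); exact: A_cst.
apply: (smooth_on_coord (@open_overlap _ _ _ d (c t.1))).
by have [] := atlas_compatible dM (atlas_c t.1).
Qed.

Lemma smooth_Floc d : atlas M d -> smooth_on (target d) (Floc d).
Proof.
move=> dM; apply: smooth_on_of_coord; first exact: target_open.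
move=> k; have -> : (fun x => Floc d x 0 k) = (fun x => Fc (enum_val k) (chart_inv d x)).
  by apply/funext => x; rewrite /Floc /= mxE.
exact: smooth_Fc.
Qed.

Lemma diff_Floc d x : atlas M d -> target d x -> differentiable (Floc d) x.
Proof. by move=> dM tx; have [h _] := smooth_Floc dM 1%N; exact: h. Qed.

Lemma diff_transition d e x : atlas M d -> atlas M e -> overlap d e x -> differentiable (transition d e) x.
Proof. by move=> dM eM ox; have [h _] := atlas_compatible dM eM; have [h1 _] := h 1%N; exact: h1. Qed.

Lemma Jac_chain d e p : atlas M d -> atlas M e -> source d p -> source e p ->
  Jac d p = 'J (transition d e) (chart_map d p) *m Jac e p.
Proof.
move=> dM eM dp ep; have ov := overlap_map dp ep; rewrite /Jac.
have dt := diff_transition dM eM ov.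
have te : transition d e (chart_map d p) = chart_map e p by exact: transition_map.
have dF : differentiable (Floc e) (transition d e (chart_map d p)).
  by rewrite te; apply: diff_Floc => //; exact: chart_map_target.
have jc := jacobian_comp dt dF; rewrite te in jc.
have ne : \forall x \near chart_map d p, (Floc e \o transition d e) x = Floc d x.
  apply: (near_eq_on (@open_overlap _ _ _ d e) _ ov) => x [tx sx].
  by rewrite /Floc /transition /= chart_mapK.
exact: etrans (esym (jacobian_near_eq ne (differentiable_comp dt dF))) jc.
Qed.

Lemma chi_source i p : chi i p != 0 -> source (c i) p.
Proof. exact: chart_bump_source. Qed.

Lemma Jrow d x (v : 'rV[R]_3) k : atlas M d -> target d x ->
  (v *m 'J (Floc d) x) 0 k = 'D_v (fun y => Floc d y 0 k) x.
Proof. by move=> dM tx; apply: jac_entry; exact: diff_Floc. Qed.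

Lemma Fc_derive i k p (v : 'rV[R]_3) : source (c i) p -> let x := chart_map (c i) p in
  (v *m Jac (c i) p) 0 (enum_rank (i, Some k)) =
   chi i p * v 0 k + x 0 k * (v *m Jac (c i) p) 0 (enum_rank (i, None)).
Proof.
move=> cp x; have tx : target (c i) x by exact: chart_map_target.
rewrite /Jac (Jrow _ _ (atlas_c i) tx) (Jrow _ _ (atlas_c i) tx).
have E j : (fun y => Floc (c i) y 0 (enum_rank (i, j))) = (fun y => Fc (i, j) (chart_inv (c i) y)).
  by apply/funext => y; rewrite /Floc /= mxE enum_rankK.
rewrite !E; have dN : differentiable (fun y => Fc (i, None) (chart_inv (c i) y)) x.
  by apply: smooth_fun_differentiable (smooth_Fc (i, None) (atlas_c i)) tx.
have dX : differentiable (fun y : 'rV[R]_3 => y 0 k : R) x by exact: differentiable_coord.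
have -> : 'D_v (fun y => Fc (i, Some k) (chart_inv (c i) y)) x =
   'D_v ((fun y => Fc (i, None) (chart_inv (c i) y)) * (fun y : 'rV[R]_3 => y 0 k : R)) x.
  apply: near_eq_derive; apply: (near_eq_on (@target_open _ _ _ (c i))) tx => y ty.
  by rewrite !fctE /Fc /= mulr1 chart_invK.
rewrite deriveM; [|exact: diff_derivable..].
have -> : 'D_v (fun y : 'rV[R]_3 => y 0 k : R) x = v 0 k.
  by rewrite -(@derive_row R 3 3 id) ?derive_id //; exact: derivable_id.
by rewrite /Fc /= mulr1 chart_mapK // -![_ *: _]/(_ * _).
Qed.

(** In a chart whose bump is active at p, the derivatives of the bump and of its product with a
    coordinate both vanish along the vector; by the Leibniz rule so does the coordinate. *)
Lemma Jac_inj d p (v : 'rV[R]_3) : A d -> source d p -> v *m Jac d p = 0 -> v = 0.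
Proof.
move=> Ad dp; have [i ci] := bump_cover p; have cp := chi_source ci.
rewrite (Jac_chain (AM Ad) (atlas_c i) dp cp) mulmxA; set u := v *m _ => h.
have u0 : u = 0.
  have z0 j : (u *m Jac (c i) p) 0 j = 0 by rewrite h mxE.
  apply/rowP => k; rewrite [RHS]mxE; apply/eqP; have := Fc_derive k u cp; rewrite /= !z0 mulr0 addr0.
  by move/esym/eqP; rewrite mulf_eq0 /chi (negbTE ci).
have : 'J (transition d (c i)) (chart_map d p) \in unitmx.
  rewrite unitmxE unitfE gt_eqF //; apply: Aor => //; exact: overlap_map.
by move=> ju; rewrite -(mulmxK ju v) -/u u0 mul0mx.
Qed.

(** An orthonormal basis of the image of the tangent space, positively oriented in every chart of
    [A]; asking for all charts avoids carrying a chosen one. *)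
Definition frame_at p (F : triad R N) := orthonormal F /\ forall d, A d -> source d p ->
  exists2 B : 'M[R]_3, 0 < \det B & F = tri (B *m Jac d p).

Lemma frame_at_exists p : exists F, frame_at p F.
Proof.
have [d Ad dp] := Acov p; have [B B0 o] := gram_schmidt (fun v => Jac_inj Ad dp (v := v)).
exists (tri (B *m Jac d p)); split => // e Ae ep.
exists (B *m 'J (transition d e) (chart_map d p)).
  by rewrite det_mulmx mulr_gt0 //; apply: Aor => //; exact: overlap_map.
by rewrite -mulmxA -Jac_chain //; exact: AM.
Qed.

Definition fdist p q := nm (emb_map p - emb_map q).

Lemma emb_near p (t : R) : 0 < t -> nbhs p [set q | fdist q p < t].
Proof.
move=> t0; have [d Ad dp] := Acov p; have dM := AM Ad; pose z := chart_map d p.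
have tz : target d z := chart_map_target dp.
have N1 : 0 < N%:R + 1 :> R by rewrite ltr_wpDl.
pose t' := t / (2 * (N%:R + 1)).
have t'0 : 0 < t' by rewrite divr_gt0 // mulr_gt0.
have h : \forall x \near z, `|Floc d z - Floc d x| < t'.
  by have /cvgrPdist_lt h := differentiable_continuous (diff_Floc dM tz); exact: h.
have h1 : nbhs p (chart_map d @^-1` [set x | `|Floc d z - Floc d x| < t']) by apply: (chart_map_cvg dp); exact: h.
have h2 : nbhs p (source d) by apply: open_nbhs_nbhs; split => //; exact: source_open.
apply: filterS (filterI h1 h2) => q [/= hq sq].
have E r : source d r -> Floc d (chart_map d r) = emb_map r by move=> sr; rewrite /Floc /= chart_mapK.
rewrite /z !E // in hq.
rewrite /fdist nm_subC; apply: le_lt_trans (nm_bound (ltW t'0) (fun k => le_trans (row_coord_le _ k) (ltW hq))) _.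
have -> : (N%:R + 1) * t' = t / 2 by rewrite /t'; field; rewrite gt_eqF.
lra.
Qed.

(** All that is used about the geometry near q: secants and tangent spaces are almost parallel to
    the one at q, and a single constant combination [Cf] of the coordinate fields of one chart,
    multiplied by its bump, stays close to the frame [Fq]. *)
Definition flat_at (th del : R) (q : M) := exists i, forall Fq, frame_at q Fq -> exists Cf : 'M[R]_3,
  forall p p', fdist p q < del -> fdist p' q < del ->
   [/\ off Fq (emb_map p' - emb_map p) <= th * nm (emb_map p' - emb_map p),
      source (c i) p,
      forall v, nm (emb (tri (chi i p *: (Cf *m Jac (c i) p))) v - emb Fq v) <= th * vnorm v &
      forall Fp, frame_at p Fp -> tilt Fq Fp th /\
        0 < det3 (turn Fq Fp (@e1 R)) (turn Fq Fp (Vec 0 1 0)) (turn Fq Fp (@e3 R))].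

Lemma local_flat q0 (th : R) : 0 < th -> exists2 del, 0 < del & forall q, fdist q q0 < del -> flat_at th del q.
Proof.
move=> th0; have [i ci] := bump_cover q0; have cq0 := chi_source ci; have Ai := Ac i; have Mi := atlas_c i.
pose z := chart_map (c i) q0; have tz : target (c i) z := chart_map_target cq0.
have [C C0 HC] := inj_bound (fun v => @Jac_inj _ _ v Ai cq0).
have [h [h0 hth h1]] := small_exists th0.
pose e := h / (8 * C); have e0 : 0 < e by rewrite divr_gt0 // mulr_gt0.
have eC : C * e = h / 8 by rewrite /e; field; rewrite gt_eqF.
have [r r0 [rt rs]] := strict_map (@target_open _ _ _ (c i)) (smooth_Floc Mi) tz e0.
pose a := chi i q0; have a0 : 0 < a by rewrite lt_def ci /a /chi chart_bump_ge0.
have z1 : 0 < 8 * (1 + `|z|) by rewrite mulr_gt0 // ltr_pwDl.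
(* The first bound keeps the bump near its value [a] at q0, hence the point in the chart; the second
   then keeps its coordinates within [r] of [z]. *)
have [D [D0 D1 D2]] : exists D, [/\ 0 < D, D <= a * h / 64 & D <= r * a / (8 * (1 + `|z|))].
  exists (Num.min (a * h / 64) (r * a / (8 * (1 + `|z|)))).
  split; [| by rewrite ge_min lexx | by rewrite ge_min lexx orbT].
  by rewrite lt_min; apply/andP; split; apply: divr_gt0 => //; exact: mulr_gt0.
have ah : a * h <= a * (1 / 1000) by rewrite ler_wpM2l // ltW.
have loc p : fdist p q0 < D -> [/\ source (c i) p, `|chart_map (c i) p - z| < r & `|chi i p - a| < D].
  move=> hp; have cmp o : `|Fc (i, o) p - Fc (i, o) q0| < D.
    apply: le_lt_trans hp; have := comp_le_nm (emb_map p - emb_map q0) (enum_rank (i, o)).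
    by rewrite sub1E /emb_map !mxE !enum_rankK.
  have cN := cmp None; rewrite /Fc /= !mulr1 -/a in cN.
  have [pa p0] := above_half a0 ah D1 cN.
  have sp : source (c i) p by apply: chi_source; rewrite gt_eqF.
  have [rh0 rh] := half_bounds r0.
  split=> //; apply: (@le_lt_trans _ _ (r / 2)) => //; apply: row_norm_le => [|k]; first exact: ltW.
  have ck := cmp (Some k); rewrite /Fc /= -/a -/z in ck; rewrite sub1E.
  exact: (coord_close a0 pa r0 (row_coord_le z k) ck cN D2).
have [Dh0 Dh] := half_bounds D0; exists (D / 2) => //.
move=> q hq; exists i => Fq [oq hFq].
have close p : fdist p q < D / 2 -> fdist p q0 < D.
  move=> hpq; apply: le_lt_trans (nmB _ (emb_map q) _) _; rewrite -/(fdist p q) -/(fdist q q0).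
  exact: halves_lt.
have [sq zq cq] := loc q (lt_trans hq Dh).
have [Bq Bq0 FqE] := hFq _ Ai sq.
have uBq : Bq \in unitmx by rewrite unitmxE unitfE gt_eqF.
(* The factor normalises the bump at q; at p there remains the ratio [chi i p / chi i q], which is
   close to one. *)
exists ((chi i q)^-1 *: Bq) => p p' /close/loc[sp zp cp] /close/loc[sp' zp' cp'].
have nJ p1 : `|chart_map (c i) p1 - z| < r -> near_J0 (Jac (c i) q0) e (Jac (c i) p1).
  by move=> hr u; exact: (rs _ _ hr hr).1.
have [y0 rc] := ratio_close a0 h0 h1 D1 cp cq.
split=> //.
- apply: (@le_trans _ _ (h * nm (emb_map p' - emb_map p))); last by apply: ler_wpM2r => //; exact: nm_ge0.
  apply: (off_estimate C0 e0 h0 h1 eC HC (nJ _ zq) oq uBq FqE (u := chart_map (c i) p' - chart_map (c i) p)).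
  by have := (rs _ _ zp zp').2; rewrite /Floc /= !chart_mapK.
- move=> v; apply: (@le_trans _ _ (h * vnorm v)); last by apply: ler_wpM2r => //; exact: vnorm_ge0.
  rewrite -scalemxAl scalerA.
  exact: (field_estimate C0 e0 h0 h1 eC HC v (nJ _ zq) (nJ _ zp) oq FqE rc).
- move=> Fp [op hFp]; have [Bp Bp0 FpE] := hFp _ Ai sp.
  have [tl dp] := turn_estimate C0 e0 h0 h1 eC HC (nJ _ zq) (nJ _ zp) oq op Bq0 Bp0 FqE FpE.
  split=> // v; apply: le_trans (tl v) _; apply: ler_wpM2r => //; exact: vnorm_ge0.
Qed.

Lemma uniform_flat (th : R) : 0 < th -> exists2 del, 0 < del & forall q, flat_at th del q.
Proof.
move=> th0; have /compact_near_coveringP cov : compact [set: M] by exact: Mc.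
have mono del del' q : del' <= del -> flat_at th del q -> flat_at th del' q.
  move=> dd [i H]; exists i => Fq /H[Cf HCf]; exists Cf => p p' hp hp'.
  by apply: HCf; [exact: lt_le_trans hp dd | exact: lt_le_trans hp' dd].
have h : \forall del \near (0 : R)^'+, [set: M] `<=` (flat_at th del : set M).
  apply: (cov R ((0 : R)^'+) (fun del => flat_at th del)) => q0 _.
  have [D D0 H] := local_flat q0 th0.
  exists ([set q | fdist q q0 < D], [set del | del <= D]).
    by split; [exact: emb_near | exact: nbhs_right_le].
  by move=> [q del] [/= h1 h2]; apply: mono h2 _; exact: H.
have [del [d0 hd]] : exists del : R, 0 < del /\ [set: M] `<=` (flat_at th del : set M).
  by apply: (@filter_ex _ ((0 : R)^'+)); apply: filterI h; exact: nbhs_right_gt.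
by exists del => // q; exact: hd.
Qed.

(** A separated family of maximal size also covers. The sizes are bounded because each of finitely
    many covering balls of radius eps/2 contains at most one of its points. *)
Lemma net_exists (eps : R) : 0 < eps -> exists (n : nat) (z : 'I_n -> M),
  (forall i j, i != j -> eps <= fdist (z i) (z j)) /\ forall p, exists i, fdist p (z i) < eps.
Proof.
move=> e0; have e2 : 0 < eps / 2 by lra.
have fC p q : fdist p q = fdist q p by exact: nm_subC.
have [m [f hf]] := finite_cover (fun p => emb_near p e2).
pose Q n := `[< exists z : 'I_n -> M, forall i j, i != j -> eps <= fdist (z i) (z j) >].
have Q0 : exists n, Q n.
  have z0 : 'I_0 -> M by case.
  by exists 0%N; apply/asboolP; exists z0; case.
have Qm n : Q n -> (n <= m)%N.
  move=> /asboolP[z hz]; have /choice[g hg] := fun i => hf (z i).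
  have gi : injective g.
    move=> i j gij; apply/eqP/negP => /negP /hz; rewrite leNgt => /negP; apply.
    apply: le_lt_trans (nmB _ (emb_map (f (g i))) _) _; have := hg i; have := hg j; rewrite -gij /= (fC (z j)) /fdist; lra.
  by have := leq_card g gi; rewrite !card_ord.
case: (ex_maxnP Q0 Qm) => n /asboolP[z hz] mx; exists n, z; split=> // p.
apply: contrapT => /forallNP np.
have : Q n.+1.
  apply/asboolP; exists (fun i => if unlift ord0 i is Some j then z j else p) => i j.
  case: unliftP => [i'|] ->; case: unliftP => [j'|] ->; rewrite ?eqxx // => ij.
  - by apply: hz; apply: contraNneq ij => ->.
  - by rewrite fC leNgt; apply/negP.
  - by rewrite leNgt; apply/negP.
by move/mx; rewrite ltnn.
Qed.

Lemma Jtrans b d e p : atlas M b -> atlas M d -> atlas M e -> source b p -> source d p -> source e p ->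
  'J (transition b e) (chart_map b p) = 'J (transition b d) (chart_map b p) *m 'J (transition d e) (chart_map d p).
Proof.
move=> bM dM eM bp dp ep; have ov := overlap_map bp dp.
have dt := diff_transition bM dM ov.
have te : transition b d (chart_map b p) = chart_map d p by exact: transition_map.
have de : differentiable (transition d e) (transition b d (chart_map b p)).
  by rewrite te; apply: diff_transition => //; exact: overlap_map.
have jc := jacobian_comp dt de; rewrite te in jc.
have ne : \forall x \near chart_map b p, (transition d e \o transition b d) x = transition b e x.
  apply: (near_eq_on (@open_overlap _ _ _ b d) _ ov) => x [tx sx].
  by rewrite /transition /= chart_mapK.
exact: etrans (esym (jacobian_near_eq ne (differentiable_comp dt de))) jc.
Qed.

Section Field.

Variables (n : nat) (bc : 'I_n -> 'I_L * 'M[R]_3) (psi : 'I_n -> M -> R) (w : 'I_n -> M -> 'rV[R]_3).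

(** The component in the chart [d] of a sum of fields given in the charts [c i], transported by the
    Jacobians of the transitions. The factor [chi] makes each summand vanish where its chart is not
    defined. *)
Definition glued_field (p : M) (d : chart R 3 M) : 'rV[R]_3 := if `[< charts_at p d >] then
  \sum_j (psi j p * chi (bc j).1 p) *:
    (w j p *m (bc j).2 *m 'J (transition (c (bc j).1) d) (chart_map (c (bc j).1) p)) else 0.

Lemma glued_field_tangent p : tangent_space p (glued_field p).
Proof.
split=> [d nd|d e hd he]; first by rewrite /glued_field asboolF.
have [dM dp] := hd; have [eM ep] := he.
have dt : differentiable (transition d e) (chart_map d p).
  by apply: diff_transition => //; exact: overlap_map.
apply: etrans _ (esym (diff_jac _ dt)).
rewrite /glued_field (asboolT hd) (asboolT he) mulmx_suml; apply: eq_bigr => j _.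
apply: scale_cond => nz.
exact: etrans (f_equal (mulmx _) (Jtrans (atlas_c _) dM eM (chi_source nz) dp ep)) (mulmxA _ _ _).
Qed.

Lemma smooth_chi_jac i d (m k : 'I_3) : atlas M d -> smooth_fun (target d)
  (fun x => chi i (chart_inv d x) * 'J (transition (c i) d) (chart_map (c i) (chart_inv d x)) m k).
Proof.
move=> dM; have iM := atlas_c i; have [s1 s2] := atlas_compatible iM dM.
have oid := @open_overlap _ _ _ (c i) d; have odi := @open_overlap _ _ _ d (c i).
apply: (smooth_chi_mul (G := fun x => 'J (transition (c i) d) (transition d (c i) x) m k) dM).
apply: (smooth_fun_eq odi (f := fun x => 'D_(delta_mx 0 m) (fun y => transition (c i) d y 0 k) (transition d (c i) x))).
  move=> x /transition_overlap ox.
  exact: etrans (esym (jac_entry _ _ (diff_transition iM dM ox))) (delta_mulE _ _ _).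
apply: (alg_smooth odi).
apply: (A_comp (U' := overlap (c i) d) (f := 'D_(delta_mx 0 m) (fun y => transition (c i) d y 0 k))).
- exact: (smooth_fun_derive _ (smooth_on_coord oid k s1)).
- by move=> x; exact: transition_overlap.
- by move=> l; apply: A_base; exact: (smooth_on_coord odi l s2).
Qed.

Lemma glued_field_smooth d : atlas M d -> (forall j, alg (target d) (fun x => psi j (chart_inv d x))) ->
  (forall j l, alg (target d) (fun x => w j (chart_inv d x) 0 l)) ->
  smooth_on (target d) (fun x => glued_field (chart_inv d x) d).
Proof.
move=> dM ap aw; have dO := @target_open _ _ _ d; apply: (smooth_on_of_coord dO) => i.
apply: (smooth_fun_eq dO (f := fun x => \sum_j \sum_m (psi j (chart_inv d x) * (\sum_l w j (chart_inv d x) 0 l * (bc j).2 l m)) *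
   (chi (bc j).1 (chart_inv d x) * 'J (transition (c (bc j).1) d) (chart_map (c (bc j).1) (chart_inv d x)) m i))).
  move=> x tx; have hd : charts_at (chart_inv d x) d by split=> //; exact: chart_inv_source.
  rewrite /glued_field (asboolT hd) summxE; apply: eq_bigr => j _.
  rewrite [RHS]mxE [X in _ = _ * X]mxE mulr_sumr; apply: eq_bigr => m _; rewrite [X in _ = _ * (X * _)]mxE; ring.
apply: (alg_smooth dO); apply: alg_sum => j; apply: alg_sum => m; apply: A_mul.
  by apply: A_mul => //; apply: alg_sum => l; apply: A_mul => //; exact: A_cst.
by apply: A_base; exact: smooth_chi_jac.
Qed.

Lemma glued_field_jac p d : atlas M d -> source d p -> glued_field p d *m Jac d p =
  \sum_j (psi j p * chi (bc j).1 p) *: (w j p *m (bc j).2 *m Jac (c (bc j).1) p).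
Proof.
move=> dM dp; have hd : charts_at p d by [].
rewrite /glued_field (asboolT hd) mulmx_suml; apply: eq_bigr => j _.
have [z|nz] := eqVneq (chi (bc j).1 p) 0; first by rewrite z mulr0 !scale0r mul0mx.
by rewrite -scalemxAl -mulmxA -(Jac_chain (atlas_c _) dM (chi_source nz) dp).
Qed.

End Field.

Lemma smooth_weight (eps : R) (y : 'rV[R]_N) d : atlas M d ->
  alg (target d) (fun x => bump 0 (4 - nm (eps^-1 *: emb_map (chart_inv d x) - y) ^+ 2)).
Proof.
move=> dM; have h k : alg (target d) (fun x => eps^-1 * Fc (enum_val k) (chart_inv d x) + - y 0 k).
  by apply: A_add; [apply: A_mul; [exact: A_cst | apply: A_base; exact: smooth_Fc] | exact: A_cst].
have S := alg_sum (index_enum _) (fun k => A_mul (h k) (h k)).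
apply: A_eq (A_bump 0 (A_add (A_cst _ 4) (alg_opp S))) => x _.
by congr (bump 0 (_ - _)); rewrite nm2 /ip; apply: eq_bigr => k _; rewrite sub1E /emb_map !mxE.
Qed.

Lemma embedded_parallelizable : parallelizable M.
Proof.
have Lam0 : 0 < 4`!%:R * 100 :> R by rewrite mulr_gt0 // ltr0n fact_gt0.
have c00 : 0 < bump 0 3 :> R by exact: bump_gt0.
have [th th0 DF] := discrete_framing #|{: 'I_(cells R) * 'I_(cells R) * 'I_(cells R)}| Lam0 c00.
(* Near net points are up to 40 apart in rescaled units, so a relative flatness of [th / 40] gives
   the absolute bound [th] on [off]. *)
have th40 : 0 < th / 40 by rewrite divr_gt0.
have [h [h0 hth h1]] := small_exists th40.
have [del del0 flat] := uniform_flat h0.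
(* Rescaling by [eps^-1] gives the net spacing one, and the radius 40 used in [net_data] then
   corresponds to 40/50 of [del], where flatness holds. *)
pose eps := del / 50; have eps0 : 0 < eps by rewrite divr_gt0.
have [n [z [zsep zcov]]] := net_exists eps0.
have /choice[F hF] := fun i => frame_at_exists (z i).
have /choice[bc Hbc] (i : 'I_n) : exists t : 'I_L * 'M[R]_3, forall p p', fdist p (z i) < del -> fdist p' (z i) < del ->
   [/\ off (F i) (emb_map p' - emb_map p) <= h * nm (emb_map p' - emb_map p),
      source (c t.1) p,
      forall v, nm (emb (tri (chi t.1 p *: (t.2 *m Jac (c t.1) p))) v - emb (F i) v) <= h * vnorm v &
      forall Fp, frame_at p Fp -> tilt (F i) Fp h /\
        0 < det3 (turn (F i) Fp (@e1 R)) (turn (F i) Fp (Vec 0 1 0)) (turn (F i) Fp (@e3 R))].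
  by have [j H] := flat (z i); have [Cf HCf] := H _ (hF i); exists (j, Cf).
have oF i : orthonormal (F i) := (hF i).1.
pose y p := eps^-1 *: emb_map p; pose x i := y (z i).
pose P u := exists p, u = y p; pose psi (j : 'I_n) (u : 'rV[R]_N) := bump 0 (4 - nm (u - x j) ^+ 2).
have ei0 : 0 < eps^-1 by rewrite invr_gt0.
have sc p p' : nm (y p - y p') = eps^-1 * fdist p p' by rewrite -scalerBr nmZ gtr0_norm.
have close p i : nm (y p - x i) <= 40 -> fdist p (z i) < del.
  by rewrite sc ler_pdivrMl // => h'; apply: le_lt_trans h' (eps_close del0).
have offy i p p' : nm (y p - x i) <= 40 -> nm (y p' - x i) <= 40 -> off (F i) (y p' - y p) <= h * nm (y p' - y p).
  move=> /close hp /close hp'; have [ho _ _ _] := Hbc i p p' hp hp'.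
  by rewrite -scalerBr offZ nmZ (gtr0_norm ei0) mulrCA ler_pM2l.
have sep i j : i != j -> 1 <= nm (x i - x j) by move=> ij; rewrite sc ler_pdivlMl // mulr1; exact: zsep.
have D : net_data #|{: 'I_(cells R) * 'I_(cells R) * 'I_(cells R)}| (4`!%:R * 100) (bump 0 3) x F P psi.
  apply: net_data_bump => //; first by move=> i; exists (z i).
  move=> i _ _ [p ->] [p' ->] hp hp'; have o1 := offy i p' p hp' hp.
  exact: (flat_proj h1 (nm_ge0 _) o1 (proj_lower (y p - y p') (oF i))).
have [||q [a H]] := DF _ _ x F P psi D sep.
- by move=> _ [p ->]; have [i hi] := zcov p; exists i; rewrite sc ler_pdivrMl // mulr1 ltW.
- move=> i j; rewrite /SpinNet.near => nij.
  have n1 : nm (x j - x i) <= 40 by rewrite nm_subC; exact: le_trans nij (forty R).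
  have n0 : nm (x i - x i) <= 40 by rewrite subrr nm0.
  have [_ _ _ hfr] := Hbc i (z j) (z j) (close _ _ n1) (close _ _ n1).
  have [tl dt] := hfr _ (hF j); split=> //.
    by move=> v; apply: le_trans (tl v) _; apply: ler_wpM2r; [exact: vnorm_ge0 | exact: (small_le h0 hth)].
  by apply: le_trans (offy i (z i) (z j) n0 n1) _; exact: (small_mul h0 hth (nm_ge0 _) n1).
(* In the j-th local frame the k-th field is the k-th basis vector turned by the section as read at
   j. *)
pose X (k : 'I_3) := glued_field bc (fun j p => psi j (y p))
  (fun j p => rowv (rot (sect psi q a j (y p)) (vecr (delta_mx 0 k)))).
have apsi d j : atlas M d -> alg (target d) (fun x => psi j (y (chart_inv d x))).
  by move=> dM; exact: smooth_weight.
exists X; split=> [k|p al hal].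
  split=> [p|d dM]; first exact: glued_field_tangent.
  apply: glued_field_smooth => // [j|j l]; first exact: apsi.
  by apply: alg_sect => j'; exact: apsi.
have [d Ad dp] := Acov p; have dM := AM Ad.
have E : \sum_k al k *: X k p d = 0.
  by move: hal; rewrite !big_ord_recl !big_ord0 => /(congr1 (fun f => f d)).
(* A relation between the fields at p, pushed into R^N by [Jac d p], becomes the weighted sum of
   [discrete_framing] for the vector of its coefficients, with the bumped coordinate fields [Z j] as
   approximate frames. *)
pose u : 'rV[R]_3 := \row_k al k.
pose Z (j : 'I_n) := tri (chi (bc j).1 p *: ((bc j).2 *m Jac (c (bc j).1) p)).
have v0 : vnorm (vecr u) = 0.
  apply: (H (y p) (ex_intro _ p erefl) Z).
    move=> j nz; have np := nd_psi_supp D (ex_intro _ p erefl) nz.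
    have hp := close p j (le_trans np (two40 R)).
    have [_ _ hz _] := Hbc j p p hp hp.
    have [b1 b2 b3] := emb_basis (Z j); have [g1 g2 g3] := emb_basis (F j).
    have hh v : vnorm v = 1 -> nm (emb (Z j) v - emb (F j) v) <= th.
      by move=> v1; apply: le_trans (hz v) _; rewrite v1 mulr1; exact: (small_le h0 hth).
    rewrite -b1 -b2 -b3 -g1 -g2 -g3; split; apply: hh; rewrite /vnorm /dot /=.
    - by rewrite !mulr0 mulr1 !addr0 sqrtr1.
    - by rewrite !mulr0 mulr1 add0r addr0 sqrtr1.
    - by rewrite !mulr0 mulr1 !add0r sqrtr1.
  have E2 : (\sum_k al k *: X k p d) *m Jac d p = 0 by rewrite E mul0mx.
  rewrite -[RHS]E2 mulmx_suml.
  under [RHS]eq_bigr => k _ do rewrite -scalemxAl (glued_field_jac _ _ _ dM dp) scaler_sumr.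
  rewrite exchange_big; apply: eq_bigr => j _.
  rewrite emb_tri rowv_rot_sum mulmx_suml scaler_sumr; apply: eq_bigr => k _.
  rewrite -scalemxAl -scalemxAr mulmxA !scalerA mxE; congr (_ *: _); ring.
move=> k; apply/eqP; rewrite -normr_le0 -v0.
by have := rowv_le (vecr u) k; rewrite rowvK mxE.
Qed.

End Embedding.

End Manifold.

Theorem mainTheorem1 (R : realType) (M : smooth_manifold R 3)
  (M_closed : closed_manifold M) (M_orientable : orientable M) :
  parallelizable M.
Proof.
have [A [AM Acov Aor]] := M_orientable.
have [L [c [x0 [rho [Ac rho0 boxc bump_cover]]]]] := Manifold.finite_bumps M_closed Acov.
eapply Manifold.embedded_parallelizable; eassumption.
Qed.
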